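(* For every $m\in\mathbb{N}$ there exists a constant $C(m)$ depending only on $m$ such that the following holds. Whenever $f\in S_k(\mathbb{Z}/2^m\mathbb{Z})$ (for some weight $k$) is a strong eigenform modulo $2^m$ that is the reduction of an eigenform with coefficients in $\mathbb{Z}_2$, then $$\deg_m f\le C(m).$$ Moreover, any such form $f$ is the reduction modulo $2^m$ of a form of weight bounded by a constant $\kappa(m)$ depending only on $m$, that can be taken to be $12C(m)$ for $m=1,2,3$, and to be $6+2^{m-2}+12C(m)$ if $m\ge4$.
   Context: All forms are on $\mathrm{SL}_2(\mathbb{Z})$. $Q=E_4$ and $R=E_6$ are the normalized Eisenstein series of weights $4$ and $6$ (constant term $1$), and $\Delta$ is Ramanujan's cusp form of weight $12$. For a commutative ring $A$, $M_k(A)=M_k(\mathbb{Z})\otimes A$ is the space of modular forms of weight $k$ with coefficients in $A$ in the naive sense (spanned over $A$ by forms with integral $q$-expansions), and $S_k(A)$ is the analogous space of cusp forms; the images of $Q,R,\Delta$ in $M_k(\mathbb{Z}/2^m\mathbb{Z})$ are denoted by the same letters. A ''form'' here is a modular form on $\mathrm{SL}_2(\mathbb{Z})$ (with coefficients in $\mathbb{Z}_2$). ''Eigenform'' means normalized cuspidal eigenform for all Hecke operators $T_n$. A strong eigenform modulo $2^m$ (level $1$) is the reduction modulo $2^m$ of the $q$-expansion of an eigenform of some weight; for an eigenform with coefficients in $\mathbb{Z}_2$ the reduction modulo $2^m$ is the usual one, $\mathbb{Z}_2\to\mathbb{Z}/2^m\mathbb{Z}$, on $q$-expansion coefficients. For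 even $k\ge4$, the forms $Q^a\Delta^c$ with $a,c\ge 0$, $4a+12c=k$ (if $k\equiv0\pmod 4$), respectively $RQ^a\Delta^c$ with $a,c\ge 0$, $4a+12c=k-6$ (if $k\equiv2\pmod4$), form a $\mathbb{Z}$-basis of the module of weight $k$ modular forms with $q$-expansion in $\mathbb{Z}[[q]]$. Hence every $f\in M_k(\mathbb{Z}/2^m\mathbb{Z})$ is uniquely a $\mathbb{Z}/2^m\mathbb{Z}$-linear combination of these monomials. For $f\in S_k(\mathbb{Z}/2^m\mathbb{Z})$, the degree $\deg_m f$ is the highest power of $\Delta$ occurring (with nonzero coefficient) in this expansion. *)

(* Defs.v *)
From HB Require Import structures.
From mathcomp Require Import all_boot all_order all_algebra.
From mathcomp Require Import all_classical all_reals all_analysis.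
From mathcomp Require Import complex.

Set Implicit Arguments.
Unset Strict Implicit.
Unset Printing Implicit Defensive.
Import Order.TTheory GRing.Theory Num.Theory numFieldNormedType.Exports.
Local Open Scope classical_set_scope.
Local Open Scope ring_scope.

(* The ring of 2-adic integers, as the inverse limit of the rings Z/2^n:
   [z2_res x n] is the representative in [0, 2^n) of x modulo 2^n. *)

Record Z2 := MkZ2 {
  z2_res : nat -> int;
  z2_compat : forall n, z2_res n = (z2_res n.+1 %% 2 ^+ n)%Z }.

HB.instance Definition _ := gen_eqMixin Z2.
HB.instance Definition _ := gen_choiceMixin Z2.

Lemma z2_eqP (x y : Z2) :
  (forall n, (z2_res x n = z2_res y n %[mod 2 ^+ n])%Z) -> x = y.
Proof.
have idem (z : Z2) n : (z2_res z n %% 2 ^+ n)%Z = z2_res z n.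
  by rewrite z2_compat modz_mod.
case: x y => [u hu] [v hv] /= huv.
have uv : u = v.
  apply: funext => n; move: (idem (MkZ2 hu) n) (idem (MkZ2 hv) n) (huv n).
  by move=> /= -> ->.
by move: hu hv; rewrite uv => hu hv; rewrite (Prop_irrelevance hu hv).
Qed.

Lemma z2_res_mod (x : Z2) n : (z2_res x n.+1 = z2_res x n %[mod 2 ^+ n])%Z.
Proof. by rewrite [z2_res x n]z2_compat modz_mod. Qed.

Fact z2_of_subproof (u : nat -> int) :
  (forall n, (u n.+1 = u n %[mod 2 ^+ n])%Z) ->
  forall n, (u n %% 2 ^+ n)%Z = ((u n.+1 %% 2 ^+ n.+1)%Z %% 2 ^+ n)%Z.
Proof.
move=> hu n; rewrite -hu {1}(divz_eq (u n.+1) (2 ^+ n.+1)).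
by rewrite {2}exprS mulrA modzMDl.
Qed.

Definition z2_of (u : nat -> int)
    (hu : forall n, (u n.+1 = u n %[mod 2 ^+ n])%Z) : Z2 :=
  MkZ2 (z2_of_subproof hu).

Lemma z2_ofE u hu n : (z2_res (@z2_of u hu) n = u n %[mod 2 ^+ n])%Z.
Proof. by rewrite /= modz_mod. Qed.

Fact z2_cst_subproof (a : int) (n : nat) : (a = a %[mod 2 ^+ n])%Z.
Proof. by []. Qed.

Fact z2_add_subproof (x y : Z2) n :
  (z2_res x n.+1 + z2_res y n.+1 = z2_res x n + z2_res y n %[mod 2 ^+ n])%Z.
Proof. by rewrite -modzDm !z2_res_mod modzDm. Qed.

Fact z2_opp_subproof (x : Z2) n :
  (- z2_res x n.+1 = - z2_res x n %[mod 2 ^+ n])%Z.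
Proof. by rewrite -modzNm z2_res_mod modzNm. Qed.

Fact z2_mul_subproof (x y : Z2) n :
  (z2_res x n.+1 * z2_res y n.+1 = z2_res x n * z2_res y n %[mod 2 ^+ n])%Z.
Proof. by rewrite -modzMm !z2_res_mod modzMm. Qed.

Definition z2_zero := z2_of (z2_cst_subproof 0).
Definition z2_one := z2_of (z2_cst_subproof 1).
Definition z2_add x y := z2_of (z2_add_subproof x y).
Definition z2_opp x := z2_of (z2_opp_subproof x).
Definition z2_mul x y := z2_of (z2_mul_subproof x y).

Definition z2_simp := (z2_ofE, modz_mod, modzDml, modzDmr, modzMml, modzMmr).

Fact z2_addA : associative z2_add.
Proof. by move=> x y z; apply: z2_eqP => n; rewrite /= !z2_simp addrA. Qed.
Fact z2_addC : commutative z2_add.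
Proof. by move=> x y; apply: z2_eqP => n; rewrite /= !z2_simp addrC. Qed.
Fact z2_add0 : left_id z2_zero z2_add.
Proof. by move=> x; apply: z2_eqP => n; rewrite /= !z2_simp add0r. Qed.
Fact z2_addN : left_inverse z2_zero z2_opp z2_add.
Proof. by move=> x; apply: z2_eqP => n; rewrite /= !z2_simp addNr. Qed.
HB.instance Definition _ :=
  GRing.isZmodule.Build Z2 z2_addA z2_addC z2_add0 z2_addN.

Fact z2_mulA : associative z2_mul.
Proof. by move=> x y z; apply: z2_eqP => n; rewrite /= !z2_simp mulrA. Qed.
Fact z2_mulC : commutative z2_mul.
Proof. by move=> x y; apply: z2_eqP => n; rewrite /= !z2_simp mulrC. Qed.
Fact z2_mul1 : left_id z2_one z2_mul.
Proof. by move=> x; apply: z2_eqP => n; rewrite /= !z2_simp mul1r. Qed.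
Fact z2_mulDl : left_distributive z2_mul z2_add.
Proof. by move=> x y z; apply: z2_eqP => n; rewrite /= !z2_simp mulrDl. Qed.
Fact z2_one_neq0 : z2_one != z2_zero.
Proof. by apply/eqP => /(congr1 (fun x : Z2 => z2_res x 1%N)). Qed.
HB.instance Definition _ := GRing.Zmodule_isComNzRing.Build Z2
  z2_mulA z2_mulC z2_mul1 z2_mulDl z2_one_neq0.

(* For m > 0, the canonical projection of Z_2 onto Z/2^m (recall that the
   carrier ['Z_(2 ^ m)] is the ring of integers modulo 2^m only if m > 0). *)
Definition z2_red (m : nat) (x : Z2) : 'Z_(2 ^ m) := (z2_res x m)%:~R.

(* Modular forms on SL_2(Z). *)

(* R[i] as a [numFieldType], which equips it with its norm topology and with
   complex differentiation ([derivable f z 1]). *)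
Definition Cplx (R : realType) : numFieldType := R[i].

(* exp (2 * pi * i * z) *)
Definition nome (R : realType) (z : Cplx R) : Cplx R :=
  let r := expR (- (2 * pi * complex.Im z)) in
  let t := 2 * pi * complex.Re z in
  ((r * cos t) +i* (r * sin t))%C.

Definition weakly_modular (R : realType) (k : nat) (F : Cplx R -> Cplx R) :=
  forall a b c d : int, a * d - b * c = 1 ->
  forall z : Cplx R, 0 < complex.Im z ->
    F ((a%:~R * z + b%:~R) / (c%:~R * z + d%:~R)) =
    (c%:~R * z + d%:~R) ^+ k * F z.

Definition holomorphic_on_H (R : realType) (F : Cplx R -> Cplx R) :=
  forall z : Cplx R, 0 < complex.Im z -> derivable F z 1.

Definition has_qexp (R : realType) (F : Cplx R -> Cplx R) (a : nat -> Cplx R) :=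
  forall z : Cplx R, 0 < complex.Im z ->
    (fun N : nat => \sum_(n < N) a n * nome z ^+ n) @ \oo --> F z.

(* M_k(Z), a form being represented by its q-expansion at infinity; that the
   expansion has no negative power of q is holomorphy at the cusp. *)
Definition Mk_int (R : realType) (k : nat) (a : nat -> int) :=
  exists F : Cplx R -> Cplx R,
    [/\ holomorphic_on_H F, weakly_modular k F
      & has_qexp F (fun n => (a n)%:~R)].

Definition Sk_int (R : realType) (k : nat) (a : nat -> int) :=
  Mk_int R k a /\ a 0%N = 0.

Definition int_span (A : comNzRingType) (P : (nat -> int) -> Prop)
    (f : nat -> A) :=
  exists (r : nat) (c : 'I_r -> A) (g : 'I_r -> nat -> int),
    (forall i, P (g i)) /\ (forall n, f n = \sum_(i < r) c i * (g i n)%:~R).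

(* M_k(A) and S_k(A), as sets of q-expansions: since M_k(Z) and S_k(Z) are
   saturated in Z[[q]], tensoring with A loses nothing. *)
Definition Mk (R : realType) (k : nat) (A : comNzRingType) (f : nat -> A) :=
  int_span (Mk_int R k) f.

Definition Sk (R : realType) (k : nat) (A : comNzRingType) (f : nat -> A) :=
  int_span (Sk_int R k) f.

(* Hecke operator T_n in weight k on q-expansions. *)
Definition hecke (A : comNzRingType) (k n : nat) (f : nat -> A) (j : nat) : A :=
  \sum_(d <- divisors n | (d %| j)%N)
    (d ^ k.-1)%N%:R * f ((n * j) %/ d ^ 2)%N.

Definition eigenform (R : realType) (A : comNzRingType) (k : nat)
    (f : nat -> A) :=
  [/\ Sk R k f, f 1%N = 1
    & forall n, (0 < n)%N ->
        exists lambda : A, forall j, hecke k n f j = lambda * f j].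

(* f is the reduction modulo 2^m of an eigenform, of some weight, with
   coefficients in Z_2. *)
Definition strong_eigenform_Z2 (R : realType) (m : nat)
    (f : nat -> 'Z_(2 ^ m)) :=
  exists (k : nat) (g : nat -> Z2),
    eigenform R k g /\ forall n, f n = z2_red m (g n).

(* Power series over Z and the forms Q = E_4, R = E_6 and Delta. *)

Definition ps_mul (f g : nat -> int) (n : nat) : int :=
  \sum_(i < n.+1) f i * g (n - i)%N.

Definition ps_one (n : nat) : int := (n == 0%N)%:R.

Definition ps_exp (f : nat -> int) (e : nat) : nat -> int :=
  iter e (ps_mul f) ps_one.

Definition sigma (e n : nat) : nat := (\sum_(d <- divisors n) d ^ e)%N.

Definition Qform (n : nat) : int :=
  if n == 0%N then 1 else 240 * (sigma 3 n)%:Z.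

Definition Rform (n : nat) : int :=
  if n == 0%N then 1 else - (504 * (sigma 5 n)%:Z).

(* Delta = q * prod_(i >= 1) (1 - q^i)^24; the factors with i > n do not
   contribute to the coefficient of q^n. *)
Definition Delta (n : nat) : int :=
  ('X * \prod_(1 <= i < n.+1) (1 - 'X^i) ^+ 24 : {poly int})`_n.

(* The basis of M_k(Z), k >= 4 even: Q^a Delta^c with 4a + 12c = k if 4 | k,
   R Q^a Delta^c with 4a + 12c = k - 6 otherwise. *)
Definition basis_index (k a c : nat) : bool :=
  if (4 %| k)%N then (4 * a + 12 * c == k)%N
  else (6 + 4 * a + 12 * c == k)%N.

Definition basis_form (k a c : nat) : nat -> int :=
  let g := ps_mul (ps_exp Qform a) (ps_exp Delta c) in
  if (4 %| k)%N then g else ps_mul Rform g.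

(* deg_m f = d, for f in S_k(Z/2^m): d is the largest exponent of Delta that
   occurs with a nonzero coefficient in the expansion of f in the basis. *)
Definition has_degree (m k : nat) (f : nat -> 'Z_(2 ^ m)) (d : nat) :=
  exists x : nat -> nat -> 'Z_(2 ^ m),
    [/\ forall n, f n = \sum_(a < k.+1) \sum_(c < k.+1 | basis_index k a c)
                          x a c * (basis_form k a c n)%:~R,
        exists a, basis_index k a d /\ x a d != 0
      & forall a c, basis_index k a c -> x a c != 0 -> (c <= d)%N].

(* Main.v *)
(* Write f = sum_c x_c R^e Q^(a_c) Delta^c. Modulo 2 one has Q = R = 1, so that f
   becomes a polynomial in Delta, on which T_2, T_3 and T_5 act by explicit
   recursions; they lower suitable heights of the exponents, and as a
   consequence the degree of a polynomial P is bounded in terms of the degrees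
   of the T_p P - l_p P for p = 2, 3, 5. By induction on j, the x_c are then
   divisible by 2^j as soon as c exceeds a constant: if they are divisible by
   2^j for c >= D, write f = h + 2^j f'; since f is an eigenform modulo 2^m, the
   reductions modulo 2 of the T_p f' - l_p f' are determined by h, which ranges
   over a finite set modulo 2^m because Q^a depends only on a modulo 2^(m - 4).
   Changing the exponents of Q in their classes modulo 2^(m - 4) finally lowers
   the weight.

   That forms of weight k have such expansions rests on the modularity of Q and
   R, proved with the Lipschitz formula for sum_n (z + n)^-k and Eisenstein sums
   over squares centered at 0, and on the vanishing of the forms f with
   v(f) > k / 12, for which f^12 / Delta^k is shown to be bounded. *)

Require Import Defs.
From HB Require Import structures.
From mathcomp Require Import all_boot all_order all_algebra.
From mathcomp Require Import all_classical all_reals all_analysis.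
From mathcomp Require Import complex.
From mathcomp Require Import ring lra zify.

Set Implicit Arguments.
Unset Strict Implicit.
Unset Printing Implicit Defensive.
Import Order.TTheory GRing.Theory Num.Theory numFieldNormedType.Exports.
Local Open Scope classical_set_scope.
Local Open Scope ring_scope.

(** The obstacle is that f' is not an eigenform modulo 2, only a solution of T_p f' - l_p f' =
    (something determined by h), so the nilpotence of T_3 and T_5 modulo 2 is not enough. What is
    needed is the inhomogeneous bound on deg P, whose first effect is l_p = 0 once the degree is
    large. T_2 then controls the even exponents. Among odd exponents the pair ([H0], [Hg])
    determines the exponent, T_3 and T_5 have explicit leading terms with respect to it, and one of
    the two always isolates a term of maximal height. As the low parts h enter only through their
    finiteness, C(m) comes out without an explicit value.

    The constants come from 240 = 16 * 15 and 504 = 8 * 63. Hence Q = 1 modulo 16 and Q^(2^(m-4)) =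
    1 modulo 2^m for m >= 4, while R = 1 modulo 8 only. For m <= 3 both Q and R disappear and weight
    12 C is reached; for m >= 4 a factor R costs 6 and an exponent of Q below 2^(m-4) costs less
    than 4 * 2^(m-4) = 2^(m-2). *)

Local Notation F2 := 'F_2.

(** * Power series *)

(** A separate name for sequences, so that their canonical product is the Cauchy product and not the
    pointwise one. *)
Definition ps (A : Type) := nat -> A.
HB.instance Definition _ (A : Type) := gen_eqMixin (ps A).
HB.instance Definition _ (A : Type) := gen_choiceMixin (ps A).

Definition psadd (A : zmodType) (f g : ps A) : ps A := fun n => f n + g n.
Definition psopp (A : zmodType) (f : ps A) : ps A := fun n => - f n.
Definition pszero (A : zmodType) : ps A := fun n => 0.
Fact psaddA (A : zmodType) : associative (@psadd A).
Proof. by move=> f g h; apply: funext => n; rewrite /psadd addrA. Qed.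

Fact psaddC (A : zmodType) : commutative (@psadd A).
Proof. by move=> f g; apply: funext => n; rewrite /psadd addrC. Qed.

Fact psadd0 (A : zmodType) : left_id (@pszero A) (@psadd A).
Proof. by move=> f; apply: funext => n; rewrite /psadd add0r. Qed.

Fact psaddN (A : zmodType) : left_inverse (@pszero A) (@psopp A) (@psadd A).
Proof. by move=> f; apply: funext => n; rewrite /psadd addNr. Qed.

HB.instance Definition _ (A : zmodType) :=
  GRing.isZmodule.Build (ps A) (@psaddA A) (@psaddC A) (@psadd0 A) (@psaddN A).

Definition psmul (A : comNzRingType) (f g : ps A) : ps A :=
  fun n => \sum_(i < n.+1) f i * g (n - i)%N.
Definition psone (A : comNzRingType) : ps A := fun n => (n == 0%N)%:R.
Definition pstr (A : comNzRingType) (N : nat) (f : ps A) : {poly A} :=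
  \poly_(i < N) f i.

(** A coefficient of a Cauchy product only sees truncations of the factors; the ring axioms are
    inherited from [{poly A}] in this way. *)
Lemma psmulE (A : comNzRingType) (f g : ps A) N n : (n < N)%N ->
  psmul f g n = (pstr N f * pstr N g)`_n.
Proof.
move=> nN; rewrite coefM; apply: eq_bigr => i _; rewrite !coef_poly.
have := ltn_ord i; rewrite ltnS => iN.
by rewrite (leq_ltn_trans iN nN) (leq_ltn_trans (leq_subr _ _) nN).
Qed.

Fact psmulA (A : comNzRingType) : associative (@psmul A).
Proof.
move=> f g h; apply: funext => n; rewrite !(@psmulE _ _ _ n.+1) //.
transitivity ((pstr n.+1 f * (pstr n.+1 g * pstr n.+1 h))`_n).
  rewrite !coefM; apply: eq_bigr => i _; congr (_ * _).
  by rewrite [LHS]coef_poly ltnS leq_subr (@psmulE _ _ _ n.+1) // ltnS leq_subr.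
rewrite mulrA !coefM; apply: eq_bigr => i _; congr (_ * _).
by rewrite [RHS]coef_poly ltn_ord (@psmulE _ _ _ n.+1).
Qed.

Fact psmulC (A : comNzRingType) : commutative (@psmul A).
Proof.
by move=> f g; apply: funext => n; rewrite !(@psmulE _ _ _ n.+1) // mulrC.
Qed.

Fact psmul1 (A : comNzRingType) : left_id (@psone A) (@psmul A).
Proof.
move=> f; apply: funext => n; rewrite /psmul big_ord_recl /psone eqxx mul1r subn0.
by rewrite big1 ?addr0 // => i _; rewrite mul0r.
Qed.

Fact psmulDl (A : comNzRingType) : left_distributive (@psmul A) (@psadd A).
Proof.
move=> f g h; apply: funext => n; rewrite /psmul /psadd -big_split /=.
by apply: eq_bigr => i _; rewrite mulrDl.
Qed.

Fact psone_neq0 (A : comNzRingType) : @psone A != @pszero A.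
Proof.
by apply/eqP => /(congr1 (fun f => f 0%N))/eqP; rewrite /psone /pszero oner_eq0.
Qed.

HB.instance Definition _ (A : comNzRingType) := GRing.Zmodule_isComNzRing.Build
  (ps A) (@psmulA A) (@psmulC A) (@psmul1 A) (@psmulDl A) (@psone_neq0 A).

Section PowerSeries.
Variable A : comNzRingType.
Implicit Types f g : ps A.

Lemma psD f g n : (f + g) n = f n + g n. Proof. by []. Qed.

Lemma psN f n : (- f) n = - f n. Proof. by []. Qed.

Lemma psB f g n : (f - g) n = f n - g n. Proof. by []. Qed.

Lemma ps0 n : (0 : ps A) n = 0. Proof. by []. Qed.

Lemma ps1 n : (1 : ps A) n = (n == 0%N)%:R. Proof. by []. Qed.

Lemma psM f g n : (f * g) n = \sum_(i < n.+1) f i * g (n - i)%N.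
Proof. by []. Qed.

Lemma psMn f k n : (f *+ k) n = f n *+ k.
Proof. by elim: k => // k IH; rewrite !mulrS psD IH. Qed.

Lemma psMnl k f n : (k%:R * f) n = k%:R * f n.
Proof. by rewrite mulr_natl psMn mulr_natl. Qed.

Lemma psMzl (k : int) f n : (k%:~R * f) n = k%:~R * f n.
Proof. by rewrite !mulrzl; case: k => k; rewrite /intmul ?psN psMn. Qed.

Lemma ps_sum (I : Type) (r : seq I) (P : pred I) (F : I -> ps A) n :
  (\sum_(i <- r | P i) F i) n = \sum_(i <- r | P i) F i n.
Proof. by elim/big_rec2: _ => // i x y _ <-. Qed.

Lemma psM_congr N f g f' g' n : (n < N)%N ->
  (forall i, (i < N)%N -> f i = f' i) -> (forall i, (i < N)%N -> g i = g' i) ->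
  (f * g) n = (f' * g') n.
Proof.
move=> nN hf hg; apply: eq_bigr => i _; rewrite hf ?hg //.
  by rewrite (leq_ltn_trans (leq_subr _ _)).
by rewrite (leq_trans _ nN).
Qed.

Definition psX (k : nat) : ps A := fun n => (n == k)%:R.

Lemma psXM k f n : (psX k * f) n = if (k <= n)%N then f (n - k)%N else 0.
Proof.
rewrite psM; case: leqP => kn.
  rewrite (bigD1 (Ordinal (leq_ltn_trans kn (ltnSn n)))) //= /psX eqxx mul1r.
  by rewrite big1 ?addr0 // => i /negPf; rewrite -val_eqE /= => ->; rewrite mul0r.
rewrite big1 // => i _; rewrite /psX.
by case: eqP => [ik|]; rewrite ?mul0r //; have := ltn_ord i; lia.
Qed.

Lemma psXD k l : psX (k + l) = psX k * psX l.
Proof.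
apply: funext => n; rewrite psXM /psX; case: leqP => kn.
  by have -> : (n == (k + l)%N) = ((n - k)%N == l) by lia.
by have -> : (n == (k + l)%N) = false by lia.
Qed.

Lemma psX_exp k : psX 1 ^+ k = psX k.
Proof. by elim: k => // k IH; rewrite exprS IH -psXD. Qed.

(** Vanishing propagates from coefficient n - k to coefficient n. This is how denominators 1 - q^k
    are cleared below. *)
Lemma ps_cancel k f : (0 < k)%N -> (1 - psX k) * f = 0 -> f = 0.
Proof.
move=> k0 /eqP; rewrite mulrBl mul1r subr_eq0 => /eqP fE; apply: funext => n.
elim/ltn_ind: n => n IH; rewrite fE psXM; case: leqP => // kn.
by rewrite IH // ltn_subrL k0 (leq_trans k0 kn).
Qed.

(** The derivation q d/dq. *)
Definition psD1 f : ps A := fun n => n%:R * f n.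
Lemma psD1D f g : psD1 (f + g) = psD1 f + psD1 g.
Proof. by apply: funext => n; rewrite /psD1 !psD mulrDr. Qed.

Lemma psD1N f : psD1 (- f) = - psD1 f.
Proof. by apply: funext => n; rewrite /psD1 !psN mulrN. Qed.

Lemma psD1M f g : psD1 (f * g) = psD1 f * g + f * psD1 g.
Proof.
apply: funext => n; rewrite /psD1 psD !psM mulr_sumr -big_split /=.
apply: eq_bigr => i _.
have -> : n%:R = i%:R + (n - i)%:R :> A by rewrite -natrD subnKC // -ltnS.
by ring.
Qed.

Lemma psD1X f k : psD1 (f ^+ k.+1) = k.+1%:R * f ^+ k * psD1 f.
Proof.
elim: k => [|k IH]; first by rewrite expr1 expr0 !mul1r.
by rewrite exprS psD1M IH -[k.+2%:R]natr1 !exprS; ring.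
Qed.

Lemma psD1n k : psD1 k%:R = 0.
Proof.
by apply: funext => -[|n]; rewrite /psD1 ?mul0r // -[k%:R]mulr1 psMnl ps1 !mulr0.
Qed.

Lemma psD1_1 : psD1 1 = 0. Proof. exact: (psD1n 1). Qed.

Definition ps_of_poly (p : {poly A}) : ps A := fun n => p`_n.
Lemma ps_of_polyM p q : ps_of_poly (p * q) = ps_of_poly p * ps_of_poly q.
Proof. by apply: funext => n; rewrite /ps_of_poly coefM. Qed.

Lemma ps_of_polyD p q : ps_of_poly (p + q) = ps_of_poly p + ps_of_poly q.
Proof. by apply: funext => n; rewrite /ps_of_poly coefD. Qed.

Lemma ps_of_polyN p : ps_of_poly (- p) = - ps_of_poly p.
Proof. by apply: funext => n; rewrite /ps_of_poly coefN. Qed.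

Lemma ps_of_poly1 : ps_of_poly 1 = 1.
Proof. by apply: funext => n; rewrite /ps_of_poly coef1. Qed.

Lemma ps_of_polyXn k : ps_of_poly 'X^k = psX k.
Proof. by apply: funext => n; rewrite /ps_of_poly coefXn. Qed.

Lemma ps_of_polyX p k : ps_of_poly (p ^+ k) = ps_of_poly p ^+ k.
Proof. by elim: k => [|k IH]; rewrite ?ps_of_poly1 // !exprS ps_of_polyM IH. Qed.

Lemma psM_0 f g : (f * g) 0%N = f 0%N * g 0%N.
Proof. by rewrite psM big_ord1. Qed.

Lemma psM_1 f g : (f * g) 1%N = f 0%N * g 1%N + f 1%N * g 0%N.
Proof. by rewrite psM !big_ord_recl big_ord0 addr0. Qed.

End PowerSeries.
Arguments psX : simpl never.
Arguments psD1 : simpl never.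
Arguments ps_of_poly : simpl never.

Lemma ps_mulE (f g : ps int) : ps_mul f g = f * g. Proof. by []. Qed.

Lemma ps_expE (f : ps int) e : ps_exp f e = f ^+ e.
Proof. by elim: e => // e IH; rewrite exprS -IH. Qed.

Definition psmap (A B : comNzRingType) (phi : A -> B) (f : ps A) : ps B :=
  fun n => phi (f n).

Section PsMap.
Variables (A B : comNzRingType) (phi : {rmorphism A -> B}).
Fact psmap_zmod : zmod_morphism (psmap phi).
Proof. by move=> f g; apply: funext => n; rewrite /psmap psB rmorphB. Qed.

Fact psmap_monoid : monoid_morphism (psmap phi).
Proof.
split; first by apply: funext => n; rewrite /psmap ps1 rmorph_nat.
move=> f g; apply: funext => n; rewrite /psmap !psM rmorph_sum.
by apply: eq_bigr => i _; rewrite rmorphM.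
Qed.

HB.instance Definition _ := GRing.isZmodMorphism.Build (ps A) (ps B) (psmap phi) psmap_zmod.
HB.instance Definition _ := GRing.isMonoidMorphism.Build (ps A) (ps B) (psmap phi) psmap_monoid.
End PsMap.

(** With n the order of f, the coefficient n + k of the product reduces to [f n * g k] once the
    earlier coefficients of g are known to vanish. *)
Lemma ps_mulf_eq0 (A : idomainType) (f g : ps A) :
  f * g = 0 -> f = 0 \/ g = 0.
Proof.
move=> fg; have [|/eqP f0] := eqVneq f 0; [by left | right].
have [n0 fn0] : exists n, f n != 0.
  apply: contrapT => h; apply: f0; apply: funext => n.
  by apply/eqP; apply: contrapT => /negP ?; apply: h; exists n.
have [n fn nmin] := ex_minnP (ex_intro (fun n => f n != 0) _ fn0).
apply: funext => k; elim/ltn_ind: k => k IH.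
have := congr1 (fun h => h (n + k)%N) fg; rewrite psM.
have nk : (n < (n + k).+1)%N by lia.
rewrite (bigD1 (Ordinal nk)) //= big1 => [|i /negPf]; last first.
  rewrite -val_eqE /= => /negbT; rewrite neq_ltn => /orP[ni|ni].
    have : ~~ (f i != 0) by apply/negP => /nmin; lia.
    by rewrite negbK => /eqP ->; rewrite mul0r.
  by rewrite IH ?mulr0 //; have := ltn_ord i; lia.
rewrite addr0 addKn => /eqP; rewrite ps0 mulf_eq0 (negPf fn) /=.
by move/eqP.
Qed.

(** * Ramanujan identities *)

(** The Lambert series q^a / (1 - q^a). *)
Definition lambert (a : nat) : ps int :=
  fun n => ((0 < n)%N && (a %| n)%N)%:R.

Lemma lambertE a : (0 < a)%N -> (1 - psX int a) * lambert a = psX int a.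
Proof.
move=> a0; apply: funext => n; rewrite mulrBl mul1r psB psXM /lambert /psX.
case: (leqP a n) => an.
  have [->|na] := eqVneq n a; first by rewrite subnn ltnn /= subr0 a0 dvdnn.
  have -> : (0 < n)%N by lia.
  have -> : (0 < n - a)%N by lia.
  by rewrite /= dvdn_subl // subrr.
have -> : (n == a) = false by lia.
by case: n an => //= n an; rewrite gtnNdvd.
Qed.

Lemma lambert_big a n : (n < a)%N -> lambert a n = 0.
Proof. by case: n => // n na; rewrite /lambert gtnNdvd. Qed.

(** With u = q^a and v = q^b, 1 + u/(1 - u) + v/(1 - v) = (1 - uv)/((1 - u)(1 - v)). The three
    denominators are cleared by [ps_cancel]. *)
Lemma lambertM a b : (0 < a)%N -> (0 < b)%N ->
  lambert a * lambert b = lambert (a + b) * (1 + lambert a + lambert b).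
Proof.
move=> a0 b0; apply/eqP; rewrite -subr_eq0; apply/eqP.
have ea := lambertE a0; have eb := lambertE b0.
have /lambertE eab : (0 < a + b)%N by rewrite addn_gt0 a0.
apply: (ps_cancel a0); apply: (ps_cancel b0).
have ab0 : (0 < a + b)%N by rewrite addn_gt0 a0.
apply: (ps_cancel ab0).
move: ea eb eab; rewrite psXD.
set u := psX int a; set v := psX int b.
set x := lambert a; set y := lambert b; set z := lambert (a + b) => ea eb eab.
transitivity ((1 - u * v) * ((1 - u) * x) * ((1 - v) * y) - ((1 - u * v) * z) *
  ((1 - u) * (1 - v) + ((1 - u) * x) * (1 - v) + (1 - u) * ((1 - v) * y))).
  by ring.
by rewrite ea eb eab; ring.
Qed.

(** If L is the series of a, then q d/dq maps it to a (L + L^2). *)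
Lemma lambert_sqr a n : (0 < a)%N ->
  a%:R * (lambert a * lambert a) n = (n%:R - a%:R) * lambert a n.
Proof.
move=> a0; have ea := lambertE a0.
have dX : psD1 (psX int a) = a%:R * psX int a.
  apply: funext => k; rewrite psMnl /psD1 /psX.
  by case: eqP => [->|]; rewrite ?mulr0.
have dE : psD1 (lambert a) = a%:R * (lambert a + lambert a * lambert a).
  apply/eqP; rewrite -subr_eq0; apply/eqP; apply: (ps_cancel a0).
  have h : (1 - psX int a) * psD1 (lambert a) =
      a%:R * psX int a + a%:R * psX int a * lambert a.
    have := congr1 (@psD1 _) ea; rewrite psD1M psD1D psD1N dX psD1_1 => hD.
    transitivity ((0 - a%:R * psX int a) * lambert a +
      (1 - psX int a) * psD1 (lambert a) + a%:R * psX int a * lambert a); first by ring.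
    by rewrite hD.
  rewrite mulrBr h; move: ea; set u := psX int a; set x := lambert a => ea.
  transitivity (a%:R * u + (a%:R * u) * x - a%:R * (((1 - u) * x) * (1 + x))); first by ring.
  by rewrite ea; ring.
have := congr1 (fun f => f n) dE.
rewrite /psD1 psMnl psD mulrDr => /eqP; rewrite addrC -subr_eq => /eqP <-.
by rewrite mulrBl.
Qed.

(* A re-indexing by [c = a + b] of [q^(a+b)], of which a polynomial invariant
   under the symmetric group permuting [a], [b] and [-(a+b)] is a fixed
   point; every convolution identity below comes from it. *)
Lemma lambert_conv (f u : nat -> nat -> int) (n : nat) :
  (forall a b, f a b = f b a) -> (forall a b, u a b = u b a) ->
  (forall a b, u a (a + b)%N = f a b) ->
  \sum_(1 <= a < n.+1) \sum_(1 <= b < n.+1) (f a b - u a b) * (lambert a * lambert b) n =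
  \sum_(1 <= c < n.+1) (\sum_(1 <= a < c) f a (c - a)%N) * lambert c n -
  \sum_(1 <= a < n.+1) u a a * (lambert a * lambert a) n.
Proof.
move=> fC uC ufE; set N := n.+1.
(* Shift to c = a + b; since G vanishes beyond n, the sum over c may be cut at n. *)
have reindexN (a : nat) (G : nat -> int) : (forall c, (n < c)%N -> G c = 0) ->
    \sum_(1 <= b < N) G (a + b)%N = \sum_(1 <= c < N) if (a < c)%N then G c else 0.
  move=> G0; transitivity (\sum_(a.+1 <= c < a + N) G c).
    rewrite -{1}[a.+1]add1n big_addn addnC addnK.
    by apply: eq_bigr => i _; rewrite addnC.
  rewrite -big_mkcond /=; have [aN|Na] := leqP N a.+1.
    rewrite [RHS]big_nat_cond [RHS]big_pred0; last by move=> c; lia.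
    rewrite big_nat_cond big1 // => c; rewrite andbT => /andP[ac _]; apply: G0; lia.
  rewrite (big_cat_nat (n := N)) //=; [|lia..].
  rewrite [X in _ + X]big_nat_cond [X in _ + X]big1 ?addr0; last first.
    by move=> c; rewrite andbT => /andP[ac _]; apply: G0; lia.
  rewrite [RHS](big_cat_nat (n := a.+1)) //=; last by rewrite ltnW.
  rewrite [X in _ = X + _]big_nat_cond [X in _ = X + _]big_pred0 ?add0r => [|c]; last by lia.
  by rewrite [LHS]big_nat_cond [RHS]big_nat_cond; apply: eq_bigl => c; lia.
pose Lc c a := (lambert c * lambert a) n.
have Lc0 c a : (n < c)%N -> Lc c a = 0.
  move=> nc; rewrite /Lc psM big1 // => i _; rewrite lambert_big ?mul0r //.
  by rewrite (leq_ltn_trans _ nc) // -ltnS.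
have LcC a b : Lc a b = Lc b a by rewrite /Lc mulrC.
(* [lambertM] splits each product into the series of a + b and its products with those of a and of
   b; by symmetry the last two contribute equally. *)
have e1 : \sum_(1 <= a < N) \sum_(1 <= b < N) f a b * Lc a b =
    \sum_(1 <= a < N) \sum_(1 <= b < N) f a b * lambert (a + b) n +
    (\sum_(1 <= a < N) \sum_(1 <= b < N) f a b * Lc (a + b)%N a) *+ 2.
  rewrite mulr2n [X in _ = _ + (_ + X)]exchange_big -!big_split /=.
  rewrite big_nat [RHS]big_nat; apply: eq_bigr => a /andP[a0 _].
  rewrite -!big_split /= big_nat [RHS]big_nat; apply: eq_bigr => b /andP[b0 _].
  have -> : Lc a b = lambert (a + b) n + Lc (a + b)%N a + Lc (a + b)%N b.
    by rewrite /Lc lambertM // !mulrDr mulr1 !psD.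
  by rewrite (addnC b a) (fC b a) !mulrDr addrA.
have e2 : \sum_(1 <= a < N) \sum_(1 <= b < N) f a b * lambert (a + b) n =
    \sum_(1 <= c < N) (\sum_(1 <= a < c) f a (c - a)%N) * lambert c n.
  transitivity (\sum_(1 <= a < N) \sum_(1 <= c < N)
     if (a < c)%N then f a (c - a)%N * lambert c n else 0).
    apply: eq_bigr => a _; rewrite -reindexN; last first.
      by move=> c nc; rewrite lambert_big ?mulr0.
    by apply: eq_bigr => b _; rewrite addKn.
  rewrite exchange_big /= big_nat [RHS]big_nat; apply: eq_bigr => c /andP[_ cN].
  rewrite -big_mkcond mulr_suml [RHS](big_nat_widen _ _ N) ?(ltnW cN) //=.
(* Since f a b = u a (a + b), the sum runs over the pairs a < c; doubled, it is by symmetry the full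
   square without its diagonal. *)
have e3 : (\sum_(1 <= a < N) \sum_(1 <= b < N) f a b * Lc (a + b)%N a) *+ 2 =
    \sum_(1 <= a < N) \sum_(1 <= c < N) u a c * Lc a c -
    \sum_(1 <= a < N) u a a * Lc a a.
  have -> : \sum_(1 <= a < N) \sum_(1 <= b < N) f a b * Lc (a + b)%N a =
     \sum_(1 <= a < N) \sum_(1 <= c < N) if (a < c)%N then u a c * Lc c a else 0.
    apply: eq_bigr => a _; rewrite -reindexN; last first.
      by move=> c nc; rewrite Lc0 ?mulr0.
    by apply: eq_bigr => b _; rewrite ufE.
  rewrite mulr2n [X in _ + X = _]exchange_big -big_split -sumrB /=.
  rewrite big_nat [RHS]big_nat; apply: eq_bigr => a /andP[a0 aN].
  rewrite -big_split /=.
  have aI : a \in index_iota 1 N by rewrite mem_index_iota a0.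
  rewrite (bigD1_seq a) ?iota_uniq //= ltnn addr0 add0r.
  rewrite [X in _ = X - _](bigD1_seq a) ?iota_uniq //= [X in _ = X - _]addrC addrK.
  apply: eq_bigr => c ca; rewrite uC [Lc a c]LcC.
  by case: ltngtP ca => //= ac; rewrite ?addr0 ?add0r // uC LcC.
transitivity (\sum_(1 <= a < N) \sum_(1 <= b < N) f a b * Lc a b -
    \sum_(1 <= a < N) \sum_(1 <= b < N) u a b * Lc a b).
  rewrite -sumrB; apply: eq_bigr => a _; rewrite -sumrB; apply: eq_bigr => b _.
  by rewrite mulrBl.
rewrite e1 e2 e3; ring.
Qed.

Definition divsum (e : nat) : ps int :=
  fun n => if n == 0%N then 0 else (sigma e n)%:Z.

Lemma divsumE e N n : (n < N)%N ->
  divsum e n = \sum_(1 <= a < N) (a ^ e)%N%:R * lambert a n.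
Proof.
rewrite /divsum; case: n => [|n] nN /=.
  by rewrite big1 // => a _; rewrite /lambert mulr0.
rewrite /sigma -natz natr_sum.
transitivity (\sum_(a <- index_iota 1 N | (a %| n.+1)%N) (a ^ e)%N%:R : int).
  rewrite -[RHS]big_filter; apply: perm_big; apply: uniq_perm.
  - exact: divisors_uniq.
  - by rewrite filter_uniq ?iota_uniq.
  move=> d; rewrite mem_filter mem_index_iota -dvdn_divisors //.
  case: (boolP (d %| n.+1)%N) => //= dn.
  by rewrite (dvdn_gt0 _ dn) //= (leq_ltn_trans (dvdn_leq _ dn)).
rewrite big_mkcond; apply: eq_bigr => a _; rewrite /lambert /=.
by case: (a %| _)%N; rewrite ?mulr1 ?mulr0.
Qed.

Lemma divsumM e e' n : (divsum e * divsum e') n =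
  \sum_(1 <= a < n.+1) \sum_(1 <= b < n.+1)
     (a ^ e)%N%:R * (b ^ e')%N%:R * (lambert a * lambert b) n.
Proof.
pose B e : ps int := \sum_(1 <= a < n.+1) (a ^ e)%N%:R * lambert a.
have dB k i : (i < n.+1)%N -> divsum k i = B k i.
  move=> iN; rewrite (divsumE _ iN) /B ps_sum; apply: eq_bigr => a _.
  by rewrite psMnl.
rewrite (@psM_congr _ n.+1 _ _ (B e) (B e')) // => [|i|i]; [|exact: dB..].
rewrite /B big_distrlr /= ps_sum; apply: eq_bigr => a _; rewrite ps_sum.
by apply: eq_bigr => b _; rewrite mulrACA -mulrA !psMnl mulrA.
Qed.

(** The sum over a + b = c needed in [divsum33]. The factor 30 clears the denominators of
    Faulhaber's formulas. *)
Lemma diag_sum_e3 c : 30 * \sum_(1 <= a < c) ((a * (c - a) * c)%N%:Z) ^+ 2 =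
  (if c is 0 then 0 else c%:Z ^+ 7 - c%:Z ^+ 3).
Proof.
case: c => [|n]; first by rewrite big_geq ?mulr0.
set c := n.+1.
(* The upper limit is separated from c, so that induction on it keeps the summand fixed. *)
suff H m : (m <= n)%N -> 30 * \sum_(1 <= a < m.+1) ((a * (c - a) * c)%N%:Z) ^+ 2 =
   c%:Z ^+ 2 * (5 * c%:Z ^+ 2 * (m%:Z + 1) * m%:Z * (2 * m%:Z + 1)
   - 15 * c%:Z * ((m%:Z + 1) * m%:Z) ^+ 2
   + (m%:Z + 1) * m%:Z * (2 * m%:Z + 1) * (3 * (m%:Z + 1) ^+ 2 - 3 * (m%:Z + 1) - 1)).
  by rewrite H // /c -natr1; set x := n%:Z; ring.
elim: m => [|m IH] mn; first by rewrite big_geq //; ring.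
rewrite big_nat_recr //= mulrDr IH ?(ltnW mn) // !PoszM -subzn; last by rewrite /c; lia.
by rewrite -natr1; set x := m%:Z; set y := c%:Z; ring.
Qed.

(** Up to sign, the second elementary symmetric function of a, b and -(a + b). *)
Definition e2sq (a b : nat) : int := a%:Z ^+ 2 + a%:Z * b%:Z + b%:Z ^+ 2.

Lemma diag_sum_e2_2 c : 30 * \sum_(1 <= a < c) e2sq a (c - a) ^+ 2 =
  (if c is 0 then 0 else
   21 * c%:Z ^+ 5 - 30 * c%:Z ^+ 4 + 10 * c%:Z ^+ 3 - c%:Z).
Proof.
case: c => [|n]; first by rewrite big_geq ?mulr0.
set c := n.+1.
suff H m : (m <= n)%N -> 30 * \sum_(1 <= a < m.+1) e2sq a (c - a) ^+ 2 =
   30 * c%:Z ^+ 4 * m%:Z - 30 * c%:Z ^+ 3 * m%:Z * (m%:Z + 1)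
   + 15 * c%:Z ^+ 2 * (m%:Z + 1) * m%:Z * (2 * m%:Z + 1)
   - 15 * c%:Z * ((m%:Z + 1) * m%:Z) ^+ 2
   + (m%:Z + 1) * m%:Z * (2 * m%:Z + 1) * (3 * (m%:Z + 1) ^+ 2 - 3 * (m%:Z + 1) - 1).
  by rewrite H // /c -natr1; set x := n%:Z; ring.
elim: m => [|m IH] mn; first by rewrite big_geq //; ring.
rewrite big_nat_recr //= mulrDr IH ?(ltnW mn) // /e2sq -subzn; last by rewrite /c; lia.
by rewrite -natr1; set x := m%:Z; set y := c%:Z; ring.
Qed.

Lemma diag_sum_e2_3 c : 420 * \sum_(1 <= a < c) e2sq a (c - a) ^+ 3 =
  (if c is 0 then 0 else
   249 * c%:Z ^+ 7 - 420 * c%:Z ^+ 6 + 210 * c%:Z ^+ 5 - 49 * c%:Z ^+ 3 + 10 * c%:Z).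
Proof.
case: c => [|n]; first by rewrite big_geq ?mulr0.
set c := n.+1.
suff H m : (m <= n)%N -> 420 * \sum_(1 <= a < m.+1) e2sq a (c - a) ^+ 3 =
   let M := m%:Z + 1 in
   420 * c%:Z ^+ 6 * m%:Z - 630 * c%:Z ^+ 5 * m%:Z * M
   + 420 * c%:Z ^+ 4 * M * m%:Z * (2 * m%:Z + 1)
   - 735 * c%:Z ^+ 3 * (M * m%:Z) ^+ 2
   + 84 * c%:Z ^+ 2 * M * m%:Z * (2 * m%:Z + 1) * (3 * M ^+ 2 - 3 * M - 1)
   - 105 * c%:Z * M ^+ 2 * m%:Z ^+ 2 * (2 * M ^+ 2 - 2 * M - 1)
   + 10 * M * m%:Z * (2 * m%:Z + 1) * (3 * M ^+ 4 - 6 * M ^+ 3 + 3 * M + 1).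
  by rewrite H //= /c -natr1; set x := n%:Z; ring.
elim: m => [|m IH] mn; first by rewrite big_geq //=; ring.
rewrite big_nat_recr //= mulrDr IH ?(ltnW mn) // /e2sq -subzn; last by rewrite /c; lia.
by rewrite /= -natr1; set x := m%:Z; set y := c%:Z; ring.
Qed.

Lemma divsum_scale (k : int) e n : k%:~R * divsum e n =
  \sum_(1 <= a < n.+1) k * a%:Z ^+ e * lambert a n.
Proof.
rewrite (divsumE _ (ltnSn n)) mulr_sumr; apply: eq_bigr => a _.
by rewrite natrX intz mulrA natz.
Qed.

(** This is E_4^2 = E_8. With f = (a b (a + b))^2 and u = (a b (b - a))^2 the difference f - u is 4
    a^3 b^3, and u vanishes on the diagonal. *)
Lemma divsum33 : 120 * (divsum 3 * divsum 3) = divsum 7 - divsum 3.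
Proof.
apply: funext => n.
pose f (a b : nat) : int := ((a * b * (a + b))%N%:Z) ^+ 2.
pose u (a b : nat) : int := (a%:Z * b%:Z * (b%:Z - a%:Z)) ^+ 2.
have fC a b : f a b = f b a by rewrite /f (mulnC a) addnC.
have uC a b : u a b = u b a by rewrite /u; ring.
have ufE a b : u a (a + b)%N = f a b by rewrite /u /f PoszD !PoszM; ring.
have := congr1 ( *%R 30) (lambert_conv n fC uC ufE).
have -> : \sum_(1 <= a < n.+1) \sum_(1 <= b < n.+1)
   (f a b - u a b) * (lambert a * lambert b) n = 4 * (divsum 3 * divsum 3) n.
  rewrite divsumM mulr_sumr; apply: eq_bigr => a _; rewrite mulr_sumr.
  apply: eq_bigr => b _; rewrite mulrA !natrX /f /u !PoszM PoszD !natz; congr (_ * _); ring.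
rewrite [X in _ - X]big1; last by move=> a _; rewrite /u subrr mulr0 expr0n mul0r.
rewrite subr0 => H.
rewrite psMnl psB; transitivity (30 * (4 * (divsum 3 * divsum 3) n)); first by ring.
rewrite H mulr_sumr -[divsum 7 n]mul1r -[divsum 3 n]mul1r.
rewrite !(divsum_scale 1) -sumrB big_nat [RHS]big_nat.
apply: eq_bigr => c /andP[c0 _]; rewrite mulrA.
have -> : \sum_(1 <= a < c) f a (c - a)%N = \sum_(1 <= a < c) ((a * (c - a) * c)%N%:Z) ^+ 2.
  rewrite big_nat [RHS]big_nat; apply: eq_bigr => a /andP[_ ac].
  by rewrite /f subnKC // ltnW.
rewrite diag_sum_e3; case: c c0 => // c _; ring.
Qed.

(** The differential equation of E_4. For the square of [e2sq], f - u = 4 (a^3 b + a b^3); the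
    diagonal values u c c = c^4 bring in the derivative through [lambert_sqr]. *)
Lemma divsum13 : 240 * (divsum 1 * divsum 3) =
  21 * divsum 5 + 10 * divsum 3 - divsum 1 - 30 * psD1 (divsum 3).
Proof.
apply: funext => n.
pose f (a b : nat) : int := e2sq a b ^+ 2.
pose u (a b : nat) : int := (a%:Z ^+ 2 - a%:Z * b%:Z + b%:Z ^+ 2) ^+ 2.
have fC a b : f a b = f b a by rewrite /f /e2sq; ring.
have uC a b : u a b = u b a by rewrite /u; ring.
have ufE a b : u a (a + b)%N = f a b by rewrite /u /f /e2sq PoszD; ring.
have := congr1 ( *%R 30) (lambert_conv n fC uC ufE).
have -> : \sum_(1 <= a < n.+1) \sum_(1 <= b < n.+1)
   (f a b - u a b) * (lambert a * lambert b) n = 8 * (divsum 1 * divsum 3) n.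
  transitivity (4 * (divsum 1 * divsum 3) n + 4 * (divsum 3 * divsum 1) n).
    rewrite !divsumM !mulr_sumr -big_split; apply: eq_bigr => a _ /=.
    rewrite !mulr_sumr -big_split; apply: eq_bigr => b _ /=.
    rewrite !natrX /f /u /e2sq !natz; ring.
  by rewrite (mulrC (divsum 3)); ring.
move=> H; rewrite !(psB, psD) !psMnl; transitivity (30 * (8 * (divsum 1 * divsum 3) n));
  first by ring.
rewrite H /psD1 mulrA -[divsum 1 n]mul1r.
rewrite (divsum_scale 21) (divsum_scale 10) (divsum_scale 1) (divsumE 3 (ltnSn n)).
rewrite mulrBr !mulr_sumr -big_split /= -!sumrB big_nat [RHS]big_nat.
apply: eq_bigr => c /andP[c0 _]; rewrite mulrA diag_sum_e2_2.
have -> : u c c * (lambert c * lambert c) n = c%:Z ^+ 3 * ((n%:R - c%:R) * lambert c n).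
  by rewrite -lambert_sqr // /u !natz; ring.
case: c c0 => // c _; rewrite !natrX !natz; ring.
Qed.

(** The differential equation of E_6. For the cube of [e2sq], f - u = 6 (a^5 b + a b^5) + 14 a^3
    b^3, and the last term is removed by [divsum33]. *)
Lemma divsum15 : 504 * (divsum 1 * divsum 5) =
  20 * divsum 7 + 21 * divsum 5 + divsum 1 - 42 * psD1 (divsum 5).
Proof.
apply: funext => n.
pose f (a b : nat) : int := e2sq a b ^+ 3.
pose u (a b : nat) : int := (a%:Z ^+ 2 - a%:Z * b%:Z + b%:Z ^+ 2) ^+ 3.
have fC a b : f a b = f b a by rewrite /f /e2sq; ring.
have uC a b : u a b = u b a by rewrite /u; ring.
have ufE a b : u a (a + b)%N = f a b by rewrite /u /f /e2sq PoszD; ring.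
have := congr1 ( *%R 420) (lambert_conv n fC uC ufE).
have -> : \sum_(1 <= a < n.+1) \sum_(1 <= b < n.+1)
   (f a b - u a b) * (lambert a * lambert b) n =
   12 * (divsum 1 * divsum 5) n + 14 * (divsum 3 * divsum 3) n.
  transitivity (6 * (divsum 1 * divsum 5) n + 6 * (divsum 5 * divsum 1) n +
                14 * (divsum 3 * divsum 3) n).
    rewrite !divsumM !mulr_sumr -!big_split; apply: eq_bigr => a _ /=.
    rewrite !mulr_sumr -!big_split; apply: eq_bigr => b _ /=.
    rewrite !natrX /f /u /e2sq !natz; ring.
  by rewrite (mulrC (divsum 5)); ring.
have := congr1 (fun f => f n) divsum33; rewrite /= psMnl psB => H3 H.
(* 420 * 12 = 10 * 504 and 420 * 14 = 49 * 120. *)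
apply: (@mulfI _ 10) => //.
transitivity (420 * (12 * (divsum 1 * divsum 5) n + 14 * (divsum 3 * divsum 3) n)
   - 49 * (120 * (divsum 3 * divsum 3) n)); first by rewrite psMnl; ring.
rewrite H H3 !(psB, psD) !psMnl /psD1.
transitivity (249 * divsum 7 n + 210 * divsum 5 n + (-49) * divsum 3 n + 10 * divsum 1 n
   - 420 * (n%:R * divsum 5 n) - 49 * (divsum 7 n - divsum 3 n)); last by ring.
congr (_ - _).
rewrite (divsum_scale 249) (divsum_scale 210) (divsum_scale (-49)) (divsum_scale 10) (divsumE
  5 (ltnSn n)).
rewrite mulrBr !mulr_sumr -!big_split /= -!sumrB big_nat [RHS]big_nat.
apply: eq_bigr => c /andP[c0 _]; 
have -> : 420 * ((\sum_(1 <= a < c) f a (c - a)%N) * lambert c n) =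
  420 * (\sum_(1 <= a < c) e2sq a (c - a) ^+ 3) * lambert c n by rewrite mulrA.
rewrite diag_sum_e2_3.
have -> : u c c * (lambert c * lambert c) n = c%:Z ^+ 5 * ((n%:R - c%:R) * lambert c n).
  by rewrite -lambert_sqr // /u !natz; ring.
case: c c0 => // c _; rewrite !natrX !natz; ring.
Qed.

(** The quasi-modular series E_2. *)
Definition Eis2 : ps int := 1 - 24 * divsum 1.

Lemma QformE : Qform = (1 + 240 * divsum 3 : ps int).
Proof.
by apply: funext => -[|n]; rewrite psD psMnl ps1 /divsum /Qform //= add0r.
Qed.

Lemma RformE : Rform = (1 - 504 * divsum 5 : ps int).
Proof.
by apply: funext => -[|n]; rewrite psB psMnl ps1 /divsum /Rform //= sub0r.
Qed.

Lemma ramanujan_Q_aux (K : comPzRingType) (x1 x3 x5 x13 dx3 : K) : 240 * x13 =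
  21 * x5 + 10 * x3 - x1 - 30 * dx3 -> x13 = x1 * x3 ->
  3 * (240 * dx3) = (1 - 24 * x1) * (1 + 240 * x3) - (1 - 504 * x5).
Proof.
move=> h e; transitivity (504 * x5 + 240 * x3 - 24 * x1 - 24 * (240 * x13)).
  by rewrite h; ring.
by rewrite e; ring.
Qed.

Lemma ramanujan_R_aux (K : comPzRingType) (x1 x3 x5 x7 x15 x33 dx5 : K) :
  504 * x15 = 20 * x7 + 21 * x5 + x1 - 42 * dx5 -> 120 * x33 = x7 - x3 ->
  x15 = x1 * x5 -> x33 = x3 * x3 ->
  2 * (- (504 * dx5)) = (1 - 24 * x1) * (1 - 504 * x5) - (1 + 240 * x3) ^+ 2.
Proof.
move=> h h' e e'; transitivity (- 504 * x5 - 24 * x1 - 480 * x3 +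
   24 * (504 * x15) - 480 * (120 * x33)).
  by rewrite h h'; ring.
by rewrite e e'; ring.
Qed.

Lemma ramanujan_Q : 3 * psD1 (Qform : ps int) = Eis2 * (Qform : ps int) - (Rform : ps int).
Proof.
rewrite QformE RformE psD1D psD1_1 add0r psD1M psD1n mul0r add0r.
exact: ramanujan_Q_aux divsum13 _.
Qed.

Lemma ramanujan_R : 2 * psD1 (Rform : ps int) =
  Eis2 * (Rform : ps int) - (Qform : ps int) ^+ 2.
Proof.
rewrite QformE RformE psD1D psD1N psD1_1 add0r psD1M psD1n mul0r add0r.
exact: ramanujan_R_aux divsum15 divsum33 _ _.
Qed.

Lemma psD1_Q3R2 : let W := (Qform : ps int) ^+ 3 - (Rform : ps int) ^+ 2 in
  psD1 W = Eis2 * W.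
Proof.
rewrite /= psD1D psD1N !psD1X.
transitivity ((Qform : ps int) ^+ 2 * (3 * psD1 (Qform : ps int)) -
  (Rform : ps int) * (2 * psD1 (Rform : ps int))); first by ring.
by rewrite ramanujan_Q ramanujan_R; ring.
Qed.

Definition Delta_trunc (N : nat) : ps int :=
  psX int 1 * \prod_(1 <= i < N.+1) (1 - psX int i) ^+ 24.

Lemma Delta_truncE N n : (n <= N)%N -> Delta n = Delta_trunc N n.
Proof.
move=> nN.
have DE M : Delta_trunc M =
    ps_of_poly ('X * \prod_(1 <= i < M.+1) (1 - 'X^i) ^+ 24 : {poly int}).
  rewrite ps_of_polyM -[X in _ = ps_of_poly X * _]expr1 ps_of_polyXn.
  congr (_ * _); elim: M => [|M IH]; first by rewrite !big_geq // ps_of_poly1.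
  rewrite (big_nat_recr M.+1) // [in RHS](big_nat_recr M.+1) //=.
  by rewrite ps_of_polyM -IH ps_of_polyX ps_of_polyD ps_of_poly1
    ps_of_polyN ps_of_polyXn.
transitivity (Delta_trunc n n); first by rewrite DE.
rewrite -(subnKC nN); elim: (N - n)%N => [|k IH]; first by rewrite addn0.
rewrite {}IH addnS /Delta_trunc [in RHS]big_nat_recr //= mulrA.
set F := psX int 1 * _; set i := (n + k).+1.
rewrite -[F in LHS]mulr1; apply: (@psM_congr _ i) => //; first by rewrite /i; lia.
move=> j ji; have h : forall l, (l < i)%N -> (1 - psX int i) l = (1 : ps int) l.
  by move=> l li; rewrite psB /psX ltn_eqF // subr0.
have H : forall e l, (l < i)%N -> ((1 - psX int i) ^+ e) l = (1 : ps int) l.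
  elim=> // e IH l li; rewrite exprS -[1 in RHS]mulr1.
  by apply: (@psM_congr _ i).
by rewrite H.
Qed.

(** Logarithmic derivative of the product: the factor (1 - q^i)^24 contributes -24 i q^i / (1 -
    q^i). It is computed on truncated products, where L is the truncation of [divsum 1]. *)
Lemma psD1_Delta : psD1 (Delta : ps int) = Eis2 * (Delta : ps int).
Proof.
apply: funext => N.
have dX i : psD1 (psX int i) = i%:R * psX int i.
  apply: funext => k; rewrite psMnl /psD1 /psX.
  by case: eqP => [->|]; rewrite ?mulr0.
pose L : ps int := \sum_(1 <= i < N.+1) i%:R * lambert i.
have H : psD1 (Delta_trunc N) = (1 - 24 * L) * Delta_trunc N.
  rewrite /Delta_trunc /L {L}; elim: N => [|N IH].
    by rewrite !big_geq // mulr1 mulr0 subr0 mul1r dX mul1r.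
  have dF : psD1 ((1 - psX int N.+1) ^+ 24) =
      24%:R * (1 - psX int N.+1) ^+ 23 * (0 - N.+1%:R * psX int N.+1).
    by rewrite psD1X psD1D psD1N psD1_1 dX.
  rewrite !(big_nat_recr N.+1) //= mulrA psD1M {}IH dF.
  have := @lambertE N.+1 isT; set x := psX int N.+1; set l := lambert N.+1 => e.
  set p := psX int 1 * _; set S := \sum_(1 <= i < N.+1) _.
  transitivity ((1 - 24 * S) * (p * (1 - x) ^+ 24) - 24 * N.+1%:R * x * p * (1 - x) ^+ 23).
    by ring.
  rewrite -{2}e; ring.
transitivity (psD1 (Delta_trunc N) N); first by rewrite /psD1 (@Delta_truncE N).
rewrite H; apply: (@psM_congr _ N.+1) => // i iN; last by rewrite (@Delta_truncE N).
rewrite /Eis2 !psB !psMnl (divsumE 1 iN) /L ps_sum; congr (_ - _ * _).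
by apply: eq_bigr => a _; rewrite psMnl expn1.
Qed.

(** The coefficient of q^n reads (n - 1) W_n = a combination of the W_i with i < n, so W_1 alone is
    free. *)
Lemma psD1_Eis2_eq0 (W : ps int) : psD1 W = Eis2 * W -> W 1%N = 0 -> W = 0.
Proof.
move=> dW W1; apply: funext => n; elim/ltn_ind: n => n IH.
have := congr1 (fun f => f n) dW; rewrite psM big_ord_recl /= subn0 big1; last first.
  by move=> i _; rewrite IH ?mulr0 //= /bump /=; have := ltn_ord i; lia.
have -> : Eis2 0%N = 1 by rewrite /Eis2 psB psMnl ps1 /divsum /= mulr0 subr0.
rewrite /psD1 addr0 mul1r => /eqP; rewrite -subr_eq0 -{2}[W n]mul1r -mulrBl mulf_eq0.
case: n {IH} => [|[|n]] //; first by rewrite sub0r oppr_eq0 => /orP[|/eqP].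
by rewrite -[n.+2%:R]natr1 addrK pnatr_eq0 => /eqP.
Qed.

(** Both sides solve the equation of [psD1_Eis2_eq0], and their coefficients of q agree because 1728
    = 3 * 240 + 2 * 504. *)
Lemma DeltaQR : 1728 * (Delta : ps int) = (Qform : ps int) ^+ 3 - (Rform : ps int) ^+ 2.
Proof.
apply/eqP; rewrite -subr_eq0; apply/eqP; apply: psD1_Eis2_eq0.
  rewrite psD1D psD1N psD1_Q3R2 psD1M psD1_Delta psD1n mul0r add0r; ring.
have D1 : Delta 1 = 1.
  rewrite (@Delta_truncE 1) // /Delta_trunc psXM /= big_nat1.
  have : forall e, ((1 - psX int 1) ^+ e) 0%N = 1.
    by elim=> // e IH; rewrite exprS psM big_ord1 subn0 IH.
  by move=> ->.
have Q1 : Qform 1 = 240 by rewrite /Qform /sigma /= big_seq1.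
have R1 : Rform 1 = - 504 by rewrite /Rform /sigma /= big_seq1.
have Q0 : Qform 0 = 1 by []. have R0 : Rform 0 = 1 by [].
rewrite psB psB psMnl D1 !exprS expr0 !mulr1 !(psM_1, psM_0) Q1 R1 Q0 R0; lia.
Qed.

(** * Delta and theta series modulo 2 *)

(** The elements not fixed by f cancel in pairs; [enum_rank] selects one of each pair. *)
Lemma sum_involution (K : zmodType) (T : finType) (S : pred T) (f : T -> T) (F : T -> K) :
  (forall x : K, x + x = 0) ->
  (forall x, S x -> S (f x)) -> (forall x, S x -> f (f x) = x) ->
  (forall x, S x -> F (f x) = F x) ->
  \sum_(x | S x) F x = \sum_(x | S x && (f x == x)) F x.
Proof.
move=> K2 Sf ff Ff; rewrite (bigID (fun x => f x == x)) /=.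
rewrite [X in _ + X](bigID (fun x => enum_rank x < enum_rank (f x))%N) /=.
rewrite [X in _ + (X + _)](reindex_onto f f) /=; last first.
  by move=> x /andP[/andP[Sx _] _]; apply: ff.
rewrite [X in _ + (X + _)](eq_big (fun x => S x && (f x != x) &&
    ~~ (enum_rank x < enum_rank (f x))%N) F) ?K2 ?addr0 //.
  move=> x; case Sx: (S x); last first.
    by apply/negP => /andP[/andP[/andP[/Sf Sffx _] _] /eqP ffx]; rewrite ffx Sx in Sffx.
  rewrite (Sf _ Sx) ff // eqxx andbT eq_sym /= -leqNgt ltn_neqAle.
  have -> : (enum_rank (f x) == enum_rank x :> nat) = (f x == x).
    by rewrite (inj_eq val_inj) (inj_eq enum_rank_inj).
  by case: eqP.
move=> x /andP[/andP[/andP[Sfx _] _] /eqP fx]; by rewrite -(Ff _ Sfx) fx.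
Qed.


Lemma F2_addrr (x : F2) : x + x = 0.
Proof. by apply: addrr_pchar2; apply: pchar_Fp. Qed.

Lemma psF2_addrr (f : ps F2) : f + f = 0.
Proof. by apply: funext => n; rewrite psD F2_addrr. Qed.

Section Substitution.
Variable A : comNzRingType.
Implicit Types f g : ps A.

(** [psV] and [psU] are the operators V_c and U_c on q-expansions; T_p is U_p + p^(k-1) V_p in
    weight k. *)
Definition psV (c : nat) f : ps A := fun n => if (c %| n)%N then f (n %/ c)%N else 0.
Definition psU (c : nat) f : ps A := fun n => f (c * n)%N.

Lemma psV_Mn c f n : (0 < c)%N -> psV c f (c * n)%N = f n.
Proof. by move=> c0; rewrite /psV dvdn_mulr // mulKn. Qed.

Lemma psV_inj c : (0 < c)%N -> injective (psV c).
Proof.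
move=> c0 f g fg; apply: funext => n.
by rewrite -(psV_Mn f n c0) fg psV_Mn.
Qed.

Lemma psV_V c c' f : (0 < c)%N -> (0 < c')%N -> psV c (psV c' f) = psV (c * c') f.
Proof.
move=> c0 c0'; apply: funext => n; rewrite /psV.
have [/dvdnP[k ->]|cn] := boolP (c %| n)%N; last first.
  by case: ifP => // /(dvdn_trans (dvdn_mulr c' (dvdnn c))); rewrite (negPf cn).
by rewrite mulnK // (mulnC k) dvdn_pmul2l // divnMl.
Qed.

Lemma psVD c f g : psV c (f + g) = psV c f + psV c g.
Proof. by apply: funext => n; rewrite psD /psV; case: ifP; rewrite ?addr0. Qed.

Lemma psV1 c : (0 < c)%N -> psV c 1 = 1.
Proof.
move=> c0; apply: funext => n; rewrite /psV ps1.
have [/dvdnP[k ->]|cn] := boolP (c %| n)%N;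
  first by rewrite mulnK // ps1 muln_eq0 (gtn_eqF c0) orbF.
by case: n cn => [|n]; rewrite ?dvdn0.
Qed.

Lemma psVM_coef c f g n : (0 < c)%N ->
  (psV c f * g) n = \sum_(i < (n %/ c).+1) f i * g (n - c * i)%N.
Proof.
move=> c0; rewrite psM.
transitivity (\sum_(0 <= i < n.+1 | (c %| i)%N) f (i %/ c)%N * g (n - i)%N).
  rewrite -(big_mkord xpredT (fun i => psV c f i * g (n - i)%N)) [RHS]big_mkcond.
  by apply: eq_bigr => i _; rewrite /psV; case: ifP; rewrite ?mul0r.
rewrite -(big_mkord xpredT (fun i => f i * g (n - c * i)%N)) -[LHS]big_filter.
rewrite (perm_big [seq (c * i)%N | i <- index_iota 0 (n %/ c).+1]); last first.
  apply: uniq_perm; rewrite ?filter_uniq ?iota_uniq //.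
    rewrite map_inj_uniq ?iota_uniq // => i j /eqP; rewrite eqn_pmul2l // => /eqP //.
  move=> i; rewrite mem_filter mem_index_iota leq0n ltnS.
  apply/andP/mapP => [[/dvdnP[k ->] /= kn]|[k]].
    by exists k; rewrite 1?mulnC // mem_index_iota ltnS leq_divRL.
  rewrite mem_index_iota ltnS leq_divRL // => kn ->.
  by rewrite dvdn_mulr // mulnC.
by rewrite big_map; apply: eq_bigr => i _; rewrite mulKn.
Qed.

Lemma psVM c f g : (0 < c)%N -> psV c (f * g) = psV c f * psV c g.
Proof.
move=> c0; apply: funext => n; rewrite psVM_coef // /psV.
have [/dvdnP[k ->]|cn] := boolP (c %| n)%N.
  rewrite mulnK // psM; apply: eq_bigr => i _.
  by rewrite mulnC -mulnBr dvdn_mulr // mulKn.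
rewrite big1 // => i _; rewrite /psV; case: ifP => h; [case/negP: cn | by rewrite mulr0].
have := ltn_ord i; rewrite ltnS leq_divRL // mulnC => le.
by rewrite -(subnKC le) dvdn_addr // dvdn_mulr.
Qed.

Lemma psVX c f k : (0 < c)%N -> psV c (f ^+ k) = psV c f ^+ k.
Proof.
by move=> c0; elim: k => [|k IH]; rewrite ?psV1 // !exprS psVM // IH.
Qed.

(** The projection formula. It turns an equation between D and V_p D into a recursion for U_p
    (D^k). *)
Lemma psU_VM c f g : (0 < c)%N -> psU c (psV c f * g) = f * psU c g.
Proof.
move=> c0; apply: funext => n; rewrite /psU psVM_coef // mulKn // psM.
by apply: eq_bigr => i _; rewrite mulnBr.
Qed.

Lemma psUD c f g : psU c (f + g) = psU c f + psU c g.
Proof. by []. Qed.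

End Substitution.
Arguments psV : simpl never.
Arguments psU : simpl never.

(** Frobenius: the involution i -> n - i on the terms of the square leaves only the middle one. *)
Lemma psF2_sqr (f : ps F2) : f ^+ 2 = psV 2 f.
Proof.
apply: funext => n; rewrite expr2 psM.
rewrite (sum_involution (f := @rev_ord n.+1)) //; first last.
- by move=> x _; rewrite /= !subSS mulrC subKn // -ltnS.
- by move=> x _; rewrite rev_ordK.
- exact: F2_addrr.
rewrite /psV; have [/dvdnP[k ->]|n2] := boolP (2 %| n)%N; last first.
  rewrite big_pred0 // => i; apply/negP => /eqP /(congr1 val) /= e.
  by move: n2 (ltn_ord i); rewrite dvdn2 => n2 i2; lia.
rewrite mulnK //; have kn : (k < (k * 2).+1)%N by lia.
rewrite (big_pred1 (Ordinal kn)) /=.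
  have -> : (k * 2 - k)%N = k by lia.
  have := F2_addrr (f k); case: (f k) => [[|[|//]] h] _ /=; apply/val_inj => //=.
move=> i; rewrite /= -!val_eqE /= subSS; have := ltn_ord i; lia.
Qed.

(** The theta series of c u^2 over the u in P; for c > 0 no u > n contributes to q^n. *)
Definition theta (P : pred nat) (c : nat) : ps F2 :=
  fun n => \sum_(u < n.+1) (P u && (c * (u * u) == n)%N)%:R.

Lemma theta_widen P c N n : (0 < c)%N -> (n <= N)%N ->
  theta P c n = \sum_(u < N.+1) (P u && (c * (u * u) == n)%N)%:R.
Proof.
move=> c0 nN; rewrite /theta -!(big_mkord xpredT (fun u => (P u && (c * (u * u) == n)%N)%:R)).
rewrite [RHS](big_cat_nat (n := n.+1)) //= [X in _ = _ + X]big_nat [X in _ =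
  _ + X]big1 ?addr0 //.
move=> u /andP[nu _]; have -> : (c * (u * u) == n)%N = false; last by rewrite andbF.
by apply/eqP; nia.
Qed.

Lemma theta_V P c k : (0 < c)%N -> (0 < k)%N -> psV k (theta P c) = theta P (k * c).
Proof.
move=> c0 k0; apply: funext => n; rewrite /psV.
have [/dvdnP[l ->]|kn] := boolP (k %| n)%N.
  rewrite mulnK // (@theta_widen _ _ (l * k)) //; last by nia.
  apply: eq_bigr => u _; congr ((_ && _)%:R).
  by rewrite -[LHS](eqn_pmul2l k0) mulnA [(k * l)%N]mulnC.
rewrite /theta big1 // => u _.
have -> : (k * c * (u * u) == n)%N = false; last by rewrite andbF.
by apply/eqP => e; case/negP: kn; rewrite -e -mulnA dvdn_mulr.
Qed.

Lemma thetaM P P' c c' N : (0 < c)%N -> (0 < c')%N ->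
  (theta P c * theta P' c') N =
  \sum_(u < N.+1) \sum_(v < N.+1)
    ([&& P u, P' v & c * (u * u) + c' * (v * v) == N])%N%:R.
Proof.
move=> c0 c0'; rewrite psM.
transitivity (\sum_(i < N.+1) \sum_(u < N.+1) \sum_(v < N.+1)
   ((P u && (c * (u * u) == i)%N)%:R * (P' v && (c' * (v * v) == N - i)%N)%:R : F2)).
  apply: eq_bigr => i _; rewrite (@theta_widen _ _ N) //; last by rewrite -ltnS.
  rewrite (@theta_widen P' _ N) ?leq_subr // mulr_suml.
  by apply: eq_bigr => u _; rewrite mulr_sumr.
rewrite exchange_big; apply: eq_bigr => u _ /=.
rewrite exchange_big; apply: eq_bigr => v _ /=.
have [iN|iN] := leqP (c * (u * u))%N N; last first.
  rewrite big1 => [|i _]; last first.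
    have -> : (c * (u * u) == i)%N = false by have := ltn_ord i; lia.
    by rewrite andbF mul0r.
  have -> : (c * (u * u) + c' * (v * v) == N)%N = false by lia.
  by rewrite !andbF mulr0n.
have iN' : (c * (u * u) < N.+1)%N by [].
rewrite (bigD1 (Ordinal iN')) //= big1 ?addr0; last first.
  move=> i /eqP /val_eqP /= ni.
  by rewrite eq_sym (negPf ni) andbF mul0r.
rewrite eqxx andbT -natrM mulnb; congr (nat_of_bool _)%:R.
by case: (P u) => //=; case: (P' v) => //=; lia.
Qed.

(* The Boolean is the sign of [v], which a congruence condition in [S]
   determines. *)
Lemma sum_signed_involution (N : nat) (S : nat -> nat -> bool -> bool)
    (f : nat -> nat -> bool -> nat * nat * bool) :
  (forall u v b, S u v b -> (u <= N)%N && (v <= N)%N) ->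
  (forall u v b, S u v b -> S (f u v b).1.1 (f u v b).1.2 (f u v b).2 /\
     f (f u v b).1.1 (f u v b).1.2 (f u v b).2 = (u, v, b)) ->
  \sum_(u < N.+1) \sum_(v < N.+1) ((S u v true)%:R + (S u v false)%:R) =
  \sum_(u < N.+1) \sum_(v < N.+1)
    ((S u v true && (f u v true == (val u, val v, true)))%:R +
     (S u v false && (f u v false == (val u, val v, false)))%:R) :> F2.
Proof.
move=> Sb Sf.
pose T := ('I_N.+1 * 'I_N.+1 * bool)%type.
have toT (G : nat -> nat -> bool -> bool) :
    \sum_(u < N.+1) \sum_(v < N.+1) ((G u v true)%:R + (G u v false)%:R) =
    \sum_(x : T | G x.1.1 x.1.2 x.2) 1 :> F2.
  rewrite [RHS]big_mkcond pair_bigA /=.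
  rewrite -(pair_bigA _ (fun (p : 'I_N.+1 * 'I_N.+1) b => if G p.1 p.2 b then 1 else 0 : F2)).
  apply: eq_bigr => -[u v] _; rewrite big_bool /=.
  by case: (G u v true); case: (G u v false).
rewrite (toT S) (toT (fun u v b => S u v b && (f u v b == (u, v, b)))).
pose F (x : T) : T := let y := f x.1.1 x.1.2 x.2 in (inord y.1.1, inord y.1.2, y.2).
have FE (x : T) : S x.1.1 x.1.2 x.2 ->
    [/\ (F x).1.1 = (f x.1.1 x.1.2 x.2).1.1 :> nat,
        (F x).1.2 = (f x.1.1 x.1.2 x.2).1.2 :> nat
      & (F x).2 = (f x.1.1 x.1.2 x.2).2].
  move=> /Sf[/Sb /andP[h1 h2] _]; split=> //=; exact: inordK.
rewrite (sum_involution (f := F)) //; first last.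
- move=> x Sx; have [e1 e2 e3] := FE _ Sx; have [Sy ff] := Sf _ _ _ Sx.
  rewrite {1}/F e1 e2 e3 ff /=.
  case: x {Sx e1 e2 e3 Sy ff} => -[u v] b /=.
  by congr (_, _, _); apply: val_inj; rewrite /= inordK.
- move=> x Sx; have [e1 e2 e3] := FE _ Sx; have [Sy ff] := Sf _ _ _ Sx.
  by rewrite e1 e2 e3.
- exact: F2_addrr.
apply: eq_bigl => -[[u v] b] /=; case Sx: (S u v b) => //=.
have [/= e1 e2 _] := FE (u, v, b) Sx.
rewrite /F /= {FE}; case: (f u v b) e1 e2 => -[u' v'] b' /= e1 e2.
apply/eqP/eqP => -[eu ev eb]; first by rewrite -e1 -e2 eu ev eb.
by congr (_, _, _); [apply: val_inj; rewrite /= e1|apply: val_inj; rewrite /= e2|].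
Qed.

Definition absd (a b : nat) : nat := (a - b) + (b - a).

(** Delta modulo 2, by [Delta_mod2]. *)
Definition D2 : ps F2 := theta odd 1.
(** Modulo 2 this is eta(24 z), by Euler's pentagonal number theorem. It serves as a cube root of
    V_3 D in [D2_mod5]. *)
Definition th6 : ps F2 := theta (fun u => coprime u 6) 1.

(** The fixed points of the involutions below lie on lines u = k v and contribute theta series. The
    condition k^2 <= c keeps u within the range of summation. *)
Lemma F2_theta_diag (P : pred nat) (c k N : nat) : (0 < c)%N -> (0 < k)%N -> (k * k <= c)%N ->
  \sum_(u < N.+1) \sum_(v < N.+1) [&& u == k * v :> nat, P v & c * (v * v) == N]%N%:R =
  theta P c N.
Proof.
move=> c0 k0 kc; rewrite exchange_big /=; apply: eq_bigr => v _.
have [/andP[Pv /eqP e]|nP] := boolP (P v && (c * (v * v) == N)%N); last first.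
  by rewrite big1 // => u _; rewrite andbF mulr0n.
have kv : (k * v < N.+1)%N by rewrite ltnS; move: e kc; nia.
rewrite (bigD1 (Ordinal kv)) //= eqxx big1 ?addr0 // => u.
by rewrite -val_eqE /= => /negPf ->; rewrite mulr0n.
Qed.

(** The modular equation of level 3. By Frobenius the right side is D(q^4) + D(q^12), which is the
    contribution of the fixed points u = v and u = 3v of an involution on the solutions of u^2 +
    3v^2 = N in odd u, v. *)
Lemma D2_mod3 : D2 * psV 3 D2 = D2 ^+ 4 + psV 3 D2 ^+ 4.
Proof.
rewrite (exprM _ 2 2) (exprM (psV 3 D2) 2 2) !psF2_sqr !psV_V //=.
rewrite /D2 !theta_V // !muln1; apply: funext => N; rewrite thetaM // psD.
pose S (u v : nat) (b : bool) := [&& odd u, odd v, u * u + 3 * (v * v) == N &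
   (if b then u %% 4 == v %% 4 else (u + v) %% 4 == 0)]%N.
(* u^2 + 3v^2 is the norm of u + v sqrt(-3). The new pair consists of the absolute values of the
   coordinates after multiplication by the unit (1 + sqrt(-3))/2; the Boolean is the sign of v for
   which these are odd. *)
pose f (u v : nat) (b : bool) : nat * nat * bool :=
  if b then ((absd u (3 * v)) %/ 2, (u + v) %/ 2, (u < 3 * v))%N
  else ((u + 3 * v) %/ 2, (absd u v) %/ 2, (u < v))%N.
transitivity (\sum_(u < N.+1) \sum_(v < N.+1) ((S u v true)%:R + (S u v false)%:R : F2)).
  apply: eq_bigr => u _; apply: eq_bigr => v _; rewrite /S mul1n.
  case: (boolP (odd u)) => ou; last by rewrite addr0.
  case: (boolP (odd v)) => ov; last by rewrite addr0.
  case: eqP => e; last by rewrite addr0.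
  have [h|h] := boolP (u %% 4 == v %% 4)%N.
    have -> : ((u + v) %% 4 == 0)%N = false by lia.
    by rewrite addr0.
  have -> : ((u + v) %% 4 == 0)%N = true by lia.
  by rewrite add0r.
have fS u v b : S u v b -> S (f u v b).1.1 (f u v b).1.2 (f u v b).2 /\
     f (f u v b).1.1 (f u v b).1.2 (f u v b).2 = (u, v, b).
  case: b => /and4P[ou ov /eqP e h].
    have [h'|h'] := ltnP u (3 * v)%N; rewrite /S /f /absd /= ?h' ?(ltnNge u) ?h' /=.
      have [a ea] : exists a, (u + 2 * a = 3 * v)%N by exists ((3 * v - u) %/ 2)%N; lia.
      have [t et] : exists t, (u + v = 2 * t)%N by exists ((u + v) %/ 2)%N; lia.
      have -> : ((u - 3 * v + (3 * v - u)) %/ 2 = a)%N by lia.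
      have -> : ((u + v) %/ 2 = t)%N by lia.
      split; last by congr (_, _, _); lia.
      apply/and4P; split; [lia|lia| |lia].
      have ea' : (a + t = 2 * v)%N by lia.
      by apply/eqP; rewrite -e; nia.
    have [a ea] : exists a, (u = 2 * a + 3 * v)%N by exists ((u - 3 * v) %/ 2)%N; lia.
    have [t et] : exists t, (u + v = 2 * t)%N by exists ((u + v) %/ 2)%N; lia.
    have -> : ((u - 3 * v + (3 * v - u)) %/ 2 = a)%N by lia.
    have -> : ((u + v) %/ 2 = t)%N by lia.
    split; last by congr (_, _, _); lia.
    apply/and4P; split; [lia|lia| |lia].
    have -> : (t = a + 2 * v)%N by lia.
    by apply/eqP; rewrite -e ea; nia.
  have [h'|h'] := leqP v u; rewrite /S /f /absd /= ?h' ?(ltnNge u) ?h' /=.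
    have [a ea] : exists a, (u = v + 2 * a)%N by exists ((u - v) %/ 2)%N; lia.
    have -> : ((u - v + (v - u)) %/ 2 = a)%N by lia.
    have -> : ((u + 3 * v) %/ 2 = a + 2 * v)%N by lia.
    split; last by congr (_, _, _); lia.
    apply/and4P; split; [lia|lia| |lia].
    by apply/eqP; rewrite -e ea; nia.
  have [a ea] : exists a, (v = u + 2 * a)%N by exists ((v - u) %/ 2)%N; lia.
  have -> : ((u - v + (v - u)) %/ 2 = a)%N by lia.
  have -> : ((u + 3 * v) %/ 2 = 2 * u + 3 * a)%N by lia.
  split; last by congr (_, _, _); lia.
  apply/and4P; split; [lia|lia| |lia].
  by apply/eqP; rewrite -e ea; nia.
rewrite (sum_signed_involution _ fS); last first.
  by move=> u v b /and4P[ou ov /eqP e h]; apply/andP; split; nia.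
rewrite -(@F2_theta_diag odd 4 1) // -(@F2_theta_diag odd 12 3) // -big_split /=.
apply: eq_bigr => u _; rewrite -big_split /=; apply: eq_bigr => v _.
congr (_%:R + _%:R); congr nat_of_bool; rewrite /S /f /absd !xpair_eqE;
  move: (nat_of_ord u) (nat_of_ord v) => {u v} u v {fS S f}.
  apply/idP/idP => [/andP[/and4P[ou ov /eqP e h] /andP[/andP[/eqP h1 /eqP h2]
    h3]]|/and3P[/eqP -> ov /eqP <-]].
    have uv : u = v by lia.
    rewrite mul1n uv eqxx ov -e uv; apply/eqP; lia.
  by apply/andP; split; [apply/and4P; split|apply/andP; split; [apply/andP; split|]]; lia.
apply/idP/idP => [/andP[/and4P[ou ov /eqP e h] /andP[/andP[/eqP h1 /eqP h2] h3]]|/and3P[/eqP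
  -> ov /eqP <-]].
  have uv : (u = 3 * v)%N by lia.
  rewrite uv eqxx ov -e uv; apply/eqP; lia.
by apply/andP; split; [apply/and4P; split|apply/andP; split; [apply/andP; split|]]; lia.
Qed.

Lemma coprime6 u : coprime u 6 = odd u && (u %% 3 != 0)%N.
Proof.
rewrite (@coprimeMr u 2 3) coprimen2; congr (_ && _).
by rewrite coprime_sym prime_coprime // /dvdn.
Qed.

(** The method of [D2_mod3] for u^2 + 2v^2, with multiplication by (1 + 2 sqrt(-2))/3 of norm 1; the
    fixed points are u = v. *)
Lemma th6_mod2 : th6 * psV 2 th6 = psV 3 D2.
Proof.
rewrite /D2 /th6 !theta_V // !muln1; apply: funext => N; rewrite thetaM //.
pose S (u v : nat) (b : bool) := [&& odd u, odd v, u * u + 2 * (v * v) == N &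
   (if b then u %% 3 == v %% 3 else (u + v) %% 3 == 0)]%N.
pose f (u v : nat) (b : bool) : nat * nat * bool :=
  if b then ((absd u (4 * v)) %/ 3, (2 * u + v) %/ 3, (u < 4 * v))%N
  else ((u + 4 * v) %/ 3, (absd (2 * u) v) %/ 3, (2 * u < v))%N.
transitivity (\sum_(u < N.+1) \sum_(v < N.+1) ((S u v true)%:R + (S u v false)%:R : F2)).
  apply: eq_bigr => u _; apply: eq_bigr => v _; rewrite /S mul1n !coprime6.
  case: (boolP (odd u)) => ou; last by rewrite addr0.
  case: (boolP (odd v)) => ov; last by rewrite andbF addr0.
  have [e|e] := boolP (u * u + 2 * (v * v) == N)%N; last by rewrite /= !andbF addr0.
  have [h|h] := boolP (u %% 3 == v %% 3)%N; have [h'|h'] := boolP ((u + v) %% 3 == 0)%N.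
  (* If 3 divides both u and v, the pair is counted for either sign of v and cancels. *)
  - have -> : (u %% 3 != 0)%N = false by lia.
    by rewrite F2_addrr.
  - have -> : (u %% 3 != 0)%N = true by lia.
    have -> : (v %% 3 != 0)%N = true by lia.
    by rewrite addr0.
  - have -> : (u %% 3 != 0)%N = true by lia.
    have -> : (v %% 3 != 0)%N = true by lia.
    by rewrite add0r.
  have -> : [&& true && (u %% 3 != 0), true && (v %% 3 != 0) & true]%N = false by lia.
  by rewrite /= addr0.
have fS u v b : S u v b -> S (f u v b).1.1 (f u v b).1.2 (f u v b).2 /\
     f (f u v b).1.1 (f u v b).1.2 (f u v b).2 = (u, v, b).
  case: b => /and4P[ou ov /eqP e h].
    have [t et] : exists t, (2 * u + v = 3 * t)%N by exists ((2 * u + v) %/ 3)%N; lia.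
    have [h'|h'] := ltnP u (4 * v)%N; rewrite /S /f /absd /= ?h' ?(ltnNge u) ?h' /=.
      have [a ea] : exists a, (u + 3 * a = 4 * v)%N by exists ((4 * v - u) %/ 3)%N; lia.
      have -> : ((u - 4 * v + (4 * v - u)) %/ 3 = a)%N by lia.
      have -> : ((2 * u + v) %/ 3 = t)%N by lia.
      split; last by congr (_, _, _); lia.
      apply/and4P; split; [lia|lia| |lia].
      have ev : (v = 3 * t - 2 * u)%N by lia.
      have e1 : (3 * u + a = 4 * t)%N by lia.
      by apply/eqP; rewrite -e; nia.
    have [a ea] : exists a, (u = 3 * a + 4 * v)%N by exists ((u - 4 * v) %/ 3)%N; lia.
    have -> : ((u - 4 * v + (4 * v - u)) %/ 3 = a)%N by lia.
    have -> : ((2 * u + v) %/ 3 = t)%N by lia.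
    split; last by congr (_, _, _); lia.
    apply/and4P; split; [lia|lia| |lia].
    have -> : (t = 2 * a + 3 * v)%N by lia.
    by apply/eqP; rewrite -e ea; nia.
  have [t et] : exists t, (u + 4 * v = 3 * t)%N by exists ((u + 4 * v) %/ 3)%N; lia.
  have [h'|h'] := leqP v (2 * u); rewrite /S /f /absd /= ?h' ?(ltnNge (2 * u)) ?h' /=.
    have [a ea] : exists a, (2 * u = v + 3 * a)%N by exists ((2 * u - v) %/ 3)%N; lia.
    have -> : ((2 * u - v + (v - 2 * u)) %/ 3 = a)%N by lia.
    have -> : ((u + 4 * v) %/ 3 = t)%N by lia.
    split; last by congr (_, _, _); lia.
    apply/and4P; split; [lia|lia| |lia].
    have e1 : (3 * u = t + 4 * a)%N by lia.
    by apply/eqP; rewrite -e; nia.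
  have [a ea] : exists a, (v = 2 * u + 3 * a)%N by exists ((v - 2 * u) %/ 3)%N; lia.
  have -> : ((2 * u - v + (v - 2 * u)) %/ 3 = a)%N by lia.
  have -> : ((u + 4 * v) %/ 3 = 3 * u + 4 * a)%N by lia.
  split; last by congr (_, _, _); lia.
  apply/and4P; split; [lia|lia| |lia].
  by apply/eqP; rewrite -e ea; nia.
rewrite (sum_signed_involution _ fS); last first.
  by move=> u v b /and4P[ou ov /eqP e h]; apply/andP; split; nia.
rewrite -(@F2_theta_diag odd 3 1) //.
apply: eq_bigr => u _; apply: eq_bigr => v _.
rewrite -[RHS]addr0; congr (_ + _); last first.
  (* A fixed point with the negative sign would have u = 2v, impossible for odd u. *)
  have -> : S u v false && (f u v false == (nat_of_ord u, nat_of_ord v, false)) = false;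
    last by rewrite mulr0n.
  rewrite /S /f /absd !xpair_eqE /=; move: (nat_of_ord u) (nat_of_ord v) => {u v} u v {fS S f}.
  by apply/negP => /andP[/and4P[ou ov /eqP e h] /andP[/andP[/eqP h1 /eqP h2] h3]]; lia.
congr (_%:R); congr nat_of_bool.
rewrite /S /f /absd !xpair_eqE /=; move: (nat_of_ord u) (nat_of_ord v) => {u v} u v {fS S f}.
apply/idP/idP => [/andP[/and4P[ou ov /eqP e h] /andP[/andP[/eqP h1 /eqP h2] h3]]|/and3P[/eqP
  -> ov /eqP <-]].
  have uv : u = v by lia.
  rewrite mul1n uv eqxx ov -e uv; apply/eqP; lia.
by apply/andP; split; [apply/and4P; split|apply/andP; split; [apply/andP; split|]]; lia.
Qed.

(** The same for u^2 + 5v^2, with multiplication by (2 + sqrt(-5))/3 of norm 1; the fixed points are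
    u = v and u = 5v. *)
Lemma th6_mod5 : th6 * psV 5 th6 = psV 6 D2 + psV 30 D2.
Proof.
rewrite /D2 /th6 !theta_V // !muln1; apply: funext => N; rewrite thetaM // psD.
pose S (u v : nat) (b : bool) := [&& odd u, odd v, u * u + 5 * (v * v) == N &
   (if b then u %% 3 == v %% 3 else (u + v) %% 3 == 0)]%N.
pose f (u v : nat) (b : bool) : nat * nat * bool :=
  if b then ((absd (2 * u) (5 * v)) %/ 3, (u + 2 * v) %/ 3, (2 * u < 5 * v))%N
  else ((2 * u + 5 * v) %/ 3, (absd u (2 * v)) %/ 3, (u < 2 * v))%N.
transitivity (\sum_(u < N.+1) \sum_(v < N.+1) ((S u v true)%:R + (S u v false)%:R : F2)).
  apply: eq_bigr => u _; apply: eq_bigr => v _; rewrite /S mul1n !coprime6.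
  case: (boolP (odd u)) => ou; last by rewrite addr0.
  case: (boolP (odd v)) => ov; last by rewrite andbF addr0.
  have [e|e] := boolP (u * u + 5 * (v * v) == N)%N; last by rewrite /= !andbF addr0.
  have [h|h] := boolP (u %% 3 == v %% 3)%N; have [h'|h'] := boolP ((u + v) %% 3 == 0)%N.
  - have -> : (u %% 3 != 0)%N = false by lia.
    by rewrite F2_addrr.
  - have -> : (u %% 3 != 0)%N = true by lia.
    have -> : (v %% 3 != 0)%N = true by lia.
    by rewrite addr0.
  - have -> : (u %% 3 != 0)%N = true by lia.
    have -> : (v %% 3 != 0)%N = true by lia.
    by rewrite add0r.
  have -> : [&& true && (u %% 3 != 0), true && (v %% 3 != 0) & true]%N = false by lia.
  by rewrite /= addr0.
have fS u v b : S u v b -> S (f u v b).1.1 (f u v b).1.2 (f u v b).2 /\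
     f (f u v b).1.1 (f u v b).1.2 (f u v b).2 = (u, v, b).
  case: b => /and4P[ou ov /eqP e h].
    have [t et] : exists t, (u + 2 * v = 3 * t)%N by exists ((u + 2 * v) %/ 3)%N; lia.
    have [h'|h'] := ltnP (2 * u) (5 * v)%N; rewrite /S /f /absd /= ?h' ?(ltnNge (2 * u)) ?h' /=.
      have [a ea] : exists a, (2 * u + 3 * a = 5 * v)%N by exists ((5 * v - 2 * u) %/ 3)%N; lia.
      have -> : ((2 * u - 5 * v + (5 * v - 2 * u)) %/ 3 = a)%N by lia.
      have -> : ((u + 2 * v) %/ 3 = t)%N by lia.
      split; last by congr (_, _, _); lia.
      apply/and4P; split; [lia|lia| |lia].
      have e1 : (3 * v = 2 * t + a)%N by lia.
      by apply/eqP; rewrite -e; nia.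
    have [a ea] : exists a, (2 * u = 3 * a + 5 * v)%N by exists ((2 * u - 5 * v) %/ 3)%N; lia.
    have -> : ((2 * u - 5 * v + (5 * v - 2 * u)) %/ 3 = a)%N by lia.
    have -> : ((u + 2 * v) %/ 3 = t)%N by lia.
    split; last by congr (_, _, _); lia.
    apply/and4P; split; [lia|lia| |lia].
    have e1 : (2 * t = a + 3 * v)%N by lia.
    by apply/eqP; rewrite -e; nia.
  have [t et] : exists t, (2 * u + 5 * v = 3 * t)%N by exists ((2 * u + 5 * v) %/ 3)%N; lia.
  have [h'|h'] := leqP (2 * v) u; rewrite /S /f /absd /= ?h' ?(ltnNge u) ?h' /=.
    have [a ea] : exists a, (u = 2 * v + 3 * a)%N by exists ((u - 2 * v) %/ 3)%N; lia.
    have -> : ((u - 2 * v + (2 * v - u)) %/ 3 = a)%N by lia.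
    have -> : ((2 * u + 5 * v) %/ 3 = 3 * v + 2 * a)%N by lia.
    split; last by congr (_, _, _); lia.
    apply/and4P; split; [lia|lia| |lia].
    by apply/eqP; rewrite -e ea; nia.
  have [a ea] : exists a, (2 * v = u + 3 * a)%N by exists ((2 * v - u) %/ 3)%N; lia.
  have -> : ((u - 2 * v + (2 * v - u)) %/ 3 = a)%N by lia.
  have -> : ((2 * u + 5 * v) %/ 3 = t)%N by lia.
  split; last by congr (_, _, _); lia.
  apply/and4P; split; [lia|lia| |lia].
  have e1 : (t + 2 * a = 3 * v)%N by lia.
  by apply/eqP; rewrite -e; nia.
rewrite (sum_signed_involution _ fS); last first.
  by move=> u v b /and4P[ou ov /eqP e h]; apply/andP; split; nia.
rewrite -(@F2_theta_diag odd 6 1) // -(@F2_theta_diag odd 30 5) // -big_split /=.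
apply: eq_bigr => u _; rewrite -big_split /=; apply: eq_bigr => v _.
congr (_%:R + _%:R); congr nat_of_bool; rewrite /S /f /absd !xpair_eqE;
  move: (nat_of_ord u) (nat_of_ord v) => {u v} u v {fS S f}.
  apply/idP/idP => [/andP[/and4P[ou ov /eqP e h] /andP[/andP[/eqP h1 /eqP h2]
    h3]]|/and3P[/eqP -> ov /eqP <-]].
    have uv : u = v by lia.
    rewrite mul1n uv eqxx ov -e uv; apply/eqP; lia.
  by apply/andP; split; [apply/and4P; split|apply/andP; split; [apply/andP; split|]]; lia.
apply/idP/idP => [/andP[/and4P[ou ov /eqP e h] /andP[/andP[/eqP h1 /eqP h2] h3]]|/and3P[/eqP
  -> ov /eqP <-]].
  have uv : (u = 5 * v)%N by lia.
  rewrite uv eqxx ov -e uv; apply/eqP; lia.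
by apply/andP; split; [apply/and4P; split|apply/andP; split; [apply/andP; split|]]; lia.
Qed.

(** With a = [th6] and b = V_5 a, [th6_mod2] gives a^3 = V_3 D and b^3 = V_15 D, while [th6_mod5]
    reads a b = (a^3 + b^3)^2. The cube of the latter is V_3 of the claim. *)
Lemma D2_mod5 : (D2 + psV 5 D2) ^+ 6 = D2 * psV 5 D2.
Proof.
apply: (@psV_inj _ 3) => //; rewrite psVX // psVM // psVD psV_V //.
have e3 : psV 3 D2 = th6 ^+ 3 by rewrite -th6_mod2 -psF2_sqr; ring.
have e15 : psV 15 D2 = psV 5 th6 ^+ 3 by rewrite -psVX // -e3 psV_V.
rewrite (exprM _ 2 3) sqrrD.
have -> : psV 3 D2 * psV 15 D2 *+ 2 = 0 by rewrite mulr2n psF2_addrr.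
rewrite addr0 !psF2_sqr !psV_V // -th6_mod5 e3 e15; ring.
Qed.

Lemma Delta_mod2_arith a : exists w, (5 * a ^ 3 + 7 * a ^ 5 = 24 * w + 12 * odd a)%N.
Proof.
have H8 : ((5 * a ^ 3 + 7 * a ^ 5) %% 8 = 4 * odd a)%N.
  rewrite -modnDm -(modnMmr 5) -(modnMmr 7) -(modnXm 3) -(modnXm 5).
  have -> : odd a = odd (a %% 8) by lia.
  by have := ltn_pmod a (isT : (0 < 8)%N); case: (a %% 8)%N => [|[|[|[|[|[|[|[|]]]]]]]].
have H3 : ((5 * a ^ 3 + 7 * a ^ 5) %% 3 = 0)%N.
  rewrite -modnDm -(modnMmr 5) -(modnMmr 7) -(modnXm 3) -(modnXm 5).
  by have := ltn_pmod a (isT : (0 < 3)%N); case: (a %% 3)%N => [|[|[|]]].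
exists ((5 * a ^ 3 + 7 * a ^ 5) %/ 24)%N; lia.
Qed.

Definition redF2 : ps int -> ps F2 := psmap (intr : int -> F2).
Lemma redF2D f g : redF2 (f + g) = redF2 f + redF2 g.
Proof. exact: (rmorphD (psmap (intr : {rmorphism int -> F2}))). Qed.

Lemma redF2N f : redF2 (- f) = - redF2 f.
Proof. exact: (rmorphN (psmap (intr : {rmorphism int -> F2}))). Qed.

Lemma redF2M f g : redF2 (f * g) = redF2 f * redF2 g.
Proof. exact: (rmorphM (psmap (intr : {rmorphism int -> F2}))). Qed.

Lemma redF2X f k : redF2 (f ^+ k) = redF2 f ^+ k.
Proof. exact: (rmorphXn (psmap (intr : {rmorphism int -> F2}))). Qed.

Lemma redF2_nat k : redF2 k%:R = k%:R.
Proof. exact: (rmorph_nat (psmap (intr : {rmorphism int -> F2}))). Qed.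

Definition odd_divisors : ps F2 :=
  fun n => \sum_(1 <= a < n.+1) (odd a)%:R * (lambert a n)%:~R.

Lemma F2_nat n : n%:R = (odd n)%:R :> F2.
Proof.
rewrite -[in LHS](odd_double_half n) natrD -addnn natrD F2_addrr addr0 //.
Qed.

Lemma psF2_nat n : n%:R = (odd n)%:R :> ps F2.
Proof.
rewrite -[in LHS](odd_double_half n) natrD -addnn natrD psF2_addrr addr0 //.
Qed.

Lemma psF2_opp (f : ps F2) : - f = f.
Proof. by apply/eqP; rewrite eq_sym -subr_eq0 opprK psF2_addrr. Qed.

Lemma odd_divisors_even k : odd_divisors (2 * k)%N = odd_divisors k.
Proof.
rewrite /odd_divisors (big_cat_nat (n := k.+1)) //=; last by lia.
rewrite [X in _ + X]big_nat [X in _ + X]big1 => [|a /andP[ka _]]; last first.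
  case: (boolP (odd a)) => oa; last by rewrite mul0r.
  rewrite mul1r /lambert; case: (boolP (a %| 2 * k)%N) => //; rewrite ?andbF //.
  rewrite Gauss_dvdr ?coprimen2 // andbT => /dvdnP[q e].
  have -> : k = 0%N by case: q e => [|q]; nia.
  by [].
rewrite addr0; apply: eq_bigr => a _; rewrite /lambert muln_gt0 /=.
case: (boolP (odd a)) => oa; last by rewrite !mul0r.
by rewrite Gauss_dvdr ?coprimen2.
Qed.

(** All divisors of n are odd, and the involution a -> n / a on them leaves only a square root of
    n. *)
Lemma odd_divisors_odd n : odd n -> odd_divisors n = D2 n.
Proof.
move=> on; have n0 : (0 < n)%N by case: n on.
rewrite /odd_divisors /D2 /theta.
transitivity (\sum_(a < n.+1 | (a %| n)%N) 1 : F2).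
  rewrite [RHS]big_mkcond -(big_mkord xpredT (fun a => if (a %| n)%N then 1 else 0)).
  rewrite [RHS]big_ltn //= dvd0n (gtn_eqF n0) add0r; apply: eq_bigr => a _.
  rewrite /lambert n0 /=; case: (boolP (a %| n)%N) => an; last by rewrite mulr0.
  by rewrite (dvdn_odd an on) mulr1.
pose f (a : 'I_n.+1) : 'I_n.+1 := inord (n %/ a).
have fE a : f a = (n %/ a)%N :> nat by rewrite /f inordK // ltnS leq_div.
rewrite (sum_involution (f := f)) //; first last.
- move=> a an; have a0 := dvdn_gt0 n0 an.
  by apply: val_inj; rewrite /= !fE divnA // mulKn.
- by move=> a an; rewrite fE; apply/dvdnP; exists (val a); rewrite mulnC divnK.
- exact: F2_addrr.
rewrite big_mkcond; apply: eq_bigr => a _; rewrite mul1n.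
have -> : (a %| n)%N && (f a == a) = odd a && (a * a == n)%N; last by case: ifP.
apply/andP/andP => [[an /eqP fa]|[oa /eqP aa]].
  split; first exact: dvdn_odd an on.
  by have := fE a; rewrite fa => {2}->; rewrite mulnC divnK.
have a0 : (0 < a)%N by case: (nat_of_ord a) oa.
split; first by rewrite -{2}aa dvdn_mull.
by apply/eqP/val_inj; rewrite /= fE -[X in (X %/ _)%N]aa mulKn.
Qed.

Lemma redF2_divsum e : (0 < e)%N -> redF2 (divsum e) = odd_divisors.
Proof.
move=> e0; apply: funext => n; rewrite /redF2 /psmap (divsumE _ (ltnSn n)).
rewrite rmorph_sum; apply: eq_bigr => a _ /=; rewrite rmorphM rmorph_nat F2_nat oddX.
by rewrite (gtn_eqF e0).
Qed.

(** In (1 + 240 a)^3 - (1 - 504 b)^2 the terms of degree 2 and 3 are multiples of 1728, so that only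
    the linear part 144 (5a + 7b) needs an arithmetic argument, namely [Delta_mod2_arith]. *)
Lemma Delta_divsum_aux (K : comPzRingType) (d q r a b : K) : 1728 * d = q ^+ 3 - r ^+ 2 ->
  q = 1 + 240 * a -> r = 1 - 504 * b ->
  144 * (12 * (d - 100 * a ^+ 2 - 8000 * a ^+ 3 + 147 * b ^+ 2)) = 144 * (5 * a + 7 * b).
Proof.
move=> h hq hr.
transitivity (1728 * d - 144 * (1200 * a ^+ 2) - 144 * (12 * (8000 * a ^+ 3)) +
  144 * (1764 * b ^+ 2)); first by ring.
by rewrite h hq hr; ring.
Qed.

Lemma ps_natI (k : nat) (f g : ps int) : (0 < k)%N -> k%:R * f = k%:R * g -> f = g.
Proof.
move=> k0 fg; apply: funext => n; have := congr1 (fun h => h n) fg.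
rewrite !psMnl => /mulfI; apply; by rewrite pnatr_eq0 -lt0n.
Qed.

(** Modulo 2 only the linear part X and the square of [divsum 5] survive. By Frobenius the latter is
    V_2 of the former, which cancels the even exponents; the odd ones are given by
    [odd_divisors_odd]. *)
Lemma Delta_mod2 : redF2 (Delta : ps int) = D2.
Proof.
have := Delta_divsum_aux DeltaQR QformE RformE => /(ps_natI (k := 144) isT).
set X := (Delta : ps int) - _ - _ + _ => XE.
have Xred : redF2 X = odd_divisors.
  apply: funext => n; have := congr1 (fun h => h n) XE.
  rewrite psD !psMnl !(divsumE _ (ltnSn n)) !mulr_sumr -big_split /= => Xn.
  pose w a := projT1 (cid (Delta_mod2_arith a)).
  have wE a : (5 * a ^ 3 + 7 * a ^ 5 = 24 * w a +
    12 * odd a)%N := projT2 (cid (Delta_mod2_arith a)).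
  have {Xn} : 12 * X n = 12 * \sum_(1 <= a < n.+1) ((2 * w a + odd a)%N%:R * lambert a n).
    rewrite Xn mulr_sumr; apply: eq_bigr => a _.
    transitivity ((5 * a ^ 3 + 7 * a ^ 5)%N%:R * lambert a n).
      by rewrite natrD !natrM; ring.
    by rewrite wE !(natrD, natrM); ring.
  move=> /mulfI -/(_ isT) Xn.
  rewrite /redF2 /psmap Xn rmorph_sum; apply: eq_bigr => a _ /=.
  by rewrite rmorphM rmorph_nat F2_nat oddD oddM /= oddb.
have -> : (Delta : ps int) = X + 100 * divsum 3 ^+ 2 +
  8000 * divsum 3 ^+ 3 - 147 * divsum 5 ^+ 2.
  by rewrite /X; ring.
clearbody X; rewrite !redF2D redF2N !(redF2X, redF2M, redF2_nat) Xred.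
rewrite (psF2_nat 100) (psF2_nat 8000) (psF2_nat 147) /= !mul0r !addr0 mul1r redF2_divsum //.
rewrite psF2_opp psF2_sqr; apply: funext => n; rewrite psD /psV.
have [/dvdnP[k ->]|n2] := boolP (2 %| n)%N.
  rewrite mulnK // mulnC odd_divisors_even F2_addrr /D2 /theta big1 // => u _.
  have -> : odd u && (1 * (u * u) == 2 * k)%N = false; last by [].
  by apply/negP => /andP[ou /eqP]; rewrite mul1n => /(congr1 odd); rewrite oddM ou oddM.
by rewrite addr0 odd_divisors_odd // -[odd n]negbK -dvdn2.
Qed.

(** * Hecke operators on polynomials in Delta modulo 2 *)

(* [t3 k] and [t5 k] are the polynomials in D = [D2] giving T_3 (D ^ k) and
   T_5 (D ^ k); their recursions are the modular equations [D2_mod3], [D2_mod5]. *)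
Fixpoint t3 (k : nat) : {poly F2} :=
  match k with
  | S (S (S k1)) => if k1 is S k0 then 'X * t3 k1 + 'X^4 * t3 k0 else 'X
  | _ => 0
  end.

Fixpoint t5 (k : nat) : {poly F2} :=
  if k is S (S k4) then if k4 is S (S k2) then if k2 is S k1 then
    if k1 is S k0 then
      'X^2 * t5 k4 + 'X^4 * t5 k2 + 'X * t5 k1 + 'X^6 * t5 k0
    else 'X
  else 0 else 0 else 0.

Lemma t3S k : t3 (4 + k) = 'X * t3 (1 + k) + 'X^4 * t3 k. Proof. by []. Qed.

Lemma t5S k : t5 (6 + k) = 'X^2 * t5 (4 + k) + 'X^4 * t5 (2 + k) + 'X * t5 (1 + k) +
  'X^6 * t5 k.
Proof. by []. Qed.
Arguments t3 : simpl never.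
Arguments t5 : simpl never.

Lemma polyF2_addrr (p : {poly F2}) : p + p = 0.
Proof. by apply/polyP => i; rewrite coefD coef0 F2_addrr. Qed.

(** The shift E of the index satisfies E^4 = X E + X^4; in characteristic 2, squaring this i times
    replaces E by E^Q and X by X^Q. *)
Lemma t3_rec i k (Q := (2 ^ i)%N) :
  t3 (4 * Q + k) = 'X^Q * t3 (Q + k) + 'X^(4 * Q) * t3 k.
Proof.
rewrite {}/Q; elim: i k => [|i IH] k; first exact: t3S.
rewrite expnS; move: (2 ^ i)%N IH => Q IH.
have -> : (4 * (2 * Q) + k = 4 * Q + (4 * Q + k))%N by lia.
rewrite IH.
have -> : (Q + (4 * Q + k) = 4 * Q + (Q + k))%N by lia.
rewrite !IH.
have -> : (Q + (Q + k) = 2 * Q + k)%N by lia.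
have -> : 'X^(4 * (2 * Q)) = 'X^(4 * Q) ^+ 2 :> {poly F2} by rewrite -exprM; congr ('X^_); lia.
have -> : 'X^(2 * Q) = 'X^Q ^+ 2 :> {poly F2} by rewrite -exprM mulnC.
set z := 'X^Q; set w := 'X^(4 * Q).
transitivity (z ^+ 2 * t3 (2 * Q + k) + w ^+ 2 * t3 k + (z * w * t3 (Q + k) + z * w * t3 (Q +
  k))).
  by ring.
by rewrite polyF2_addrr addr0.
Qed.

(** As [t3_rec], for E^6 = X^2 E^4 + X^4 E^2 + X E + X^6. *)
Lemma t5_rec6 i k (Q := (2 ^ i)%N) :
  t5 (6 * Q + k) = 'X^Q ^+ 2 * t5 (4 * Q + k) + 'X^Q ^+ 4 * t5 (2 * Q + k)
     + 'X^Q * t5 (Q + k) + 'X^Q ^+ 6 * t5 k.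
Proof.
rewrite {}/Q; elim: i k => [|i IH] k; first by rewrite !muln1 expr1 t5S.
rewrite expnS; move: (2 ^ i)%N IH => Q IH.
have e a b : (a = b)%N -> t5 a = t5 b by move=> ->.
have H6 : t5 (6 * (2 * Q) + k) = 'X^Q ^+ 2 * t5 (10 * Q + k) + 'X^Q ^+ 4 * t5 (8 * Q + k)
     + 'X^Q * t5 (7 * Q + k) + 'X^Q ^+ 6 * t5 (6 * Q + k).
  rewrite (e _ (6 * Q + (6 * Q + k))%N); last by lia.
  rewrite [LHS]IH; congr (_ * _ + _ * _ + _ * _ + _); apply: e; lia.
have H10 : t5 (10 * Q + k) = 'X^Q ^+ 2 * t5 (8 * Q + k) + 'X^Q ^+ 4 * t5 (6 * Q + k)
     + 'X^Q * t5 (5 * Q + k) + 'X^Q ^+ 6 * t5 (4 * Q + k).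
  rewrite (e _ (6 * Q + (4 * Q + k))%N); last by lia.
  rewrite [LHS]IH; congr (_ * _ + _ * _ + _ * _ + _); apply: e; lia.
have H8 : t5 (8 * Q + k) = 'X^Q ^+ 2 * t5 (6 * Q + k) + 'X^Q ^+ 4 * t5 (4 * Q + k)
     + 'X^Q * t5 (3 * Q + k) + 'X^Q ^+ 6 * t5 (2 * Q + k).
  rewrite (e _ (6 * Q + (2 * Q + k))%N); last by lia.
  rewrite [LHS]IH; congr (_ * _ + _ * _ + _ * _ + _); apply: e; lia.
have H7 : t5 (7 * Q + k) = 'X^Q ^+ 2 * t5 (5 * Q + k) + 'X^Q ^+ 4 * t5 (3 * Q + k)
     + 'X^Q * t5 (2 * Q + k) + 'X^Q ^+ 6 * t5 (Q + k).
  rewrite (e _ (6 * Q + (Q + k))%N); last by lia.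
  rewrite [LHS]IH; congr (_ * _ + _ * _ + _ * _ + _); apply: e; lia.
rewrite (e (4 * (2 * Q) + k) (8 * Q + k))%N; last by lia.
rewrite (e (2 * (2 * Q) + k) (4 * Q + k))%N; last by lia.
have -> : 'X^(2 * Q) = 'X^Q ^+ 2 :> {poly F2} by rewrite -exprM mulnC.
have H0 := IH k; move: H6 H10 H8 H7 H0; set z := 'X^Q.
set b8 := t5 (8 * Q + k); set b6 := t5 (6 * Q + k).
set b10 := t5 (10 * Q + k); set b7 := t5 (7 * Q + k); set b5 := t5 (5 * Q + k).
set b4 := t5 (4 * Q + k); set b3 := t5 (3 * Q + k); set b2 := t5 (2 * Q + k).
set b1 := t5 (Q + k); set b0 := t5 k => -> H10 H8 H7 H6.
transitivity (z ^+ 2 * (z ^+ 2 * b8 + z ^+ 4 * b6 + z * b5 + z ^+ 6 * b4) +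
  z ^+ 4 * (z ^+ 2 * b6 + z ^+ 4 * b4 + z * b3 + z ^+ 6 * b2) +
  z * (z ^+ 2 * b5 + z ^+ 4 * b3 + z * b2 + z ^+ 6 * b1) +
  z ^+ 6 * (z ^+ 2 * b4 + z ^+ 4 * b2 + z * b1 + z ^+ 6 * b0)).
  by rewrite -H10 -H8 -H7 -H6.
(* J collects the cross terms, each of which occurs twice. *)
pose J := z ^+ 6 * b6 + z ^+ 3 * b5 + z ^+ 8 * b4 + z ^+ 5 * b3 + z ^+ 10 * b2 + z ^+ 7 * b1.
rewrite -[RHS]addr0 -(polyF2_addrr J) /J; ring.
Qed.

(** E^8 = X^8 + X E^3 + X^3 E, from E^2 times the relation of degree 6. It serves to lower a leading
    base 4 digit 2 or 3, and [t5_rec16] a leading digit 1. *)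
Lemma t5_rec8 i k (Q := (2 ^ i)%N) :
  t5 (8 * Q + k) = 'X^Q ^+ 8 * t5 k + 'X^Q * t5 (3 * Q + k) + 'X^Q ^+ 3 * t5 (Q + k).
Proof.
have e a b : (a = b)%N -> t5 a = t5 b by move=> ->.
have H8 : t5 (8 * Q + k) = 'X^Q ^+ 2 * t5 (6 * Q + k) + 'X^Q ^+ 4 * t5 (4 * Q + k)
     + 'X^Q * t5 (3 * Q + k) + 'X^Q ^+ 6 * t5 (2 * Q + k).
  rewrite (e _ (6 * Q + (2 * Q + k))%N); last by lia.
  rewrite [LHS]t5_rec6; congr (_ * _ + _ * _ + _ * _ + _); apply: e; lia.
rewrite H8 t5_rec6 -/Q; set z := 'X^Q.
pose J := z ^+ 4 * t5 (4 * Q + k) + z ^+ 6 * t5 (2 * Q + k).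
rewrite -[RHS]addr0 -(polyF2_addrr J) /J; ring.
Qed.

(** The square of the relation of [t5_rec8], with E^6 eliminated. *)
Lemma t5_rec16 i k (Q := (2 ^ i)%N) :
  t5 (16 * Q + k) = 'X^Q ^+ 16 * t5 k + 'X^Q ^+ 8 * t5 k + 'X^Q ^+ 4 * t5 (4 * Q + k)
    + 'X^Q ^+ 3 * t5 (Q + k).
Proof.
have e a b : (a = b)%N -> t5 a = t5 b by move=> ->.
have := t5_rec8 i.+1 k; rewrite /= expnS -/Q.
rewrite (e (8 * (2 * Q) + k) (16 * Q + k))%N; last by lia.
rewrite (e (3 * (2 * Q) + k) (6 * Q + k))%N; last by lia.
rewrite t5_rec6 -/Q => ->.
have -> : 'X^(2 * Q) = 'X^Q ^+ 2 :> {poly F2} by rewrite -exprM mulnC.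
set z := 'X^Q; pose J := z ^+ 6 * t5 (2 * Q + k).
rewrite -[RHS]addr0 -(polyF2_addrr J) /J; ring.
Qed.

(** * Heights of exponents computed from base 4 digits *)

Lemma base4_ind (P : nat -> Prop) : P 0%N ->
  (forall k d, (d < 4)%N -> P k -> P (4 * k + d)%N) -> forall k, P k.
Proof.
move=> P0 PS k; elim/ltn_ind: k => k IH; have [->//|k0] := posnP k.
have -> : k = (4 * (k %/ 4) + k %% 4)%N by lia.
by apply: PS; [rewrite ltn_mod|apply: IH; lia].
Qed.

Section DigitSums.
Variable w : nat -> nat.
Definition digsum (k : nat) : nat := \sum_(t < k) w ((k %/ 4 ^ t) %% 4) * 2 ^ t.
Hypothesis w0 : w 0 = 0%N.

Lemma digsum0 : digsum 0 = 0%N. Proof. by rewrite /digsum big_ord0. Qed.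

Lemma digsum_widen N k : (k <= N)%N ->
  digsum k = (\sum_(t < N) w ((k %/ 4 ^ t) %% 4) * 2 ^ t)%N.
Proof.
move=> kN; rewrite /digsum -!(big_mkord xpredT (fun t => w ((k %/ 4 ^ t) %% 4) * 2 ^ t)%N).
rewrite [RHS](big_cat_nat (n := k)) //= [X in _ = (_ + X)%N]big_nat [X in _ =
  (_ + X)%N]big1 ?addn0 //.
move=> t /andP[kt _]; rewrite divn_small ?mod0n ?w0 ?mul0n //.
by rewrite (leq_trans _ (leq_pexp2l (isT : (0 < 4)%N) kt)) // ltn_expl.
Qed.

Lemma digsum4 k d : (d < 4)%N -> digsum (4 * k + d) = (w d + 2 * digsum k)%N.
Proof.
move=> d4; rewrite (@digsum_widen (4 * k + d).+1) // big_ord_recl /=.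
rewrite expn0 divn1 muln1; have -> : ((4 * k + d) %% 4 = d)%N by lia.
congr (_ + _)%N; rewrite (@digsum_widen (4 * k + d) k); last by lia.
rewrite big_distrr /=; apply: eq_bigr => t _; rewrite /bump /= add1n !expnS divnMA.
have -> : ((4 * k + d) %/ 4 = k)%N by lia.
by rewrite mulnCA.
Qed.

Lemma digsum_top t d l : (d < 4)%N -> (l < 4 ^ t)%N ->
  digsum (d * 4 ^ t + l) = (w d * 2 ^ t + digsum l)%N.
Proof.
move=> d4; elim: t l => [|t IH] l.
  rewrite expn0 ltnS leqn0 => /eqP ->; rewrite !muln1 digsum0 -[(d + 0)%N](add0n) addn0.
  by rewrite -[0%N](muln0 4) digsum4 // digsum0.
move=> lt; have e : l = (4 * (l %/ 4) + l %% 4)%N by lia.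
have -> : (d * 4 ^ t.+1 + l = 4 * (d * 4 ^ t + l %/ 4) + l %% 4)%N by rewrite {1}e expnS; lia.
have l4 : (l %% 4 < 4)%N by rewrite ltn_mod.
rewrite digsum4 // IH; last by move: lt; rewrite expnS; lia.
by rewrite {3}e digsum4 // expnS; lia.
Qed.

(** Subadditivity at one digit: a carry counts [w 1] with the doubled weight of the next place. *)
Hypothesis wD : forall a b, (a < 4)%N -> (b < 4)%N ->
    (w ((a + b) %% 4) + 2 * (w 1 * ((a + b) %/ 4)) <= w a + w b)%N.

Lemma digsumS k : (digsum k.+1 <= digsum k + w 1)%N.
Proof.
elim/base4_ind: k => [|k d d4 IH].
  by rewrite -{1}[1%N]/(4 * 0 + 1)%N digsum4 // digsum0 muln0 addn0.
have [d3|d3] := ltnP d 3.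
  rewrite -addnS !digsum4 //; have := wD d4 (isT : (1 < 4)%N).
  rewrite addn1 modn_small ?divn_small //; lia.
have -> : d = 3%N by lia.
have -> : ((4 * k + 3).+1 = 4 * k.+1 + 0)%N by lia.
have : (w 0 + 2 * (w 1 * 1) <= w 3 + w 1)%N := wD (isT : (3 < 4)%N) (isT : (1 < 4)%N).
rewrite !digsum4 // w0; lia.
Qed.

Lemma digsumD a b : (digsum (a + b) <= digsum a + digsum b)%N.
Proof.
elim/base4_ind: a b => [|a d d4 IH] b; first by rewrite add0n digsum0.
have -> : b = (4 * (b %/ 4) + b %% 4)%N by lia.
have e4 : (b %% 4 < 4)%N by rewrite ltn_mod.
move: (b %/ 4)%N (b %% 4)%N e4 => {}b e e4.
have -> : (4 * a + d + (4 * b + e) = 4 * (a + b + (d + e) %/ 4) + (d + e) %% 4)%N by lia.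
rewrite !digsum4 ?ltn_mod //; have := wD d4 e4.
have : ((d + e) %/ 4 < 2)%N by lia.
case: ((d + e) %/ 4)%N => [|[|//]] _; rewrite ?addn0 ?addn1.
  have := IH b; lia.
have := IH b; have := digsumS (a + b); lia.
Qed.

End DigitSums.

(* Heights in the style of Nicolas and Serre, computed on base 4 digits: T_3 and
   T_5 lower [H0] by at least 2, while [k <= H0 k ^ 2], so that bounds on [H0]
   are bounds on the degree. *)
Definition H0 := digsum id.
(** In terms of the code (n_3, n_5) of Nicolas and Serre for odd k: [Hg] is n_3, [H0] is 1 + 2 (n_3
    + n_5) and [H1] is 1 + n_3 + 2 n_5. *)
Definition H1 := digsum (fun d => d - d %/ 2)%N.
Definition Hg := digsum (fun d => d %/ 2)%N.

Ltac small4 := let a := fresh in let b := fresh in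
  move=> a b; case: a => [|[|[|[|//]]]]; case: b => [|[|[|[|//]]]].

Lemma H0_4 k d : (d < 4)%N -> H0 (4 * k + d) = (d + 2 * H0 k)%N.
Proof. exact: digsum4. Qed.

Lemma H1_4 k d : (d < 4)%N -> H1 (4 * k + d) = (d - d %/ 2 + 2 * H1 k)%N.
Proof. exact: digsum4. Qed.

Lemma Hg_4 k d : (d < 4)%N -> Hg (4 * k + d) = (d %/ 2 + 2 * Hg k)%N.
Proof. exact: digsum4. Qed.

Lemma H0_top t d l : (d < 4)%N -> (l < 4 ^ t)%N -> H0 (d * 4 ^ t + l) = (d * 2 ^ t + H0 l)%N.
Proof. exact: digsum_top. Qed.

Lemma H1_top t d l : (d < 4)%N -> (l < 4 ^ t)%N ->
  H1 (d * 4 ^ t + l) = ((d - d %/ 2) * 2 ^ t + H1 l)%N.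
Proof. exact: digsum_top. Qed.

Lemma Hg_top t d l : (d < 4)%N -> (l < 4 ^ t)%N ->
  Hg (d * 4 ^ t + l) = (d %/ 2 * 2 ^ t + Hg l)%N.
Proof. exact: digsum_top. Qed.

Lemma H0D a b : (H0 (a + b) <= H0 a + H0 b)%N.
Proof. by apply: digsumD => //; small4. Qed.

Lemma H1D a b : (H1 (a + b) <= H1 a + H1 b)%N.
Proof. by apply: digsumD => //; small4. Qed.

Lemma H0_0 : H0 0 = 0%N. Proof. exact: digsum0. Qed.

Lemma H1_0 : H1 0 = 0%N. Proof. exact: digsum0. Qed.

Lemma Hg_0 : Hg 0 = 0%N. Proof. exact: digsum0. Qed.

Lemma H0_pow t d : (d < 4)%N -> H0 (d * 4 ^ t) = (d * 2 ^ t)%N.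
Proof. by move=> d4; rewrite -[X in H0 X]addn0 H0_top ?expn_gt0 // H0_0 addn0. Qed.

Lemma H1_pow t d : (d < 4)%N -> H1 (d * 4 ^ t) = ((d - d %/ 2) * 2 ^ t)%N.
Proof. by move=> d4; rewrite -[X in H1 X]addn0 H1_top ?expn_gt0 // H1_0 addn0. Qed.

Lemma H_small d : (d < 4)%N -> [/\ H0 d = d, H1 d = (d - d %/ 2)%N & Hg d = (d %/ 2)%N].
Proof.
move=> d4; have := (H0_4 0 d4, H1_4 0 d4, Hg_4 0 d4).
by rewrite muln0 !add0n H0_0 H1_0 Hg_0 muln0 !addn0 => -[[-> ->] ->].
Qed.

Lemma H1_Hg k : (H1 k + Hg k)%N = H0 k.
Proof.
elim/base4_ind: k => [|k d d4 IH]; first by rewrite H0_0 H1_0 Hg_0.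
by rewrite H0_4 // H1_4 // Hg_4 //; lia.
Qed.

(** The parities of [H0] and [Hg] are the two bits of the lowest digit. *)
Lemma H0_Hg_inj k l : H0 k = H0 l -> Hg k = Hg l -> k = l.
Proof.
elim/base4_ind: k l => [|k d d4 IH] l.
  elim/base4_ind: l => [//|l e e4 IH]; rewrite H0_0 Hg_0 H0_4 // Hg_4 // => h1 h2.
  have /IH : H0 0 = H0 l by rewrite H0_0; lia.
  by rewrite Hg_0 => /(_ ltac:(lia)) <-; lia.
have -> : l = (4 * (l %/ 4) + l %% 4)%N by lia.
have e4 : (l %% 4 < 4)%N by rewrite ltn_mod.
move: (l %/ 4)%N (l %% 4)%N e4 => {}l e e4; rewrite !H0_4 // !Hg_4 // => h1 h2.
have de : (d %% 2 = e %% 2)%N by lia.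
have := H1_Hg k; have := H1_Hg l => a1 a2.
have hg : (d %/ 2 + 2 * Hg k = e %/ 2 + 2 * Hg l)%N by [].
have : (d %/ 2 = e %/ 2)%N by lia.
move=> dd; have -> : d = e by lia.
by rewrite (IH l) //; lia.
Qed.

Lemma H0_le k : (H0 k <= k)%N.
Proof. by elim/base4_ind: k => [|k d d4 IH]; rewrite ?H0_0 // H0_4 //; lia. Qed.

(** One digit at a time: (d + 2h)^2 >= 4 h^2 + d. *)
Lemma le_H0_sqr k : (k <= H0 k ^ 2)%N.
Proof. by elim/base4_ind: k => [|k d d4 IH]; rewrite ?H0_0 // H0_4 //; nia. Qed.

Lemma base4_top k : (0 < k)%N ->
  exists t d l, [/\ k = (d * 4 ^ t + l)%N, (0 < d < 4)%N & (l < 4 ^ t)%N].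
Proof.
elim/base4_ind: k => [//|k d d4 IH] k0; have [k00|/IH [t [e [l [-> e4 lt]]]]] := posnP k.
  by exists 0%N, d, 0%N; rewrite expn0; split; lia.
by exists t.+1, e, (4 * l + d)%N; rewrite expnS; split=> //; lia.
Qed.

(** If adding 4^r destroys all digits 2 and 3, a carry took place, and [H0] falls short of
    [H0 l + 2 ^ r] by at least one. *)
Lemma Hg_add l r : (H0 (l + 4 ^ r) + (0 < Hg l) <= H0 l + 2 ^ r + (0 < Hg (l + 4 ^ r)))%N.
Proof.
elim: r l => [|r IH] l.
  have -> : l = (4 * (l %/ 4) + l %% 4)%N by lia.
  have e4 : (l %% 4 < 4)%N by rewrite ltn_mod.
  move: (l %/ 4)%N (l %% 4)%N e4 => {}l e e4; rewrite !expn0.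
  have [e3|e3] := ltnP e 3; first by rewrite -addnA !H0_4 ?Hg_4 //; lia.
  have -> : e = 3%N by lia.
  have -> : (4 * l + 3 + 1 = 4 * (l + 1) + 0)%N by lia.
  rewrite !H0_4 ?Hg_4 //; have := H0D l 1; rewrite -[X in (_ <= _ + H0 X)%N ->
    _]/(1 * 4 ^ 0)%N H0_pow // expn0; lia.
have -> : l = (4 * (l %/ 4) + l %% 4)%N by lia.
have e4 : (l %% 4 < 4)%N by rewrite ltn_mod.
move: (l %/ 4)%N (l %% 4)%N e4 => {}l e e4.
have -> : (4 * l + e + 4 ^ r.+1 = 4 * (l + 4 ^ r) + e)%N by rewrite expnS; lia.
rewrite !H0_4 ?Hg_4 // expnS; have := IH l.
have := H0D l (1 * 4 ^ r); rewrite H0_pow // !mul1n; lia.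
Qed.

(** Either a digit 2 or 3 is left, or a carry makes [H0] fall short. *)
Lemma Hg_add3 l r : (H0 (l + 3 * 4 ^ r) < H0 l + 3 * 2 ^ r + (0 < Hg (l + 3 * 4 ^ r)))%N.
Proof.
elim: r l => [|r IH] l.
  have -> : l = (4 * (l %/ 4) + l %% 4)%N by lia.
  have e4 : (l %% 4 < 4)%N by rewrite ltn_mod.
  move: (l %/ 4)%N (l %% 4)%N e4 => {}l e e4; rewrite !expn0.
  have [->|e0] := posnP e; first by rewrite addn0 !H0_4 ?Hg_4 // -[(4 * l)%N]addn0 H0_4 //; lia.
  have -> : (4 * l + e + 3 * 1 = 4 * (l + 1) + e.-1)%N by lia.
  rewrite !H0_4 ?Hg_4 //; try lia.
  have := H0D l 1; rewrite -[X in (_ <= _ + H0 X)%N -> _]/(1 * 4 ^ 0)%N H0_pow // expn0; lia.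
have -> : l = (4 * (l %/ 4) + l %% 4)%N by lia.
have e4 : (l %% 4 < 4)%N by rewrite ltn_mod.
move: (l %/ 4)%N (l %% 4)%N e4 => {}l e e4.
have -> : (4 * l + e + 3 * 4 ^ r.+1 = 4 * (l + 3 * 4 ^ r) + e)%N by rewrite expnS; lia.
rewrite !H0_4 ?Hg_4 // expnS; have := IH l.
have := H0D l (3 * 4 ^ r); rewrite H0_pow //; lia.
Qed.

Lemma coefXnM_neq0 (p : {poly F2}) n m : ('X^n * p)`_m != 0 ->
  exists2 i, m = (n + i)%N & p`_i != 0.
Proof.
rewrite coefXnM; case: ltnP => [|nm]; first by rewrite eqxx.
by exists (m - n)%N => //; lia.
Qed.

Lemma coefD_neq0 (p q : {poly F2}) m : (p + q)`_m != 0 -> p`_m != 0 \/ q`_m != 0.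
Proof.
rewrite coefD; have [->|] := eqVneq p`_m 0; last by left.
by rewrite add0r; right.
Qed.

Lemma pow4_2 s : (4 ^ s = 2 ^ (2 * s))%N. Proof. by rewrite expnM. Qed.

(** By subadditivity both terms of [t3_rec] stay within the heights of k: what the power of X adds
    is what the smaller index has lost. The induction hypothesis then supplies the decrease. *)
Lemma t3_supp k m : (t3 k)`_m != 0 -> (H0 m + 2 <= H0 k)%N /\ (H1 m + 1 <= H1 k)%N.
Proof.
elim/ltn_ind: k m => k IH m; have [k4|k4] := ltnP k 4.
  case: k k4 {IH} => [|[|[|[|//]]]] _; rewrite ?coef0 ?eqxx // /t3 coefX.
  have [->|] := eqVneq m 1%N; [move=> _|by rewrite eqxx];
    rewrite -[3%N]/(4 * 0 + 3)%N -[1%N]/(4 * 0 + 1)%N.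
  by rewrite !H0_4 // !H1_4 // H0_0 H1_0.
have [[|s] [d [l [kE /andP[d0 d4] lt]]]] := base4_top (leq_trans (isT : (0 < 4)%N) k4).
  by move: lt kE k4; rewrite expn0; lia.
have s0 : (0 < 4 ^ s)%N by rewrite expn_gt0.
(* c times the leading power of 4 is split off, with c = 2 for leading digit 2 and c = 1 for 1 and
   3. In each case [H1] loses exactly one unit of that place. *)
have main (c l' : nat) : (0 < c < 3)%N -> k = (4 * (c * 4 ^ s) + l')%N ->
   (c * 4 ^ s = 2 ^ (2 * s + c.-1))%N ->
   H0 k = (H0 l' + c * 2 ^ s.+1)%N -> H1 k = (H1 l' + 2 ^ s.+1)%N ->
   (t3 k)`_m != 0 -> (H0 m + 2 <= H0 k)%N /\ (H1 m + 1 <= H1 k)%N.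
  move=> /andP[c0 c3] k' cs e0 e1; rewrite {1}k' cs t3_rec -cs.
  have h0 := H0_pow s (ltn_trans c3 (isT : (3 < 4)%N)).
  have h1 := H1_pow s (ltn_trans c3 (isT : (3 < 4)%N)).
  have h0' : H0 (4 * (c * 4 ^ s)) = (c * 2 ^ s.+1)%N.
    by rewrite mulnCA -expnS H0_pow // (ltn_trans c3).
  have h1' : H1 (4 * (c * 4 ^ s)) = ((c - c %/ 2) * 2 ^ s.+1)%N.
    by rewrite mulnCA -expnS H1_pow // (ltn_trans c3).
  have cb : (c - c %/ 2 = 1)%N by lia.
  move: h1 h1'; rewrite cb !mul1n => h1 h1'; rewrite expnS in e0 e1 h0' h1'.
  move=> /coefD_neq0 [] /coefXnM_neq0 [i -> /IH].
    have := H0D (c * 4 ^ s) l'; have := H1D (c * 4 ^ s) l'.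
    have := H0D (c * 4 ^ s) i; have := H1D (c * 4 ^ s) i.
    by rewrite h0 h1 e0 e1 => ? ? ? ? /(_ ltac:(nia)); lia.
  have := H0D (4 * (c * 4 ^ s)) i; have := H1D (4 * (c * 4 ^ s)) i.
  by rewrite h0' h1' e0 e1 => ? ? /(_ ltac:(nia)); lia.
have [d2|d2] := eqVneq d 2%N.
  apply: (main 2 l) => //; first by rewrite kE d2 expnS; lia.
  - by rewrite /= addn1 expnS -pow4_2.
  - by rewrite kE d2 H0_top // addnC.
  by rewrite kE d2 H1_top // addnC mul1n.
apply: (main 1%N ((d.-1) * 4 ^ s.+1 + l)%N) => //.
- by rewrite kE expnS; nia.
- by rewrite /= addn0 mul1n -pow4_2.
- by rewrite kE !H0_top //; nia.
rewrite kE !H1_top //; last by lia.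
have -> : (d.-1 - d.-1 %/ 2 = (d - d %/ 2).-1)%N by lia.
have : (0 < d - d %/ 2)%N by lia.
nia.
Qed.

(** As [H1 + Hg = H0], the second inequality says that a monomial m of the maximal height [H0 k - 2]
    with [Hg m = 0] arises only from k with [Hg k = 0]. *)
Lemma t5_supp k m : (t5 k)`_m != 0 ->
  (H0 m + 2 <= H0 k)%N /\ (H1 m + 2 + (0 < Hg k) <= H0 k)%N.
Proof.
elim/ltn_ind: k m => k IH m; have [k8|k8] := ltnP k 8.
  have E5 : t5 5 = 'X by [].
  have E7 : t5 7 = 'X^3.
    have -> : t5 7 = 'X^2 * t5 5 + 'X^4 * t5 3 + 'X * t5 2 + 'X^6 * t5 1 by [].
    by rewrite (_ : t5 3 = 0) // (_ : t5 2 = 0) // (_ : t5 1 = 0) // !mulr0 !addr0 E5 -exprSr.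
  have E6 : t5 6 = 0.
    have -> : t5 6 = 'X^2 * t5 4 + 'X^4 * t5 2 + 'X * t5 1 + 'X^6 * t5 0 by [].
    by rewrite (_ : t5 4 = 0) // (_ : t5 2 = 0) // (_ : t5 1 = 0) // (_ : t5 0 =
      0) // !mulr0 !addr0.
  case: k k8 {IH} => [|[|[|[|[|[|[|[|//]]]]]]]] _; rewrite ?E5 ?E6 ?E7 ?coef0 ?eqxx //.
    rewrite coefX; have [->|] := eqVneq m 1%N; [move=> _|by rewrite eqxx].
    have [a0 a1 ag] := H_small (isT : (1 < 4)%N).
    have := (H0_4 1 (isT : (1 < 4)%N), Hg_4 1 (isT : (1 < 4)%N)).
    by rewrite (_ : 4 * 1 + 1 = 5)%N // a0 ag => -[-> ->]; rewrite a1.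
  rewrite coefXn; have [->|] := eqVneq m 3%N; [move=> _|by rewrite eqxx].
  have [a0 a1 ag] := H_small (isT : (1 < 4)%N).
  have [b0 b1 bg] := H_small (isT : (3 < 4)%N).
  have := (H0_4 1 (isT : (3 < 4)%N), Hg_4 1 (isT : (3 < 4)%N)).
  by rewrite (_ : 4 * 1 + 3 = 7)%N // a0 ag => -[-> ->]; rewrite b0 b1.
have [[|t] [d [l [kE /andP[d0 d4] lt]]]] := base4_top (leq_trans (isT : (0 < 8)%N) k8).
  by move: lt kE k8; rewrite expn0; lia.
(* Leading digit at least 2: 8 * 4^t = 2 * 4^(t+1) is split off by [t5_rec8]. *)
have [d2|d2] := leqP 2 d.
  pose l' := ((d - 2) * 4 ^ t.+1 + l)%N.
  have kE' : k = (8 * 4 ^ t + l')%N by rewrite kE /l' expnS; nia.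
  have Hk : H0 k = (H0 l' + 4 * 2 ^ t)%N.
    by rewrite kE /l' !H0_top //; [rewrite expnS; nia|lia].
  have Hgk : (0 < Hg k)%N = true.
    rewrite kE Hg_top //; have : (0 < 2 ^ t.+1)%N by rewrite expn_gt0.
    have : (0 < d %/ 2)%N by lia.
    by nia.
  have s0 : (0 < 2 ^ t)%N by rewrite expn_gt0.
  have s4 : (0 < 4 ^ t)%N by rewrite expn_gt0.
  have h1 := H0_pow t (isT : (1 < 4)%N); have g1 := H1_pow t (isT : (1 < 4)%N).
  have h3 := H0_pow t (isT : (3 < 4)%N); have g3 := H1_pow t (isT : (3 < 4)%N).
  have h8 := H0_pow t.+1 (isT : (2 < 4)%N); have g8 := H1_pow t.+1 (isT : (2 < 4)%N).
  have e8 : (2 * 4 ^ t.+1 = 8 * 4 ^ t)%N by rewrite expnS; lia.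
  rewrite e8 in h8 g8; rewrite !mul1n in h1 g1; rewrite /= ?mul1n in g1 g3 g8.
  rewrite Hk Hgk {1}kE' pow4_2 t5_rec8 -pow4_2 -!exprM => /coefD_neq0 [/coefD_neq0[]|].
  - rewrite mulnC => /coefXnM_neq0 [i -> /IH] /(_ ltac:(lia)) [a1 a2].
    have := H0D (8 * 4 ^ t) i; have := H1D (8 * 4 ^ t) i.
    rewrite h8 g8 expnS; lia.
  - move=> /coefXnM_neq0 [i -> /IH] /(_ ltac:(lia)) [a1 a2].
    have := H0D (4 ^ t) i; have := H1D (4 ^ t) i.
    have := H0D l' (3 * 4 ^ t); have := Hg_add3 l' t.
    rewrite (addnC l') h1 g1 h3; lia.
  rewrite mulnC => /coefXnM_neq0 [i -> /IH] /(_ ltac:(lia)) [a1 a2].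
  have := H0D (3 * 4 ^ t) i; have := H1D (3 * 4 ^ t) i; have := H0D (4 ^ t) l'.
  rewrite h3 g3 h1; lia.
(* Leading digit 1: after lowering t by one, 16 * 4^t is split off by [t5_rec16]; this does not
   change [Hg]. *)
have d1 : d = 1%N by lia.
rewrite d1 mul1n in kE; case: t => [|t] in lt kE.
  by move: lt kE k8; rewrite expn1; lia.
have kE' : k = (16 * 4 ^ t + l)%N by rewrite kE !expnS; lia.
have Hk : H0 k = (H0 l + 4 * 2 ^ t)%N.
  by rewrite kE -[(4 ^ _)%N]mul1n H0_top // !expnS; lia.
have Hgk : Hg k = Hg l by rewrite kE -[(4 ^ _)%N]mul1n Hg_top.
have s0 : (0 < 2 ^ t)%N by rewrite expn_gt0.
have s4 : (0 < 4 ^ t)%N by rewrite expn_gt0.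
have h1 := H0_pow t (isT : (1 < 4)%N); have g1 := H1_pow t (isT : (1 < 4)%N).
have h3 := H0_pow t (isT : (3 < 4)%N); have g3 := H1_pow t (isT : (3 < 4)%N).
have h4 := H0_pow t.+1 (isT : (1 < 4)%N); have g4 := H1_pow t.+1 (isT : (1 < 4)%N).
have h8 := H0_pow t.+1 (isT : (2 < 4)%N); have g8 := H1_pow t.+1 (isT : (2 < 4)%N).
have h16 := H0_pow t.+2 (isT : (1 < 4)%N); have g16 := H1_pow t.+2 (isT : (1 < 4)%N).
rewrite ?expnS /= ?mul1n in h1 g1 h3 g3 h4 g4 h8 g8 h16 g16.
have e8 : (2 * (4 * 4 ^ t) = 8 * 4 ^ t)%N by lia.
have e16 : (4 * (4 * 4 ^ t) = 16 * 4 ^ t)%N by lia.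
rewrite e8 in h8 g8; rewrite e16 in h16 g16.
rewrite Hk Hgk {1}kE' pow4_2 t5_rec16 -pow4_2 -!exprM =>
  /coefD_neq0 [/coefD_neq0[/coefD_neq0[]|]|].
- rewrite mulnC => /coefXnM_neq0 [i -> /IH] /(_ ltac:(lia)) [a1 a2].
  have := H0D (16 * 4 ^ t) i; have := H1D (16 * 4 ^ t) i; rewrite h16 g16; lia.
- rewrite mulnC => /coefXnM_neq0 [i -> /IH] /(_ ltac:(lia)) [a1 a2].
  have := H0D (8 * 4 ^ t) i; have := H1D (8 * 4 ^ t) i; rewrite h8 g8; lia.
- rewrite mulnC => /coefXnM_neq0 [i -> /IH] /(_ ltac:(lia)) [a1 a2].
  have := H0D (4 * 4 ^ t) i; have := H1D (4 * 4 ^ t) i; have := H0D (4 * 4 ^ t) l.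
  have := Hg_add l t.+1; rewrite !expnS (addnC l) h4 g4; lia.
rewrite mulnC => /coefXnM_neq0 [i -> /IH] /(_ ltac:(lia)) [a1 a2].
have := H0D (3 * 4 ^ t) i; have := H1D (3 * 4 ^ t) i; have := H0D (4 ^ t) l.
have := Hg_add l t; rewrite (addnC l) h3 g3 h1; lia.
Qed.

(** Lucas's theorem modulo 2, for the last binary digits. *)
Lemma odd_bin2 n m : [/\ odd 'C(n.*2, m.*2) = odd 'C(n, m),
  odd 'C(n.*2, m.*2.+1) = false,
  odd 'C(n.*2.+1, m.*2) = odd 'C(n, m)
  & odd 'C(n.*2.+1, m.*2.+1) = odd 'C(n, m)].
Proof.
have key n' : (forall m, odd 'C(n'.*2, m.*2) = odd 'C(n', m)) ->
   (forall m, odd 'C(n'.*2, m.*2.+1) = false) -> forall m,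
   odd 'C(n'.*2.+1, m.*2) = odd 'C(n', m) /\ odd 'C(n'.*2.+1, m.*2.+1) = odd 'C(n', m).
  move=> h1 h2 [|k].
    by split; rewrite ?bin0 // binS oddD (h2 0%N) (h1 0%N) !bin0.
  by split; [rewrite doubleS binS oddD h2 -doubleS h1 addbF|rewrite binS oddD h2 h1].
elim: n m => [|n IH] m.
  have [||h1 h2] := key 0%N _ _ m.
  - by case=> [|k].
  - by [].
  by case: m h1 h2 => [|m] h1 h2; split.
have H : (forall m, odd 'C(n.+1.*2, m.*2) = odd 'C(n.+1, m)) /\
   (forall m, odd 'C(n.+1.*2, m.*2.+1) = false).
  split=> -[|k].
  - by rewrite !bin0.
  - rewrite (doubleS n) (doubleS k) (binS n.*2.+1 k.*2.+1) (binS n k).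
    rewrite (oddD 'C(n.*2.+1, k.*2.+2) _) (oddD 'C(n, k.+1) _).
    by have [_ _ _ ->] := IH k; rewrite -(doubleS k); have [_ _ -> _] := IH k.+1.
  - by rewrite doubleS binS oddD; have [_ _ h1 h2] := IH 0%N; rewrite h1 h2 addbb.
  by rewrite doubleS binS oddD; have [_ _ h1 h2] := IH k.+1; rewrite h1 h2 addbb.
have [h1 h2] := H; have [h3 h4] := key _ h1 h2 m.
by split.
Qed.

Lemma odd_bin4 n m d e : (d < 4)%N -> (e < 4)%N ->
  odd 'C(4 * n + d, 4 * m + e) = odd 'C(n, m) && odd 'C(d, e).
Proof.
have E k : (4 * k = k.*2.*2)%N by lia.
rewrite !E => d4 e4.
have [a0 a1 a2 a3] := odd_bin2 n m.
have [b0 b1 b2 b3] := odd_bin2 n.*2 m.*2; have [c0 c1 c2 c3] := odd_bin2 n.*2.+1 m.*2.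
have [d0' d1' d2' d3'] := odd_bin2 n.*2 m.*2.+1; have [e0 e1 e2 e3] := odd_bin2 n.*2.+1 m.*2.+1.
case: d d4 => [|[|[|[|//]]]] _; case: e e4 => [|[|[|[|//]]]] _;
  rewrite ?addn0 ?addn1 ?addn2 ?addn3 -?doubleS
  ?(b0, b1, b2, b3, c0, c1, c2, c3) ?(d0', d1', d2', d3', e0, e1, e2, e3)
  ?(a0, a1, a2, a3) /= ?andbT ?andbF //.
Qed.

(* The coefficient of ['X^(e + 4 * j)] in [t3 (3 * e + 4 * j)]; it is what the
   generating series [y t^3 / (1 + y t^3 + y^4 t^4)] gives. *)
Lemma t3_low k m : (t3 k)`_m != 0 -> (k <= 3 * m)%N /\ (m + 2 <= k)%N.
Proof.
elim/ltn_ind: k m => k IH m; have [k4|k4] := ltnP k 4.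
  case: k k4 {IH} => [|[|[|[|//]]]] _; rewrite ?coef0 ?eqxx // /t3 coefX.
  by have [->|] := eqVneq m 1%N; [move=> _|rewrite eqxx].
have -> : k = (4 + (k - 4))%N by lia.
rewrite t3S -['X]expr1 => /coefD_neq0 [] /coefXnM_neq0 [i -> /IH] /(_ ltac:(lia)); lia.
Qed.

Lemma t3_coef j e : (t3 (3 * e.+1 + 4 * j))`_(e.+1 + 4 * j) = 'C(e + j, e)%:R.
Proof.
elim: {e j}(e + j).+1 {-2}e {-2}j (leqnn (e + j).+1) => // N IH e j; rewrite ltnS => eN.
case: j eN => [|j] eN.
  rewrite !muln0 !addn0 binn; case: e eN => [|e] eN; first by rewrite /t3 coefX.
  have -> : (3 * e.+2 = 4 + (3 * e + 2))%N by lia.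
  rewrite t3S -['X]expr1 coefD !coefXnM /= subn1 /=.
  have -> : (1 + (3 * e + 2) = 3 * e.+1)%N by lia.
  have := IH e 0%N ltac:(lia); rewrite muln0 !addn0 binn => ->.
  case: ifP => h; rewrite ?addr0 //.
  by have [->|/t3_low] := eqVneq (t3 (3 * e + 2))`_(e.+2 - 4) 0; [rewrite addr0|lia].
have -> : (3 * e.+1 + 4 * j.+1 = 4 + (3 * e.+1 + 4 * j))%N by lia.
rewrite t3S -['X]expr1 coefD !coefXnM.
have -> : (e.+1 + 4 * j.+1 < 1)%N = false by lia.
have -> : (e.+1 + 4 * j.+1 < 4)%N = false by lia.
have -> : (e.+1 + 4 * j.+1 - 4 = e.+1 + 4 * j)%N by lia.
rewrite IH; last by lia.
have -> : (e.+1 + 4 * j.+1 - 1 = e + 4 * j.+1)%N by lia.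
have -> : (1 + (3 * e.+1 + 4 * j) = 3 * e + 4 * j.+1)%N by lia.
case: e eN => [|e] eN.
  have [->|/t3_low] := eqVneq (t3 (3 * 0 + 4 * j.+1))`_(0 + 4 * j.+1) 0; last by lia.
  by rewrite add0r !bin0.
rewrite IH; last by lia.
have -> : (e.+1 + j = e + j.+1)%N by lia.
have -> : (e.+1 + j.+1 = (e + j.+1).+1)%N by lia.
by rewrite binS natrD addrC.
Qed.

Lemma t5_low k m : (t5 k)`_m != 0 -> (m + 4 <= k)%N.
Proof.
elim/ltn_ind: k m => k IH m; have [k6|k6] := ltnP k 6.
  case: k k6 {IH} => [|[|[|[|[|[|//]]]]]] _; rewrite ?coef0 ?eqxx // /t5 coefX.
  by have [->|] := eqVneq m 1%N; [move=> _|rewrite eqxx].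
have -> : k = (6 + (k - 6))%N by lia.
rewrite t5S -['X]expr1 => /coefD_neq0 [/coefD_neq0 [/coefD_neq0 []|]|];
  move=> /coefXnM_neq0 [i -> /IH] /(_ ltac:(lia)); lia.
Qed.

Lemma coef_1X (n k : nat) : ((1 + 'X : {poly F2}) ^+ n)`_k = 'C(n, k)%:R.
Proof.
elim: n k => [|n IH] k; first by rewrite expr0 coef1 bin0n.
rewrite exprS mulrDl mul1r coefD coefXM !IH; case: k => [|k]; first by rewrite !bin0 addr0.
by rewrite binS natrD.
Qed.

(** Modulo 2, (1 + X)^6 + (1 + X)^4 + (1 + X)^2 + 1 = X^6. *)
Lemma bin_shift6 n k : 'C(n + 6, k)%:R + 'C(n + 4, k)%:R + 'C(n + 2, k)%:R + 'C(n, k)%:R =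
  (if (k < 6)%N then 0 else 'C(n, k - 6)%:R) :> F2.
Proof.
rewrite -!coef_1X -coefXnM -!coefD !exprD; apply: (congr1 (fun q : {poly F2} => q`_k)).
set p := _ ^+ n; set x : {poly F2} := 'X; rewrite -/x.
pose J := p * (2 + 6 * x + 11 * x ^+ 2 + 12 * x ^+ 3 + 8 * x ^+ 4 + 3 * x ^+ 5).
transitivity (x ^+ 6 * p + (J + J)); first by rewrite /J; ring.
by rewrite polyF2_addrr addr0.
Qed.

(** The generating series x t^5 / ((1 + x t)^6 + x t^5) is a geometric series in x t^5 / (1 + x
    t)^6, whose term of index e gives this coefficient. In the induction [bin_shift6] plays the part
    of Pascal's rule. *)
Lemma t5_coef k m e : k = (m + 4 * e.+1)%N -> (t5 k)`_m = 'C(k + e, 6 * e + 5)%:R.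
Proof.
elim/ltn_ind: k m e => k IH m e kE; have [k6|k6] := ltnP k 6.
  have -> : e = 0%N by lia.
  have [k4|k5] : k = 4%N \/ k = 5%N by lia.
    by rewrite k4 /t5 coef0 bin_small.
  have -> : m = 1%N by lia.
  by rewrite k5 /t5 coefX binn.
pose n := (k - 6)%N; have nE : k = (6 + n)%N by rewrite /n; lia.
rewrite nE t5S -['X]expr1 !coefD !coefXnM.
have [mn] : (m + 4 * e.+1 = 6 + n)%N by lia.
have H2 : (if (m < 2)%N then 0 else (t5 (4 + n))`_(m - 2)) = 'C(n + e + 4, 6 * e + 5)%:R.
  case: ltnP => m2; first by rewrite bin_small //; lia.
  by rewrite (IH (4 + n)%N _ (m - 2)%N e) //; [congr ('C(_, _)%:R); lia|lia|lia].
have H4 : (if (m < 4)%N then 0 else (t5 (2 + n))`_(m - 4)) = 'C(n + e + 2, 6 * e + 5)%:R.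
  case: ltnP => m2; first by rewrite bin_small //; lia.
  by rewrite (IH (2 + n)%N _ (m - 4)%N e) //; [congr ('C(_, _)%:R); lia|lia|lia].
have H6 : (if (m < 6)%N then 0 else (t5 n)`_(m - 6)) = 'C(n + e, 6 * e + 5)%:R.
  case: ltnP => m2; first by rewrite bin_small //; lia.
  by rewrite (IH n _ (m - 6)%N e) //; lia.
have H1' : (if (m < 1)%N then 0 else (t5 (1 + n))`_(m - 1)) =
   if (6 * e + 5 < 6)%N then 0 else 'C(n + e, 6 * e + 5 - 6)%:R :> F2.
  case: e mn kE {H2 H4 H6} => [|e] mn kE.
    rewrite muln0 add0n; case: ltnP => // m1.
    by have [->//|/t5_low] := eqVneq (t5 (1 + n))`_(m - 1) 0; lia.
  have -> : (6 * e.+1 + 5 < 6)%N = false by lia.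
  case: ltnP => m1; first by rewrite bin_small //; lia.
  by rewrite (IH (1 + n)%N _ (m - 1)%N e) //; [congr ('C(_, _)%:R); lia|lia|lia].
rewrite H2 H4 H6 H1' -bin_shift6.
have -> : (6 + n + e = n + e + 6)%N by lia.
set a := 'C(_ + 4, _)%:R; set b := 'C(_ + 2, _)%:R; set c := 'C(n + e, _)%:R;
  set d := 'C(_ + 6, _)%:R.
transitivity (d + ((a + a) + (b + b) + (c + c))); first by ring.
by rewrite !F2_addrr !addr0.
Qed.

(** T_3 lowers n_3 by exactly one on some monomial: [Hg m + 1 = Hg k]. The coefficient is a binomial
    coefficient by [t3_coef], odd by Lucas's theorem. *)
Lemma t3_lead k : odd k -> (0 < Hg k)%N ->
  exists m, [/\ (H0 m + 2 = H0 k)%N, (H1 m + 1 = H1 k)%N & (t3 k)`_m != 0].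
Proof.
(* For k = 4k' + 1 the two exponents are 3 (e + 1) + 4j and (e + 1) + 4j with e = 4a + 2; a is built
   digit by digit along k', so that [odd_bin4] applies at each digit. *)
have key k' : (0 < Hg k')%N -> exists m a,
    [/\ k' = (m + 2 * a.+1)%N, (a <= m)%N, (H0 m + 2 = H0 k')%N, (H1 m + 1 = H1 k')%N
      & odd 'C(4 * a + 2 + (m - a), 4 * a + 2)].
  elim/base4_ind: k' => [|k' d d4 IH]; first by rewrite Hg_0.
  rewrite Hg_4 // => Hgk; have [d2|d2] := leqP 2 d.
    exists (4 * k' + (d - 2))%N, 0%N; rewrite !H0_4 ?H1_4 //; try lia.
    split; try lia; rewrite muln0 add0n subn0.
    have -> : (2 + (4 * k' + (d - 2)) = 4 * k' + d)%N by lia.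
    rewrite -[2%N in X in 'C(_, X)]/(4 * 0 + 2)%N odd_bin4 // bin0.
    by case: d d2 d4 {Hgk} => [|[|[|[|//]]]].
  have /IH [m [a [kE am h0 h1 oa]]] : (0 < Hg k')%N by lia.
  exists (4 * m + (d + 2))%N, (4 * a + 2)%N; rewrite !H0_4 ?H1_4 //; try lia.
  split; try lia.
  have -> : (4 * (4 * a + 2) + 2 + (4 * m + (d + 2) - (4 * a + 2)) =
    4 * (4 * a + 2 + (m - a)) + (d + 2))%N by lia.
  rewrite odd_bin4 ?oa //; last by lia.
  by case: d d2 d4 {Hgk h0 h1} => [|[|//]].
have coefE m e j : k = (3 * e.+1 + 4 * j)%N -> m = (e.+1 + 4 * j)%N -> odd 'C(e + j, e) ->
   (t3 k)`_m != 0 by move=> -> -> o; rewrite t3_coef F2_nat o oner_eq0.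
move=> ok; have kE : k = (4 * (k %/ 4) + k %% 4)%N by lia.
have [k3|k1] : (k %% 4 = 3)%N \/ (k %% 4 = 1)%N by lia.
  move=> _; exists (4 * (k %/ 4) + 1)%N; rewrite {2 4}kE k3 !H0_4 // !H1_4 //; split; try lia.
  by apply: (@coefE _ 0%N (k %/ 4)%N); rewrite ?bin0 //; lia.
rewrite {1}kE k1 Hg_4 // => Hgk.
have /key [m [a [k'E am h0 h1 o]]] : (0 < Hg (k %/ 4))%N by lia.
exists (4 * m + 3)%N; rewrite {1 2}kE k1 !H0_4 // !H1_4 //; split; try lia.
by apply: (@coefE _ (4 * a + 2)%N (m - a)%N) => //; lia.
Qed.

(** The counterpart for T_5 when n_3 = 0: then n_5 is lowered by exactly one. *)
Lemma t5_lead k : odd k -> Hg k = 0%N -> (1 < k)%N ->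
  exists m, [/\ (H0 m + 2 = H0 k)%N, Hg m = 0%N & (t5 k)`_m != 0].
Proof.
have key k' : (0 < k')%N -> Hg k' = 0%N -> exists m a,
    [/\ k' = (m + a.+1)%N, ~~ odd a, (H0 m + 1 = H0 k')%N, Hg m = 0%N
      & odd 'C(4 * k' + a.+1, 6 * a + 5)].
  elim/base4_ind: k' => [//|k' d d4 IH] k0.
  rewrite Hg_4 // => Hgk; have d2 : (d < 2)%N by lia.
  case: d d4 d2 k0 Hgk => [|[|//]] _ _ k0 Hgk; last first.
    exists (4 * k' + 0)%N, 0%N; rewrite !H0_4 ?Hg_4 //; split; try lia.
    by rewrite -[(6 * 0 + 5)%N]/(4 * (4 * 0 + 1) + 1)%N !odd_bin4 // bin0.
  have /IH [|m [a [kE ea h0 hg o]]] : (0 < k')%N by lia.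
    by lia.
  exists (4 * m + 1)%N, (4 * a + 2)%N; rewrite !H0_4 ?Hg_4 //; split; try lia.
  have -> : (4 * (4 * k' + 0) + (4 * a + 2).+1 = 4 * (4 * k' + a) + 3)%N by lia.
  have -> : (6 * (4 * a + 2) + 5 = 4 * (6 * a + 4) + 1)%N by lia.
  rewrite odd_bin4 // andbT.
  have [b ab] : exists b, a = b.*2 by exists a./2; lia.
  move: o; rewrite ab.
  have -> : (4 * k' + b.*2.+1 = (2 * k' + b).*2.+1)%N by lia.
  have -> : (6 * b.*2 + 5 = (6 * b + 2).*2.+1)%N by lia.
  have -> : (4 * k' + b.*2 = (2 * k' + b).*2)%N by lia.
  have -> : (6 * b.*2 + 4 = (6 * b + 2).*2)%N by lia.
  by have [-> _ _ ->] := odd_bin2 (2 * k' + b) (6 * b + 2).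
move=> ok Hgk k1; have kE : k = (4 * (k %/ 4) + k %% 4)%N by lia.
have r4 : (k %% 4 < 4)%N by rewrite ltn_mod.
move: Hgk; rewrite kE Hg_4 // => Hgk.
have r1 : (k %% 4 = 1)%N by lia.
have /key [|m [a [k'E ea h0 hg o]]] : (0 < k %/ 4)%N by lia.
  by lia.
exists (4 * m + 1)%N; rewrite r1 !H0_4 ?Hg_4 //; split; try lia.
rewrite (@t5_coef _ _ a); last by lia.
have -> : (4 * (k %/ 4) + 1 + a = 4 * (k %/ 4) + a.+1)%N by lia.
by rewrite F2_nat o oner_eq0.
Qed.

(** * Bounds on the degree of a polynomial in D from its images under Hecke operators *)

Definition linext (t : nat -> {poly F2}) (P : {poly F2}) : {poly F2} :=
  \sum_(k < size P) P`_k *: t k.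

Lemma linext_widen t (P : {poly F2}) N : (size P <= N)%N ->
  linext t P = \sum_(k < N) P`_k *: t k.
Proof.
move=> PN; rewrite /linext -!(big_mkord xpredT (fun k => P`_k *: t k)).
rewrite [RHS](big_cat_nat (n := size P)) //= [X in _ = _ + X]big_nat [X in _ =
  _ + X]big1 ?addr0 //.
by move=> k /andP[Pk _]; rewrite nth_default // scale0r.
Qed.

Lemma linextD t (P Q : {poly F2}) : linext t (P + Q) = linext t P + linext t Q.
Proof.
have h := size_polyD P Q.
rewrite !(@linext_widen t _ (maxn (size P) (size Q))) ?leq_max ?leqnn ?orbT //.
  rewrite -[RHS]big_split /=.
  by apply: eq_bigr => k _; rewrite coefD scalerDl.
by rewrite -leq_max.
Qed.

Lemma coef_linext (t : nat -> {poly F2}) (P : {poly F2}) m : (linext t P)`_m =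
  \sum_(k < size P) P`_k * (t k)`_m.
Proof. by rewrite coef_sum; apply: eq_bigr => k _; rewrite coefZ. Qed.

Lemma coef_linext_neq0 (t : nat -> {poly F2}) (P : {poly F2}) m : (linext t P)`_m != 0 ->
  exists k, P`_k != 0 /\ (t k)`_m != 0.
Proof.
move=> h; apply: contrapT => nh; case/eqP: h; rewrite coef_linext big1 // => k _.
have [->|h1] := eqVneq P`_k 0; first by rewrite mul0r.
have [->|h2] := eqVneq (t k)`_m 0; first by rewrite mulr0.
by case: nh; exists k.
Qed.

Lemma coef_linext1 (t : nat -> {poly F2}) (P : {poly F2}) m k : P`_k != 0 -> (t k)`_m != 0 ->
  (forall l, l <> k -> P`_l != 0 -> (t l)`_m = 0) -> (linext t P)`_m != 0.
Proof.
move=> Pk tk others; have kP : (k < size P)%N.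
  by rewrite ltnNge; apply/negP => /(nth_default 0) e; rewrite e eqxx in Pk.
rewrite coef_linext (bigD1 (Ordinal kP)) //= big1 ?addr0 ?mulf_neq0 // => l /eqP lk.
have [->|Pl] := eqVneq P`_l 0; first by rewrite mul0r.
by rewrite others ?mulr0 // => e; apply: lk; apply: val_inj.
Qed.

(** In T_3 P or T_5 P there is a monomial only 2 below the maximal height of P to which a single
    term of P contributes, so that nothing can cancel it. *)
Lemma t35_bound (P : {poly F2}) M : (0 < M)%N -> (forall k, P`_k != 0 -> odd k) ->
  (forall m, (linext t3 P)`_m != 0 -> (H0 m <= M)%N) ->
  (forall m, (linext t5 P)`_m != 0 -> (H0 m <= M)%N) ->
  forall k, P`_k != 0 -> (H0 k <= M + 2)%N.
Proof.
move=> M0 Podd B3 B5 k Pk; rewrite leqNgt; apply/negP => Mk.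
have inP l : P`_l != 0 -> (l < size P)%N.
  by move=> Pl; rewrite ltnNge; apply/negP => /(nth_default 0) e; rewrite e eqxx in Pl.
pose S (l : 'I_(size P)) := P`_l != 0.
have SK : S (Ordinal (inP k Pk)) by [].
have [k1 Pk1 k1max] : exists2 k1 : 'I_(size P), S k1 & forall l, P`_l != 0 -> (H0 l <= H0 k1)%N.
  case: (@arg_maxnP _ (Ordinal (inP k Pk)) S (fun l => H0 l) SK) => k1 Sk1 h.
  by exists k1 => // l Pl; apply: (h (Ordinal (inP l Pl))).
have hk1 : (M + 2 < H0 k1)%N := leq_trans Mk (k1max k Pk).
(* If some k0 of maximal height has [Hg k0 = 0], T_5 isolates it: by [t5_supp] any other
   contribution to its leading monomial comes from an index of the same height with [Hg] zero, hence
   from k0 by [H0_Hg_inj]. *)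
have [/existsP[k0 /and3P[Pk0 /eqP h0 /eqP g0]]|none] :=
  boolP [exists l : 'I_(size P), [&& S l, H0 l == H0 k1 & Hg l == 0%N]].
  have k01 : (1 < k0)%N.
    by rewrite ltnNge; apply/negP => h; have := H0_le k0; rewrite h0; lia.
  have [m [m0 mg tm]] := t5_lead (Podd _ Pk0) g0 k01.
  suff /B5 : (linext t5 P)`_m != 0 by lia.
  apply: (coef_linext1 Pk0 tm) => l lk Pl; apply/eqP; apply: contrapT => /negP tl.
  have [a1 a2] := t5_supp tl; have := k1max l Pl; have := H1_Hg m.
  move=> b1 b2; have e0 : H0 l = H0 k0.
    by apply/eqP; rewrite eqn_leq {1}h0 b2 -m0.
  have e1 : Hg l = Hg k0.
    have : (H1 m + 2 + (0 < Hg l) <= H0 m + 2)%N by rewrite m0 -e0.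
    by rewrite g0 -b1 mg; case: (Hg l) => // h; rewrite addn0 addn1 ltnn.
  exact: lk (H0_Hg_inj e0 e1).
(* Otherwise T_3 isolates the index of largest [H1], that is of smallest [Hg], among those of
   maximal height. *)
pose S' (l : 'I_(size P)) := S l && (H0 l == H0 k1).
have Sk1 : S' k1 by rewrite /S' Pk1 eqxx.
case: (@arg_maxnP _ k1 S' (fun l => H1 l) Sk1) => k2 /andP[Pk2 /eqP h2] k2max.
have g2 : (0 < Hg k2)%N.
  rewrite lt0n; apply/negP => g2; case/negP: none; apply/existsP; exists k2.
  by rewrite Pk2 h2 eqxx.
have [m [m0 m1 tm]] := t3_lead (Podd _ Pk2) g2.
suff /B3 : (linext t3 P)`_m != 0 by lia.
apply: (coef_linext1 Pk2 tm) => l lk Pl; apply/eqP; apply: contrapT => /negP tl.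
have [a1 a2] := t3_supp tl; have b := k1max l Pl.
have hl : H0 l = H0 k1 by apply/eqP; rewrite eqn_leq b -h2 -m0.
have := k2max (Ordinal (inP l Pl)); rewrite /S' /= /S /= Pl hl eqxx => /(_ isT) c.
have := H1_Hg l; have := H1_Hg k2 => d1 d2.
have e0 : H0 l = H0 k2 by rewrite hl h2.
have e1' : H1 l = H1 k2 by apply/eqP; rewrite eqn_leq c -m1.
have e1 : Hg l = Hg k2 by move: d1; rewrite -e0 -d2 e1' => /addnI.
exact: lk (H0_Hg_inj e0 e1).
Qed.

(** U_2 on polynomials in D: it maps D^(2i) to D^i and odd powers to 0, by Frobenius. *)
Definition t2 (P : {poly F2}) : {poly F2} := \poly_(i < size P) P`_(2 * i).

Lemma hecke_degree_bound d : exists B, forall (P : {poly F2}) (l2 l3 l5 : F2),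
  (size (t2 P - l2 *: P)%R <= d)%N -> (size (linext t3 P - l3 *: P)%R <= d)%N ->
  (size (linext t5 P - l5 *: P)%R <= d)%N -> (size P <= B)%N.
Proof.
(* For a leading exponent n that is odd, [t35_bound] gives H0 n <= (2d + 1) + 2, and n <= (H0 n)^2
   by [le_H0_sqr]; even exponents are below 2d. *)
exists (maxn d.+2 ((2 * d + 3) ^ 2).+1) => P l2 l3 l5 h2 h3 h5.
rewrite leq_max; have [Pd|Pd] := leqP (size P) d.+1; first by rewrite leqW.
apply/orP; right.
pose n := (size P).-1; have nE : size P = n.+1 by rewrite /n; lia.
have Pn : P`_n != 0 by rewrite -[n]/(size P).-1 -lead_coefE lead_coef_eq0 -size_poly_eq0 nE.
(* T_p lowers degrees, so the coefficient of degree n of T_p P - l P is -l times the leading one; it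
   vanishes as n >= d. *)
have l0 (T : {poly F2}) (l : F2) : (size (T - l *: P)%R <= d)%N -> T`_n = 0 -> l = 0.
  move=> hd Tn; have := nth_default 0 (leq_trans hd (_ : d <= n)%N).
  rewrite coefB coefZ Tn sub0r => /(_ ltac:(lia))/eqP.
  by rewrite oppr_eq0 mulf_eq0 (negPf Pn) orbF => /eqP.
have inP l : P`_l != 0 -> (l <= n)%N.
  by move=> Pl; rewrite -ltnS -nE ltnNge; apply/negP => /(nth_default 0) e;
    rewrite e eqxx in Pl.
have l20 : l2 = 0.
  apply: (l0 _ _ h2); rewrite coef_poly; case: ifP => // _.
  by have [//|/inP] := eqVneq P`_(2 * n) 0; lia.
have l30 : l3 = 0.
  apply: (l0 _ _ h3); apply/eqP; apply: contrapT =>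
    /negP /coef_linext_neq0 [k [/inP kn /t3_low]]; lia.
have l50 : l5 = 0.
  apply: (l0 _ _ h5); apply/eqP; apply: contrapT =>
    /negP /coef_linext_neq0 [k [/inP kn /t5_low]]; lia.
move: h2 h3 h5; rewrite l20 l30 l50 !scale0r !subr0 => h2 h3 h5.
pose Pe : {poly F2} := \poly_(k < size P) (if odd k then 0 else P`_k).
pose Po : {poly F2} := \poly_(k < size P) (if odd k then P`_k else 0).
have PE : P = Pe + Po.
  apply/polyP => k; rewrite coefD !coef_poly; case: ltnP => kP.
    by case: ifP; rewrite ?addr0 ?add0r.
  by rewrite addr0 nth_default.
have Peven k : Pe`_k != 0 -> (k < 2 * d)%N.
  rewrite coef_poly; case: ltnP => [kP|]; last by rewrite eqxx.
  case: ifP => [|ok Pk]; first by rewrite eqxx.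
  have : (t2 P)`_(k./2) != 0.
    rewrite coef_poly; have -> : (k./2 < size P)%N by lia.
    by have -> : (2 * k./2 = k)%N by lia.
  have [hk|hk] := ltnP k./2 d; first by lia.
  by rewrite nth_default ?eqxx // (leq_trans h2).
(* T_p of the odd part differs from T_p P by T_p of the even part, which has degree below 2d. *)
have bound (t : nat -> {poly F2}) : (size (linext t P) <= d)%N ->
    (forall k m, (t k)`_m != 0 -> (m <= k)%N) ->
    forall m, (linext t Po)`_m != 0 -> (H0 m <= 2 * d + 1)%N.
  move=> hd tlow m hm; apply: (leq_trans (H0_le m)); rewrite leqNgt; apply/negP => dm.
  have e : linext t Po = linext t P - linext t Pe by rewrite [in X in
    X - _]PE linextD addrAC subrr add0r.
  have : (linext t P)`_m = 0 by rewrite nth_default // (leq_trans hd) //; lia.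
  have [z|/coef_linext_neq0 [k [/Peven kd /tlow]]] := eqVneq (linext t Pe)`_m 0; last by lia.
  by move: hm; rewrite e coefB z subr0 => h h'; rewrite h' eqxx in h.
have Pon k : Po`_k != 0 -> odd k.
  rewrite coef_poly; case: ltnP => [kP|]; last by rewrite eqxx.
  by case: ifP => //; rewrite eqxx.
have := @t35_bound Po (2 * d + 1) _ Pon (bound _ h3 _) (bound _ h5 _) n.
rewrite addn1 => /(_ isT) H.
have [ndo|on] := boolP (odd n); last first.
  have /Peven nd : Pe`_n != 0 by rewrite coef_poly nE ltnSn (negPf on).
  by rewrite nE; nia.
have : Po`_n != 0 by rewrite coef_poly nE ltnSn ndo.
move=> /H hn; rewrite nE ltnS (leq_trans (le_H0_sqr n)) // leq_exp2r //.
have -> : (2 * d + 3 = (2 * d).+1 + 2)%N by lia.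
by apply: hn => k m => [/t3_low|/t5_low]; lia.
Qed.

(** * Evaluation of polynomials at D and Hecke operators on q-expansions modulo 2 *)

Section PsConst.
Variable A : comNzRingType.
Definition psC (c : A) : ps A := fun n => if n == 0%N then c else 0.
Lemma psCM_coef c (f : ps A) n : (psC c * f) n = c * f n.
Proof.
rewrite psM big_ord_recl /= subn0 big1 ?addr0 // => i _; by rewrite /psC /= mul0r.
Qed.

Fact psC_zmod : zmod_morphism psC.
Proof.
by move=> x y; apply: funext => n; rewrite psB /psC; case: eqP; rewrite ?subr0.
Qed.

Fact psC_monoid : monoid_morphism psC.
Proof.
split; first by apply: funext => n; rewrite ps1 /psC; case: eqP.
by move=> x y; apply: funext => n; rewrite psCM_coef /psC; case: eqP; rewrite ?mulr0.
Qed.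

HB.instance Definition _ := GRing.isZmodMorphism.Build A (ps A) psC psC_zmod.
HB.instance Definition _ := GRing.isMonoidMorphism.Build A (ps A) psC psC_monoid.
End PsConst.
Arguments psC : simpl never.

Definition evD (P : {poly F2}) : ps F2 := (map_poly (@psC F2) P).[D2].

Lemma evDD P Q : evD (P + Q) = evD P + evD Q.
Proof. by rewrite /evD rmorphD hornerD. Qed.

Lemma evDM P Q : evD (P * Q) = evD P * evD Q.
Proof. by rewrite /evD rmorphM hornerM. Qed.

Lemma evDXn n : evD 'X^n = D2 ^+ n.
Proof. by rewrite /evD map_polyXn hornerXn. Qed.

Lemma evDXnM n P : evD ('X^n * P) = D2 ^+ n * evD P.
Proof. by rewrite evDM evDXn. Qed.

Lemma evDX : evD 'X = D2.
Proof. by rewrite /evD map_polyX hornerX. Qed.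

Lemma evDXM P : evD ('X * P) = D2 * evD P.
Proof. by rewrite evDM evDX. Qed.

Lemma evDC c : evD c%:P = psC c.
Proof. by rewrite /evD map_polyC hornerC. Qed.

Lemma evD0 : evD 0 = 0.
Proof. by rewrite /evD rmorph0 horner0. Qed.

Lemma evDZ c P : evD (c *: P) = psC c * evD P.
Proof. by rewrite /evD linearZ /= hornerZ. Qed.

Lemma evD_sum (I : Type) (r : seq I) (F : I -> {poly F2}) :
  evD (\sum_(i <- r) F i) = \sum_(i <- r) evD (F i).
Proof. by elim/big_rec2: _ => [|i x y _ <-]; rewrite ?evD0 ?evDD. Qed.

Lemma evDE P : evD P = \sum_(k < size P) psC P`_k * D2 ^+ k.
Proof.
rewrite -{1}[P]coefK poly_def evD_sum; apply: eq_bigr => k _.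
by rewrite evDZ evDXn.
Qed.

Lemma D2_0 : D2 0%N = 0.
Proof. by rewrite /D2 /theta big_ord1 mulr0n. Qed.

Lemma D2_1 : D2 1%N = 1.
Proof. by rewrite /D2 /theta !big_ord_recl big_ord0 /= mulr0n add0r addr0. Qed.

(** D has no constant term, so the constant coefficient of P is read off; then a factor D is
    cancelled. *)
Lemma evD_inj P : evD P = 0 -> P = 0.
Proof.
have Dn0 : D2 <> 0 by move/(congr1 (fun f => f 1%N)); rewrite D2_1 ps0 => /eqP;
  rewrite oner_eq0.
elim/poly_ind: P => [//|P c IH]; rewrite evDD evDM evDX evDC => h.
have c0 : c = 0.
  have := congr1 (fun f => f 0%N) h; rewrite psD psM_0 D2_0 mulr0 add0r /psC /=.
  by [].
move: h; rewrite c0 rmorph0 !addr0 => /ps_mulf_eq0 [/IH ->|//].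
by rewrite mul0r.
Qed.

(** T_p modulo 2 for odd p, where p^(k-1) is odd. *)
Definition psT (p : nat) (f : ps F2) : ps F2 := psU p f + psV p f.

Lemma psTD p f g : psT p (f + g) = psT p f + psT p g.
Proof. by rewrite /psT psVD psUD addrACA. Qed.

Lemma psUC p c (f : ps F2) : psU p (psC c * f) = psC c * psU p f.
Proof. by apply: funext => n; rewrite psCM_coef /psU psCM_coef. Qed.

Lemma psVC p c (f : ps F2) : psV p (psC c * f) = psC c * psV p f.
Proof.
by apply: funext => n; rewrite psCM_coef /psV psCM_coef; case: ifP; rewrite ?mulr0.
Qed.

Lemma psTC p c f : psT p (psC c * f) = psC c * psT p f.
Proof. by rewrite /psT psUC psVC mulrDr. Qed.

Lemma psU0 p : psU p (0 : ps F2) = 0. Proof. by []. Qed.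

Lemma psV0 p : psV p (0 : ps F2) = 0.
Proof. by apply: funext => n; rewrite /psV; case: ifP. Qed.

Lemma psT_sum p (I : Type) (r : seq I) (F : I -> ps F2) :
  psT p (\sum_(i <- r) F i) = \sum_(i <- r) psT p (F i).
Proof.
by elim/big_rec2: _ => [|i x y _ <-]; rewrite ?psTD // /psT psU0 psV0 addr0.
Qed.

(** Squaring is V_2, which commutes with U_p and V_p for odd p. *)
Lemma psT_sqr p f : odd p -> psT p (f ^+ 2) = psT p f ^+ 2.
Proof.
move=> op; have p0 : (0 < p)%N by case: p op.
have -> : psT p f ^+ 2 = psU p f ^+ 2 + psV p f ^+ 2.
  by rewrite /psT sqrrD mulr2n psF2_addrr addr0.
rewrite /psT psVX //; congr (_ + _); rewrite !psF2_sqr; apply: funext => n.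
rewrite /psU /psV Gauss_dvdr ?coprime2n //.
by case: ifP => // /dvdnP[k ->]; rewrite mulnA !mulnK.
Qed.

Lemma theta_odd_coef c n : (0 < c)%N ->
  theta odd c n = [exists u : 'I_n.+1, odd u && (c * (u * u) == n)%N]%:R.
Proof.
move=> c0; rewrite /theta; case: existsP => [[u0 /andP[ou /eqP e]]|nex]; last first.
  rewrite big1 // => u _; case: (boolP (_ && _)) => // h.
  by case: nex; exists u.
rewrite (bigD1 u0) //= ou e eqxx big1 ?addr0 // => u /eqP uu0.
case: (boolP (_ && _)) => // /andP[_ /eqP e']; case: uu0; apply: val_inj => /=.
by move/eqP: (etrans e' (esym e)); rewrite eqn_pmul2l // => /eqP; nia.
Qed.

(** An odd square divisible by p is (p v)^2, so U_p D = V_p D. *)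
Lemma D2_UV p : prime p -> odd p -> psT p D2 = 0.
Proof.
move=> pp op; have p0 := prime_gt0 pp.
have -> : psT p D2 = psU p D2 + theta odd p by rewrite /psT /D2 theta_V // muln1.
have : psU p D2 = theta odd p; last by move=> ->; rewrite psF2_addrr.
apply: funext => n; rewrite /psU /D2 !theta_odd_coef //; congr (nat_of_bool _)%:R.
apply/existsP/existsP => -[u /andP[ou /eqP e]].
  have : (p %| u * u)%N by rewrite mul1n in e; rewrite e dvdn_mulr.
  rewrite Euclid_dvdM // orbb => /dvdnP[v uE].
  have en : (p * (v * v) = n)%N.
    by apply/eqP; rewrite -(eqn_pmul2l p0) -e uE; apply/eqP; lia.
  have vn : (v < n.+1)%N by rewrite ltnS -en; nia.
  by exists (Ordinal vn); rewrite /= en eqxx andbT; move: ou; rewrite uE oddM => /andP[].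
have hu : (p * u < (p * n).+1)%N by rewrite ltnS leq_pmul2l // -ltnS.
by exists (Ordinal hu); rewrite /= oddM op ou /=; apply/eqP; rewrite -[X in (_ = _ * X)%N]e;
  lia.
Qed.

Lemma psU_VX p i g : (0 < p)%N -> psU p (psV p D2 ^+ i * g) = D2 ^+ i * psU p g.
Proof. by move=> p0; rewrite -psVX // psU_VM. Qed.

(** The modular equation is symmetric in D and y = V_3 D. Solved for D^4 it gives the recursion for
    U_3 by the projection formula; solved for y^4 it gives the same recursion for V_3. *)
Lemma psT3_rec k : psT 3 (D2 ^+ (4 + k)) =
  D2 * psT 3 (D2 ^+ (1 + k)) + D2 ^+ 4 * psT 3 (D2 ^+ k).
Proof.
rewrite !exprD expr1; pose y := psV 3 D2.
have e : D2 ^+ 4 = y ^+ 1 * D2 + y ^+ 4.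
  by rewrite expr1 [y * D2]mulrC D2_mod3 -addrA psF2_addrr addr0.
have e' : y ^+ 4 = D2 * y + D2 ^+ 4 by rewrite D2_mod3 addrAC psF2_addrr add0r.
have hU : psU 3 (D2 ^+ 4 * D2 ^+ k) = D2 * psU 3 (D2 * D2 ^+ k) + D2 ^+ 4 * psU 3 (D2 ^+ k).
  by rewrite {1}e mulrDl psUD -mulrA !psU_VX.
have hV : psV 3 (D2 ^+ 4 * D2 ^+ k) = D2 * psV 3 (D2 * D2 ^+ k) + D2 ^+ 4 * psV 3 (D2 ^+ k).
  have aV i : psV 3 (D2 ^+ i * D2 ^+ k) = y ^+ i * psV 3 (D2 ^+ k).
    by rewrite (psVM (D2 ^+ i)) // psVX.
  by rewrite (aV 4) e' (aV 1%N : psV 3 (D2 * D2 ^+ k) = _) expr1 mulrDl mulrA.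
by rewrite /psT hU hV !mulrDr addrACA.
Qed.

Lemma mod5_aux (K : comPzRingType) (x y : K) : (forall z : K, z + z = 0) ->
  (x + y) ^+ 6 = x * y -> x ^+ 6 = y ^+ 2 * x ^+ 4 + y ^+ 4 * x ^+ 2 + y * x + y ^+ 6.
Proof.
move=> K2 e; rewrite [y * x]mulrC -e.
pose J := 3 * x ^+ 5 * y + 8 * x ^+ 4 * y ^+ 2 + 10 * x ^+ 3 * y ^+ 3 + 8 * x ^+ 2 * y ^+ 4 +
  3 * x * y ^+ 5 + y ^+ 6.
by rewrite -[LHS]addr0 -(K2 J) /J; ring.
Qed.

(** As [psT3_rec], with the equation of level 5 expanded by [mod5_aux]. *)
Lemma psT5_rec k : psT 5 (D2 ^+ (6 + k)) = D2 ^+ 2 * psT 5 (D2 ^+ (4 + k)) +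
   D2 ^+ 4 * psT 5 (D2 ^+ (2 + k)) + D2 * psT 5 (D2 ^+ (1 + k)) + D2 ^+ 6 * psT 5 (D2 ^+ k).
Proof.
rewrite !exprD expr1; pose y := psV 5 D2.
have e : D2 ^+ 6 = y ^+ 2 * D2 ^+ 4 + y ^+ 4 * D2 ^+ 2 + y ^+ 1 * D2 + y ^+ 6.
  by rewrite expr1; apply: mod5_aux D2_mod5; apply: psF2_addrr.
have e' : y ^+ 6 = D2 ^+ 2 * y ^+ 4 + D2 ^+ 4 * y ^+ 2 + D2 * y + D2 ^+ 6.
  by apply: mod5_aux; [apply: psF2_addrr|rewrite addrC D2_mod5 mulrC].
have hU : psU 5 (D2 ^+ 6 * D2 ^+ k) = D2 ^+ 2 * psU 5 (D2 ^+ 4 * D2 ^+ k) +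
    D2 ^+ 4 * psU 5 (D2 ^+ 2 * D2 ^+ k) + D2 * psU 5 (D2 * D2 ^+ k) + D2 ^+ 6 * psU 5 (D2 ^+ k).
  have aU i j : psU 5 (y ^+ i * D2 ^+ j * D2 ^+ k) = D2 ^+ i * psU 5 (D2 ^+ j * D2 ^+ k).
    by rewrite -mulrA psU_VX.
  rewrite {1}e !mulrDl !psUD (aU 2 4) (aU 4 2) (aU 1 1 : psU 5 (y ^+ 1 * D2 * D2 ^+ k) = _).
  by rewrite psU_VX.
have hV : psV 5 (D2 ^+ 6 * D2 ^+ k) = D2 ^+ 2 * psV 5 (D2 ^+ 4 * D2 ^+ k) +
    D2 ^+ 4 * psV 5 (D2 ^+ 2 * D2 ^+ k) + D2 * psV 5 (D2 * D2 ^+ k) + D2 ^+ 6 * psV 5 (D2 ^+ k).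
  have aV i : psV 5 (D2 ^+ i * D2 ^+ k) = y ^+ i * psV 5 (D2 ^+ k).
    by rewrite (psVM (D2 ^+ i)) // psVX.
  rewrite (aV 6) e' (aV 4) (aV 2) (aV 1%N : psV 5 (D2 * D2 ^+ k) = _) expr1.
  by rewrite !mulrDl !mulrA.
have aux (K : zmodType) (a b c d a' b' c' d' : K) :
  a + b + c + d + (a' + b' + c' + d') = a + a' + (b + b') + (c + c') + (d + d').
  by rewrite !addrA [a + b + c + d + a']addrAC [a + b + c + a']addrAC [a + b + a']addrAC
    [a + a' + b + c + d + b']addrAC [a + a' + b + c + b']addrAC
    [a + a' + b + b' + c + d + c']addrAC.
by rewrite /psT hU hV !mulrDr aux.
Qed.

Lemma D2X_coef k : (forall n, (n < k)%N -> (D2 ^+ k) n = 0) /\ (D2 ^+ k) k = 1.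
Proof.
elim: k => [|k [IH1 IH2]]; first by split.
split=> [n nk|]; rewrite exprS psM.
  rewrite big1 // => -[[|i] iN] _ /=; first by rewrite D2_0 mul0r.
  by rewrite IH1 ?mulr0 //; lia.
rewrite !big_ord_recl /= D2_0 mul0r add0r /bump /= D2_1 mul1r subn1 /= IH2 big1 ?addr0 // =>
  i _.
by rewrite IH1 ?mulr0 //; have := ltn_ord i; lia.
Qed.

(** A series t with t^2 = D t is 0 or D, and the coefficient of q in T_p (D^p) is that of q^p in
    D^p, which is 1. *)
Lemma psT_id_of_sqr p k : (1 < p)%N -> psT p (D2 ^+ p) ^+ 2 = D2 * psT p (D2 ^+ p) ->
  k = p -> psT p (D2 ^+ k) = D2.
Proof.
move=> p1 e ->; have : psT p (D2 ^+ p) * (psT p (D2 ^+ p) - D2) = 0.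
  by rewrite mulrBr -expr2 e mulrC subrr.
case/ps_mulf_eq0 => [/(congr1 (fun f => f 1%N))|/eqP]; last by rewrite subr_eq0 => /eqP.
rewrite /psT psD /psU /psV muln1 (D2X_coef p).2 ps0.
by case: ifP => [/dvdn_leq|_]; [lia|rewrite addr0 => /eqP; rewrite oner_eq0].
Qed.

Lemma psT_1 p : (1 < p)%N -> psT p 1 = 0.
Proof.
move=> p1; rewrite /psT psV1; last by lia.
have -> : psU p (1 : ps F2) = 1; last by rewrite psF2_addrr.
by apply: funext => n; rewrite /psU !ps1 muln_eq0; case: p p1.
Qed.

Lemma psT3_pow k : psT 3 (D2 ^+ k) = evD (t3 k).
Proof.
have h0 : psT 3 (D2 ^+ 0) = 0 by rewrite expr0 psT_1.
have h1 : psT 3 (D2 ^+ 1) = 0 by rewrite expr1 D2_UV.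
have h2 : psT 3 (D2 ^+ 2) = 0 by rewrite psT_sqr // -[D2]expr1 h1 expr0n.
have h3 : psT 3 (D2 ^+ 3) = D2.
  apply: (@psT_id_of_sqr 3) => //; rewrite -psT_sqr // -exprM (psT3_rec 2) h2 mulr0 addr0 //.
elim/ltn_ind: k => k IH; have [k4|k4] := ltnP k 4.
  case: k k4 {IH} => [|[|[|[|//]]]] _; rewrite ?h0 ?h1 ?h2 ?h3 /t3 ?evD0 //.
  by rewrite evDX.
have -> : k = (4 + (k - 4))%N by lia.
rewrite t3S psT3_rec evDD evDXnM evDXM !IH //; lia.
Qed.

(** The recursion and b(2k) = b(k)^2 determine the initial values: b 6 = 0 gives b 3 = 0, and the
    two expressions of b 10 give the equation for b 5. *)
Lemma psT5_start (x : ps F2) (b : nat -> ps F2) :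
  (forall k, b (6 + k)%N = x ^+ 2 * b (4 + k)%N + x ^+ 4 * b (2 + k)%N +
     x * b (1 + k)%N + x ^+ 6 * b k) ->
  (forall k, b (k * 2)%N = b k ^+ 2) -> b 0%N = 0 -> b 1%N = 0 ->
  [/\ b 2%N = 0, b 3%N = 0, b 4%N = 0 & b 5%N ^+ 2 = x * b 5%N].
Proof.
move=> rec sqr b0 b1.
have b2 : b 2%N = 0 by rewrite (sqr 1%N) b1 expr0n.
have b4 : b 4%N = 0 by rewrite (sqr 2%N) b2 expr0n.
have b6 : b 6%N = 0 by rewrite (rec 0%N) b4 b2 b1 b0 !mulr0 !addr0.
have b3 : b 3%N = 0 by move: b6; rewrite (sqr 3%N) expr2 => /ps_mulf_eq0 [].
have b8 : b 8%N = 0 by rewrite (sqr 4%N) b4 expr0n.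
split=> //; rewrite -(sqr 5%N) (rec 4%N) b8 b6 b4 !mulr0 add0r addr0 add0r //.
Qed.

Lemma psT5_pow k : psT 5 (D2 ^+ k) = evD (t5 k).
Proof.
have h0 : psT 5 (D2 ^+ 0) = 0 by rewrite expr0 psT_1.
have h1 : psT 5 (D2 ^+ 1) = 0 by rewrite expr1 D2_UV.
have sqr j : psT 5 (D2 ^+ (j * 2)) = psT 5 (D2 ^+ j) ^+ 2 by rewrite exprM psT_sqr.
have [h2 h3 h4 h5'] := psT5_start psT5_rec sqr h0 h1.
have h5 : psT 5 (D2 ^+ 5) = D2 by apply: (@psT_id_of_sqr 5).
elim/ltn_ind: k => k IH; have [k6|k6] := ltnP k 6.
  case: k k6 {IH} => [|[|[|[|[|[|//]]]]]] _; rewrite ?h0 ?h1 ?h2 ?h3 ?h4 ?h5 /t5 ?evD0 //.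
  by rewrite evDX.
have -> : k = (6 + (k - 6))%N by lia.
rewrite t5S psT5_rec !evDD !evDXnM evDXM !IH //; lia.
Qed.

Lemma psT3_evD P : psT 3 (evD P) = evD (linext t3 P).
Proof.
rewrite evDE psT_sum /linext evD_sum; apply: eq_bigr => k _.
by rewrite psTC psT3_pow evDZ.
Qed.

Lemma psT5_evD P : psT 5 (evD P) = evD (linext t5 P).
Proof.
rewrite evDE psT_sum /linext evD_sum; apply: eq_bigr => k _.
by rewrite psTC psT5_pow evDZ.
Qed.

Lemma psU2_pow k : psU 2 (D2 ^+ k) = if odd k then 0 else D2 ^+ k./2.
Proof.
have U2D : psU 2 D2 = 0.
  apply: funext => n; rewrite /psU /D2 /theta big1 // => u _.
  have -> : (odd u && (1 * (u * u) == 2 * n))%N = false; last by [].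
  by apply/negP => /andP[ou /eqP]; rewrite mul1n => /(congr1 odd); rewrite oddM ou oddM.
rewrite -{1}(odd_double_half k) exprD -mul2n mulnC exprM psF2_sqr mulrC.
rewrite psU_VM //; case: (odd k); rewrite ?expr1 ?U2D ?mulr0 // expr0.
have -> : psU 2 (1 : ps F2) = 1; last by rewrite mulr1.
by apply: funext => n; rewrite /psU !ps1 muln_eq0.
Qed.

Lemma psU_sum p (I : Type) (r : seq I) (F : I -> ps F2) :
  psU p (\sum_(i <- r) F i) = \sum_(i <- r) psU p (F i).
Proof. by elim/big_rec2: _ => [|i x y _ <-]. Qed.

Lemma psU2_evD P : psU 2 (evD P) = evD (t2 P).
Proof.
rewrite evDE psU_sum.
have -> : evD (t2 P) = \sum_(k < size P) psC P`_(2 * k) * D2 ^+ k.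
  by rewrite /t2 poly_def evD_sum; apply: eq_bigr => k _; rewrite evDZ evDXn.
rewrite -(big_mkord xpredT (fun k => psC P`_(2 * k)%N * D2 ^+ k)).
rewrite -(big_mkord xpredT (fun k => psU 2 (psC P`_k * D2 ^+ k))).
have -> : \sum_(0 <= k < size P) psU 2 (psC P`_k * D2 ^+ k) =
  \sum_(0 <= k < (2 * size P)%N) psU 2 (psC P`_k * D2 ^+ k).
  rewrite [RHS](big_cat_nat (n := size P)) //=; last by lia.
  rewrite [X in _ = _ + X]big_nat [X in _ = _ + X]big1 ?addr0 // => k /andP[Pk _].
  by rewrite nth_default // rmorph0 mul0r.
elim: (size P) => [|N IH]; first by rewrite muln0 !big_geq.
rewrite mulnS !big_nat_recr //= IH -addrA; congr (_ + _).
rewrite !psUC !psU2_pow /= oddM /= mulr0 addr0; congr (_ * _ ^+ _); lia.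
Qed.

(** * Uniform divisibility modulo powers of 2 *)

(** A partial function on a finite type is bounded. This is where C(m) loses any explicit form. *)
Lemma fin_uniform_bound (T : finType) (Pr : T -> nat -> Prop) :
  (forall t n n', Pr t n -> Pr t n' -> n = n') ->
  exists B, forall t n, Pr t n -> (n <= B)%N.
Proof.
move=> Pu; have /choice [F FP] t : exists B, forall n, Pr t n -> (n <= B)%N.
  have [[n Pn]|nex] := pselect (exists n, Pr t n).
    by exists n => n' Pn'; rewrite (Pu _ _ _ Pn Pn').
  by exists 0%N => n Pn; case: nex; exists n.
exists (\max_t F t) => t n /FP h.
by rewrite (leq_trans h) // (leq_bigmax (F := F)).
Qed.

Definition pscong (M : nat) (f g : ps int) := exists h, f = g + M%:R * h.

Lemma pscong_refl M f : pscong M f f.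
Proof. by exists 0; rewrite mulr0 addr0. Qed.

Lemma pscong_trans M f g h : pscong M f g -> pscong M g h -> pscong M f h.
Proof. by move=> [a ->] [b ->]; exists (a + b); rewrite mulrDr -addrA [M%:R * a + _]addrC. Qed.

Lemma pscong_sym M f g : pscong M f g -> pscong M g f.
Proof. by move=> [a ->]; exists (- a); rewrite mulrN addrK. Qed.

Lemma pscongD M f g f' g' : pscong M f g -> pscong M f' g' -> pscong M (f + f') (g + g').
Proof. by move=> [a ->] [b ->]; exists (a + b); rewrite mulrDr addrACA. Qed.

Lemma pscongM M f g f' g' : pscong M f g -> pscong M f' g' -> pscong M (f * f') (g * g').
Proof.
move=> [a ->] [b ->]; exists (a * g' + g * b + M%:R * a * b); ring.
Qed.

Lemma pscongX M f g n : pscong M f g -> pscong M (f ^+ n) (g ^+ n).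
Proof.
move=> h; elim: n => [|n IH]; first exact: pscong_refl.
by rewrite !exprS; apply: pscongM.
Qed.

Lemma pscong_sum M (I : Type) (r : seq I) (F G : I -> ps int) :
  (forall i, pscong M (F i) (G i)) -> pscong M (\sum_(i <- r) F i) (\sum_(i <- r) G i).
Proof.
move=> h; elim: r => [|i r IH]; first by rewrite !big_nil; apply: pscong_refl.
by rewrite !big_cons; apply: pscongD.
Qed.

Lemma pscong_int (M : nat) (x y : int) : (x = y %[mod M])%Z -> pscong M x%:~R y%:~R.
Proof.
move=> e; exists ((x %/ M)%Z - (y %/ M)%Z)%:~R.
rewrite -[M%:R](rmorph_nat intr) -rmorphM -rmorphD /= natz.
by rewrite {1}(divz_eq x M) {1}(divz_eq y M) e; congr _%:~R; ring.
Qed.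

Lemma pscong_dvd M M' f g : (M %| M')%N -> pscong M' f g -> pscong M f g.
Proof. by move=> /dvdnP[k ->] [h ->]; exists (k%:R * h); rewrite mulnC natrM mulrA. Qed.

(** 240 = 16 * 15, and each squaring of 1 + 2^n h gains a factor 2. *)
Lemma Qform_pow2 i : pscong (2 ^ (4 + i)) ((Qform : ps int) ^+ (2 ^ i)) 1.
Proof.
elim: i => [|i [h IH]].
  exists (15 * divsum 3); rewrite expn0 expr1 QformE mulrA -natrM.
  by congr (_ + _ * _).
exists (h + (2 ^ (3 + i))%:R * h ^+ 2).
rewrite expnS mulnC exprM IH !addnS !expnS !natrM; ring.
Qed.

(** For m <= 4 the truncated subtraction gives 2^0 = 1, and all exponents are congruent. *)
Lemma Qform_period m a b : (a = b %[mod 2 ^ (m - 4)])%N ->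
  pscong (2 ^ m) ((Qform : ps int) ^+ a) ((Qform : ps int) ^+ b).
Proof.
have key a' : pscong (2 ^ m) ((Qform : ps int) ^+ a') ((Qform : ps int) ^+ (a' %% 2 ^ (m - 4))).
  rewrite {1}(divn_eq a' (2 ^ (m - 4))) exprD mulnC exprM -[X in pscong _ _ X]mul1r.
  apply: pscongM; last exact: pscong_refl.
  rewrite -[X in pscong _ _ X](expr1n _ (a' %/ 2 ^ (m - 4))); apply: pscongX.
  apply: pscong_dvd (Qform_pow2 (m - 4)); apply: dvdn_exp2l; lia.
by move=> e; apply: pscong_trans (key a) _; rewrite e; apply: pscong_sym.
Qed.

Lemma redF2_cong M f g : (2 %| M)%N -> pscong M f g -> redF2 f = redF2 g.
Proof.
move=> /dvdnP[k ->] [h ->]; rewrite redF2D redF2M redF2_nat natrM.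
by rewrite (psF2_nat 2) /= mulr0 mul0r addr0.
Qed.

Lemma redF2_int (x : int) : redF2 x%:~R = x%:~R.
Proof. exact: (rmorph_int (psmap (intr : {rmorphism int -> F2}))). Qed.

Lemma redF2_Q : redF2 (Qform : ps int) = 1.
Proof.
rewrite (@redF2_cong 16 _ 1) //; first exact: (redF2_nat 1).
by have := Qform_pow2 0; rewrite expr1.
Qed.

Lemma Rform_cong : pscong 8 (Rform : ps int) 1.
Proof.
exists (- (63 * divsum 5)); rewrite RformE mulrN mulrA -natrM.
by congr (_ - _ * _).
Qed.

Lemma redF2_R : redF2 (Rform : ps int) = 1.
Proof. by rewrite (@redF2_cong 8 _ 1) //; [exact: (redF2_nat 1)|exact: Rform_cong]. Qed.

Lemma redF2_U p f : redF2 (psU p f) = psU p (redF2 f). Proof. by []. Qed.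

Lemma redF2_V p f : redF2 (psV p f) = psV p (redF2 f).
Proof. by apply: funext => n; rewrite /redF2 /psmap /psV; case: ifP. Qed.

Definition monom (eps : bool) (a c : nat) : ps int :=
  (Rform : ps int) ^+ eps * (Qform : ps int) ^+ a * (Delta : ps int) ^+ c.

Lemma redF2_monom eps a c : redF2 (monom eps a c) = D2 ^+ c.
Proof. by rewrite /monom !redF2M !redF2X redF2_Q redF2_R Delta_mod2 !expr1n !mul1r. Qed.

(** T_p - l, with p^(weight - 1) replaced by a free integer k: only its residue modulo 2^m will
    matter. *)
Definition heckeop (p : nat) (k l : int) (f : ps int) : ps int :=
  psU p f + k%:~R * psV p f - l%:~R * f.

Lemma heckeopD p k l f g : heckeop p k l (f + g) = heckeop p k l f + heckeop p k l g.
Proof. rewrite /heckeop psVD psUD; ring. Qed.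

Lemma psV_natM p n (f : ps int) : psV p (n%:R * f) = n%:R * psV p f.
Proof. by apply: funext => i; rewrite psMnl /psV psMnl; case: ifP; rewrite ?mulr0. Qed.

Lemma heckeopMn p k l n f : heckeop p k l (n%:R * f) = n%:R * heckeop p k l f.
Proof.
rewrite /heckeop psV_natM.
have -> : psU p (n%:R * f) = n%:R * psU p f by apply: funext => i; rewrite psMnl /psU psMnl.
ring.
Qed.

Lemma heckeop_cong M p k l k' l' f g : pscong M f g -> (k = k' %[mod M])%Z ->
  (l = l' %[mod M])%Z ->
  pscong M (heckeop p k l f) (heckeop p k' l' g).
Proof.
move=> fg kk ll; apply: (@pscong_trans _ _ (heckeop p k l g)).
  case: fg => h ->; exists (heckeop p k l h).
  by rewrite heckeopD heckeopMn.
have /pscong_sym [a ea] := pscong_int ll; have [b eb] := pscong_int kk.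
exists (b * psV p g + a * g); rewrite /heckeop eb ea; ring.
Qed.

Definition hecke_ok (p : nat) (k : int) (lin : {poly F2} -> {poly F2}) :=
  forall (l : int) f P, redF2 f = evD P ->
    redF2 (heckeop p k l f) = evD (lin P - (l%:~R : F2) *: P).

Lemma hecke_ok_aux p k l f P Q : psU p (evD P) + k%:~R * psV p (evD P) = evD Q ->
  redF2 f = evD P -> redF2 (heckeop p k l f) = evD (Q - (l%:~R : F2) *: P).
Proof.
move=> h fP; rewrite /heckeop !redF2D redF2N !redF2M !redF2_int redF2_U redF2_V fP h.
by rewrite -scaleNr evDD evDZ rmorphN rmorph_int mulNr.
Qed.

Lemma oddzE (k : int) : ~~ (2 %| k)%Z -> exists b, k = b * 2 + 1.
Proof.
move=> k2; exists (k %/ 2)%Z; rewrite {1}(divz_eq k 2); congr (_ + _).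
by have := modz_ge0 k (isT : (2 : int) != 0); have := ltz_pmod k (isT : (0 : int) < 2);
  move: k2; rewrite dvdzE; lia.
Qed.

Lemma psF2_odd (k : int) : ~~ (2 %| k)%Z -> k%:~R = 1 :> ps F2.
Proof.
move=> /oddzE[b ->].
rewrite intrD intrM (_ : (2 : int)%:~R = 2%:R) // (psF2_nat 2).
by rewrite mulr0 add0r.
Qed.

Lemma psF2_even (k : int) : (2 %| k)%Z -> k%:~R = 0 :> ps F2.
Proof. by move=> /dvdzP[b ->]; rewrite intrM (_ : (2 : int)%:~R =
  2%:R) // (psF2_nat 2) mulr0. Qed.

Lemma hecke_ok2 k : (2 %| k)%Z -> hecke_ok 2 k t2.
Proof.
by move=> k2 l f P; apply: hecke_ok_aux; rewrite psF2_even // mul0r addr0 psU2_evD.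
Qed.

Lemma hecke_ok3 k : ~~ (2 %| k)%Z -> hecke_ok 3 k (linext t3).
Proof.
by move=> k2 l f P; apply: hecke_ok_aux; rewrite psF2_odd // mul1r; apply: psT3_evD.
Qed.

Lemma hecke_ok5 k : ~~ (2 %| k)%Z -> hecke_ok 5 k (linext t5).
Proof.
by move=> k2 l f P; apply: hecke_ok_aux; rewrite psF2_odd // mul1r; apply: psT5_evD.
Qed.

Definition expansion (eps : bool) (N : nat) (x : nat -> int) (al : nat -> nat) : ps int :=
  \sum_(0 <= c < N) (x c)%:~R * monom eps (al c) c.

Lemma modzE2 (m : nat) (x : int) : exists i : 'I_(2 ^ m), (x = (val i)%:Z %[mod (2 ^ m)%N])%Z.
Proof.
have M0 : ((2 ^ m)%N : int) != 0 by rewrite eqz_nat -lt0n expn_gt0.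
have h0 := modz_ge0 x M0.
have h1 : (x %% (2 ^ m)%N)%Z < (2 ^ m)%N by apply: ltz_pmod; rewrite ltz_nat expn_gt0.
have h2 : (`|(x %% (2 ^ m)%N)%Z| < 2 ^ m)%N by rewrite -ltz_nat gez0_abs.
by exists (Ordinal h2); rewrite /= gez0_abs // modz_mod.
Qed.

(** The parity condition is that of p^(w-1) for prime p and w >= 2; modulo 2 it leaves U_2 for p = 2
    and U_p + V_p otherwise. *)
Definition hecke_zero (m p : nat) (f : ps int) := exists k l : int,
  ((2 %| k)%Z = (p == 2%N)) /\ pscong (2 ^ m) (heckeop p k l f) 0.

Lemma expansion_split eps N D j x y al : (D <= N)%N ->
  (forall c, (D <= c < N)%N -> x c = (2 ^ j)%:R * y c) ->
  expansion eps N x al = expansion eps D x al +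
    (2 ^ j)%:R * \sum_(D <= c < N) (y c)%:~R * monom eps (al c) c.
Proof.
move=> DN xy; rewrite /expansion (big_cat_nat _ DN) //=; congr (_ + _).
rewrite mulr_sumr; apply: eq_big_nat => c cN.
by rewrite xy // intrM mulrA (rmorph_nat intr).
Qed.

Lemma redF2_tail eps D N y al :
  redF2 (\sum_(D <= c < N) (y c)%:~R * monom eps (al c) c) =
  evD (\sum_(D <= c < N) ((y c)%:~R : F2) *: 'X^c).
Proof.
have rsum (r : seq nat) F : redF2 (\sum_(i <- r) F i) = \sum_(i <- r) redF2 (F i).
  elim: r => [|i r IH]; first by rewrite !big_nil (redF2_nat 0).
  by rewrite !big_cons redF2D IH.
rewrite rsum evD_sum.
apply: eq_bigr => c _; rewrite evDZ evDXn rmorph_int.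
by rewrite redF2M redF2_int redF2_monom.
Qed.

Lemma coef_tail D N (y : nat -> int) c : (D <= c < N)%N ->
  (\sum_(D <= i < N) ((y i)%:~R : F2) *: 'X^i)`_c = (y c)%:~R.
Proof.
move=> cN; rewrite coef_sum big_mkcond /= (bigD1_seq c) ?mem_index_iota ?iota_uniq //=.
rewrite coefZ coefXn eqxx mulr1 big1 ?addr0 // => i /negPf ic.
by rewrite coefZ coefXn eq_sym ic mulr0.
Qed.

(* The part of the expansion above a given exponent of Delta is 2^j times a
   series [f], which modulo 2 is a polynomial [P] in D; the low part [h] then
   determines the image of [P] under the Hecke operator modulo 2. *)
Definition tail_size j p k l (h : ps int) (lin : {poly F2} -> {poly F2}) (n : nat) :=
  hecke_ok p k lin /\ exists f P, [/\ redF2 f = evD P,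
    pscong (2 ^ j.+1) ((2 ^ j)%:R * heckeop p k l f + heckeop p k l h) 0
    & n = size (lin P - (l%:~R : F2) *: P)].

(** For the same h, 2^j times the difference of the two images is 0 modulo 2^(j+1), so the images
    agree modulo 2; [evD_inj] passes to polynomials. *)
Lemma tail_size_unique j p k l h lin n n' :
  tail_size j p k l h lin n -> tail_size j p k l h lin n' -> n = n'.
Proof.
move=> [ok [f [P [fP [a ea] ->]]]] [_ [f' [P' [fP' [a' ea'] ->]]]].
have e : heckeop p k l f = heckeop p k l f' + 2%:R * (a - a').
  apply: (@ps_natI (2 ^ j)); first by rewrite expn_gt0.
  move: ea ea'; rewrite !add0r expnS natrM; set u := heckeop p k l f.
  set u' := heckeop p k l f'; set v := heckeop p k l h; move: u u' v (2 ^ j)%:R.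
  clear; move=> u u' v w e e'.
  have -> : w * u = (w * u + v) - v by ring.
  rewrite e; have -> : v = 2 * w * a' - w * u' by rewrite -e'; ring.
  ring.
apply: (congr1 (fun p : {poly F2} => size p)); apply/eqP; rewrite -subr_eq0; apply/eqP;
  apply: evD_inj.
set A := lin P - _; set B := lin P' - _; apply: (@addIr _ (evD B)).
rewrite -evDD subrK add0r /A /B -(ok l _ _ fP) -(ok l _ _ fP') e redF2D redF2M redF2_nat
  (psF2_nat 2).
by rewrite mul0r addr0.
Qed.

Lemma expansion_cong eps N m x y al be :
  (forall c, (c < N)%N -> (x c = y c %[mod (2 ^ m)%N])%Z /\ (al c = be c %[mod 2 ^ m])%N) ->
  pscong (2 ^ m) (expansion eps N x al) (expansion eps N y be).
Proof.
move=> h; rewrite /expansion !big_mkord; apply: pscong_sum => c.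
have [h1 h2] := h c (ltn_ord c); apply: pscongM; first exact: pscong_int.
apply: pscongM; last exact: pscong_refl; apply: pscongM; first exact: pscong_refl.
apply: Qform_period.
have d : (2 ^ (m - 4) %| 2 ^ m)%N by apply: dvdn_exp2l; lia.
by rewrite -(modn_dvdm _ d) h2 modn_dvdm.
Qed.

(* The low part matters only through finitely many residues modulo 2^m: its
   coefficients, the exponents of Q, and the parameters of the operator. *)
Lemma tail_size_bound (m j p D : nat) lin : (0 < m)%N -> (j < m)%N ->
  (forall k : int, (2 %| k)%Z = (p == 2%N) -> hecke_ok p k lin) ->
  exists B, forall eps N x y al, (D <= N)%N ->
    (forall c, (D <= c < N)%N -> x c = (2 ^ j)%:R * y c) ->
    hecke_zero m p (expansion eps N x al) ->
    let P := \sum_(D <= i < N) ((y i)%:~R : F2) *: 'X^i in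
    exists l : F2, (size (lin P - l *: P)%R <= B)%N.
Proof.
move=> m0 jm ok.
pose T : finType := (bool * {ffun 'I_D -> 'I_(2 ^ m)} * {ffun 'I_D -> 'I_(2 ^ m)}
  * 'I_(2 ^ m) * 'I_(2 ^ m))%type.
pose gx (u : {ffun 'I_D -> 'I_(2 ^ m)}) (c : nat) : nat :=
  if insub c is Some i then val (u i) else 0%N.
pose hh (t : T) := expansion t.1.1.1.1 D (fun c => (gx t.1.1.1.2 c)%:Z) (gx t.1.1.2).
pose kk (t : T) := (val t.1.2)%:Z; pose ll (t : T) := (val t.2)%:Z.
have [B hB] := @fin_uniform_bound T (fun t => tail_size j p (kk t) (ll t) (hh t) lin)
  (fun t n n' => @tail_size_unique j p (kk t) (ll t) (hh t) lin n n').
exists B => eps N x y al DN xy [k [l [kp hz]]] P.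
have [k' ek] := modzE2 m k; have [l' el] := modzE2 m l.
have /choice [u uP] c := modzE2 m (x c).
have M0 : (0 < 2 ^ m)%N by rewrite expn_gt0.
pose t : T := (eps, [ffun c : 'I_D => u c], [ffun c : 'I_D =>
  Ordinal (ltn_pmod (al c) M0)], k', l').
exists ((ll t)%:~R); apply: (hB t); split.
  apply: ok; rewrite -kp /kk /=.
  (* The residue k' has the parity of k because 2^m is even. *)
  have [b eb] : exists b : int, k = (val k')%:Z + b * 2.
    exists (((k %/ (2 ^ m)%N)%Z - (k'%:Z %/ (2 ^ m)%N)%Z) * (2 ^ m.-1)%N).
    have e2 : (2 ^ m)%N%:Z = (2 ^ m.-1)%N%:Z * 2 by rewrite -{1}(prednK m0) expnSr.
    rewrite -mulrA -e2 {1}(divz_eq k (2 ^ m)%N) ek {2}(divz_eq (val k')%:Z (2 ^ m)%N); ring.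
  rewrite eb; apply/dvdzP/dvdzP => -[q eq].
    by exists (q + b); rewrite eq; ring.
  by exists (q - b); rewrite mulrBl -eq; ring.
exists (\sum_(D <= c < N) (y c)%:~R * monom eps (al c) c), P; split => //.
  exact: redF2_tail.
apply: (@pscong_dvd _ (2 ^ m)); first exact: dvdn_exp2l.
apply: pscong_trans hz; rewrite (expansion_split eps al DN xy) heckeopD addrC heckeopMn.
apply: pscongD; last first.
  apply: pscongM; first exact: pscong_refl.
  by apply: heckeop_cong; [exact: pscong_refl| |]; symmetry.
apply: heckeop_cong; [|by symmetry|by symmetry].
apply: expansion_cong => c cD; rewrite /gx /= insubT /= !ffunE /=; split; first by rewrite uP.
by rewrite modn_mod.
Qed.

Lemma uniform_divisibility m j : (0 < m)%N -> (j <= m)%N -> exists D,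
  forall eps N x al, hecke_zero m 2 (expansion eps N x al) ->
    hecke_zero m 3 (expansion eps N x al) -> hecke_zero m 5 (expansion eps N x al) ->
  forall c, (D <= c < N)%N -> ((2 ^ j)%:R %| x c)%Z.
Proof.
move=> m0; elim: j => [|j IH] jm.
  by exists 0%N => eps N x al _ _ _ c _; rewrite expn0 dvd1z.
have [D hD] := IH (ltnW jm).
have [B2 h2] := @tail_size_bound m j 2 D t2 m0 jm (fun k h => hecke_ok2 (etrans h erefl)).
have ok3 (k : int) : (2 %| k)%Z = (3 == 2)%N -> hecke_ok 3 k (linext t3).
  by move=> h; apply: hecke_ok3; rewrite h.
have ok5 (k : int) : (2 %| k)%Z = (5 == 2)%N -> hecke_ok 5 k (linext t5).
  by move=> h; apply: hecke_ok5; rewrite h.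
have [B3 h3] := tail_size_bound D m0 jm ok3; have [B5 h5] := tail_size_bound D m0 jm ok5.
have [B hB] := hecke_degree_bound (maxn B2 (maxn B3 B5)).
exists (maxn D B) => eps N x al z2 z3 z5 c; rewrite geq_max => /andP[/andP[Dc Bc] cN].
have DN : (D <= N)%N by lia.
pose y c := (x c %/ (2 ^ j)%:R)%Z.
have xy c' : (D <= c' < N)%N -> x c' = (2 ^ j)%:R * y c'.
  by move=> h; rewrite mulrC /y divzK //; apply: (hD eps N x al).
set P := \sum_(D <= i < N) ((y i)%:~R : F2) *: 'X^i.
have [l2 s2] := h2 _ _ _ _ _ DN xy z2; have [l3 s3] := h3 _ _ _ _ _ DN xy z3.
have [l5 s5] := h5 _ _ _ _ _ DN xy z5.
have sP : (size P <= B)%N.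
  apply: (hB _ l2 l3 l5); [apply: leq_trans s2 _|apply: leq_trans s3 _|apply: leq_trans s5 _].
  - by rewrite leq_maxl.
  - by rewrite !leq_max leqnn orbT.
  - by rewrite !leq_max leqnn !orbT.
(* The reduction of y c is a coefficient of P in degree c >= B, beyond the size of P. *)
have yc : (2 %| y c)%Z.
  have : P`_c = 0 by rewrite nth_default // (leq_trans sP).
  rewrite coef_tail ?Dc //; case: (boolP (2 %| y c)%Z) => // /oddzE[b ->].
  rewrite intrD intrM (_ : (2 : int)%:~R = 0 :> F2); last exact: val_inj.
  by rewrite mulr0 add0r.
rewrite xy ?Dc // expnS mulnC natrM; exact: dvdz_mul.
Qed.

(** * Limits and q-expansions over the complex numbers *)

(** The modulus with values in R; the norm of [Cplx R] takes its values in R[i]. *)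
Definition nm (R : realType) (z : Cplx R) : R := ComplexField.Normc.normc z.

Lemma nm_def (R : realType) (z : Cplx R) : nm z =
  Num.sqrt (complex.Re z ^+ 2 + complex.Im z ^+ 2).
Proof. by case: z. Qed.

Lemma nm_ge0 (R : realType) (z : Cplx R) : 0 <= nm z.
Proof. by rewrite nm_def sqrtr_ge0. Qed.

Lemma normE (R : realType) (z : Cplx R) : `|z| = (nm z)%:C%C :> R[i].
Proof. by []. Qed.

Lemma nm_sqr (R : realType) (z : Cplx R) : nm z ^+ 2 = complex.Re z ^+ 2 + complex.Im z ^+ 2.
Proof. by rewrite nm_def sqr_sqrtr // addr_ge0 ?sqr_ge0. Qed.

Lemma nmM (R : realType) (z w : Cplx R) : nm (z * w) = nm z * nm w.
Proof. exact: ComplexField.Normc.normcM. Qed.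

Lemma nmV (R : realType) (z : Cplx R) : nm z^-1 = (nm z)^-1.
Proof. exact: ComplexField.Normc.normcV. Qed.

Lemma nm0 (R : realType) : nm (0 : Cplx R) = 0.
Proof. exact: ComplexField.Normc.normc0. Qed.

Lemma nm1 (R : realType) : nm (1 : Cplx R) = 1.
Proof. exact: ComplexField.Normc.normc1. Qed.

Lemma nm_eq0 (R : realType) (z : Cplx R) : (nm z == 0) = (z == 0).
Proof.
apply/eqP/eqP => [|->]; [exact: ComplexField.Normc.eq0_normc|exact: nm0].
Qed.

Lemma nm_gt0 (R : realType) (z : Cplx R) : (0 < nm z) = (z != 0).
Proof. by rewrite lt0r nm_ge0 andbT nm_eq0. Qed.

Lemma nmD (R : realType) (z w : Cplx R) : nm (z + w) <= nm z + nm w.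
Proof. by have := ler_normD (z : R[i]) w; rewrite !normE lecE => /andP[_]. Qed.

Lemma nmN (R : realType) (z : Cplx R) : nm (- z) = nm z.
Proof. by case: z => a b; rewrite !nm_def /= !sqrrN. Qed.

Lemma nm_sym (R : realType) (z w : Cplx R) : nm (z - w) = nm (w - z).
Proof. by rewrite -nmN opprB. Qed.

Lemma nmX (R : realType) (z : Cplx R) n : nm (z ^+ n) = nm z ^+ n.
Proof. by elim: n => [|n IH]; rewrite ?expr0 ?nm1 // !exprS nmM IH. Qed.

Lemma nm_sum (R : realType) (I : Type) (r : seq I) (P : pred I) (F : I -> Cplx R) :
  nm (\sum_(i <- r | P i) F i) <= \sum_(i <- r | P i) nm (F i).
Proof.
elim/big_rec2: _ => [|i y x _ h]; first by rewrite nm0.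
by apply: le_trans (nmD _ _) _; rewrite lerD2l.
Qed.

Lemma nm_real (R : realType) (x : R) : nm (x%:C%C : Cplx R) = `|x|.
Proof. by rewrite nm_def /= expr0n /= addr0 sqrtr_sqr. Qed.

Lemma nm_int (R : realType) (n : int) : nm (n%:~R : Cplx R) = `|n%:~R|.
Proof. by rewrite -nm_real (rmorph_int (real_complex R)). Qed.

Lemma nm_nat (R : realType) (n : nat) : nm (n%:R : Cplx R) = n%:R.
Proof. by rewrite -[n%:R]/(n%:Z%:~R) nm_int ger0_norm // ler0n. Qed.

Lemma nm_Re (R : realType) (z : Cplx R) : `|complex.Re z| <= nm z.
Proof. by rewrite -sqrtr_sqr nm_def ler_wsqrtr // lerDl sqr_ge0. Qed.

Lemma nm_Im (R : realType) (z : Cplx R) : `|complex.Im z| <= nm z.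
Proof. by rewrite -sqrtr_sqr nm_def ler_wsqrtr // lerDr sqr_ge0. Qed.

Lemma nm_le (R : realType) (z : Cplx R) : nm z <= `|complex.Re z| + `|complex.Im z|.
Proof.
rewrite -(@ler_pXn2r _ 2) ?nnegrE ?nm_ge0 ?addr_ge0 // nm_sqr sqrrD.
rewrite -[complex.Re z ^+ 2](real_normK (num_real _)) -[complex.Im z ^+ 2](real_normK
  (num_real _)).
have : 0 <= `|complex.Re z| * `|complex.Im z| by rewrite mulr_ge0.
lra.
Qed.

Lemma nmB_ge (R : realType) (z w : Cplx R) : nm z - nm w <= nm (z - w).
Proof. by rewrite lerBlDr; have := nmD (z - w) w; rewrite subrK. Qed.

Definition lim_to (R : realType) (u : nat -> Cplx R) (l : Cplx R) :=
  forall e : R, 0 < e -> exists N, forall n, (N <= n)%N -> nm (u n - l) < e.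

Lemma cvg_lim_to (R : realType) (u : nat -> Cplx R) (l : Cplx R) :
  u @ \oo --> l <-> lim_to u l.
Proof.
split=> [/cvgrPdist_lt h e e0|h].
  have /h [N _ hN] : 0 < (e%:C%C : Cplx R) by rewrite ltcE /= eqxx.
  by exists N => n /hN; rewrite normE nm_sym ltcE /= eqxx.
apply/cvgrPdist_lt => e e0.
move: (e0); rewrite ltcE /= => /andP[/eqP ime /h [N hN]].
exists N => // n /= /hN; rewrite normE nm_sym ltcE /= => ->.
by rewrite ime eqxx.
Qed.

(** One-sided: these sequences serve as upper bounds of moduli. *)
Definition null (R : realType) (b : nat -> R) :=
  forall e, 0 < e -> exists N, forall n, (N <= n)%N -> b n < e.

Lemma null_le (R : realType) (a b : nat -> R) N : null b ->
  (forall n, (N <= n)%N -> a n <= b n) -> null a.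
Proof.
move=> hb ab e /hb [M hM]; exists (maxn M N) => n; rewrite geq_max => /andP[Mn Nn].
exact: le_lt_trans (ab _ Nn) (hM _ Mn).
Qed.

Lemma nullD (R : realType) (a b : nat -> R) : null a -> null b -> null (fun n => a n + b n).
Proof.
move=> ha hb e e0; have e2 : 0 < e / 2 by lra.
have [[N hN] [M hM]] := (ha _ e2, hb _ e2).
exists (maxn N M) => n; rewrite geq_max => /andP[/hN h1 /hM h2]; lra.
Qed.

Lemma nullZ (R : realType) (c : R) (b : nat -> R) : 0 <= c -> null b -> null (fun n => c * b n).
Proof.
move=> c0 hb e e0; have [N hN] := hb (e / (c + 1)) ltac:(by rewrite divr_gt0 // ltr_wpDl).
exists N => n /hN; rewrite ltr_pdivlMr ?ltr_wpDl // => h.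
have [b0|b0] := leP 0 (b n); first by apply: le_lt_trans h; nra.
by apply: le_lt_trans e0; rewrite mulr_ge0_le0 // ltW.
Qed.

Lemma null_comp (R : realType) (b : nat -> R) (s : nat -> nat) :
  (forall n, (n <= s n)%N) -> null b -> null (fun n => b (s n)).
Proof. by move=> hs hb e /hb [N hN]; exists N => n Nn; apply: hN; apply: leq_trans (hs n). Qed.

Lemma null_inv (R : realType) : null (fun n => (n.+1%:R)^-1 : R).
Proof.
move=> e e0; exists (Num.Def.archi_bound e^-1) => n hn.
have ie : 0 < e^-1 by rewrite invr_gt0.
rewrite invf_plt ?posrE // ?ltr0Sn //.
apply: lt_le_trans (archi_boundP (ltW ie)) _; rewrite ler_nat; exact: leq_trans hn _.
Qed.

(** Bernoulli's inequality for 1/t. *)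
Lemma natX_bound (R : realType) (t : R) n : 0 < t -> t < 1 -> n%:R * t ^+ n <= (1 - t)^-1.
Proof.
move=> t0 t1; have h : n%:R * (1 - t) <= (t ^+ n)^-1.
  have d0 : 0 <= t^-1 - 1 by rewrite subr_ge0 invf_ge1 // ltW.
  have hb : 1 + n%:R * (t^-1 - 1) <= t ^- n.
    elim: n => [|n IH]; first by rewrite mul0r addr0 expr0 invr1.
    rewrite exprS invfM; apply: le_trans (_ : t^-1 * (1 + n%:R * (t^-1 - 1)) <= _); last first.
      by rewrite ler_wpM2l // invr_ge0 ltW.
    rewrite -addn1 natrD; have n0 : (0 : R) <= n%:R by rewrite ler0n.
      move: (t^-1) (n%:R : R) d0 n0 => x y x1 y0.
    have : 0 <= y * (x - 1) ^+ 2 by rewrite mulr_ge0 ?sqr_ge0.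
    lra.
  apply: le_trans hb; have : 1 - t <= t^-1 - 1.
    have : t * (t^-1 - 1) = 1 - t by rewrite mulrBr mulfV ?gt_eqF // mulr1.
    have : 0 <= (1 - t) * (t^-1 - 1) by rewrite mulr_ge0 // subr_ge0 ltW.
    lra.
  have n0 : (0 : R) <= n%:R by rewrite ler0n.
  move: (t^-1) (n%:R : R) n0 => x y y0 h.
  have : 0 <= y * (x - 1 - (1 - t)) by rewrite mulr_ge0 // subr_ge0.
  lra.
have tn : 0 < t ^+ n by rewrite exprn_gt0.
rewrite -[leRHS]mul1r ler_pdivlMr ?subr_gt0 //.
have := ler_wpM2r (ltW tn) h; rewrite mulVf ?gt_eqF //; lra.
Qed.

Lemma null_geom (R : realType) (t : R) : 0 < t -> t < 1 -> null (fun n => t ^+ n).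
Proof.
move=> t0 t1; apply: (@null_le _ _ (fun n => 2 * (1 - t)^-1 * (n.+1%:R)^-1) 1); last first.
  move=> n n0; rewrite ler_pdivlMr ?ltr0n //.
  have := natX_bound n t0 t1; have : t ^+ n * n.+1%:R <= 2 * (n%:R * t ^+ n).
    have : (n.+1%:R : R) <= 2 * n%:R by rewrite -natrM ler_nat; lia.
    have : 0 < t ^+ n by rewrite exprn_gt0.
    move: (n.+1%:R : R) (n%:R : R) (t ^+ n) => a b c c0 ab.
    have : 0 <= c * (2 * b - a) by apply: mulr_ge0; [exact: ltW|rewrite subr_ge0].
    lra.
  lra.
apply: nullZ; last exact: null_inv.
by rewrite mulr_ge0 // invr_ge0 subr_ge0 ltW.
Qed.

Lemma null_le0 (R : realType) (x : R) (b : nat -> R) : null b -> (forall n, x <= b n) -> x <= 0.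
Proof.
move=> hb h; rewrite leNgt; apply/negP => /hb [N /(_ N (leqnn _))].
by rewrite ltNge h.
Qed.

Lemma lim_to_le (R : realType) (u : nat -> Cplx R) l (b : nat -> R) N :
  null b -> (forall n, (N <= n)%N -> nm (u n - l) <= b n) -> lim_to u l.
Proof. exact: null_le. Qed.

Lemma lim_to_unique (R : realType) (u : nat -> Cplx R) l l' :
  lim_to u l -> lim_to u l' -> l = l'.
Proof.
move=> h h'; apply/eqP; rewrite -subr_eq0 -nm_eq0 eq_le nm_ge0 andbT.
apply: null_le0 (nullD h h') _ => n; rewrite [X in _ <= X + _]nm_sym.
by apply: le_trans (nmD _ _); rewrite addrA subrK.
Qed.

Lemma lim_to_eq (R : realType) (u v : nat -> Cplx R) l : u =1 v -> lim_to u l -> lim_to v l.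
Proof. by move=> uv h e /h [N hN]; exists N => n /hN; rewrite uv. Qed.

Lemma lim_to_cst (R : realType) (l : Cplx R) : lim_to (fun=> l) l.
Proof. by move=> e e0; exists 0%N => n _; rewrite subrr nm0. Qed.

Lemma lim_toD (R : realType) (u v : nat -> Cplx R) l l' :
  lim_to u l -> lim_to v l' -> lim_to (fun n => u n + v n) (l + l').
Proof.
move=> h h'; apply: (@lim_to_le _ _ _ _ 0 (nullD h h')) => n _.
by apply: le_trans (nmD _ _); rewrite opprD addrACA.
Qed.

Lemma lim_toZ (R : realType) (c : Cplx R) (u : nat -> Cplx R) l :
  lim_to u l -> lim_to (fun n => c * u n) (c * l).
Proof.
move=> h; apply: (@lim_to_le _ _ _ _ 0 (nullZ (nm_ge0 c) h)) => n _.
by rewrite -mulrBr nmM.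
Qed.

Lemma lim_to_bound (R : realType) (u : nat -> Cplx R) l B N : lim_to u l ->
  (forall n, (N <= n)%N -> nm (u n) <= B) -> nm l <= B.
Proof.
move=> h hB; rewrite -subr_le0; apply: (null_le0 (null_comp (s := fun n =>
  (n + N)%N) _ h)) => n.
  by rewrite leq_addr.
rewrite nm_sym; apply: le_trans (nmB_ge _ _).
by rewrite lerD2l lerN2 hB // leq_addl.
Qed.

Lemma lim_to_bounded (R : realType) (u : nat -> Cplx R) l : lim_to u l ->
  exists B, forall n, nm (u n) <= B.
Proof.
move=> /(_ 1 ltr01)[N hN]; exists (\sum_(i < N) nm (u i) + nm l + 1) => n.
have [Nn|nN] := leqP N n.
  have := hN _ Nn; have := nmB_ge (u n) l.
  have : 0 <= \sum_(i < N) nm (u i) by apply: sumr_ge0 => i _; exact: nm_ge0.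
  lra.
rewrite (bigD1 (Ordinal nN)) //= -!addrA lerDl.
have := nm_ge0 l; have : 0 <= \sum_(i < N | i != Ordinal nN) nm (u i).
  by apply: sumr_ge0 => i _; exact: nm_ge0.
lra.
Qed.

Lemma lim_toM (R : realType) (u v : nat -> Cplx R) l l' :
  lim_to u l -> lim_to v l' -> lim_to (fun n => u n * v n) (l * l').
Proof.
move=> h h'; have [B hB] := lim_to_bounded h; have B0 : 0 <= B := le_trans (nm_ge0 _) (hB 0%N).
apply: (@lim_to_le _ _ _ _ 0 (nullD (nullZ B0 h') (nullZ (nm_ge0 l') h))) => n _.
have -> : u n * v n - l * l' = u n * (v n - l') + l' * (u n - l) by ring.
apply: le_trans (nmD _ _) _; by rewrite !nmM lerD2r ler_wpM2r // nm_ge0.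
Qed.

Lemma lim_to_comp (R : realType) (u : nat -> Cplx R) l (s : nat -> nat) :
  (forall n, (n <= s n)%N) -> lim_to u l -> lim_to (fun n => u (s n)) l.
Proof. exact: null_comp. Qed.

Lemma nm_nome (R : realType) (z : Cplx R) : nm (nome z) = expR (- (2 * pi * complex.Im z)).
Proof.
rewrite nm_def /nome /= !exprMn -mulrDr cos2Dsin2 mulr1 sqrtr_sqr ger0_norm // expR_ge0.
Qed.

Lemma nomeD (R : realType) (z w : Cplx R) : nome (z + w) = nome z * nome w.
Proof.
case: z w => [a b] [c d]; apply/eqP; rewrite eq_complex /nome /=.
rewrite !mulrDr opprD expRD cosD sinD; apply/andP; split; apply/eqP; ring.
Qed.

Lemma nome0 (R : realType) : nome (0 : Cplx R) = 1.
Proof. by apply/eqP; rewrite eq_complex /nome /= !mulr0 oppr0 expR0 cos0 sin0 mulr0 !mulr1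
  !eqxx. Qed.

Lemma nomeMn (R : realType) (z : Cplx R) n : nome (n%:R * z) = nome z ^+ n.
Proof.
elim: n => [|n IH]; first by rewrite mul0r nome0.
by rewrite -addn1 natrD mulrDl mul1r nomeD IH exprD.
Qed.

Lemma nome1 (R : realType) : nome (1 : Cplx R) = 1.
Proof.
apply/eqP; rewrite eq_complex /nome /= mulr0 oppr0 expR0 !mulr1 !mul1r.
by rewrite mulrC mulr_natr cos2pi sin2pi !eqxx.
Qed.

Lemma nome_nat (R : realType) n : nome (n%:R : Cplx R) = 1.
Proof. by rewrite -[n%:R]mulr1 nomeMn nome1 expr1n. Qed.

Lemma nome_lt1 (R : realType) (z : Cplx R) : 0 < complex.Im z -> nm (nome z) < 1.
Proof. by move=> h; rewrite nm_nome expR_lt1 oppr_lt0 !mulr_gt0 // pi_gt0. Qed.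

Lemma nome_gt0 (R : realType) (z : Cplx R) : 0 < nm (nome z).
Proof. by rewrite nm_nome expR_gt0. Qed.

Lemma nome_surj (R : realType) (r : R) : 0 < r -> r < 1 -> exists2 y, 0 < y &
  forall x, nm (nome (x +i* y)%C) = r.
Proof.
move=> r0 r1; exists (- ln r / (2 * pi)).
  by rewrite divr_gt0 ?mulr_gt0 ?pi_gt0 // oppr_gt0 ln_lt0 // r0.
move=> x; rewrite nm_nome /=; have p0 : 2 * pi != 0 :> R by rewrite mulf_neq0 // gt_eqF ?pi_gt0.
by rewrite mulrC divfK // opprK lnK.
Qed.

Definition conv (R : realType) (a : ps (Cplx R)) (q l : Cplx R) :=
  lim_to (fun N => \sum_(n < N) a n * q ^+ n) l.
(** Radius of convergence at least 1, stated on the coefficients. *)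
Definition tame (R : realType) (a : ps (Cplx R)) :=
  forall r : R, 0 < r -> r < 1 -> exists A, forall n, nm (a n) * r ^+ n <= A.

Lemma conv_bound (R : realType) (a : ps (Cplx R)) q l : conv a q l ->
  exists A, forall n, nm (a n) * nm q ^+ n <= A.
Proof.
move=> /lim_to_bounded[B hB]; exists (B + B) => n.
rewrite -nmX -nmM; have := hB n.+1; rewrite big_ord_recr /=.
move=> h; apply: le_trans (lerD h (hB n)); rewrite -[X in _ <= _ + X]nmN.
by apply: le_trans (nmD _ _); rewrite [X in nm (X + _)]addrC addrK.
Qed.

Lemma has_qexpP (R : realType) (F : Cplx R -> Cplx R) a : has_qexp F a <->
  forall z, 0 < complex.Im z -> conv a (nome z) (F z).
Proof. by split => h z z0; apply/cvg_lim_to; apply: h. Qed.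

(** Every radius below 1 is the modulus of a nome, where the terms of the convergent series are
    bounded. *)
Lemma has_qexp_tame (R : realType) (F : Cplx R -> Cplx R) a : has_qexp F a -> tame a.
Proof.
move=> /has_qexpP h r r0 r1; have [y y0 hy] := nome_surj r0 r1.
have [A hA] := conv_bound (h (0 +i* y)%C y0); exists A => n; by rewrite -(hy 0) hA.
Qed.

Lemma tame_geom (R : realType) (a : ps (Cplx R)) (r : R) : tame a -> r < 1 ->
  exists A t, [/\ 0 <= A, 0 < t, t < 1 & forall q n, nm q <= r ->
    nm (a n * q ^+ n) <= A * t ^+ n].
Proof.
(* Here r < s < t < 1: boundedness at radius t becomes geometric decay of ratio s / t at radius
   r. *)
move=> ha r1; pose s := (1 + Num.max r 0) / 2; pose t := (1 + s) / 2.
have m1 : Num.max r 0 < 1 by rewrite gt_max r1 ltr01.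
have m0 : 0 <= Num.max r 0 by rewrite le_max lexx orbT.
have mr : r <= Num.max r 0 by rewrite le_max lexx.
have [A hA] := ha t ltac:(rewrite /t /s; lra) ltac:(rewrite /t /s; lra).
have t0 : 0 < t by rewrite /t /s; lra.
have s0 : 0 < s by rewrite /s; lra.
exists A, (s / t); split.
- by apply: le_trans (hA 0%N); rewrite expr0 mulr1 nm_ge0.
- by rewrite divr_gt0.
- by rewrite ltr_pdivrMr // mul1r /t /s; lra.
move=> q n qr; rewrite nmM nmX expr_div_n mulrA ler_pdivlMr ?exprn_gt0 // -mulrA.
rewrite [nm q ^+ n * _]mulrC mulrA; apply: ler_pM => //.
- by rewrite mulr_ge0 ?nm_ge0 // exprn_ge0 // ltW.
- by rewrite exprn_ge0 // nm_ge0.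
- by rewrite lerXn2r ?nnegrE ?nm_ge0 ?(ltW s0) // (le_trans qr) // /s; lra.
Qed.

Lemma geom_sum_le (R : realType) (t : R) m n : 0 < t -> t < 1 ->
  \sum_(m <= i < n) t ^+ i <= t ^+ m / (1 - t).
Proof.
move=> t0 t1; have d : 0 < 1 - t by rewrite subr_gt0.
have tp k : 0 < t ^+ k by rewrite exprn_gt0.
have [nm|mn] := leqP n m; first by rewrite big_geq // divr_ge0 // ltW.
have : \sum_(m <= i < n) t ^+ i = (t ^+ m - t ^+ n) / (1 - t).
  apply: (mulIf (lt0r_neq0 d)); rewrite divfK ?lt0r_neq0 // mulr_suml.
  transitivity (\sum_(m <= i < n) (- t ^+ i.+1 - (- t ^+ i))).
    by apply: eq_bigr => i _; rewrite exprS; ring.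
  by rewrite telescope_sumr ?(ltnW mn) //; ring.
by move=> ->; rewrite ler_pM2r ?invr_gt0 // gerBl ltW.
Qed.

Lemma conv_tail (R : realType) (a : ps (Cplx R)) q l (A t : R) : 0 <= A -> 0 < t -> t < 1 ->
  (forall n, nm (a n * q ^+ n) <= A * t ^+ n) -> conv a q l -> forall N,
  nm (l - \sum_(n < N) a n * q ^+ n) <= A * (t ^+ N / (1 - t)).
Proof.
move=> A0 t0 t1 h hl N.
apply: (@lim_to_bound _ (fun M => \sum_(n < M) a n * q ^+ n +
  (-1) * \sum_(n < N) a n * q ^+ n) _ _ N).
  rewrite -[l - _](congr1 (fun x => l + x) (mulN1r _)); apply: lim_toD => //; exact: lim_to_cst.
move=> M NM; rewrite mulN1r -!(big_mkord xpredT (fun n => a n * q ^+ n)).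
rewrite (@big_cat_nat _ _ _ N 0 M) //= [X in nm (X - _)]addrC addrK;
  apply: le_trans (nm_sum _ _ _) _.
apply: le_trans (ler_wpM2l A0 (geom_sum_le N M t0 t1)); rewrite mulr_sumr.
by apply: ler_sum => i _.
Qed.

(** c t^n is the tail of the majorant, so v - c t^n increases and stays bounded. *)
Lemma real_geom_lim (R : realType) (v : nat -> R) (A t : R) : 0 <= A -> 0 < t -> t < 1 ->
  (forall n, `|v n.+1 - v n| <= A * t ^+ n) -> exists l, null (fun n => `|v n - l|).
Proof.
move=> A0 t0 t1 h; pose c := A / (1 - t); have c0 : 0 <= c by rewrite divr_ge0 // subr_ge0 ltW.
have cE n : A * t ^+ n = c * t ^+ n - c * t ^+ n.+1.
  rewrite -mulrBr exprS -{2}[t ^+ n]mul1r -mulrBl mulrA /c divfK // subr_eq0 eq_sym.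
  by rewrite lt_eqF.
pose w n := v n - c * t ^+ n.
have wup : nondecreasing_seq w.
  apply/nondecreasing_seqP => n; have := h n; rewrite cE ler_norml => /andP[+ _].
  rewrite /w; lra.
have wd n : v n + c * t ^+ n <= v 0%N + c.
  elim: n => [|n IH]; first by rewrite expr0 mulr1.
  apply: le_trans IH; have := h n; rewrite cE ler_norml => /andP[_]; lra.
have /nondecreasing_is_cvgn hc := wup.
have /hc /cvg_ex[l /cvgrPdist_lt hl] : has_ubound (range w).
  exists (v 0%N + c) => _ [n _ <-]; apply: le_trans (wd n).
  rewrite /w; have : 0 <= c * t ^+ n by rewrite mulr_ge0 // exprn_ge0 // ltW.
  lra.
exists l; apply: (@null_le _ _ (fun n => `|l - w n| + c * t ^+ n) 0); last first.
  move=> n _; rewrite distrC; have -> : l - v n = (l - w n) - c * t ^+ n by rewrite /w; ring.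
  apply: le_trans (ler_normB _ _) _; rewrite lerD2l ger0_norm // mulr_ge0 //.
  by rewrite exprn_ge0 // ltW.
apply: nullD; last by apply: nullZ => //; apply: null_geom.
by move=> e /hl[N _ hN]; exists N.
Qed.

Lemma geom_lim (R : realType) (u : nat -> Cplx R) (A t : R) : 0 <= A -> 0 < t -> t < 1 ->
  (forall n, nm (u n.+1 - u n) <= A * t ^+ n) -> exists l, lim_to u l.
Proof.
move=> A0 t0 t1 h.
have [a ha] : exists a, null (fun n => `|complex.Re (u n) - a|).
  apply: (real_geom_lim A0 t0 t1) => n; apply: le_trans (h n).
  by apply: le_trans (nm_Re _); rewrite raddfB.
have [b hb] : exists b, null (fun n => `|complex.Im (u n) - b|).
  apply: (real_geom_lim A0 t0 t1) => n; apply: le_trans (h n).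
  by apply: le_trans (nm_Im _); rewrite raddfB.
exists (a +i* b)%C; apply: (@null_le _ _ _ 0%N (nullD ha hb)) => n _.
by apply: le_trans (nm_le _) _; case: (u n).
Qed.

Lemma tame_conv (R : realType) (a : ps (Cplx R)) q : tame a -> nm q < 1 -> exists l, conv a q l.
Proof.
move=> ha q1; have [A [t [A0 t0 t1 h]]] := tame_geom ha q1.
apply: (geom_lim A0 t0 t1) => n; by rewrite big_ord_recr /= [X in nm (X - _)]addrC addrK h.
Qed.

Lemma convD (R : realType) (a b : ps (Cplx R)) q l l' :
  conv a q l -> conv b q l' -> conv (a + b) q (l + l').
Proof.
move=> h h'; apply: lim_to_eq (lim_toD h h') => N.
by rewrite -big_split /=; apply: eq_bigr => i _; rewrite psD mulrDl.
Qed.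

Lemma convZ (R : realType) (c : Cplx R) (a b : ps (Cplx R)) q l :
  (forall n, b n = c * a n) -> conv a q l -> conv b q (c * l).
Proof.
move=> e h; apply: lim_to_eq (lim_toZ c h) => N.
by rewrite mulr_sumr; apply: eq_bigr => i _; rewrite e mulrA.
Qed.

Lemma conv_unique (R : realType) (a : ps (Cplx R)) q l l' : conv a q l -> conv a q l' -> l = l'.
Proof. exact: lim_to_unique. Qed.

Lemma null_nX (R : realType) (t : R) : 0 < t -> t < 1 -> null (fun n => n%:R * t ^+ n).
Proof.
move=> t0 t1; pose u := (1 + t) / 2; have [u0 u1] : 0 < u /\ u < 1 by rewrite /u; split; lra.
have tu : t <= u ^+ 2 by have := sqr_ge0 (1 - t); rewrite /u; lra.
have K0 : 0 <= (1 - u)^-1 by rewrite invr_ge0 subr_ge0 ltW.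
apply: (@null_le _ _ _ 0 (nullZ K0 (null_geom u0 u1))) => n _.
apply: le_trans (ler_wpM2r (exprn_ge0 n (ltW u0)) (natX_bound n u0 u1)).
rewrite -mulrA -exprD addnn -mul2n exprM ler_wpM2l ?ler0n //.
by rewrite lerXn2r ?nnegrE ?(ltW t0) // exprn_ge0 // ltW.
Qed.

Lemma null_n2X (R : realType) (t : R) : 0 < t -> t < 1 -> null (fun n => n%:R ^+ 2 * t ^+ n).
Proof.
move=> t0 t1; pose u := (1 + t) / 2; have [u0 u1] : 0 < u /\ u < 1 by rewrite /u; split; lra.
have tu : t <= u ^+ 2 by have := sqr_ge0 (1 - t); rewrite /u; lra.
have K0 : 0 <= (1 - u)^-1 by rewrite invr_ge0 subr_ge0 ltW.
apply: (@null_le _ _ _ 0 (nullZ K0 (null_nX u0 u1))) => n _.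
have nu : 0 <= n%:R * u ^+ n by rewrite mulr_ge0 ?ler0n // exprn_ge0 // ltW.
apply: le_trans (ler_wpM2r nu (natX_bound n u0 u1)).
rewrite mulrACA -expr2 -exprD addnn -mul2n exprM ler_wpM2l ?sqr_ge0 //.
by rewrite lerXn2r ?nnegrE ?(ltW t0) // exprn_ge0 // ltW.
Qed.

Lemma tame_le (R : realType) (a b : ps (Cplx R)) : (forall n, nm (b n) <= nm (a n)) ->
  tame a -> tame b.
Proof.
move=> ba ha r r0 r1; have [A hA] := ha r r0 r1; exists A => n; apply: le_trans (hA n).
by rewrite ler_wpM2r // exprn_ge0 // ltW.
Qed.

Lemma psM_geom (R : realType) (a b : ps (Cplx R)) (A B t r : R) n : 0 <= A -> 0 <= B ->
  0 < t -> 0 <= r ->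
  (forall n, nm (a n) * r ^+ n <= A * t ^+ n) -> (forall n, nm (b n) * r ^+ n <= B * t ^+ n) ->
  nm ((a * b) n) * r ^+ n <= n.+1%:R * (A * B * t ^+ n).
Proof.
move=> A0 B0 t0 r0 ha hb; rewrite psM.
apply: le_trans (ler_wpM2r (exprn_ge0 n r0) (nm_sum _ _ _)) _.
have -> : n.+1%:R * (A * B * t ^+ n) = \sum_(i < n.+1) A * B * t ^+ n.
  by rewrite sumr_const card_ord mulr_natl.
rewrite mulr_suml; apply: ler_sum => i _.
have iE : (i <= n)%N by have := ltn_ord i; lia.
have -> : A * B * t ^+ n = (A * t ^+ i) * (B * t ^+ (n - i)) by rewrite mulrACA -exprD subnKC.
have -> : nm (a i * b (n - i)%N) * r ^+ n =
  (nm (a i) * r ^+ i) * (nm (b (n - i)%N) * r ^+ (n - i)).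
  by rewrite nmM mulrACA -exprD subnKC.
by apply: ler_pM; rewrite ?ha ?hb // mulr_ge0 ?nm_ge0 // exprn_ge0.
Qed.

Lemma tameM (R : realType) (a b : ps (Cplx R)) : tame a -> tame b -> tame (a * b).
Proof.
move=> ha hb r r0 r1.
have [A [t [A0 t0 t1 hA]]] := tame_geom ha r1; have [B [s [B0 s0 s1 hB]]] := tame_geom hb r1.
pose u := Num.max t s; have u0 : 0 < u by rewrite lt_max t0.
have u1 : u < 1 by rewrite gt_max t1.
have rr : nm (r%:C%C : Cplx R) = r by rewrite nm_real ger0_norm // ltW.
exists (2 * (A * B) * (1 - u)^-1 + A * B) => n.
have hg (a' : ps (Cplx R)) (A' t' : R) : 0 <= A' -> 0 < t' -> t' <= u ->
    (forall q n, nm q <= r -> nm (a' n * q ^+ n) <= A' * t' ^+ n) ->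
    forall n, nm (a' n) * r ^+ n <= A' * u ^+ n.
  move=> A'0 t'0 t'u h k; have := h (r%:C%C) k; rewrite rr lexx nmM nmX rr => /(_ isT) h'.
  by apply: le_trans h' _; rewrite ler_wpM2l // lerXn2r ?nnegrE // ltW.
have := psM_geom n A0 B0 u0 (ltW r0) (hg a A t A0 t0 _ hA) (hg b B s B0 s0 _ hB).
rewrite /u !le_max !lexx orbT => /(_ isT isT) h; apply: le_trans h _; rewrite -/u.
have := natX_bound n u0 u1; have un1 : u ^+ n <= 1 by rewrite exprn_ile1 // ltW.
have AB : 0 <= A * B by rewrite mulr_ge0.
rewrite -addn1 natrD mulrDl mul1r.
have k0 : 0 <= (1 - u)^-1 by rewrite invr_ge0 subr_ge0 ltW.
move: (A * B) (u ^+ n) ((1 - u)^-1) (n%:R : R) AB un1 k0 => x y z w x0 y1 z0 wy.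
have := ler_wpM2l x0 wy; have := ler_wpM2l x0 y1; have := mulr_ge0 x0 z0; lra.
Qed.

(** The partial sum of the product and the product of the partial sums differ by N terms of degrees
    from N to 2N, of total size O(N^2 u^N). *)
Lemma convM (R : realType) (a b : ps (Cplx R)) q l l' : tame a -> tame b -> nm q < 1 ->
  conv a q l -> conv b q l' -> conv (a * b) q (l * l').
Proof.
move=> ta tb q1 ha hb; pose r := Num.max (nm q) 2^-1.
have r0 : 0 < r by rewrite lt_max; apply/orP; right; lra.
have r1 : r < 1 by rewrite gt_max q1; lra.
have qr : nm q <= r by rewrite le_max lexx.
have tab := tameM ta tb; have [c hc] := tame_conv tab q1.
have [A [t [A0 t0 t1 hA]]] := tame_geom ta r1; have [B [s [B0 s0 s1 hB]]] := tame_geom tb r1.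
pose u := Num.max t s; have u0 : 0 < u by rewrite lt_max t0.
have u1 : u < 1 by rewrite gt_max t1.
have tu : t <= u by rewrite le_max lexx.
have su : s <= u by rewrite le_max lexx orbT.
have evE N (f : ps (Cplx R)) : (pstr N f).[q] = \sum_(n < N) f n * q ^+ n.
  rewrite (horner_coef_wide _ (size_poly _ _)); apply: eq_bigr => i _.
  by rewrite coef_poly ltn_ord.
have trB (f : ps (Cplx R)) (F x : R) N : 0 <= F -> 0 < x -> x <= u ->
    (forall q n, nm q <= r -> nm (f n * q ^+ n) <= F * x ^+ n) ->
    forall n, nm ((pstr N f)`_n) * nm q ^+ n <= F * u ^+ n.
  move=> F0 x0 xu h n; rewrite coef_poly -nmX -nmM; case: ifP => _; last first.
    by rewrite mul0r nm0 mulr_ge0 // exprn_ge0 // ltW.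
  apply: le_trans (h q n qr) _; rewrite ler_wpM2l // lerXn2r ?nnegrE //; exact: ltW.
have dE N : nm (\sum_(n < N) (a * b) n * q ^+ n
    - (\sum_(n < N) a n * q ^+ n) * (\sum_(n < N) b n * q ^+ n)) <=
    2 * (A * B) * (N%:R ^+ 2 * u ^+ N).
  have AB : 0 <= A * B by rewrite mulr_ge0.
  rewrite -(evE N a) -(evE N b) -hornerM.
  have sz : (size (pstr N a * pstr N b)%R <= N + N)%N.
    apply: leq_trans (size_polyMleq _ _) _; apply: leq_trans (leq_pred _) _.
    exact: leq_add (size_poly _ _) (size_poly _ _).
  rewrite (horner_coef_wide q sz).
  rewrite -(big_mkord xpredT (fun n => (a * b) n * q ^+ n)).
  rewrite -(big_mkord xpredT (fun n => (pstr N a * pstr N b)`_n * q ^+ n)).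
  rewrite (@big_cat_nat _ _ _ N 0 (N + N)) ?leq_addr //=.
  have e1 : \sum_(0 <= i < N) (pstr N a * pstr N b)`_i * q ^+ i =
    \sum_(0 <= i < N) (a * b) i * q ^+ i.
    by apply: eq_big_nat => i iN; rewrite -psmulE.
  rewrite e1.
  rewrite opprD addrA subrr sub0r nmN; apply: le_trans (nm_sum _ _ _) _.
  apply: (@le_trans _ _ (\sum_(N <= i < N + N) 2 * (A * B) * (N%:R * u ^+ N))).
    rewrite [leRHS]big_seq [leLHS]big_seq; apply: ler_sum => i;
      rewrite mem_index_iota => /andP[Ni iN].
    rewrite nmM nmX coefM.
    apply: le_trans (psM_geom i A0 B0 u0 (nm_ge0 q) (trB a A t N A0 t0 tu hA) (trB b B s N B0
      s0 su hB)) _.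
    have -> : 2 * (A * B) * (N%:R * u ^+ N) = (2 * N%:R) * (A * B * u ^+ N) by ring.
    apply: ler_pM; rewrite ?ler0n //.
    - by rewrite mulr_ge0 // exprn_ge0 // ltW.
    - by rewrite -natrM ler_nat mul2n -addnn.
    - by rewrite ler_wpM2l // ler_wiXn2l // ltW.
  by rewrite sumr_const_nat addnK -mulr_natl; rewrite le_eqVlt; apply/orP; left; apply/eqP;
    ring.
have AB2 : 0 <= 2 * (A * B) by rewrite !mulr_ge0.
apply: (@lim_to_le _ _ _ _ 0 (nullD (nullZ AB2 (null_n2X u0 u1)) (lim_toM ha hb))) => N _.
by apply: le_trans (lerD (dE N) (lexx _)); apply: le_trans (nmD _ _); rewrite addrA subrK.
Qed.

Lemma nome_neq1 (R : realType) (x : R) : 0 < x -> x < 1 -> nome (x%:C%C : Cplx R) != 1.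
Proof.
move=> x0 x1; rewrite eq_complex /nome /= mulr0 oppr0 expR0 !mul1r;
  apply/negP => /andP[/eqP + _].
have -> : 2 * pi * x = (pi * x) *+ 2 by rewrite -mulr_natl; ring.
rewrite cos_mulr2n => h.
have s0 : 0 < sin (pi * x) by apply: sin_gt0_pi; rewrite mulr_gt0 ?pi_gt0 //= gtr_pMr ?pi_gt0.
have := cos2Dsin2 (pi * x); have : 0 < sin (pi * x) ^+ 2 by rewrite exprn_gt0.
lra.
Qed.

Lemma rational_sum (R : realType) N m : (0 < N)%N -> ~~ (N %| m)%N ->
  \sum_(j < N) nome ((N%:R^-1)%:C%C : Cplx R) ^+ (j * m) = 0.
Proof.
move=> N0 Nm; set w := nome _.
have wN : w ^+ N = 1.
  rewrite /w -nomeMn -[N%:R](rmorph_nat (real_complex R)) -rmorphM mulfV ?rmorph1 ?nome1 //.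
  by rewrite pnatr_eq0 -lt0n.
have w1 : w ^+ m != 1.
  rewrite (divn_eq m N) exprD mulnC exprM wN expr1n mul1r.
  have m0 : (0 < m %% N)%N by rewrite lt0n.
  rewrite /w -nomeMn -[_%:R](rmorph_nat (real_complex R)) -rmorphM.
  apply: nome_neq1; first by rewrite divr_gt0 // ltr0n.
  by rewrite ltr_pdivrMr ?ltr0n // mul1r ltr_nat ltn_mod.
have e := subrX1 (w ^+ m) N; move: e; rewrite -exprM mulnC exprM wN expr1n subrr => /esym/eqP.
rewrite mulf_eq0 subr_eq0 (negPf w1) /= => /eqP e.
by rewrite -[RHS]e; apply: eq_bigr => j _; rewrite mulnC exprM.
Qed.

(* Averaging over the translates of z by multiples of 1/N replaces the contour
   integral of the usual proof. *)
Lemma cauchy_estimate (R : realType) (a : ps (Cplx R)) (F : Cplx R -> Cplx R) (y M : R) :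
  0 < y -> tame a -> (forall x, conv a (nome (x +i* y)%C) (F (x +i* y)%C)) ->
  (forall x, nm (F (x +i* y)%C) <= M) -> forall n, nm (a n) * expR (- (2 * pi * y)) ^+ n <= M.
Proof.
move=> y0 ta hF hM n; set r := expR _.
have nq x : nm (nome (x +i* y)%C) = r by rewrite nm_nome.
have nq' x : nm (nome (x +i* y)%C) <= r by rewrite nq.
have r1 : r < 1 by rewrite -(nq 0) nome_lt1.
have [A [t [A0 t0 t1 hA]]] := tame_geom ta r1.
have d0 : 0 <= (1 - t)^-1 by rewrite invr_ge0 subr_ge0 ltW.
have A1 : 0 <= A * (1 - t)^-1 by rewrite mulr_ge0.
rewrite -subr_le0; apply: (null_le0 (null_comp (s := fun k =>
  (k + n.+1)%N) _ (nullZ A1 (null_geom t0 t1)))).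
  by move=> k; rewrite leq_addr.
move=> k; set N := (k + n.+1)%N; have N0 : (0 < N)%N by rewrite /N; lia.
have nN : (n < N)%N by rewrite /N; lia.
pose w := nome ((N%:R^-1)%:C%C : Cplx R); pose q0 := nome ((0 +i* y)%C : Cplx R).
have qE j : nome ((j%:R / N%:R) +i* y)%C = w ^+ j * q0.
  rewrite /w -nomeMn -nomeD; congr nome.
  have -> : (j%:R : Cplx R) = (j%:R)%:C%C by rewrite (rmorph_nat (real_complex R)).
  by rewrite -rmorphM; apply/eqP; rewrite eq_complex /= addr0 add0r !eqxx.
have wN : w ^+ N = 1.
  rewrite /w -nomeMn -[N%:R](rmorph_nat (real_complex R)) -rmorphM mulfV ?rmorph1 ?nome1 //.
  by rewrite pnatr_eq0 -lt0n.
have nw : nm w = 1 by rewrite /w nm_nome /= mulr0 oppr0 expR0.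
(* Orthogonality of the N-th roots of unity: w^(j (N - n)) is the inverse of w^(j n), and among l <
   N only l = n survives. *)
have key : N%:R * (a n * q0 ^+ n) =
    \sum_(j < N) w ^+ (j * (N - n)) * \sum_(l < N) a l * nome ((j%:R / N%:R) +i* y)%C ^+ l.
  under eq_bigr do rewrite mulr_sumr.
  rewrite exchange_big /= (bigD1 (Ordinal nN)) //= [X in _ + X]big1 ?addr0 => [|l ln].
    rewrite -[N%:R]/(N%:R) -[in LHS](card_ord N) -sumr_const mulr_suml; apply: eq_bigr => j _.
    rewrite mul1r qE exprMn -exprM mulrCA (mulrA (w ^+ _)) -exprD -mulnDr subnK ?(ltnW nN) //.
    by rewrite mulnC exprM wN expr1n mul1r.
  transitivity (a l * q0 ^+ l * \sum_(j < N) w ^+ (j * (N - n + l))).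
    rewrite mulr_sumr; apply: eq_bigr => j _.
    by rewrite qE exprMn -exprM mulnDr exprD; ring.
  rewrite rational_sum ?mulr0 //; apply/negP => /dvdnP[c cE].
  move: ln; rewrite -val_eqE /= => /eqP; apply.
  have := ltn_ord l; case: c cE => [|[|c]]; nia.
have N0' : (0 : R) < N%:R by rewrite ltr0n.
rewrite -(ler_pM2l N0').
have -> : N%:R * (nm (a n) * r ^+ n - M) = nm (N%:R * (a n * q0 ^+ n)) - N%:R * M.
  by rewrite nmM nm_nat nmM nmX nq; ring.
rewrite key lerBlDr -mulrDr; apply: le_trans (nm_sum _ _ _) _.
have -> : N%:R * (A / (1 - t) * t ^+ N + M) = \sum_(j < N) (A / (1 - t) * t ^+ N + M).
  by rewrite sumr_const card_ord mulr_natl.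
apply: ler_sum => j _; rewrite nmM nmX nw expr1n mul1r.
set x := j%:R / N%:R; have := hM x; have := conv_tail A0 t0 t1 (fun n =>
  hA _ n (nq' x)) (hF x) N.
set S := \sum_(l < N) _; rewrite nm_sym => h1 h2.
have := nmB_ge S (F (x +i* y)%C).
have -> : A / (1 - t) * t ^+ N = A * (t ^+ N / (1 - t)) by ring.
lra.
Qed.

(** [cauchy_estimate] with bound 0 on the line Im z = 1. *)
Lemma qexp_zero (R : realType) (a : ps (Cplx R)) (F : Cplx R -> Cplx R) : has_qexp F a ->
  (forall z, 0 < complex.Im z -> F z = 0) -> a = 0.
Proof.
move=> hF F0; have ta := has_qexp_tame hF; apply: funext => n; rewrite ps0.
have := @cauchy_estimate _ a F 1 0 ltr01 ta _ _ n.
move/has_qexpP: hF => hF /(_ (fun x => hF (x +i* 1)%C ltr01)) h.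
have /h : forall x, nm (F (x +i* 1)%C) <= 0 by move=> x; rewrite F0 ?nm0.
rewrite pmulr_lle0 ?exprn_gt0 ?expR_gt0 // => h0.
by apply/eqP; rewrite -nm_eq0 eq_le h0 nm_ge0.
Qed.

Lemma expRN_est (R : realType) (a : R) : `|expR (- a) - 1 + a| <= a ^+ 2 * expR `|a| /\
  `|expR (- a) - 1| <= `|a| * expR `|a|.
Proof.
have p1 := expR_ge1Dx (- a); have p2 := expR_ge1Dx a; have g0 := expR_gt0 a.
have g1 := expR_gt0 (- a); have m1 : expR a * expR (- a) = 1 by rewrite expRxMexpNx_1.
have [a0|a0] := leP 0 a.
  have e1 : expR (- a) <= 1 by rewrite expR_le1 oppr_le0.
  have e2 : 1 <= expR a by rewrite -expR0 ler_expR.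
  rewrite (ger0_norm a0); have aa : 0 <= a ^+ 2 by exact: sqr_ge0.
  have t1 := ler_wpM2l (ltW g1) p2; rewrite [X in _ <= X]mulrC m1 in t1.
  have t2 : a ^+ 2 <= a ^+ 2 * expR a by rewrite ler_peMr.
  have t3 : a <= a * expR a by rewrite ler_peMr.
  split; rewrite ler_norml; apply/andP; split; try nra.
rewrite (ltr0_norm a0); have e1 : 1 <= expR (- a) by rewrite -expR0 ler_expR oppr_ge0 ltW.
have t1 := ler_wpM2l (ltW g1) p2; rewrite [X in _ <= X]mulrC m1 in t1.
have aa : 0 <= a ^+ 2 by exact: sqr_ge0.
have t2 : a ^+ 2 <= a ^+ 2 * expR (- a) by rewrite ler_peMr.
split; rewrite ler_norml; apply/andP; split; try nra.
Qed.

Lemma sin_mvt (R : realType) (x : R) : 0 < x -> exists2 c, 0 < c < x & sin x = x * cos c.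
Proof.
move=> x0; have [c|c ci e] := MVT x0 (fun y _ => is_derive_sin y).
  exact/continuous_subspaceT/continuous_sin.
exists c; first by move: ci; rewrite in_itv.
by move: e; rewrite sin0 !subr0 mulrC.
Qed.

Lemma norm_sin (R : realType) (x : R) : `|sin x| <= `|x|.
Proof.
wlog x0 : x / 0 < x => [h|].
  have [x0|x0|<-] := ltrgtP 0 x; [exact: h| |by rewrite sin0 normr0].
  by rewrite -normrN -sinN -[leRHS]normrN; apply: h; rewrite oppr_gt0.
have [c _ ->] := sin_mvt x0; rewrite normrM ler_piMr // ler_norml.
by rewrite cos_geN1 cos_le1.
Qed.

Lemma cos_est (R : realType) (x : R) : 0 <= 1 - cos x /\ 1 - cos x <= x ^+ 2 /\ 1 - cos x <=
  `|x|.
Proof.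
have e : 1 - cos x = 2 * sin (x / 2) ^+ 2.
  have {1}-> : x = (x / 2) *+ 2 by rewrite -mulr_natr divfK.
  by rewrite cos_mulr2n; have := cos2Dsin2 (x / 2); lra.
rewrite e; have := norm_sin (x / 2); have s1 : `|sin (x / 2)| <= 1.
  by rewrite ler_norml sin_geN1 sin_le1.
rewrite -[sin _ ^+ 2](real_normK (num_real _)) -[x ^+ 2](real_normK (num_real _)).
rewrite normrM (ger0_norm (_ : 0 <= 2^-1)) //.
have := normr_ge0 (sin (x / 2)); have := normr_ge0 x.
move: `|sin _| `|x| s1 => u v u1 v0 u0 uv; repeat split; nra.
Qed.

Lemma sin_est (R : realType) (x : R) : `|sin x - x| <= x ^+ 2.
Proof.
wlog x0 : x / 0 < x => [h|].
  have [x0|x0|<-] := ltrgtP 0 x; [exact: h| |by rewrite sin0 subrr normr0 expr0n].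
  have -> : sin x - x = - (sin (- x) - (- x)) by rewrite sinN; ring.
  by rewrite normrN -sqrrN; apply: h; rewrite oppr_gt0.
have [c /andP[c0 cx] ->] := sin_mvt x0; have [h0 [_ h1]] := cos_est c.
have -> : x * cos c - x = - (x * (1 - cos c)) by ring.
rewrite normrN ger0_norm ?mulr_ge0 ?(ltW x0) // expr2 ler_wpM2l ?(ltW x0) //.
by apply: le_trans h1 _; rewrite ger0_norm ?ltW.
Qed.

Definition tpi (R : realType) : Cplx R := (0 +i* (2 * pi))%C.
Lemma nm_tpi (R : realType) : nm (tpi R) = 2 * pi.
Proof. by rewrite nm_def /= expr0n add0r sqrtr_sqr ger0_norm // mulr_ge0 // pi_ge0. Qed.

(** Real and imaginary part are each split into two pieces, and each of the four is at most s^2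
    e^s. *)
Lemma nome_est (R : realType) (w : Cplx R) :
  nm (nome w - 1 - tpi R * w) <= 4 * (2 * pi * nm w) ^+ 2 * expR (2 * pi * nm w).
Proof.
apply: le_trans (nm_le _) _; set s := 2 * pi * nm w.
case: w @s => x y s; set a := 2 * pi * y; set th := 2 * pi * x.
have p0 : 0 <= 2 * pi :> R by rewrite mulr_ge0 // pi_ge0.
have as' : `|a| <= s by rewrite /a /s normrM ger0_norm // ler_wpM2l // (nm_Im (x +i* y)%C).
have ths : `|th| <= s by rewrite /th /s normrM ger0_norm // ler_wpM2l // (nm_Re (x +i* y)%C).
have -> : complex.Re (nome (x +i* y)%C - 1 - tpi R * (x +i* y)%C) =
  (expR (- a) - 1 + a) + expR (- a) * (cos th - 1).
  by rewrite /= -/a -/th mul0r /a; ring.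
have -> : complex.Im (nome (x +i* y)%C - 1 - tpi R * (x +i* y)%C) =
  (expR (- a) - 1) * sin th + (sin th - th).
  by rewrite /= -/a -/th mul0r /th; ring.
have [e1 e2] := expRN_est a; have [c0 [c1 _]] := cos_est th.
have s1 := norm_sin th; have s2 := sin_est th.
have E1 : 1 <= expR s by rewrite -expR0 ler_expR; apply: le_trans as'.
have E2 : expR `|a| <= expR s by rewrite ler_expR.
have E3 : expR (- a) <= expR s by rewrite ler_expR; apply: le_trans as';
  rewrite -normrN ler_norm.
have aa : a ^+ 2 = `|a| ^+ 2 by rewrite real_normK // num_real.
have tt : th ^+ 2 = `|th| ^+ 2 by rewrite real_normK // num_real.
have s0 : 0 <= s := le_trans (normr_ge0 _) as'.
have b1 : a ^+ 2 <= s ^+ 2 by rewrite aa lerXn2r ?nnegrE.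
have b2 : th ^+ 2 <= s ^+ 2 by rewrite tt lerXn2r ?nnegrE.
have q1 : `|expR (- a) - 1 + a| <= s ^+ 2 * expR s.
  by apply: le_trans e1 _; apply: ler_pM => //; rewrite ?sqr_ge0 ?expR_ge0.
have q2 : `|expR (- a) * (cos th - 1)| <= s ^+ 2 * expR s.
  rewrite normrM ger0_norm ?expR_ge0 // mulrC; apply: ler_pM => //; rewrite ?expR_ge0 //.
  by rewrite -normrN opprB ger0_norm //; apply: le_trans b2.
have q3 : `|(expR (- a) - 1) * sin th| <= s ^+ 2 * expR s.
  rewrite normrM; apply: le_trans (_ : (s * expR s) * s <= _); last by rewrite expr2 mulrAC.
  apply: ler_pM => //; last exact: le_trans s1 ths.
  by apply: le_trans e2 _; apply: ler_pM => //; rewrite expR_ge0.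
have q4 : `|sin th - th| <= s ^+ 2 * expR s.
  by apply: le_trans s2 _; apply: le_trans b2 _; rewrite ler_peMr ?sqr_ge0.
have := ler_normD (expR (- a) - 1 + a) (expR (- a) * (cos th - 1)).
have := ler_normD ((expR (- a) - 1) * sin th) (sin th - th).
lra.
Qed.

Lemma tame_geom1 (R : realType) (a : ps (Cplx R)) (r : R) : tame a -> 0 <= r -> r < 1 ->
  exists A t, [/\ 0 <= A, 0 < t, t < 1 & forall n, nm (a n) * r ^+ n <= A * t ^+ n].
Proof.
move=> ta r0 r1; have [A [t [A0 t0 t1 hA]]] := tame_geom ta r1; exists A, t; split => // n.
have rr : nm (r%:C%C : Cplx R) = r by rewrite nm_real ger0_norm.
by have := hA (r%:C%C) n; rewrite rr lexx nmM nmX rr => /(_ isT).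
Qed.

Lemma tame_nat (R : realType) (a : ps (Cplx R)) : tame a -> tame (fun n => n%:R * a n : Cplx R).
Proof.
move=> ta r r0 r1; have [A [t [A0 t0 t1 hA]]] := tame_geom1 ta (ltW r0) r1.
exists (A * (1 - t)^-1) => n; rewrite nmM nm_nat.
rewrite -mulrA; apply: le_trans (ler_wpM2l (ler0n _ n) (hA n)) _.
by rewrite mulrCA ler_wpM2l // natX_bound.
Qed.

Lemma derivable_from_est (R : realType) (F : Cplx R ->
  Cplx R) z (D : Cplx R) (K d : R) : 0 < d ->
  (forall h, nm h <= d -> nm (F (z + h) - F z - h * D) <= K * nm h ^+ 2) -> derivable F z 1.
Proof.
move=> d0 hF; apply/cvg_ex; exists D; apply/cvgrPdist_lt => e e0.
have K0 : 0 <= K.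
  have := hF (d%:C%C); rewrite nm_real ger0_norm ?(ltW d0) // lexx => /(_ isT) h.
  have : 0 <= K * d ^+ 2 by apply: le_trans h; exact: nm_ge0.
  by rewrite pmulr_lge0 // exprn_gt0.
move: (e0); rewrite ltcE /= => /andP[/eqP ime e1].
pose d' := Num.min d (complex.Re e / (K + 1)).
have d'0 : 0 < d' by rewrite lt_min d0 divr_gt0 // ltr_wpDl.
have d'C : 0 < (d'%:C%C : Cplx R) by rewrite ltcE /= eqxx.
near=> h.
have hn0 : h != 0 by near: h; exact: (@nbhs_dnbhs_neq (Cplx R) 0).
have hd : nm h < d'.
  have : `|h| < d'%:C%C by near: h; exact: (@dnbhs0_lt _ (Cplx R) _ d'C).
  by rewrite normE ltcE /= eqxx.
rewrite normE ltcE /= ime eqxx /= scaler1 [h + z]addrC -[X in X *: _]/(h^-1).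
have -> : D - h^-1 *: (F (z + h) - F z) = - (h^-1 * (F (z + h) - F z - h * D)).
  rewrite [h^-1 * _]mulrBr [h^-1 * (h * D)]mulrA mulVf // mul1r opprB.
  by [].
rewrite nmN nmM nmV mulrC ltr_pdivrMr ?nm_gt0 //.
move: hd; rewrite lt_min => /andP[h1 h2].
apply: le_lt_trans (hF _ (ltW h1)) _; move: h2; rewrite ltr_pdivlMr ?ltr_wpDl // => h2.
have := nm_ge0 h; have n0 : 0 < nm h by rewrite nm_gt0.
nra.
Unshelve. all: by end_near.
Qed.

Lemma qexp_holomorphic (R : realType) (a : ps (Cplx R)) (F : Cplx R -> Cplx R) : has_qexp F a ->
  holomorphic_on_H F.
Proof.
move=> hF z z0; have ta := has_qexp_tame hF; move/has_qexpP: hF => hF.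
set y := complex.Im z in z0.
pose b : ps (Cplx R) := fun n => n%:R * a n; have tb : tame b by exact: tame_nat.
have tb2 := tame_nat tb.
have [D hD] := tame_conv tb (nome_lt1 z0).
(* For |h| <= y / 2 the factor exp(2 pi n |h|) of [nome_est] costs half of the decay of q^n. *)
pose rho : R := expR (- (pi * y)).
have rho1 : rho < 1 by rewrite expR_lt1 oppr_lt0 mulr_gt0 // pi_gt0.
have [A [t [A0 t0 t1 hA]]] := tame_geom1 tb2 (expR_ge0 _) rho1.
have y2 : 0 < y / 2 by rewrite divr_gt0.
apply: (@derivable_from_est _ _ _ (tpi R * D) (16 * pi ^+ 2 * (A * (1 - t)^-1)) (y / 2)) =>
  // h hy.
have zh0 : 0 < complex.Im (z + h).
  rewrite raddfD /= -/y; have := le_trans (nm_Im h) hy; rewrite ler_norml => /andP[+ _]; lra.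
have hl := lim_toD (lim_toD (hF _ zh0) (lim_toZ (-1) (hF _ z0))) (lim_toZ (- (h * tpi R)) hD).
have -> : F (z + h) - F z - h * (tpi R * D) = F (z + h) + -1 * F z + - (h * tpi R) * D by ring.
apply: (lim_to_bound (N := 0) hl) => N _.
rewrite !mulr_sumr -!big_split /=; apply: le_trans (nm_sum _ _ _) _.
have -> : 16 * pi ^+ 2 * (A / (1 - t)) * nm h ^+ 2 =
  16 * pi ^+ 2 * nm h ^+ 2 * A * (t ^+ 0 / (1 - t)).
  by rewrite expr0; ring.
have c0 : 0 <= 16 * pi ^+ 2 * nm h ^+ 2 * A by rewrite !mulr_ge0 ?sqr_ge0 ?pi_ge0 ?nm_ge0.
apply: le_trans (ler_wpM2l c0 (geom_sum_le 0 N t0 t1)); rewrite big_mkord mulr_sumr.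
apply: ler_sum => n _.
have -> : a n * nome (z + h) ^+ n + -1 * (a n * nome z ^+ n) +
  - (h * tpi R) * (b n * nome z ^+ n) =
  a n * nome z ^+ n * (nome (n%:R * h) - 1 - tpi R * (n%:R * h)).
  by rewrite nomeMn nomeD exprMn /b; ring.
rewrite nmM; apply: le_trans (ler_wpM2l (nm_ge0 _) (nome_est _)) _.
rewrite [nm (n%:R * h)]nmM nm_nat.
have := hA n; rewrite /b !nmM nm_nat => hh.
rewrite nmX.
have e1 : nm (nome z) ^+ n * expR (2 * pi * (n%:R * nm h)) <= rho ^+ n.
  rewrite nm_nome -!expRM_natl -expRD ler_expR -/y.
  have : 0 <= n%:R * pi * (y / 2 - nm h) by rewrite !mulr_ge0 ?ler0n ?pi_ge0 // subr_ge0.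
  lra.
have -> : nm (a n) * nm (nome z) ^+ n * (4 * (2 * pi * (n%:R * nm h)) ^+ 2 * expR (2 * pi *
  (n%:R * nm h))) =
  16 * pi ^+ 2 * nm h ^+ 2 * (n%:R * (n%:R * nm (a n)) * (nm (nome z) ^+ n * expR (2 * pi *
    (n%:R * nm h)))).
  ring.
rewrite -[leRHS]mulrA ler_wpM2l ?mulr_ge0 ?sqr_ge0 ?pi_ge0 ?nm_ge0 //; apply: le_trans hh.
by rewrite ler_wpM2l // !mulr_ge0 ?ler0n ?nm_ge0.
Qed.

(** * Vanishing of forms with many zero coefficients *)

Definition cps (R : realType) (a : ps int) : ps (Cplx R) := fun n => (a n)%:~R.

Lemma cpsM (R : realType) a b : cps R (a * b) = cps R a * cps R b.
Proof. exact: (rmorphM (psmap (intr : {rmorphism int -> Cplx R}))). Qed.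

Lemma cpsX (R : realType) a n : cps R (a ^+ n) = cps R a ^+ n.
Proof. exact: (rmorphXn (psmap (intr : {rmorphism int -> Cplx R}))). Qed.

Lemma cpsD (R : realType) a b : cps R (a + b) = cps R a + cps R b.
Proof. exact: (rmorphD (psmap (intr : {rmorphism int -> Cplx R}))). Qed.

Lemma cps_X (R : realType) k : cps R (psX int k) = psX (Cplx R) k.
Proof. by apply: funext => n; rewrite /cps /psX; case: eqP. Qed.

Lemma cps_eq0 (R : realType) a : cps R a = 0 -> a = 0.
Proof.
move=> h; apply: funext => n; have := congr1 (fun f => f n) h.
by rewrite /cps !ps0 => /eqP; rewrite intr_eq0 => /eqP.
Qed.

Lemma tame_psX (R : realType) k : tame (psX (Cplx R) k).
Proof.
move=> r r0 r1; exists 1 => n; rewrite /psX; case: eqP => _; last by rewrite nm0 mul0r.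
by rewrite nm1 mul1r exprn_ile1 // ltW.
Qed.

Lemma conv_psX (R : realType) k (q : Cplx R) : conv (psX _ k) q (q ^+ k).
Proof.
rewrite /conv; apply: (@lim_to_le _ _ _ (fun n => (n.+1%:R)^-1) k.+1) => [|N kN];
  first exact: null_inv.
rewrite (bigD1 (Ordinal kN)) //= big1 => [|i ik].
  by rewrite /psX eqxx mul1r addr0 subrr nm0 invr_ge0 ler0n.
by rewrite /psX; move: ik; rewrite -val_eqE /= => /negPf ->; rewrite mul0r.
Qed.

Lemma tameX (R : realType) (a : ps (Cplx R)) n : tame a -> tame (a ^+ n).
Proof.
move=> ta; elim: n => [|n IH]; first exact: (tame_psX (R := R) 0).
by rewrite exprS; apply: tameM.
Qed.

Lemma convX (R : realType) (a : ps (Cplx R)) q l n : tame a -> nm q < 1 -> conv a q l ->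
  conv (a ^+ n) q (l ^+ n).
Proof.
move=> ta q1 hl; elim: n => [|n IH]; first exact: (conv_psX 0 q).
by rewrite !exprS; apply: convM => //; apply: tameX.
Qed.

Lemma tame_shift (R : realType) k (a : ps (Cplx R)) : tame (psX _ k * a) -> tame a.
Proof.
move=> ta r r0 r1; have [A hA] := ta r r0 r1; exists (A / r ^+ k) => n.
have := hA (n + k)%N; rewrite psXM leq_addl addnK exprD mulrA ler_pdivlMr //.
by rewrite exprn_gt0.
Qed.

Lemma sigma_le e n : (0 < n)%N -> (sigma e n <= n ^ e.+1)%N.
Proof.
move=> n0; have dn d : d \in divisors n -> (0 < d <= n)%N.
  by rewrite -dvdn_divisors // => dn; rewrite (dvdn_gt0 n0 dn) dvdn_leq.
apply: (@leq_trans (\sum_(d <- divisors n) n ^ e)).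
  rewrite /sigma big_seq [leqRHS]big_seq; apply: leq_sum => d /dn /andP[_ h].
  by case: (e) => // e'; rewrite leq_exp2r.
rewrite big_const_seq count_predT iter_addn_0 mulnC expnS leq_mul2r.
apply/orP; right; rewrite -[leqRHS](size_iota 1) uniq_leq_size ?divisors_uniq // => d /dn.
by rewrite mem_iota add1n ltnS.
Qed.

Lemma tame_pow (R : realType) e : tame (fun n => (n ^ e)%N%:R : Cplx R).
Proof.
elim: e => [|e IH].
  by move=> r r0 r1; exists 1 => n; rewrite expn0 nm1 mul1r exprn_ile1 // ltW.
move: (tame_nat IH); congr tame; apply: funext => n.
by rewrite -natrM expnS.
Qed.

(** Geometric series in h = 1 - f: as h^N has order at least N, coefficient n involves only the
    powers up to n. *)
Lemma ps_inverse (f : ps int) : f 0%N = 1 -> exists e, f * e = 1.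
Proof.
move=> f0; pose h : ps int := 1 - f.
have h0 : h 0%N = 0 by rewrite /h psB ps1 f0 subrr.
have ho N n : (n < N)%N -> (h ^+ N) n = 0.
  elim: N n => // N IH n nN; rewrite exprS psM big1 // => -[[|i] iN] _ /=.
    by rewrite h0 mul0r.
  by rewrite IH ?mulr0 //; move: iN; lia.
exists (fun n => (\sum_(i < n.+1) h ^+ i) n); apply: funext => n.
have fE : f = 1 - h by rewrite /h opprB addrC subrK.
have -> : (f * (fun n => (\sum_(i < n.+1) h ^+ i) n)) n = (f * \sum_(i < n.+1) h ^+ i) n.
  apply: (@psM_congr _ n.+1) => // k kn.
  rewrite -!(big_mkord xpredT (fun i => h ^+ i)) [in RHS](@big_cat_nat _ _ _ k.+1) //= psD.
  have -> : (\sum_(k.+1 <= i < n.+1) h ^+ i) k = 0.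
    by rewrite ps_sum big_nat big1 // => i /andP[ki _]; apply: ho.
  by rewrite addr0.
have e := subrX1 h n.+1; rewrite fE -opprB mulNr -e opprB psB ho ?subr0 //.
Qed.

Lemma tame_divsum (R : realType) e : tame (cps R (divsum e)).
Proof.
apply: tame_le (@tame_pow R e.+1) => -[|n].
  have -> : cps R (divsum e) 0%N = 0 by [].
  by rewrite nm0 nm_ge0.
by rewrite /cps /divsum /= -pmulrn !nm_nat ler_nat sigma_le.
Qed.

(** Delta / q, the product of the (1 - q^i)^24. *)
Definition eta24 : ps int := fun n => Delta n.+1.
Lemma Delta_0 : Delta 0 = 0.
Proof. by rewrite (@Delta_truncE 0) // /Delta_trunc psXM. Qed.

Lemma Delta_1 : Delta 1 = 1.
Proof.
have h0 (f : ps int) k : (f ^+ k) 0%N = f 0%N ^+ k.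
  by elim: k => // k IH; rewrite !exprS psM_0 IH.
by rewrite (@Delta_truncE 1) // /Delta_trunc psXM big_nat1 h0.
Qed.

Lemma Delta_eta : (Delta : ps int) = psX int 1 * eta24.
Proof. by apply: funext => -[|n]; rewrite psXM ?Delta_0 //= subn1. Qed.

Lemma psD1_psX k : psD1 (psX int k) = k%:R * psX int k.
Proof. by apply: funext => n; rewrite psMnl /psD1 /psX; case: eqP => [->|_];
  rewrite ?mulr0. Qed.

Lemma eta_inv_rec (e : ps int) : eta24 * e = 1 -> psD1 e = 24 * divsum 1 * e.
Proof.
move=> he; have hd : psD1 eta24 = (Eis2 - 1) * eta24.
  have := psD1_Delta; rewrite Delta_eta psD1M psD1_psX mul1r => h.
  have {}h : psX int 1 * (psD1 eta24 - (Eis2 - 1) * eta24) = 0.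
    have -> : psX int 1 * (psD1 eta24 - (Eis2 - 1) * eta24) =
      (psX int 1 * eta24 + psX int 1 * psD1 eta24) - Eis2 * (psX int 1 * eta24) by ring.
    by rewrite h subrr.
  apply/eqP; rewrite -subr_eq0; apply/eqP; apply: funext => n.
  by have := congr1 (fun f => f n.+1) h; rewrite psXM /= subn1.
have h0 := congr1 (@psD1 int) he; rewrite psD1M hd psD1_1 in h0.
transitivity (e * (eta24 * psD1 e)); first by rewrite mulrCA mulrA he mul1r.
have -> : eta24 * psD1 e = ((Eis2 - 1) * eta24 * e +
  eta24 * psD1 e) - (Eis2 - 1) * (eta24 * e) by ring.
rewrite h0 he /Eis2; ring.
Qed.

(** Convergence of the inverse is what shows that Delta has no zero. By [eta_inv_rec], n e_n is 24
    times a convolution with sigma_1, so for n > K the weighted coefficients no longer exceed a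
    bound valid for the earlier ones. *)
Lemma tame_eta_inv (R : realType) (e : ps int) : eta24 * e = 1 -> tame (cps R e).
Proof.
move=> /eta_inv_rec he r r0 r1.
have [A [t [A0 t0 t1 hA]]] := tame_geom1 (@tame_divsum R 1) (ltW r0) r1.
pose K := 24 * (A * (t ^+ 0 / (1 - t))).
have K0 : 0 <= K by rewrite !mulr_ge0 // invr_ge0 subr_ge0 ltW.
pose N := Num.Def.archi_bound K.
have NK : K < N%:R by exact: archi_boundP.
pose f n := nm (cps R e n) * r ^+ n.
have f0 n : 0 <= f n by rewrite mulr_ge0 ?nm_ge0 // exprn_ge0 // ltW.
exists (\sum_(i < N.+1) f i) => n; rewrite -/(f n).
have [k] := ubnP n; elim: k n => // k IH n nk.
have [nN|nN] := leqP n N.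
  by rewrite (bigD1 (Ordinal (nN : (n < N.+1)%N))) //= lerDl sumr_ge0.
set B := \sum_(i < _) _ in IH *; have B0 : 0 <= B by rewrite sumr_ge0.
clearbody B.
have n0 : (0 : R) < n%:R by rewrite ltr0n; lia.
rewrite -(ler_pM2l n0); apply: (@le_trans _ _ (K * B)); last first.
  rewrite ler_wpM2r //; apply: le_trans (ltW NK) _; rewrite ler_nat; exact: ltnW.
have -> : n%:R * f n = nm (n%:R * cps R e n) * r ^+ n by rewrite nmM nm_nat mulrA.
have -> : n%:R * cps R e n = 24 * (cps R (divsum 1) * cps R e) n.
  have := congr1 (fun g : ps int => (g n)%:~R : Cplx R) he.
  rewrite /psD1 -mulrA psMnl -cpsM /cps !intrM => <-.
  by rewrite (rmorph_nat intr).
rewrite nmM (nm_nat R 24) -mulrA /K -[in leRHS]mulrA ler_wpM2l // psM.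
apply: le_trans (ler_wpM2r (exprn_ge0 n (ltW r0)) (nm_sum _ _ _)) _.
apply: le_trans (ler_wpM2r B0 (ler_wpM2l A0 (geom_sum_le 0 n.+1 t0 t1))).
rewrite (big_mkord xpredT (fun i => t ^+ i)) mulr_sumr !mulr_suml.
apply: ler_sum => i _.
have iE : (i <= n)%N by have := ltn_ord i; lia.
have -> : nm (cps R (divsum 1) i * cps R e (n - i)%N) * r ^+ n =
    (nm (cps R (divsum 1) i) * r ^+ i) * f (n - i)%N.
  by rewrite /f nmM mulrACA -exprD subnKC.
have [i0|i0] := posnP i.
  have -> : cps R (divsum 1) i = 0 by rewrite i0.
  by rewrite nm0 !mul0r !mulr_ge0 // exprn_ge0 // ltW.
apply: ler_pM => //; first by rewrite mulr_ge0 ?nm_ge0 // exprn_ge0 // ltW.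
apply: IH; lia.
Qed.

Lemma modular_T (R : realType) k (F : Cplx R -> Cplx R) : weakly_modular k F ->
  forall z, 0 < complex.Im z -> F (z + 1) = F z.
Proof.
move=> h z z0; have := h 1 1 0 1 erefl z z0.
by rewrite !mul1r mul0r add0r divr1 expr1n mul1r.
Qed.

Lemma modular_S (R : realType) k (F : Cplx R -> Cplx R) : weakly_modular k F ->
  forall z, 0 < complex.Im z -> F (- z^-1) = z ^+ k * F z.
Proof.
move=> h z z0; have := h 0 (-1) 1 0 erefl z z0.
by rewrite mul0r mul1r add0r addr0 mulN1r.
Qed.

Lemma Im_invN (R : realType) (z : Cplx R) : complex.Im (- z^-1) = complex.Im z / nm z ^+ 2.
Proof. by case: z => x y; rewrite nm_sqr /= opprK. Qed.

Lemma Im_invN_gt0 (R : realType) (z : Cplx R) : 0 < complex.Im z -> 0 < complex.Im (- z^-1).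
Proof.
move=> z0; rewrite Im_invN divr_gt0 // exprn_gt0 // nm_gt0; apply/eqP => ze.
by move: z0; rewrite ze ltxx.
Qed.

(* Below height 1/2, a translation followed by z -> -1/z at least doubles Im z. *)
Lemma reduction (R : realType) (P : Cplx R -> Prop) :
  (forall z, 0 < complex.Im z -> P (z + 1) -> P z) ->
  (forall z, 0 < complex.Im z -> P z -> P (z + 1)) ->
  (forall z, 0 < complex.Im z -> P (- z^-1) -> P z) ->
  (forall z, 2^-1 <= complex.Im z -> P z) ->
  forall z, 0 < complex.Im z -> P z.
Proof.
move=> T1 T2 S hP.
have Tn z (n : nat) : 0 < complex.Im z -> P (z + n%:R) -> P z.
  move=> z0; elim: n => [|n IH]; first by rewrite addr0.
  move=> h; apply: IH; apply: T1; last by rewrite -addrA natr1.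
  by rewrite raddfD /= -(rmorph_nat (real_complex R)) /= addr0.
have Tn' z (n : nat) : 0 < complex.Im z -> P (z - n%:R) -> P z.
  move=> z0; elim: n => [|n IH]; first by rewrite subr0.
  move=> h; apply: IH.
  have -> : z - n%:R = (z - n.+1%:R) + 1 by rewrite -natr1; ring.
  apply: T2 => //.
  by rewrite raddfB /= -(rmorph_nat (real_complex R)) /= subr0.
have Tz z (n : int) : 0 < complex.Im z -> P (z + n%:~R) -> P z.
  move=> z0; case: n => n; first exact: Tn.
  by rewrite NegzE mulrNz; apply: Tn'.
suff main n z : 0 < complex.Im z -> 1 <= complex.Im z * 2 ^+ n.+1 -> P z.
  move=> z z0; apply: (main (Num.Def.archi_bound (complex.Im z)^-1)) => //.
  have i0 : 0 < (complex.Im z)^-1 by rewrite invr_gt0.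
  rewrite -ler_pdivrMl // mulr1; apply: le_trans (ltW (archi_boundP (ltW i0))) _.
  by rewrite -natrX ler_nat; apply: leq_trans (ltnW (ltn_expl _ (isT : 1 < 2)%N)) _;
    rewrite leq_exp2l.
elim: n z => [|n IH] z z0 hz.
  by apply: hP; rewrite -[2^-1]mul1r ler_pdivrMr.
have [y2|y2] := leP 2^-1 (complex.Im z); first exact: hP.
(* The translate w has |Re w| <= 1/2 and Im w < 1/2, so |w|^2 <= 1/2 and Im(-1/w) >= 2 Im w. *)
pose m := Num.floor (complex.Re z + 2^-1); apply: (Tz z (- m)) => //.
set w := z + _; have wi : complex.Im w = complex.Im z.
  by rewrite raddfD /= -(rmorph_int (real_complex R)) /= addr0.
have wr : complex.Re w = complex.Re z - m%:~R.
  by rewrite raddfD /= -(rmorph_int (real_complex R)) /= mulrNz.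
apply: S; first by rewrite wi.
apply: IH; first by apply: Im_invN_gt0; rewrite wi.
have w0 : w != 0 by apply/eqP => we; move: z0; rewrite -wi we ltxx.
rewrite Im_invN wi mulrAC ler_pdivlMr ?exprn_gt0 ?nm_gt0 // mul1r.
have nw : nm w ^+ 2 <= 2^-1.
  rewrite nm_sqr wi wr; have := floor_le_tmp (complex.Re z + 2^-1);
    have := floorD1_gt (complex.Re z + 2^-1).
  rewrite -/m intrD => h1 h2; set x := complex.Re z in h1 h2 *;
    set y := complex.Im z in y2 z0 *.
  have : 0 <= (x - m%:~R + 2^-1) * (2^-1 - (x - m%:~R)) by apply: mulr_ge0; lra.
  have : 0 <= y * (2^-1 - y) by apply: mulr_ge0; lra.
  lra.
apply: le_trans nw _; move: hz; rewrite exprS; lra.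
Qed.

Lemma conv_unit_neq0 (R : realType) (e f : ps int) k : f * e = psX int k ->
  tame (cps R f) -> tame (cps R e) -> forall (q l : Cplx R), nm q < 1 -> q != 0 ->
    conv (cps R f) q l -> l != 0.
Proof.
move=> fe tf te q l q1 q0 hl; have [l' hl'] := tame_conv te q1.
have := convM tf te q1 hl hl'; rewrite -cpsM fe cps_X => /conv_unique /(_ (conv_psX k q)) e0.
by apply/eqP => l0; move: e0; rewrite l0 mul0r => /esym /eqP; rewrite expf_eq0 (negPf q0) andbF.
Qed.

Lemma Mk_has_series (R : realType) k (a : ps int) : Mk_int R k a -> exists F,
  [/\ holomorphic_on_H F, weakly_modular k F & has_qexp F (cps R a)].
Proof. by []. Qed.

Lemma psX_div (f : ps int) v : (forall n, (n < v)%N -> f n = 0) -> exists g, f = psX int v * g.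
Proof.
move=> h; exists (fun n => f (n + v)%N); apply: funext => n; rewrite psXM.
by case: leqP => [vn|/h //]; rewrite subnK.
Qed.

Lemma three_le_expR (R : realType) (x : R) : 3 / 2 <= x -> 3 <= expR x.
Proof.
move=> hx; have -> : expR x = expR (x / 2) ^+ 2 by rewrite -expRM_natl mulrC divfK.
have := expR_ge1Dx (x / 2); move: (expR _) => y hy.
have y0 : 7 / 4 <= y by lra.
have : 0 <= (y - 7 / 4) * (y + 7 / 4) by rewrite mulr_ge0; lra.
rewrite expr2; lra.
Qed.

Lemma clear_denominator (K : comPzRingType) (x y e a : K) v k d :
  y * e = 1 -> (12 * v = d + k)%N ->
  x ^+ d * a ^+ 12 * e ^+ k * (x * y) ^+ k = (x ^+ v * a) ^+ 12.
Proof.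
move=> ye vE; rewrite !exprMn -exprM mulnC vE exprD -[RHS]mulr1 -(expr1n _ k) -ye exprMn.
ring.
Qed.

(* The twelfth power of the form divided by Delta ^ k is invariant, has a
   q-expansion without constant term, and so is bounded; its coefficients obey
   the same bound, which is thus improved by a factor 2 on Im z >= 1/2. *)
Lemma vanishing (R : realType) k (a : ps int) : Mk_int R 12 Delta -> Mk_int R k a ->
  (forall n, (12 * n <= k)%N -> a n = 0) -> a = 0.
Proof.
move=> /Mk_has_series[D [_ Dm Dq]] /Mk_has_series[F [_ Fm Fq]] a0.
(* a vanishes to order v, and 12 v > k leaves the positive power d + 1 = 12 v - k of q in the
   quotient g. *)
pose v := (k %/ 12).+1.
have [a' aE] : exists g, a = psX int v * g.
  by apply: psX_div => n nv; apply: a0; move: nv; rewrite /v; lia.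
have [e he] : exists e, eta24 * e = 1 by apply: ps_inverse; exact: Delta_1.
have te := tame_eta_inv (R := R) he.
have tD := has_qexp_tame Dq; have tF := has_qexp_tame Fq.
have ta' : tame (cps R a') by apply: (@tame_shift _ v); rewrite -cps_X -cpsM -aE.
pose d := (12 * v - k.+1)%N; have dE : (12 * v = d + 1 + k)%N by rewrite /d /v; lia.
pose g := psX int (d + 1) * a' ^+ 12 * e ^+ k.
have gE : g * (Delta : ps int) ^+ k = a ^+ 12.
  rewrite /g Delta_eta aE -(psX_exp _ (d + 1)) -(psX_exp _ v).
  exact: clear_denominator he dE.
have tg : tame (cps R g).
  have tX f n : tame (cps R f) -> tame (cps R (f ^+ n)) by rewrite cpsX; apply: tameX.
  rewrite /g cpsM; apply: tameM; last exact: tX.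
  by rewrite cpsM cps_X; apply: tameM; [exact: tame_psX|exact: tX].
have /choice [G hG] : forall z, exists l, 0 < complex.Im z -> conv (cps R g) (nome z) l.
  move=> z; have [z0|z0] := boolP (0 < complex.Im z); last by exists 0.
  by have [l hl] := tame_conv tg (nome_lt1 z0); exists l.
move/has_qexpP: Dq => Dq; move/has_qexpP: Fq => Fq.
have GD z : 0 < complex.Im z -> G z * D z ^+ k = F z ^+ 12.
  move=> z0; have q1 := nome_lt1 z0.
  apply: (@conv_unique _ (cps R (a ^+ 12)) (nome z)).
    by rewrite -gE cpsM cpsX; apply: convM => //; [exact: tameX|exact: hG|apply: convX => //;
      exact: Dq].
  by rewrite cpsX; apply: convX => //; exact: Fq.
have D0 z : 0 < complex.Im z -> D z != 0.
  move=> z0; apply: (conv_unit_neq0 (e := e) (f := Delta) (k := 1) _ tD te (nome_lt1 z0) _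
    (Dq _ z0)).
    by rewrite Delta_eta -mulrA he mulr1.
  by rewrite -nm_gt0 nome_gt0.
have Im1 z : complex.Im (z + 1) = complex.Im z :> R by case: z => x y; rewrite /= addr0.
have GT z : 0 < complex.Im z -> G (z + 1) = G z.
  move=> z0; have z1 : 0 < complex.Im (z + 1) by rewrite Im1.
  apply: (mulIf (expf_neq0 k (D0 _ z1))); rewrite GD // (modular_T Fm) // (modular_T Dm) //.
  by rewrite GD.
have GS z : 0 < complex.Im z -> G (- z^-1) = G z.
  move=> z0; have z1 := Im_invN_gt0 z0; have Dz := expf_neq0 k (D0 _ z1).
  have zn0 : z != 0 by apply/eqP => ze; move: z0; rewrite ze ltxx.
  apply: (mulIf Dz); rewrite GD // (modular_S Fm) // (modular_S Dm) //.
  rewrite (exprMn _ (z ^+ k)) (exprMn _ (z ^+ 12)) -GD // mulrCA; congr (_ * (_ * _)).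
  by rewrite -[LHS]exprM -[RHS]exprM mulnC.
have red (M : R) : (forall z, 2^-1 <= complex.Im z -> nm (G z) <= M) ->
    forall z, 0 < complex.Im z -> nm (G z) <= M.
  move=> hM; apply: reduction => // z z0; rewrite ?GT ?GS //.
have half (z : Cplx R) : 2^-1 <= complex.Im z -> 0 < complex.Im z by apply: lt_le_trans;
  rewrite invr_gt0.
pose rho : R := expR (- pi).
have nmrho z : 2^-1 <= complex.Im z -> nm (nome z) <= rho.
  move=> h; rewrite nm_nome ler_expR lerN2; have := pi_gt0 R; nra.
have [M hM] : exists M, forall z, 0 < complex.Im z -> nm (G z) <= M.
  have rho1 : rho < 1 by rewrite expR_lt1 oppr_lt0 pi_gt0.
  have [A [t [A0 t0 t1 hA]]] := tame_geom tg rho1.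
  exists (A * (t ^+ 0 / (1 - t))); apply: red => z h.
  have := conv_tail A0 t0 t1 (fun n => hA _ n (nmrho z h)) (hG _ (half _ h)) 0.
  by rewrite big_ord0 subr0.
(* From height 1/8 the coefficients are at most M exp(pi n / 4); against |q| <= exp(- pi) on Im z >=
   1/2 this leaves tau = exp(- 3 pi / 4) <= 1/3. Without constant term the sum is at most M tau / (1
   - tau) <= M / 2. *)
have step (N : R) : (forall z, 0 < complex.Im z -> nm (G z) <= N) ->
    forall z, 0 < complex.Im z -> nm (G z) <= N / 2.
  move: N => {hM M} M hM; have M0 : 0 <= M by apply: le_trans (hM ('i)%C ltr01); exact: nm_ge0.
  have y0 : 0 < (8^-1 : R) by rewrite invr_gt0.
  have cg := @cauchy_estimate _ (cps R g) G 8^-1 M y0 tg (fun x =>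
    hG (x +i* 8^-1)%C y0) (fun x => hM (x +i* 8^-1)%C y0).
  pose tau : R := expR (- (3 / 4 * pi)).
  have tau3 : tau <= 3^-1.
    rewrite /tau expRN lef_pV2 ?posrE ?expR_gt0 //; apply: three_le_expR.
    by have := pi_ge2 R; lra.
  have tau0 : 0 < tau by exact: expR_gt0.
  have tau1 : tau < 1 by lra.
  apply: red => z h.
  have gt n : nm (cps R g n * nome z ^+ n) <= M * tau ^+ n.
    rewrite nmM nmX; have := cg n; set c := nm (cps R g n) => hc.
    have c0 : 0 <= c := nm_ge0 _.
    have -> : tau ^+ n = (expR (- (2 * pi * 8^-1)))^-1 ^+ n * rho ^+ n.
      rewrite -exprMn /tau /rho -expRN -expRD; congr (expR _ ^+ n); lra.
    rewrite mulrA; apply: ler_pM => //; rewrite ?exprn_ge0 ?nm_ge0 //.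
      by rewrite exprVn ler_pdivlMr // exprn_gt0 // expR_gt0.
    by rewrite lerXn2r ?nnegrE ?nm_ge0 ?expR_ge0 ?nmrho.
  have := conv_tail M0 tau0 tau1 gt (hG _ (half _ h)) 1.
  have -> : \sum_(n < 1) cps R g n * nome z ^+ n = 0.
    by rewrite big_ord1 /cps /g -mulrA psXM addn1 mul0r.
  rewrite subr0 expr1 => /le_trans; apply; rewrite ler_wpM2l //.
  by rewrite ler_pdivrMr ?subr_gt0 //; lra.
have G0 z : 0 < complex.Im z -> G z = 0.
  move=> z0; have hj j : nm (G z) <= M * 2^-1 ^+ j.
    elim: j z z0 => [|j IH] z z0; first by rewrite expr0 mulr1 hM.
    by rewrite exprSr mulrA; apply: step.
  have M0 : 0 <= M by apply: le_trans (hM _ z0); exact: nm_ge0.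
  have h2 : null (fun j => M * 2^-1 ^+ j) by apply: nullZ => //; apply: null_geom; lra.
  by apply/eqP; rewrite -nm_eq0 eq_le nm_ge0 (null_le0 h2 hj).
apply: (@cps_eq0 R); apply: (qexp_zero (F := F)); first exact/has_qexpP.
move=> z z0; have := GD _ z0; rewrite G0 // mul0r => /esym /eqP.
by rewrite expf_eq0 => /andP[_ /eqP].
Qed.

(** * Modularity of the Eisenstein series *)

Lemma sin_pi_ge (R : realType) (x : R) : 0 <= x -> x <= 3 / 4 ->
  pi * cos (3 / 8 * pi) ^+ 2 * x <= sin (pi * x).
Proof.
move=> x0 x1; have p0 := pi_gt0 R.
have [<-|x0'] := eqVneq 0 x; first by rewrite !mulr0 sin0.
have {x0 x0'} x0 : 0 < x by rewrite lt_neqAle x0' x0.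
pose phi := pi * x / 2; have ph0 : 0 < phi by rewrite /phi divr_gt0 // mulr_gt0.
have ph1 : phi <= 3 / 8 * pi by rewrite /phi; nra.
have c0 : 0 < cos (3 / 8 * pi : R) by apply: cos_gt0_pihalf; apply/andP; split; lra.
have mono c : 0 <= c -> c <= phi -> cos (3 / 8 * pi) <= cos c.
  move=> c1 c2; rewrite leNgt ltr_cos ?in_itv /=; [|apply/andP; split; lra|apply/andP; split;
    lra].
  by rewrite -leNgt (le_trans c2).
have -> : pi * x = phi *+ 2 by rewrite -mulr_natr /phi divfK.
rewrite sin_mulr2n mulr2n; have [c /andP[c1 c2] ->] := sin_mvt ph0.
have h1 := mono c (ltW c1) (ltW c2); have h2 := mono phi (ltW ph0) (lexx _).
have : cos (3 / 8 * pi) ^+ 2 <= cos phi * cos c.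
  by rewrite expr2; apply: ler_pM => //; exact: ltW.
have -> : pi * cos (3 / 8 * pi) ^+ 2 * x = 2 * phi * cos (3 / 8 * pi) ^+ 2.
  by rewrite /phi; field.
move=> h; have := ler_wpM2l (ltW ph0) h; lra.
Qed.

(** w = 0 is the only zero of 1 - nome w in this rectangle; the width 3/4 leaves a margin over 1/2
    for the perturbation by z in [lipschitz]. The proof rests on |1 - nome w|^2 = (1 - r)^2 + 4 r
    sin(pi x)^2 with r = |nome w|. *)
Lemma one_minus_nome (R : realType) : exists2 c : R, 0 < c & forall w : Cplx R,
  `|complex.Re w| <= 3 / 4 -> 0 <= complex.Im w <= 1 -> c * nm w <= nm (1 - nome w).
Proof.
have p0 := pi_gt0 R.
have k0 : 0 < cos (3 / 8 * pi : R) by apply: cos_gt0_pihalf; apply/andP; split; lra.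
pose al : R := 2 * pi / (1 + 2 * pi); have al0 : 0 < al by rewrite /al divr_gt0; lra.
pose r1 : R := expR (- (2 * pi)); have r10 : 0 < r1 by exact: expR_gt0.
pose s1 : R := pi * cos (3 / 8 * pi) ^+ 2.
have s10 : 0 < s1 by rewrite mulr_gt0 // exprn_gt0.
pose d : R := Num.min (al ^+ 2) (4 * r1 * s1 ^+ 2).
have d0 : 0 < d by rewrite lt_min exprn_gt0 // !mulr_gt0 // exprn_gt0.
exists (Num.sqrt d); first by rewrite sqrtr_gt0.
case=> x y hx hy; have {}hx : `|x| <= 3 / 4 := hx; have {hy} /andP[y0 y1] : 0 <= y <= 1 := hy.
rewrite -(@ler_pXn2r _ 2) ?nnegrE ?nm_ge0 ?mulr_ge0 ?sqrtr_ge0 ?nm_ge0 //.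
rewrite exprMn sqr_sqrtr ?(ltW d0) // !nm_sqr.
set r := expR (- (2 * pi * y)); set th := 2 * pi * x.
have -> : complex.Re (1 - nome (x +i* y)%C) = 1 - r * cos th by [].
have -> : complex.Im (1 - nome (x +i* y)%C) = - (r * sin th) by rewrite /= sub0r.
have -> : complex.Re (x +i* y)%C = x by [].
have -> : complex.Im (x +i* y)%C = y by [].
have -> : (1 - r * cos th) ^+ 2 + (- (r * sin th)) ^+ 2 =
  (1 - r) ^+ 2 + 4 * r * sin (pi * x) ^+ 2.
  have e1 : cos th = 1 - 2 * sin (pi * x) ^+ 2.
    have -> : th = (pi * x) *+ 2 by rewrite mulr2n /th; ring.
    by rewrite cos_mulr2n mulr2n; have := cos2Dsin2 (pi * x); lra.
  have e2 : sin th ^+ 2 = 1 - cos th ^+ 2 by have := cos2Dsin2 th; lra.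
  by rewrite sqrrN exprMn e2 e1; ring.
have rr1 : r1 <= r by rewrite ler_expR; nra.
have h1 : al * y <= 1 - r.
  have := expR_ge1Dx (2 * pi * y); have m1 := expRxMexpNx_1 (2 * pi * y); rewrite -/r in m1.
  have r0 : 0 < r by exact: expR_gt0.
  move=> h; have h2 := ler_wpM2r (ltW r0) h; rewrite m1 in h2.
  have e : al * (1 + 2 * pi) = 2 * pi by rewrite /al divfK // gt_eqF //; lra.
  have f1 : 0 <= al * (1 + 2 * pi - (1 + 2 * pi * y)) by rewrite mulr_ge0 ?(ltW al0) //; nra.
  have f2 : 0 <= y * al by rewrite mulr_ge0 // ltW.
  have y2 : 0 < 1 + 2 * pi * y by nra.
  rewrite -(ler_pM2r y2); nra.
have h2 : (s1 * x) ^+ 2 <= sin (pi * x) ^+ 2.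
  rewrite -[(s1 * x) ^+ 2](real_normK (num_real _)) -[sin _ ^+ 2](real_normK (num_real _)).
  rewrite lerXn2r ?nnegrE //; have [x0|x0] := leP 0 x.
    have h := sin_pi_ge x0 (le_trans (ler_norm x) hx).
    rewrite ger0_norm; last by rewrite mulr_ge0 // ltW.
    by apply: le_trans h _; exact: ler_norm.
  have xn : 0 <= - x by rewrite oppr_ge0 ltW.
  have xh : - x <= 3 / 4 by apply: le_trans hx; rewrite -normrN ler_norm.
  have h := sin_pi_ge xn xh; rewrite (mulrN pi) sinN in h.
  rewrite -normrN -mulrN -[leRHS]normrN ger0_norm; last by rewrite mulr_ge0 // ltW.
  by apply: le_trans h _; rewrite /s1 ler_norm.
have g1 : (al * y) ^+ 2 <= (1 - r) ^+ 2.
  have ay : 0 <= al * y by rewrite mulr_ge0 // ltW.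
  by rewrite lerXn2r ?nnegrE // (le_trans ay).
have d1 : d <= al ^+ 2 by rewrite ge_min lexx.
have d2 : d <= 4 * r1 * s1 ^+ 2 by rewrite ge_min lexx orbT.
rewrite mulrDr addrC; apply: lerD.
  by apply: le_trans g1; rewrite exprMn ler_wpM2r ?sqr_ge0.
apply: (@le_trans _ _ (4 * r * (s1 * x) ^+ 2)).
  have x2 : 0 <= x ^+ 2 by exact: sqr_ge0.
  apply: le_trans (ler_wpM2r x2 d2) _.
  have -> : 4 * r * (s1 * x) ^+ 2 = 4 * r * s1 ^+ 2 * x ^+ 2 by ring.
  by apply: ler_wpM2r => //; apply: ler_wpM2r; [exact: sqr_ge0|exact: ler_wpM2l].
by rewrite ler_wpM2l // mulr_ge0 // expR_ge0.
Qed.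

(* (2 pi i)^2 q / (1 - q)^2 is the sum of the (z + n)^-2; [lip4] and [lip6] are
   obtained from it by differentiation in z. *)
Definition lip_Y (R : realType) (q : Cplx R) : Cplx R := tpi R ^+ 2 * (q / (1 - q) ^+ 2).

Lemma near1_mul (R : realType) (a b : Cplx R) (A B t : R) : 0 <= t -> t <= 2 -> 0 <= A ->
  0 <= B ->
  nm (a - 1) <= A * t -> nm (b - 1) <= B * t -> nm (a * b - 1) <= (A * (2 * B + 1) + B) * t.
Proof.
move=> t0 t2 A0 B0 ha hb.
have -> : a * b - 1 = (a - 1) * b + (b - 1) by ring.
apply: le_trans (nmD _ _) _; rewrite nmM mulrDl; apply: lerD => //.
have nb : nm b <= 2 * B + 1.
  have := nmD (b - 1) 1; rewrite subrK nm1; have : B * t <= B * 2 by rewrite ler_wpM2l.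
  lra.
apply: le_trans (_ : (A * t) * (2 * B + 1) <= _); last by rewrite mulrAC.
by apply: ler_pM; rewrite ?nm_ge0.
Qed.

Lemma lip_Y_est (R : realType) : exists2 K : R, 0 <= K & forall w : Cplx R, w != 0 ->
  `|complex.Re w| <= 3 / 4 -> 0 <= complex.Im w <= 1 ->
  nm (w ^+ 2 * lip_Y (nome w) - 1) <= K * nm w.
Proof.
have [c c0 hc] := one_minus_nome R; have p0 := pi_gt0 R.
pose E : R := 4 * (2 * pi) ^+ 2 * expR (2 * pi * 2).
have E0 : 0 <= E by rewrite !mulr_ge0 ?sqr_ge0 ?expR_ge0 ?(ltW p0).
pose B := E / c; have B0 : 0 <= B by rewrite divr_ge0 // ltW.
pose K1 := B * (2 * B + 1) + B.
have K10 : 0 <= K1 by rewrite /K1; nra.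
exists (K1 + 2 * pi * (2 * B + 1)) => [|w w0 hx hy].
  by rewrite addr_ge0 // !mulr_ge0 ?(ltW p0) //; lra.
have t2 : nm w <= 2.
  apply: le_trans (nm_le w) _; move: hy => /andP[y0 y1]; rewrite (ger0_norm y0); lra.
have t0 := nm_ge0 w; have tp : 0 < nm w by rewrite nm_gt0.
set q := nome w; have hq : c * nm w <= nm (1 - q) by exact: hc.
have q1 : 1 - q != 0 by rewrite -nm_gt0; apply: lt_le_trans hq; rewrite mulr_gt0.
(* v tends to 1 at w = 0, and w^2 Y = v^2 q = v^2 + 2 pi i w v because v (1 - q) = - 2 pi i w. *)
pose v := - (tpi R * w / (1 - q)).
have hv : nm (v - 1) <= B * nm w.
  have -> : v - 1 = (q - 1 - tpi R * w) / (1 - q) by rewrite /v; field.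
  rewrite nmM nmV ler_pdivrMr ?nm_gt0 //; apply: le_trans (nome_est w) _.
  apply: (@le_trans _ _ (B * nm w * (c * nm w))); last by rewrite ler_wpM2l // mulr_ge0.
  have -> : B * nm w * (c * nm w) = E * nm w ^+ 2 by rewrite /B; field; exact: lt0r_neq0.
  have e : expR (2 * pi * nm w) <= expR (2 * pi * 2) by rewrite ler_expR ler_wpM2l //
    mulr_ge0 // ltW.
  have -> : E * nm w ^+ 2 = 4 * (2 * pi * nm w) ^+ 2 * expR (2 * pi * 2) by rewrite /E; ring.
  by rewrite ler_wpM2l // mulr_ge0 // sqr_ge0.
have -> : w ^+ 2 * lip_Y q - 1 = (v * v - 1) + tpi R * w * v.
  by rewrite /lip_Y /v; field.
have nv : nm v <= 2 * B + 1.
  have := nmD (v - 1) 1; rewrite subrK nm1; have : B * nm w <= B * 2 by rewrite ler_wpM2l.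
  lra.
apply: le_trans (nmD _ _) _; rewrite mulrDl; apply: lerD; first exact: near1_mul.
by rewrite !nmM nm_tpi mulrAC ler_wpM2r // ler_wpM2l // mulr_ge0 // ltW.
Qed.

Lemma nm_near1 (R : realType) (a : Cplx R) (A t : R) : t <= 2 -> 0 <= A ->
  nm (a - 1) <= A * t -> nm a <= 2 * A + 1.
Proof.
move=> t2 A0 h; have := nmD (a - 1) 1; rewrite subrK nm1;
  have : A * t <= A * 2 by rewrite ler_wpM2l.
lra.
Qed.

Definition lip4 (R : realType) (q : Cplx R) : Cplx R :=
  lip_Y q ^+ 2 + tpi R ^+ 2 / 6 * lip_Y q.
Definition lip6 (R : realType) (q : Cplx R) : Cplx R :=
  lip_Y q ^+ 3 + tpi R ^+ 2 / 4 * lip_Y q ^+ 2 + tpi R ^+ 4 / 120 * lip_Y q.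

(** Near w = 0, H(nome w) is w^-k with relative error O(|w|). This and [lip_dup] are all that
    [lipschitz] uses of H. *)
Definition lip_est (R : realType) k (H : Cplx R -> Cplx R) :=
  exists2 K : R, 0 <= K & forall w : Cplx R, w != 0 ->
  `|complex.Re w| <= 3 / 4 -> 0 <= complex.Im w <= 1 ->
  nm (w ^+ k * H (nome w) - 1) <= K * nm w.
(** The relation between the sums of (z + n)^-k at z/2, (z + 1)/2 and z, whose nomes are r, -r and
    r^2. *)
Definition lip_dup (R : realType) k (H : Cplx R -> Cplx R) := forall r : Cplx R, r ^+ 2 != 1 ->
  H r + H (- r) = 2 ^+ k * H (r ^+ 2).

Lemma nm_le2 (R : realType) (w : Cplx R) : `|complex.Re w| <= 3 / 4 ->
  0 <= complex.Im w <= 1 -> nm w <= 2.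
Proof.
move=> hx /andP[y0 y1]; apply: le_trans (nm_le w) _; rewrite (ger0_norm y0); lra.
Qed.

Lemma lip4_est (R : realType) : lip_est 4 (@lip4 R).
Proof.
have [K K0 hK] := lip_Y_est R; pose L := nm (tpi R ^+ 2 / 6).
have L0 : 0 <= L := nm_ge0 _.
exists ((K * (2 * K + 1) + K) + L * (2 * K + 1) * 2) => [|w w0 hx hy]; first by nra.
have h := hK w w0 hx hy; have t0 := nm_ge0 w; have t2 := nm_le2 hx hy.
set y := lip_Y (nome w) in h; have nb := nm_near1 t2 K0 h.
have -> : w ^+ 4 * lip4 (nome w) - 1 = (w ^+ 2 * y * (w ^+ 2 * y) - 1) +
  tpi R ^+ 2 / 6 * (w ^+ 2 * y) * w * w.
  by rewrite /lip4 -/y; ring.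
apply: le_trans (nmD _ _) _; rewrite mulrDl; apply: lerD; first exact: near1_mul.
rewrite 3!nmM -/L; apply: ler_pM; rewrite ?nm_ge0 // ?mulr_ge0 ?nm_ge0 //.
by apply: ler_pM; rewrite ?nm_ge0 // ?mulr_ge0 ?nm_ge0 // ler_wpM2l.
Qed.

Lemma lip6_est (R : realType) : lip_est 6 (@lip6 R).
Proof.
have [K K0 hK] := lip_Y_est R; pose L := nm (tpi R ^+ 2 / 4); pose M := nm (tpi R ^+ 4 / 120).
have L0 : 0 <= L := nm_ge0 _; have M0 : 0 <= M := nm_ge0 _.
pose K2 := K * (2 * K + 1) + K; have K20 : 0 <= K2 by rewrite /K2; nra.
pose K3 := K2 * (2 * K + 1) + K; have K30 : 0 <= K3 by rewrite /K3; nra.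
exists (K3 + L * (2 * K2 + 1) * 2 + M * (2 * K + 1) * 8) => [|w w0 hx hy].
  by rewrite !addr_ge0 // !mulr_ge0 // addr_ge0 // mulr_ge0.
have h := hK w w0 hx hy; have t0 := nm_ge0 w; have t2 := nm_le2 hx hy.
set y := lip_Y (nome w) in h; have nb := nm_near1 t2 K0 h.
have h2 := near1_mul t0 t2 K0 K0 h h; have nb2 := nm_near1 t2 K20 h2.
have h3 := near1_mul t0 t2 K20 K0 h2 h.
have -> : w ^+ 6 * lip6 (nome w) - 1 = (w ^+ 2 * y * (w ^+ 2 * y) * (w ^+ 2 * y) - 1) +
   tpi R ^+ 2 / 4 * (w ^+ 2 * y * (w ^+ 2 * y)) * w * w +
     tpi R ^+ 4 / 120 * (w ^+ 2 * y) * (w ^+ 3) * w.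
  by rewrite /lip6 -/y; ring.
apply: le_trans (nmD _ _) _; rewrite mulrDl; apply: lerD.
  apply: le_trans (nmD _ _) _; rewrite mulrDl; apply: lerD; first exact: h3.
  rewrite 3!nmM -/L; apply: ler_pM; rewrite ?nm_ge0 // ?mulr_ge0 ?nm_ge0 //.
  by apply: ler_pM; rewrite ?nm_ge0 // ?mulr_ge0 ?nm_ge0 // ler_wpM2l.
rewrite 3!nmM -/M; apply: ler_pM; rewrite ?nm_ge0 // ?mulr_ge0 ?nm_ge0 //.
apply: ler_pM; rewrite ?nm_ge0 // ?mulr_ge0 ?nm_ge0 // ?ler_wpM2l //.
have -> : 8 = 2 ^+ 3 :> R by ring.
by rewrite nmX lerXn2r ?nnegrE.
Qed.

Lemma lip_dup_aux (R : realType) (r : Cplx R) : r ^+ 2 != 1 -> 1 - r != 0 /\ 1 + r != 0.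
Proof.
move=> h; split; apply/eqP => e; move/eqP: h; apply.
  by move/eqP: e; rewrite subr_eq0 => /eqP <-; rewrite expr1n.
by move/eqP: e; rewrite addrC addr_eq0 => /eqP ->; rewrite sqrrN expr1n.
Qed.

Lemma lip4_dup (R : realType) : lip_dup 4 (@lip4 R).
Proof.
move=> r r1; have [a b] := lip_dup_aux r1.
have c : 1 - r ^+ 2 != 0 by rewrite subr_eq0 eq_sym.
by rewrite /lip4 /lip_Y opprK; field; rewrite a b c.
Qed.

Lemma lip6_dup (R : realType) : lip_dup 6 (@lip6 R).
Proof.
move=> r r1; have [a b] := lip_dup_aux r1.
have c : 1 - r ^+ 2 != 0 by rewrite subr_eq0 eq_sym.
by rewrite /lip6 /lip_Y opprK; field; rewrite a b c.
Qed.

Lemma nome_half (R : realType) : nome (2^-1 : Cplx R) = -1.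
Proof.
have -> : 2^-1 = (2^-1)%:C%C :> Cplx R by rewrite fmorphV /= (rmorph_nat (real_complex R)).
apply/eqP; rewrite eq_complex /nome /= mulr0 oppr0 expR0 !mul1r.
have -> : 2 * pi / 2 = pi :> R by field.
by rewrite cospi sinpi !eqxx.
Qed.

Lemma lip_iter (R : realType) k (H : Cplx R -> Cplx R) (z : Cplx R) n : lip_dup k H ->
  nome z != 1 ->
  2 ^+ (k * n) * H (nome z) = \sum_(j < 2 ^ n) H (nome ((z + j%:R) / 2 ^+ n)).
Proof.
move=> hd z1; have nz (j i : nat) : nome ((z + j%:R) / 2 ^+ i) ^+ (2 ^ i) = nome z.
  rewrite -nomeMn natrX mulrC divfK ?expf_neq0 ?pnatr_eq0 //.
  by rewrite nomeD nome_nat mulr1.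
have n1 (j i : nat) : nome ((z + j%:R) / 2 ^+ i) != 1.
  by apply/eqP => e; move: (nz j i); rewrite e expr1n => /esym/eqP; apply/negP.
elim: n => [|n IH]; first by rewrite muln0 expr0 mul1r big_ord1 addr0 divr1.
rewrite mulnS exprD -mulrA IH mulr_sumr.
have e2 : (2 ^ n.+1 = 2 ^ n + 2 ^ n)%N by rewrite expnS mul2n addnn.
rewrite e2 big_split_ord -[RHS]big_split /=; apply: eq_bigr => j _.
set r := nome ((z + j%:R) / 2 ^+ n.+1).
have r2 : r ^+ 2 = nome ((z + j%:R) / 2 ^+ n).
  by rewrite -nomeMn exprS; congr nome; field; rewrite expf_neq0 // pnatr_eq0.
rewrite -r2 -hd; last by rewrite r2.
congr (_ + H _); rewrite -[- r]mulN1r -(nome_half R) -nomeD; congr nome.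
by rewrite natrD natrX exprS; field; rewrite expf_neq0 // pnatr_eq0.
Qed.

(** The integers from -M to M - 1: for M = 2^n their number 2^(n+1) is that of the terms in the
    iterated duplication formula. *)
Definition window (R : realType) (M : nat) (f : int -> Cplx R) : Cplx R :=
  \sum_(j < 2 * M) f (j%:Z - M%:Z).

Lemma window_index M (j : 'I_(2 * M)) : `|j%:Z - M%:Z| <= M%:Z.
Proof. by have := ltn_ord j; lia. Qed.

Lemma window_S (R : realType) M (f : int -> Cplx R) :
  window M.+1 f = window M f + f M%:Z + f (- M.+1%:Z).
Proof.
rewrite /window mulnS add2n big_ord_recl big_ord_recr /= [RHS]addrC; congr (_ + (_ + _)).
- by congr f; lia.
- by apply: eq_bigr => i _; congr f; rewrite /bump /=; lia.
- by congr f; rewrite /bump /=; lia.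
Qed.

(** The terms of index L and -(L + 1) are each bounded by 4 K (1/(L + 1) - 1/(L + 2)), which
    telescopes. *)
Lemma window_tail (R : realType) (f : int -> Cplx R) (K : R) M N : 0 <= K ->
  (forall i : int, (M <= `|i|)%N -> nm (f i) <= K / (1 + i%:~R ^+ 2)) -> (M <= N)%N ->
  nm (window N f - window M f) <= 8 * K / M.+1%:R.
Proof.
move=> K0 hf MN; apply: (@le_trans _ _ (8 * K * (M.+1%:R^-1 - N.+1%:R^-1))); last first.
  by apply: ler_wpM2l; [rewrite mulr_ge0|rewrite gerBl invr_ge0 ler0n].
have -> : N = (M + (N - M))%N by lia.
elim: (N - M)%N => [|d IH]; first by rewrite addn0 !subrr nm0 mulr0.
rewrite addnS window_S; set L := (M + d)%N in IH *.
have -> : window L f + f L%:Z + f (- L.+1%:Z) - window M f =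
  window L f - window M f + f L%:Z + f (- L.+1%:Z) by ring.
apply: le_trans (nmD _ _) _; apply: le_trans (lerD (nmD _ _) (lexx _)) _.
have h1 := hf L%:Z ltac:(rewrite /L; lia); have h2 := hf (- L.+1%:Z) ltac:(rewrite /L; lia).
have x0 : (0 : R) <= L%:R by rewrite ler0n.
have e1 : L.+1%:R = L%:R + 1 :> R by rewrite natr1.
have e2 : L.+2%:R = L%:R + 2 :> R by rewrite -addn2 natrD.
have -> : 8 * K * (M.+1%:R^-1 - L.+2%:R^-1) =
  8 * K * (M.+1%:R^-1 - L.+1%:R^-1) + 8 * K * (L.+1%:R^-1 - L.+2%:R^-1) by ring.
have b1 : nm (f L%:Z) <= 4 * K * (L.+1%:R^-1 - L.+2%:R^-1).
  apply: le_trans h1 _; rewrite -pmulrn e1 e2; set x : R := L%:R in x0 *.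
  have p1 : 0 < x + 1 by lra. have p2 : 0 < x + 2 by lra. have p3 : 0 < 1 + x ^+ 2 by nra.
  have -> : 4 * K * ((x + 1)^-1 - (x + 2)^-1) = K * (4 / ((x + 1) * (x + 2))).
    by field; rewrite !lt0r_neq0.
  rewrite ler_wpM2l // -[(1 + _)^-1]div1r ler_pdivrMr // mulrAC ler_pdivlMr ?mulr_gt0 //; nra.
have b2 : nm (f (- L.+1%:Z)) <= 4 * K * (L.+1%:R^-1 - L.+2%:R^-1).
  apply: le_trans h2 _; rewrite mulrNz sqrrN -pmulrn e1 e2; set x : R := L%:R in x0 *.
  have p1 : 0 < x + 1 by lra. have p2 : 0 < x + 2 by lra. have p3 : 0 < 1 + (x + 1) ^+ 2 by nra.
  have -> : 4 * K * ((x + 1)^-1 - (x + 2)^-1) = K * (4 / ((x + 1) * (x + 2))).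
    by field; rewrite !lt0r_neq0.
  rewrite ler_wpM2l // -[(1 + _)^-1]div1r ler_pdivrMr // mulrAC ler_pdivlMr ?mulr_gt0 //; nra.
have -> : 8 * K * (L.+1%:R^-1 - L.+2%:R^-1) =
  4 * K * (L.+1%:R^-1 - L.+2%:R^-1) + 4 * K * (L.+1%:R^-1 - L.+2%:R^-1) by ring.
rewrite addrA; exact: lerD (lerD IH b1) b2.
Qed.

Lemma int_nm_le (R : realType) (z : Cplx R) (x : int) (ka : R) k : (2 <= k)%N -> 0 < ka ->
  ka * (1 + x%:~R ^+ 2) <= nm (z + x%:~R) ^+ 2 ->
  nm ((z + x%:~R) ^- k) <= Num.sqrt ka ^- (k - 2) * (ka^-1 / (1 + x%:~R ^+ 2)).
Proof.
move=> k2 ka0 h; set w := z + _ in h *; have x2 : 0 <= x%:~R ^+ 2 :> R by exact: sqr_ge0.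
have p1 : 0 < 1 + x%:~R ^+ 2 :> R by lra.
have w2 : ka <= nm w ^+ 2 by apply: le_trans h; rewrite ler_peMr ?(ltW ka0) //; lra.
have w0 : 0 < nm w ^+ 2 by apply: lt_le_trans w2.
have wp : 0 < nm w by rewrite lt0r nm_ge0 andbT; apply/eqP => e; move: w0;
  rewrite e expr0n ltxx.
have sw : Num.sqrt ka <= nm w by rewrite -(ger0_norm (nm_ge0 w)) -sqrtr_sqr ler_wsqrtr.
have s0 : 0 < Num.sqrt ka by rewrite sqrtr_gt0.
rewrite nmV nmX; have {1}-> : k = (k - 2 + 2)%N by lia.
rewrite exprD invfM; apply: ler_pM; rewrite ?invr_ge0 ?exprn_ge0 ?nm_ge0 //.
  by rewrite lef_pV2 ?posrE ?exprn_gt0 // lerXn2r ?nnegrE // ltW.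
by rewrite -invfM lef_pV2 ?posrE ?mulr_gt0.
Qed.

(* Iterating the duplication formula n + 1 times expresses [H (nome z)] through
   the values of [H] near its pole at 1, where it is known up to a relative error. *)
Lemma lipschitz (R : realType) k (H : Cplx R -> Cplx R) (z : Cplx R) (ka : R) : (3 <= k)%N ->
  lip_dup k H -> lip_est k H -> nome z != 1 -> 0 <= complex.Im z -> 0 < ka ->
  (forall i : int, ka * (1 + i%:~R ^+ 2) <= nm (z + i%:~R) ^+ 2) ->
  lim_to (fun n => window (2 ^ n) (fun i => (z + i%:~R) ^- k)) (H (nome z)).
Proof.
move=> k3; have kk : k = k.-1.+1 by lia.
have k2 : (2 <= k.-1)%N by lia.
have k13 : (k.-1 - 2 = k - 3)%N by lia.
move=> hd [K K0 hK] z1 zi ka0 hka.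
pose c := Num.sqrt ka ^- (k - 3) * ka^-1; have c0 : 0 <= c.
  by rewrite mulr_ge0 // ?invr_ge0 ?exprn_ge0 ?sqrtr_ge0 ?ltW.
pose f (i : int) : Cplx R := ((c / (1 + i%:~R ^+ 2))%:C)%C.
have wb M : \sum_(j < 2 * M) c / (1 + (j%:Z - M%:Z)%:~R ^+ 2) <= 8 * c.
  have f0 (i : int) : 0 <= c / (1 + i%:~R ^+ 2) by rewrite divr_ge0 // addr_ge0 // sqr_ge0.
  have := @window_tail _ f c 0 M c0 _ (leq0n M).
  rewrite {2}/window muln0 big_ord0 subr0 divr1 => h.
  apply: le_trans (h _) => [|i _]; last by rewrite /f nm_real ger0_norm.
  rewrite /window /f -rmorph_sum nm_real; exact: ler_norm.
have b0 : 0 <= K * (8 * c) by apply: mulr_ge0 => //; apply: mulr_ge0.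
(* From N0 on, |z| <= 2^(n+1) / 4, so the points (z + i) / 2^(n+1) of the window stay in the
   rectangle of [lip_est]. *)
pose N0 := (Num.Def.archi_bound (nm z)).+2.
apply: (@lim_to_le _ _ _ (fun n => K * (8 * c) * 2^-1 ^+ n) N0).
  by apply: nullZ => //; apply: null_geom; lra.
move=> n hn; pose M := (2 ^ n)%N; pose N : R := 2 ^+ n.+1.
have N0' : 0 < N by rewrite exprn_gt0.
have zN : nm z * 4 <= N.
  apply: (@le_trans _ _ ((Num.Def.archi_bound (nm z))%:R * 4)).
    by rewrite ler_wpM2r //; apply: ltW; apply: archi_boundP; exact: nm_ge0.
  rewrite -natrM /N -natrX ler_nat; apply: (@leq_trans (2 ^ N0.+1)); last by rewrite leq_exp2l.
  by rewrite /N0 3!expnS; have := ltn_expl (Num.Def.archi_bound (nm z)) (isT : 1 < 2)%N; lia.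
have zM : nome (z - M%:R) = nome z.
  by have := nomeD (z - M%:R) M%:R; rewrite subrK nome_nat mulr1.
have := lip_iter n.+1 hd (_ : nome (z - M%:R) != 1); rewrite zM => /(_ z1) hi.
have M2 : (2 ^ n.+1 = 2 * M)%N by rewrite expnS.
have CN : (2 ^+ n.+1 : Cplx R) != 0 by rewrite expf_neq0 // pnatr_eq0.
have nm2N : nm (2 ^+ n.+1 : Cplx R) = N by rewrite nmX (nm_nat R 2).
have HE : H (nome z) = (2 ^+ (k * n.+1))^-1 * \sum_(j < 2 * M) H (nome ((z +
  (j%:Z - M%:Z)%:~R) / 2 ^+ n.+1)).
  rewrite -M2; under eq_bigr do rewrite intrB addrCA addrC.
  apply: (mulfI (_ : 2 ^+ (k * n.+1) != 0)); first by rewrite expf_neq0 // pnatr_eq0.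
  by rewrite mulrA mulfV ?expf_neq0 ?pnatr_eq0 // mul1r.
have wj (j : 'I_(2 * M)) : nm ((z +
  (j%:Z - M%:Z)%:~R) ^- k - (2 ^+ (k * n.+1))^-1 * H (nome ((z +
    (j%:Z - M%:Z)%:~R) / 2 ^+ n.+1))) <=
    K / N * (c / (1 + (j%:Z - M%:Z)%:~R ^+ 2)).
  set i : int := j%:Z - M%:Z; set x := z + i%:~R; set w := x / 2 ^+ n.+1.
  have x0 : x != 0.
    have := hka i; rewrite -/x; apply: contraTneq => ->; rewrite nm0 expr0n -ltNge.
    by rewrite mulr_gt0 // ltr_pwDl // sqr_ge0.
  have w0 : w != 0 by rewrite mulf_neq0 // invr_eq0.
  have N1 : N^-1%:C%C = (2 ^+ n.+1)^-1 :> Cplx R.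
    by rewrite fmorphV rmorphXn /= (rmorph_nat (real_complex R) 2).
  have wre : complex.Re w = (complex.Re z + i%:~R) / N.
    rewrite /w -N1 /x; case: (z) => a b; rewrite -(rmorph_int (real_complex R)) /=; ring.
  have wim : complex.Im w = complex.Im z / N.
    rewrite /w -N1 /x; case: (z) => a b; rewrite -(rmorph_int (real_complex R)) /=; ring.
  have hN : N = 2 * M%:R by rewrite /N /M exprS natrX.
  have iM : `|i%:~R| <= N / 2 :> R.
    rewrite hN mulrC mulKf ?pnatr_eq0 // -intr_norm [M%:R]pmulrn ler_int; exact: window_index.
  have hre : `|complex.Re w| <= 3 / 4.
    rewrite wre normrM (ger0_norm (_ : 0 <= N^-1)) ?invr_ge0 ?(ltW N0') // ler_pdivrMr //.
    apply: le_trans (ler_normD _ _) _; have := nm_Re z; lra.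
  have him : 0 <= complex.Im w <= 1.
    rewrite wim divr_ge0 ?(ltW N0') //= ler_pdivrMr // mul1r; have := nm_Im z;
      rewrite ger0_norm //.
    have := nm_ge0 z; lra.
  have h := hK w w0 hre him.
  have xw : x = w * 2 ^+ n.+1 by rewrite /w divfK.
  have -> : x ^- k - (2 ^+ (k * n.+1))^-1 * H (nome w) = - (x ^- k * (w ^+ k * H (nome w) - 1)).
    have e : x ^- k = w ^- k * (2 ^+ (k * n.+1))^-1 by rewrite xw exprMn -exprM mulnC invfM.
    rewrite mulrBr mulr1 opprB mulrA; congr (_ - _ * _).
    by rewrite e mulrAC mulVf ?expf_neq0 // mul1r.
  rewrite nmN nmM; apply: le_trans (ler_wpM2l (nm_ge0 _) h) _.
  have -> : nm (x ^- k) * (K * nm w) = K / N * nm (x ^- k.-1).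
    rewrite /w nmM !nmV nm2N nmX (nmX x k.-1) {1}kk exprS; field.
    have nx : nm x != 0 by rewrite nm_eq0.
    by rewrite expf_neq0 // nx lt0r_neq0.
  apply: ler_wpM2l; first by rewrite divr_ge0 // ltW.
  by have := int_nm_le k2 ka0 (hka i); rewrite k13 mulrA.
rewrite /window HE mulr_sumr -sumrB; apply: le_trans (nm_sum _ _ _) _.
apply: le_trans (ler_sum _ (fun j _ => wj j)) _.
rewrite -mulr_sumr; apply: (@le_trans _ _ (K / N * (8 * c))).
  by apply: ler_wpM2l (wb M); rewrite divr_ge0 // ltW.
have -> : K * (8 * c) * 2^-1 ^+ n = 2 * (K * (8 * c) / N) by rewrite /N exprS exprVn; field;
  rewrite expf_neq0.
have : 0 <= K * (8 * c) / N by rewrite divr_ge0 // ltW.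
have -> : K / N * (8 * c) = K * (8 * c) / N by ring.
lra.
Qed.

(** Grouping by the codivisor m = i + 1, the row m being the series of j^e q^(m j). At n = 0 this
    needs 0^e = 0. *)
Lemma divsum_codivisors e n M : (0 < e)%N -> (n <= M)%N ->
  divsum e n = \sum_(i < M) psV i.+1 (fun j => (j ^ e)%N%:Z : int) n.
Proof.
move=> e0 nM; rewrite /divsum; case: n nM => [|n] nM /=.
  by rewrite big1 // => i _; rewrite /psV dvdn0 div0n exp0n.
have dp d : d \in divisors n.+1 -> (0 < d)%N /\ (d %| n.+1)%N.
  by rewrite -dvdn_divisors // => h; split => //; apply: dvdn_gt0 h.
have pe : perm_eq (divisors n.+1) [seq (n.+1 %/ d)%N | d <- divisors n.+1].
  apply: uniq_perm; first exact: divisors_uniq.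
    rewrite map_inj_in_uniq ?divisors_uniq // => a b /dp[a0 ha] /dp[b0 hb] e1.
    have /eqP : ((n.+1 %/ b) * a = (n.+1 %/ b) * b)%N by rewrite -{1}e1 !divnK.
    by rewrite eqn_mul2l => /orP[|/eqP //]; rewrite -leqn0 leqNgt divn_gt0 // dvdn_leq.
  move=> d; apply/idP/mapP => [/dp[d0 hd]|[d' /dp[d0 hd] ->]].
    exists (n.+1 %/ d)%N; last by rewrite divnA // mulKn.
    by rewrite -dvdn_divisors // -{2}(divnK hd) dvdn_mulr.
  by rewrite -dvdn_divisors // -{2}(divnK hd) dvdn_mulr.
rewrite /sigma (perm_big _ pe) big_map -natz natr_sum.
transitivity (\sum_(a <- index_iota 1 M.+1 | (a %| n.+1)%N) ((n.+1 %/ a) ^ e)%N%:R : int).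
  rewrite -[RHS]big_filter; apply: perm_big; apply: uniq_perm.
  - exact: divisors_uniq.
  - by rewrite filter_uniq ?iota_uniq.
  move=> d; rewrite mem_filter mem_index_iota -dvdn_divisors //.
  case: (boolP (d %| n.+1)%N) => //= dn.
  by rewrite (dvdn_gt0 _ dn) //= ltnS (leq_trans (dvdn_leq _ dn)).
rewrite big_add1 big_mkord big_mkcond; apply: eq_bigr => i _; rewrite /psV /=.
by case: ifP => //; rewrite natz.
Qed.

(** * Eisenstein sums over squares of indices *)

Definition swindow (R : realType) (M : nat) (f : int -> Cplx R) : Cplx R :=
  \sum_(j < (2 * M).+1) f (j%:Z - M%:Z).

Lemma swindowE (R : realType) M (f : int -> Cplx R) : swindow M f = window M f + f M%:Z.
Proof. by rewrite /swindow big_ord_recr /=; congr (_ + f _); lia. Qed.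

Lemma swindow_S (R : realType) M (f : int -> Cplx R) :
  swindow M.+1 f = swindow M f + (f M.+1%:Z + f (- M.+1%:Z)).
Proof. by rewrite !swindowE window_S; ring. Qed.

Lemma swindow_pairs (R : realType) M (f : int -> Cplx R) :
  swindow M f = f 0 + \sum_(i < M) (f i.+1%:Z + f (- i.+1%:Z)).
Proof.
elim: M => [|M IH]; first by rewrite /swindow muln0 big_ord1 big_ord0 [RHS]addr0.
by rewrite swindow_S IH big_ord_recr /= [RHS]addrA.
Qed.

Lemma swindow_opp (R : realType) M (f : int -> Cplx R) :
  swindow M (fun i => f (- i)) = swindow M f.
Proof.
rewrite !swindow_pairs oppr0; congr (_ + _); apply: eq_bigr => i _.
by rewrite opprK addrC.
Qed.

Lemma swindow_eq (R : realType) M (f g : int -> Cplx R) : f =1 g -> swindow M f = swindow M g.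
Proof. by move=> fg; apply: eq_bigr. Qed.

Lemma swindowZ (R : realType) M (c : Cplx R) f : swindow M (fun i => c * f i) = c * swindow M f.
Proof. by rewrite /swindow mulr_sumr. Qed.

(* The term of index (0, 0) vanishes since [0^-1 = 0]. *)
Definition box (R : realType) k M (z : Cplx R) : Cplx R :=
  swindow M (fun m => swindow M (fun n => (m%:~R * z + n%:~R) ^- k)).

Lemma exprVN_even (K : fieldType) (x : K) k : ~~ odd k -> (- x) ^- k = x ^- k.
Proof. by move=> /negbTE k2; rewrite exprNn -signr_odd k2 mul1r. Qed.

(** The square of indices is stable under (m, n) -> (n, -m), so the truncated sum transforms exactly
    under z -> -1/z before any limit is taken. *)
Lemma box_S (R : realType) k M (z : Cplx R) : ~~ odd k -> z != 0 ->
  box k M (- z^-1) = z ^+ k * box k M z.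
Proof.
move=> k2 z0; rewrite /box -swindowZ.
transitivity (swindow M (fun m => swindow M (fun n => z ^+ k * (n%:~R * z + (- m)%:~R) ^- k))).
  apply: swindow_eq => m; apply: swindow_eq => n.
  have -> : m%:~R * - z^-1 + n%:~R = (n%:~R * z + (- m)%:~R) * z^-1.
    by rewrite mulrNz mulrDl mulfK //; ring.
  by rewrite exprMn invfM exprVn invrK mulrC.
rewrite (swindow_opp M (fun m => swindow M (fun n => z ^+ k * (n%:~R * z + m%:~R) ^- k))).
rewrite {1}/swindow exchange_big /=; apply: eq_bigr => i _.
by rewrite -swindowZ.
Qed.

Lemma window_double (R : realType) M (f : int -> Cplx R) :
  window (2 * M) f = window M (fun i => f (2 * i) + f (2 * i + 1)).
Proof.
elim: M => [|M IH]; first by rewrite /window !muln0 !big_ord0.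
rewrite mulnS add2n !window_S IH.
have -> : (2 * M)%N%:Z = 2 * M%:Z by lia.
have -> : - (2 * M).+1%:Z = 2 * (- M.+1%:Z) + 1 by lia.
have -> : (2 * M).+1%:Z = 2 * M%:Z + 1 by lia.
have -> : - (2 * M).+2%:Z = 2 * (- M.+1%:Z) by lia.
ring.
Qed.

(** 8 (i + 1/2)^2 - 1 - i^2 = (7i + 1)(i + 1), which is nonnegative at integers. *)
Lemma half_int_bound (R : realType) (i : int) :
  8^-1 * (1 + i%:~R ^+ 2) <= nm ((2^-1 : Cplx R) + i%:~R) ^+ 2.
Proof.
have -> : (2^-1 : Cplx R) + i%:~R = ((2^-1 + i%:~R)%:C)%C.
  by rewrite rmorphD fmorphV /= (rmorph_nat (real_complex R) 2) (rmorph_int (real_complex R)).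
rewrite nm_real real_normK ?num_real //.
have h : (0 : int) <= (7 * i + 1) * (i + 1) by case: (leP 0 i) => ?; [nia|nia].
have : (0 : R) <= ((7 * i + 1) * (i + 1))%:~R by rewrite ler0z.
rewrite intrM !intrD intrM => h2.
have {}h2 : (0 : R) <= (7 * i%:~R + 1) * (i%:~R + 1) by apply: h2.
lra.
Qed.

Lemma null_pow2 (R : realType) : null (fun n => ((2 ^ n)%N%:R)^-1 : R).
Proof.
apply: (@null_le _ _ (fun n => 2^-1 ^+ n) 0); first by apply: null_geom; lra.
by move=> n _; rewrite natrX exprVn.
Qed.

Lemma pow2_neq1 (R : realType) k : (0 < k)%N -> (2 : Cplx R) ^+ k - 1 != 0.
Proof.
case: k => // k _; rewrite subr_eq0 -natrX pnatr_eq1 expnS.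
by apply/eqP => /(congr1 odd); rewrite oddM.
Qed.

(* The value of zeta at k comes from the same formula at z = 1/2, where q = -1. *)
Lemma zeta_limit (R : realType) k (H : Cplx R -> Cplx R) : (3 <= k)%N ->
  lip_dup k H -> lip_est k H ->
  lim_to (fun n => swindow (2 ^ n) (fun i => i%:~R ^- k)) (H (-1) / (2 ^+ k - 1)).
Proof.
move=> k3 hd he; pose f (i : int) : Cplx R := i%:~R ^- k.
have fb (i : int) : nm (f i) <= 2 / (1 + i%:~R ^+ 2).
  rewrite /f nmV nmX nm_int; have [->|i0] := eqVneq i 0.
    by rewrite normr0 expr0n (gtn_eqF (ltnW (ltnW k3))) /= invr0 divr_ge0 // addr_ge0 //
      sqr_ge0.
  have i1 : 1 <= `|i%:~R| :> R by rewrite -intr_norm ler1z; lia.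
  set x : R := `|i%:~R| in i1 *.
  have -> : (i%:~R : R) ^+ 2 = x ^+ 2 by rewrite /x real_normK // num_real.
  have x0 : 0 < x by lra.
  have p1 : 0 < 1 + x ^+ 2 by nra.
  rewrite -[_^-1]div1r ler_pdivrMr ?exprn_gt0 // mulrAC ler_pdivlMr // mul1r.
  have : x ^+ 2 <= x ^+ k by rewrite ler_weXn2l // ltnW.
  nra.
pose u n := window (2 ^ n) f.
have [zt hz] : exists zt, lim_to u zt.
  have t0 : 0 < (2^-1 : R) by lra. have t1 : (2^-1 : R) < 1 by lra.
  apply: (@geom_lim _ u 16 _ _ t0 t1) => // n.
  have := @window_tail _ f 2 (2 ^ n) (2 ^ n.+1) ltac:(lra) (fun i _ =>
    fb i) ltac:(by rewrite leq_exp2l).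
  move=> h; apply: le_trans h _; rewrite -natrM; apply: ler_wpM2l => //.
  rewrite exprVn lef_pV2 ?posrE ?exprn_gt0 ?ltr0n // -natrX ler_nat; lia.
have hl := lipschitz k3 hd he (z := 2^-1) (ka := 8^-1).
rewrite nome_half in hl; have {}hl := hl ltac:(by apply/eqP => /eqP;
  rewrite -subr_eq0 -opprD oppr_eq0 -(natrD _ 1 1) pnatr_eq0).
have {}hl := hl _ _ (@half_int_bound R).
have im0 : 0 <= complex.Im (2^-1 : Cplx R).
  have -> : 2^-1 = (2^-1)%:C%C :> Cplx R by rewrite fmorphV /= (rmorph_nat (real_complex R)).
  by [].
have {}hl := hl im0 ltac:(by rewrite invr_gt0).
have k2n : (2 : Cplx R) ^+ k != 0 by rewrite expf_neq0 // pnatr_eq0.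
(* Even and odd terms of the doubled window; in the limit (2^k - 1) zt = H(-1). *)
have rec n : u n.+1 = 2 ^- k * u n + 2 ^- k * window (2 ^ n) (fun i => (2^-1 + i%:~R) ^- k).
  rewrite /u expnS window_double /window !mulr_sumr -big_split /=; apply: eq_bigr => j _.
  move: (j%:Z - _) => i; rewrite /f !intrD intrM -!invfM -!exprMn; congr (_ ^- k + _ ^- k).
  by rewrite mulrDr mulfV ?pnatr_eq0 // addrC.
have e1 := lim_to_unique (lim_to_comp (s := succn) (fun n => leqnSn n) hz)
  (lim_to_eq (fun n => esym (rec n)) (lim_toD (lim_toZ (2 ^- k) hz) (lim_toZ (2 ^- k) hl))).
have e2 : zt = H (-1) / (2 ^+ k - 1).
  have k1 : (2 : Cplx R) ^+ k - 1 != 0 by apply: pow2_neq1; exact: leq_trans k3.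
  apply: (mulIf k1); rewrite divfK // mulrBr mulr1 {1}e1 -mulrDr mulrAC mulVf // mul1r.
  by rewrite addrC addKr.
rewrite -e2; apply: (@lim_to_le _ _ _ (fun n => nm (u n - zt) + 2 * ((2 ^ n)%N%:R)^-1) 0).
  by apply: nullD => //; apply: nullZ => //; exact: null_pow2.
move=> n _; rewrite swindowE addrAC; apply: le_trans (nmD _ _) _; rewrite lerD2l.
apply: le_trans (fb _) _; apply: ler_wpM2l => //.
have x1 : (1 : R) <= (2 ^ n)%N%:R by rewrite ler1n expn_gt0.
rewrite -pmulrn lef_pV2 ?posrE; [|nra|lra]; nra.
Qed.

Lemma lattice_bound (R : realType) (z : Cplx R) : 0 < complex.Im z ->
  exists2 ka : R, 0 < ka & forall m n : int,
    ka * (m%:~R ^+ 2 + n%:~R ^+ 2) <= nm (m%:~R * z + n%:~R) ^+ 2.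
Proof.
case: z => x y /= y0; pose s := x ^+ 2 + y ^+ 2; have s0 : 0 <= s by rewrite addr_ge0 ?sqr_ge0.
have T0 : 0 < 1 + s by lra.
exists (y ^+ 2 / (1 + s)); first by rewrite divr_gt0 // exprn_gt0.
move=> m n; set a : R := m%:~R; set b : R := n%:~R.
have -> : nm (m%:~R * (x +i* y)%C + n%:~R) ^+ 2 = (a * x + b) ^+ 2 + (a * y) ^+ 2.
  rewrite -!(rmorph_int (real_complex R)) -/a -/b nm_sqr /=; congr (_ ^+ 2 + _ ^+ 2); ring.
rewrite mulrAC ler_pdivrMr // -subr_ge0.
have -> : ((a * x + b) ^+ 2 + (a * y) ^+ 2) * (1 + s) - y ^+ 2 * (a ^+ 2 + b ^+ 2) =
    (s * a + x * b) ^+ 2 + (x * a + b) ^+ 2 by rewrite /s; ring.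
by rewrite addr_ge0 ?sqr_ge0.
Qed.

Lemma conv_dilate (R : realType) (a : ps (Cplx R)) m (q l : Cplx R) : (0 < m)%N ->
  tame (psV m a) ->
  nm q < 1 -> conv a (q ^+ m) l -> conv (psV m a) q l.
Proof.
move=> m0 ta q1 hl; have [l' hl'] := tame_conv ta q1.
rewrite -(_ : l' = l) //; apply: (lim_to_unique (lim_to_comp (s := fun N => (m * N)%N) _ hl')).
  by move=> n; rewrite leq_pmull.
apply: lim_to_eq hl => N.
rewrite -(big_mkord xpredT (fun n => a n * q ^+ m ^+ n)).
rewrite -(big_mkord xpredT (fun n => psV m a n * q ^+ n)); elim: N => [|N IH].
  by rewrite muln0 !big_geq.
rewrite big_nat_recr //= IH mulnS addnC (@big_cat_nat _ _ _ (m * N) 0 (m * N +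
  m)) ?leq_addr //=.
congr (_ + _); case: m m0 {ta hl' IH} => // m _.
rewrite big_ltn; last by rewrite -[X in (X < _)%N]addn0 ltn_add2l.
rewrite psV_Mn // exprM big_nat big1 ?addr0 // => i /andP[i1 i2].
rewrite /psV; case: ifP => [/dvdnP[c cE]|_]; last by rewrite mul0r.
exfalso; have c1 : (N < c)%N by rewrite -(@ltn_pmul2r m.+1) // -cE mulnC.
have c2 : (c < N.+1)%N by rewrite -(@ltn_pmul2r m.+1) // -cE mulSn addnC mulnC.
by move: c2; rewrite ltnS leqNgt c1.
Qed.

Section EisensteinSeries.
Variables (R : realType) (k : nat) (H : Cplx R -> Cplx R) (c : Cplx R).
Hypotheses (k4 : (4 <= k)%N) (k2 : ~~ odd k) (hd : lip_dup k H) (he : lip_est k H).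
(** The other side of the Lipschitz formula, with c = (k - 1)! / (2 pi i)^k in the two
    applications. *)
Hypothesis hT : forall q, nm q < 1 -> conv (cps R (fun j => (j ^ k.-1)%N%:Z)) q (c * H q).
Hypothesis c0 : c != 0.

(** The error has to be o(1/M) because M rows will be added. Outside the window two factors of (m z
    + n)^-k give 1/M^2, and the remaining k - 2 >= 2 give convergence. *)
Lemma row_estimate (z : Cplx R) : 0 < complex.Im z -> exists2 K : R, 0 <= K &
  forall m M : nat, (0 < m)%N -> (0 < M)%N ->
  nm (swindow M (fun n => (m%:R * z + n%:~R) ^- k) - H (nome (m%:R * z))) <= K / M%:R ^+ 2.
Proof.
have k3 : (3 <= k)%N by exact: ltnW.
have k22 : (2 <= k - 2)%N by rewrite leq_subRL // ltnW.
have kk : k = (k - 2 + 2)%N by rewrite subnK // ltnW // ltnW.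
move=> z0; have [ka ka0 hka] := lattice_bound z0.
pose K := Num.sqrt ka ^- (k - 2 - 2) * ka^-1 * ka^-1.
have K0 : 0 <= K by rewrite !mulr_ge0 ?invr_ge0 ?exprn_ge0 ?sqrtr_ge0 // ltW.
exists (9 * K) => [|m M m0 M0]; first by rewrite mulr_ge0.
pose f (n : int) := (m%:R * z + n%:~R) ^- k.
have m1 : (1 : R) <= m%:R ^+ 2 by rewrite expr_ge1 // ler1n.
have hka' (n : int) : ka * (1 + n%:~R ^+ 2) <= nm (m%:R * z + n%:~R) ^+ 2.
  apply: le_trans (hka m n); rewrite ler_wpM2l ?(ltW ka0) // lerD2r -pmulrn; exact: m1.
have Mp : (0 : R) < M%:R by rewrite ltr0n.
have K2 : 0 <= K / M%:R ^+ 2 by rewrite divr_ge0 // exprn_ge0 // ltW.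
have fb (i : int) : (M <= `|i|)%N -> nm (f i) <= K / M%:R ^+ 2 / (1 + i%:~R ^+ 2).
  move=> Mi; have h := int_nm_le k22 ka0 (hka' i).
  rewrite /f {1}kk; set w := _ + _ in h *; rewrite exprD invfM nmM.
  have -> : K / M%:R ^+ 2 / (1 + i%:~R ^+ 2) =
      Num.sqrt ka ^- (k - 2 - 2) * (ka^-1 / (1 + i%:~R ^+ 2)) * (ka^-1 * (M%:R ^+ 2)^-1).
    by rewrite /K; ring.
  apply: ler_pM; rewrite ?nm_ge0 // nmV nmX -invfM lef_pV2 ?posrE.
  - apply: le_trans (hka' i); rewrite ler_wpM2l ?(ltW ka0) //.
    apply: (@le_trans _ _ (i%:~R ^+ 2)); last by rewrite lerDr.
    rewrite -[i%:~R ^+ 2](real_normK (num_real _)) lerXn2r ?nnegrE ?ler0n //.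
    by rewrite -intr_norm [M%:R]pmulrn ler_int; move: Mi; clear; lia.
  - by apply: lt_le_trans (hka' i); rewrite mulr_gt0 // ltr_pwDl // sqr_ge0.
  - by rewrite mulr_gt0 // exprn_gt0.
have mzi : 0 < complex.Im (m%:R * z).
  case: (z) z0 => x y /= y0; rewrite -(rmorph_nat (real_complex R)) /= mul0r addr0.
  by rewrite mulr_gt0 // ltr0n.
have q1 : nome (m%:R * z) != 1.
  by apply/eqP => e; have := nome_lt1 mzi; rewrite e nm1 ltxx.
have hl := lipschitz k3 hd he q1 (ltW mzi) ka0 hka'.
rewrite nm_sym; apply: (lim_to_bound (N := M) (lim_toD hl (lim_to_cst (- swindow M f)))) =>
  n Mn.
have M2 : (M <= 2 ^ n)%N by apply: leq_trans Mn (ltnW (ltn_expl n (isT : 1 < 2)%N)).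
rewrite swindowE opprD addrA; apply: le_trans (nmD _ _) _; rewrite nmN.
have -> : 9 * K / M%:R ^+ 2 = 8 * (K / M%:R ^+ 2) + K / M%:R ^+ 2 by ring.
apply: lerD.
  apply: le_trans (window_tail K2 fb M2) _.
  by rewrite ler_pdivrMr ?ltr0n //; apply: ler_peMr; [exact: mulr_ge0|rewrite ler1n].
apply: le_trans (fb M%:Z _) _; first by [].
rewrite ler_pdivrMr ?ltr_pwDl ?sqr_ge0 // ler_peMr //.
by rewrite lerDl sqr_ge0.
Qed.

(** By [divsum_codivisors] the first M rows account for all coefficients below q^M; what remains is
    dominated by [divsum] itself. *)
Lemma lambert_rows (z l : Cplx R) : 0 < complex.Im z -> conv (cps R (divsum k.-1)) (nome z) l ->
  exists A t, [/\ 0 <= A, 0 < t, t < 1 &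
    forall M : nat, nm (l - c * \sum_(i < M) H (nome (i.+1%:R * z))) <= A * t ^+ M].
Proof.
have k1 : (0 < k.-1)%N by case: (k) k4 => [|[|]].
move=> z0 hl; have q1 := nome_lt1 z0;
  have tE : tame (cps R (divsum k.-1)) := @tame_divsum R k.-1.
have [A [t [A0 t0 t1 hA]]] := tame_geom tE q1.
exists (A / (1 - t)), t; split => //; first by rewrite divr_ge0 // subr_ge0 ltW.
move=> M; pose T : ps int := fun j => (j ^ k.-1)%N%:Z.
pose S : ps int := \sum_(i < M) psV i.+1 T.
have T0 j : 0 <= T j by [].
have Vc i : cps R (psV i.+1 T) = psV i.+1 (cps R T).
  by apply: funext => n; rewrite /cps /psV; case: ifP.
have tT : tame (cps R T) := @tame_pow R k.-1.
have tV i : tame (psV i.+1 (cps R T)).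
  apply: tame_le tT => n; rewrite /psV; case: ifP => h; last by rewrite nm0 nm_ge0.
  rewrite /cps /T -!pmulrn !nm_nat ler_nat leq_exp2r //; exact: leq_div.
have hS : conv (cps R S) (nome z) (c * \sum_(i < M) H (nome (i.+1%:R * z))).
  rewrite /S; elim: (M) => [|N IH].
    rewrite !big_ord0 mulr0; apply: lim_to_eq (lim_to_cst 0) => n.
    by rewrite big1 // => i _; rewrite /cps ps0 mul0r.
  rewrite !big_ord_recr /= mulrDr cpsD; apply: convD => //.
  rewrite Vc; apply: conv_dilate => //; rewrite -nomeMn; apply: hT.
  by rewrite nomeMn nmX exprn_ilt1 // nm_ge0.
have hd' := convD hl (convZ (c := -1) (b := - cps R S) (fun n => esym (mulN1r _)) hS).
pose D : ps (Cplx R) := cps R (divsum k.-1) - cps R S.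
have db n : nm (D n) <= nm (cps R (divsum k.-1) n).
  have S0 : 0 <= S n by rewrite /S ps_sum sumr_ge0 // => i _; rewrite /psV; case: ifP.
  have SD : S n <= divsum k.-1 n.
    rewrite (@divsum_codivisors k.-1 n (maxn M n)) ?leq_maxr // /S ps_sum.
    rewrite -!(big_mkord xpredT (fun i =>
      psV i.+1 T n)) [leRHS](@big_cat_nat _ _ _ M) ?leq_maxl //=.
    rewrite lerDl sumr_ge0 // => i _; rewrite /psV; case: ifP => //.
  rewrite /D psB /cps -rmorphB /= !nm_int !ger0_norm ?ler0z ?subr_ge0 ?(le_trans S0) //.
  by rewrite ler_int gerBl.
have dz n : (n < M)%N -> D n = 0.
  move=> nM; rewrite /D psB /cps (@divsum_codivisors k.-1 n M) ?(ltnW nM) // /S ps_sum subrr //.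
have Dt n : nm (D n * nome z ^+ n) <= A * t ^+ n.
  by apply: le_trans (hA (nome z) n (lexx _)); rewrite !nmM ler_wpM2r // nm_ge0.
have D0 : \sum_(n < M) D n * nome z ^+ n = 0 by apply: big1 => i _; rewrite dz ?mul0r.
have := conv_tail A0 t0 t1 Dt hd' M; rewrite D0 subr0 mulN1r.
by have -> : A * (t ^+ M / (1 - t)) = A / (1 - t) * t ^+ M by ring.
Qed.

(** Row 0 tends to the value of [zeta_limit]; rows m and -m agree since k is even, and the errors of
    [row_estimate] add up to O(1/M). *)
Lemma box_limit (z l : Cplx R) : 0 < complex.Im z -> conv (cps R (divsum k.-1)) (nome z) l ->
  lim_to (fun n => box k (2 ^ n) z) (H (-1) / (2 ^+ k - 1) + 2 * c^-1 * l).
Proof.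
move=> z0 hl; have [K K0 hK] := row_estimate z0.
have [A [t [A0 t0 t1 hA]]] := lambert_rows z0 hl.
have hz := zeta_limit (ltnW k4) hd he.
have nc : 0 <= 2 * nm c^-1 by rewrite mulr_ge0 // nm_ge0.
have n1 : null (fun n => 2 * nm c^-1 * (A * t ^+ (2 ^ n))).
  apply: nullZ => //; apply: nullZ => //.
  apply: (@null_comp _ (fun n => t ^+ n) (fun n => 2 ^ n)%N); last exact: null_geom.
  by move=> n; rewrite ltnW // ltn_expl.
have n2 : null (fun n => 2 * K * ((2 ^ n)%N%:R)^-1) by apply: nullZ;
  [rewrite mulr_ge0|exact: null_pow2].
apply: (@lim_to_le _ _ _ _ 0 (nullD (nullD hz n2) n1)) => n _; set M := (2 ^ n)%N.
have M0 : (0 < M)%N by rewrite expn_gt0.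
have Mp : (0 : R) < M%:R by rewrite ltr0n.
pose g (m : int) := swindow M (fun n => (m%:~R * z + n%:~R) ^- k).
have g0 : g 0 = swindow M (fun i => i%:~R ^- k).
  by apply: swindow_eq => i; rewrite mul0r add0r.
have gN m : g (- m) = g m.
  rewrite /g -(swindow_opp M (fun n => (m%:~R * z + n%:~R) ^- k)); apply: swindow_eq => i.
  by rewrite -exprVN_even // opprD !mulrNz mulNr opprK.
have -> : box k M z = g 0 + 2 * \sum_(i < M) g i.+1%:Z.
  rewrite /box swindow_pairs -/(g 0); congr (_ + _); rewrite mulr_sumr; apply: eq_bigr => i _.
  by rewrite -/(g i.+1%:Z) -/(g (- i.+1%:Z)) gN; ring.
set HS := \sum_(i < M) H (nome (i.+1%:R * z)).
set Z := _ / (2 ^+ k - 1).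
have -> : g 0 + 2 * \sum_(i < M) g i.+1 - (Z + 2 * c^-1 * l) =
  (g 0 - Z) + 2 * (\sum_(i < M) g i.+1 - HS) + (- (2 * c^-1)) * (l - c * HS).
  by field.
apply: le_trans (nmD _ _) _; apply: lerD; last first.
  by rewrite nmM nmN nmM (nm_nat R 2) ler_wpM2l // hA.
apply: le_trans (nmD _ _) _; rewrite g0 lerD2l nmM (nm_nat R 2) -mulrA ler_wpM2l //.
rewrite /HS -sumrB; apply: le_trans (nm_sum _ _ _) _.
apply: (@le_trans _ _ (\sum_(i < M) K / M%:R ^+ 2)).
  by apply: ler_sum => i _; exact: hK.
rewrite sumr_const card_ord -mulr_natr; rewrite le_eqVlt; apply/orP; left; apply/eqP.
by field; rewrite lt0r_neq0.
Qed.

Lemma eisenstein_S (z l l' : Cplx R) (e : Cplx R) : 0 < complex.Im z ->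
  e = c * H (-1) / (2 * (2 ^+ k - 1)) ->
  conv (cps R (divsum k.-1)) (nome z) l -> conv (cps R (divsum k.-1)) (nome (- z^-1)) l' ->
  e + l' = z ^+ k * (e + l).
Proof.
move=> z0 eE hl hl'; have zn0 : z != 0 by apply/eqP => ze; move: z0; rewrite ze ltxx.
have b1 := box_limit z0 hl; have b2 := box_limit (Im_invN_gt0 z0) hl'.
have := lim_to_unique b2 (lim_to_eq (fun n =>
  esym (box_S (2 ^ n) k2 zn0)) (lim_toZ (z ^+ k) b1)).
have k1 : (2 : Cplx R) ^+ k - 1 != 0 by apply: pow2_neq1; exact: leq_trans k4.
have eq1 x : H (-1) / (2 ^+ k - 1) + 2 * c^-1 * x = 2 * c^-1 * (e + x).
  by rewrite eE; field; rewrite k1 c0.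
rewrite !eq1 mulrCA; apply: mulfI; by rewrite mulf_neq0 ?pnatr_eq0 // invr_eq0.
Qed.

End EisensteinSeries.

Definition power_ps (e : nat) : ps int := fun n => (n ^ e)%N%:Z.

Lemma power_psS e : power_ps e.+1 = psD1 (power_ps e).
Proof. by apply: funext => n; rewrite /psD1 /power_ps expnS PoszM natz. Qed.

Lemma power_ps0 : (1 - psX int 1) * power_ps 0 = 1.
Proof.
apply: funext => n; rewrite mulrBl mul1r psB psXM /power_ps ps1 !expn0.
by case: n.
Qed.

(* One step of the recursion for the Eulerian polynomials. *)
Lemma eulerian_step (j : nat) (u p : ps int) : (1 - psX int 1) ^+ j.+1 * u = p ->
  (1 - psX int 1) ^+ j.+2 * psD1 u = (1 - psX int 1) * psD1 p + j.+1%:R * psX int 1 * p.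
Proof.
move=> <-; rewrite psD1M psD1X psD1D psD1N psD1_1 psD1_psX !exprS; move: (psD1 u) => v.
move: (psX int 1) => x; ring.
Qed.

Lemma eulerian3 : let x := psX int 1 in (1 - x) ^+ 4 * power_ps 3 = x + 4 * x ^+ 2 + x ^+ 3.
Proof.
move=> x; have D1 : psD1 x = x by rewrite /x psD1_psX mul1r.
have DX k : psD1 (x ^+ k.+1) = k.+1%:R * x ^+ k.+1 by rewrite psD1X D1 exprSr mulrA.
have := @eulerian_step 0 _ _ power_ps0;
  rewrite -power_psS psD1_1 mulr0 add0r mulr1 mul1r -/x => /eulerian_step.
rewrite -power_psS -/x D1 => /eulerian_step; rewrite -power_psS -/x => ->.
rewrite !(psD1D, psD1M, psD1n, psD1N, psD1_1) D1; ring.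
Qed.

Lemma eulerian5 : let x := psX int 1 in
  (1 - x) ^+ 6 * power_ps 5 = x + 26 * x ^+ 2 + 66 * x ^+ 3 + 26 * x ^+ 4 + x ^+ 5.
Proof.
move=> x; have D1 : psD1 x = x by rewrite /x psD1_psX mul1r.
have DX k : psD1 (x ^+ k.+1) = k.+1%:R * x ^+ k.+1 by rewrite psD1X D1 exprSr mulrA.
have := eulerian_step eulerian3; rewrite -power_psS -/x.
rewrite !psD1D psD1M psD1n mul0r add0r D1 !DX => /eulerian_step; rewrite -power_psS -/x => ->.
rewrite !(psD1D, psD1M, psD1n, psD1N, psD1_1) D1; ring.
Qed.

Lemma conv_nat (R : realType) (a : ps (Cplx R)) q l n : conv a q l ->
  conv (n%:R * a) q (n%:R * l).
Proof. by apply: convZ => j; rewrite psMnl. Qed.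

Lemma cps1 (R : realType) : cps R 1 = 1.
Proof. by apply: funext => n; rewrite /cps !ps1; case: eqP. Qed.

Lemma cpsN (R : realType) a : cps R (- a) = - cps R a.
Proof. by apply: funext => n; rewrite /cps !psN mulrNz. Qed.

Lemma one_minus_X (R : realType) (q : Cplx R) : conv (cps R (1 - psX int 1)) q (1 - q).
Proof.
rewrite cpsD cps1 cpsN cps_X; apply: convD; first exact: (conv_psX 0 q).
have h := @convZ _ (-1) _ (- psX _ 1) q _ (fun n => esym (mulN1r _)) (conv_psX 1 q).
by rewrite mulN1r in h.
Qed.

Lemma tame_one_minus_X (R : realType) : tame (cps R (1 - psX int 1)).
Proof. by apply: (@has_qexp_tame _ (fun z => 1 - nome z)); apply/has_qexpP => z _;
  exact: one_minus_X. Qed.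

Lemma one_minus_neq0 (R : realType) (q : Cplx R) : nm q < 1 -> 1 - q != 0.
Proof.
by move=> q1; apply/eqP => /eqP; rewrite subr_eq0 => /eqP e; move: q1; rewrite -e nm1 ltxx.
Qed.

Lemma conv_quotient (R : realType) (j : nat) (u p : ps int) (q l : Cplx R) : nm q < 1 ->
  (1 - psX int 1) ^+ j * u = p -> tame (cps R u) -> conv (cps R p) q l ->
  conv (cps R u) q (l / (1 - q) ^+ j).
Proof.
move=> q1 <- tu; have [l' hl'] := tame_conv tu q1.
have q0 := one_minus_neq0 q1.
have := convM (tameX j (@tame_one_minus_X R)) tu q1 (convX j (@tame_one_minus_X R) q1
  (one_minus_X q)) hl'.
by rewrite -cpsX -cpsM => h /(conv_unique h) <-; rewrite mulrC mulKf // expf_neq0.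
Qed.

Lemma conv_monomials (R : realType) (q : Cplx R) (s : seq (nat * nat)) :
  conv (cps R (\sum_(i <- s) i.1%:R * psX int 1 ^+ i.2)) q (\sum_(i <- s) i.1%:R * q ^+ i.2).
Proof.
elim: s => [|i s IH].
  by rewrite !big_nil; apply: lim_to_eq (lim_to_cst 0) => N; rewrite big1 // => j _;
    rewrite /cps ps0 mul0r.
rewrite !big_cons cpsD; apply: convD => //.
have -> : cps R (i.1%:R * psX int 1 ^+ i.2) = i.1%:R * psX _ i.2.
  by apply: funext => n; rewrite psX_exp /cps !psMnl intrM (rmorph_nat intr) -[(psX int _
    _)%:~R]/(cps R (psX int i.2) n) cps_X.
by apply: conv_nat; exact: conv_psX.
Qed.

Lemma tpi_neq0 (R : realType) : tpi R != 0.
Proof. by rewrite -nm_gt0 nm_tpi mulr_gt0 // pi_gt0. Qed.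

Lemma conv_cubes (R : realType) (q : Cplx R) : nm q < 1 ->
  conv (cps R (power_ps 3)) q (6 / tpi R ^+ 4 * lip4 q).
Proof.
move=> q1; have q0 := one_minus_neq0 q1; have t0 := tpi_neq0 R.
have := @conv_monomials R q [:: (1, 1); (4, 2); (1, 3)]%N.
rewrite !big_cons !big_nil /= !addr0 !mul1r !addrA => h.
have := conv_quotient q1 eulerian3 (@tame_pow R 3) h; congr conv; rewrite /lip4 /lip_Y.
by field; rewrite q0 t0.
Qed.

Lemma conv_fifth_powers (R : realType) (q : Cplx R) : nm q < 1 ->
  conv (cps R (power_ps 5)) q (120 / tpi R ^+ 6 * lip6 q).
Proof.
move=> q1; have q0 := one_minus_neq0 q1; have t0 := tpi_neq0 R.
have := @conv_monomials R q [:: (1, 1); (26, 2); (66, 3); (26, 4); (1, 5)]%N.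
rewrite !big_cons !big_nil /= !addr0 !mul1r !addrA => h.
have := conv_quotient q1 eulerian5 (@tame_pow R 5) h; congr conv; rewrite /lip6 /lip_Y.
by field; rewrite q0 t0.
Qed.

Lemma Im_div (R : realType) (u v : Cplx R) : complex.Im (u / v) =
  (complex.Im u * complex.Re v - complex.Re u * complex.Im v) / nm v ^+ 2.
Proof. by case: u v => a b [c d]; rewrite nm_sqr /=; ring. Qed.

Lemma Im_moebius (R : realType) (a b c d : int) (z : Cplx R) :
  complex.Im ((a%:~R * z + b%:~R) / (c%:~R * z + d%:~R)) =
  (a * d - b * c)%:~R * complex.Im z / nm (c%:~R * z + d%:~R) ^+ 2.
Proof.
rewrite Im_div; congr (_ / _); case: z => x y.
rewrite rmorphB !rmorphM /= -!(rmorph_int (real_complex R)) /=; ring.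
Qed.

Lemma denom_neq0 (R : realType) (a b c d : int) (z : Cplx R) : a * d - b * c = 1 ->
  0 < complex.Im z ->
  c%:~R * z + d%:~R != 0.
Proof.
move=> det z0; apply/eqP => e.
have : complex.Im (c%:~R * z + d%:~R) = c%:~R * complex.Im z.
  by case: (z) => x y; rewrite -!(rmorph_int (real_complex R)) /=; ring.
rewrite e => /esym/eqP; rewrite mulf_eq0 (gt_eqF z0) orbF intr_eq0 => /eqP c0.
move: e det; rewrite c0 mul0r add0r => /eqP; rewrite intr_eq0 => /eqP ->.
by rewrite !mulr0.
Qed.

Lemma shift_int (R : realType) (F : Cplx R -> Cplx R) :
  (forall z, 0 < complex.Im z -> F (z + 1) = F z) ->
  forall (n : int) z, 0 < complex.Im z -> F (z + n%:~R) = F z.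
Proof.
move=> FT; have Im_int (n : int) (z : Cplx R) : complex.Im (z + n%:~R) = complex.Im z.
  by case: z => x y; rewrite -(rmorph_int (real_complex R)) /= addr0.
have FN (n : nat) z : 0 < complex.Im z -> F (z + n%:R) = F z.
  move=> z0; elim: n => [|n IH]; first by rewrite addr0.
  by rewrite -natr1 addrA FT // -[n%:R]/(n%:Z%:~R) Im_int.
move=> [n|n] z z0; first exact: FN.
rewrite NegzE mulrNz -[LHS](FN n.+1); first by rewrite subrK.
by rewrite -mulrNz Im_int.
Qed.

(** Euclid's algorithm on c: with a = q c + r the matrix is T^q S times a matrix whose lower left
    entry is -r. *)
Lemma weakly_modular_ST (R : realType) k (F : Cplx R -> Cplx R) : ~~ odd k ->
  (forall z, 0 < complex.Im z -> F (z + 1) = F z) ->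
  (forall z, 0 < complex.Im z -> F (- z^-1) = z ^+ k * F z) -> weakly_modular k F.
Proof.
move=> k2 FT FS; have FZ := shift_int FT; move=> a b c d.
have [n] := ubnP `|c|%N; elim: n a b c d => // n IH a b c d cn det z z0.
have [c0|c0] := eqVneq c 0.
  have : a * d = 1 by move: det; rewrite c0 mulr0 subr0.
  have sgn (x y : int) : x * y = 1 -> y = 1 /\ x = 1 \/ y = -1 /\ x = -1.
    move=> xy; have : (`|x| * `|y|)%N = 1%N by rewrite -abszM xy.
    by move/eqP; rewrite muln_eq1 => /andP[/eqP hx /eqP hy]; move: xy; nia.
  move=> /sgn [[-> ->]|[-> ->]]; rewrite c0 mul0r add0r.
    by rewrite mul1r divr1 expr1n mul1r FZ.
  have -> : ((-1)%:~R * z + b%:~R) / (-1)%:~R = z + (- b)%:~R.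
    by rewrite !mulrNz invrN invr1; ring.
  by rewrite FZ // mulrNz -signr_odd (negPf k2) mul1r.
pose q := (a %/ c)%Z; pose r := (a %% c)%Z.
have aE : a = q * c + r := divz_eq a c.
have rc : (`|- r| < `|c|)%N.
  by have := modz_ge0 a c0; have := ltz_mod a c0; rewrite -/r; lia.
have det' : c * - (b - q * d) - d * - r = 1 by rewrite -det aE; ring.
have n' : (`|- r| < n)%N by move: cn rc; clear; lia.
have hw := IH c d (- r) (- (b - q * d)) n' det' z z0.
set w := (_ / _) in hw.
have v0 := denom_neq0 det' z0; have u0 := denom_neq0 det z0.
have wi : 0 < complex.Im w.
  by rewrite Im_moebius det' mul1r divr_gt0 // exprn_gt0 // nm_gt0.
have -> : (a%:~R * z + b%:~R) / (c%:~R * z + d%:~R) = - w^-1 + q%:~R.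
  rewrite /w aE; move: u0 v0; rewrite !(mulrNz, intrD, intrM) => u0 v0.
  by field; rewrite u0 v0.
rewrite FZ ?Im_invN_gt0 // FS // hw mulrA -exprMn; congr (_ ^+ _ * _).
by rewrite /w divfK.
Qed.

Lemma Mk_intI (R : realType) k (a : ps int) (F : Cplx R -> Cplx R) :
  weakly_modular k F -> has_qexp F (cps R a) -> Mk_int R k a.
Proof. by move=> hm hq; exists F; split; [exact: qexp_holomorphic hq|exact: hm|exact: hq]. Qed.

Lemma Mk_intM (R : realType) k l (a b : ps int) :
  Mk_int R k a -> Mk_int R l b -> Mk_int R (k + l) (a * b).
Proof.
move=> /Mk_has_series[F [_ Fm Fq]] /Mk_has_series[G [_ Gm Gq]].
apply: (@Mk_intI _ _ _ (fun z => F z * G z)).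
  by move=> A B C D h z z0; rewrite (Fm _ _ _ _ h _ z0) (Gm _ _ _ _ h _ z0) exprD mulrACA.
have ta := has_qexp_tame Fq; have tb := has_qexp_tame Gq.
move/has_qexpP: Fq => Fq; move/has_qexpP: Gq => Gq.
apply/has_qexpP => z z0; rewrite cpsM; apply: convM; rewrite ?nome_lt1 //;
  [exact: Fq|exact: Gq].
Qed.

Lemma Mk_intD (R : realType) k (a b : ps int) : Mk_int R k a -> Mk_int R k b ->
  Mk_int R k (a + b).
Proof.
move=> /Mk_has_series[F [_ Fm /has_qexpP Fq]] /Mk_has_series[G [_ Gm /has_qexpP Gq]].
apply: (@Mk_intI _ _ _ (fun z => F z + G z)).
  by move=> A B C D h z z0; rewrite (Fm _ _ _ _ h _ z0) (Gm _ _ _ _ h _ z0) mulrDr.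
apply/has_qexpP => z z0; rewrite cpsD; apply: convD; [exact: Fq|exact: Gq].
Qed.

Lemma Mk_intZ (R : realType) k (n : int) (a : ps int) : Mk_int R k a -> Mk_int R k (n%:~R * a).
Proof.
move=> /Mk_has_series[F [_ Fm /has_qexpP Fq]].
apply: (@Mk_intI _ _ _ (fun z => n%:~R * F z)).
  by move=> A B C D h z z0; rewrite (Fm _ _ _ _ h _ z0) mulrCA.
apply/has_qexpP => z z0; apply: convZ (Fq _ z0) => j.
by rewrite /cps psMzl intrM intz.
Qed.

Lemma Mk_intN (R : realType) k (a : ps int) : Mk_int R k a -> Mk_int R k (- a).
Proof. by move=> /(Mk_intZ (-1)); rewrite mulrNz mulN1r. Qed.

Lemma Mk_int1 (R : realType) : Mk_int R 0 (1 : ps int).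
Proof.
apply: (@Mk_intI _ _ _ (fun=> 1)); first by move=> *; rewrite mulr1.
by apply/has_qexpP => z _; rewrite cps1; exact: (conv_psX 0).
Qed.

Lemma Mk_intX (R : realType) k (a : ps int) n : Mk_int R k a -> Mk_int R (k * n) (a ^+ n).
Proof.
move=> h; elim: n => [|n IH]; first by rewrite muln0; exact: Mk_int1.
by rewrite exprS mulnS; apply: Mk_intM.
Qed.

(** The condition on N says that 1/N is the constant term of the lattice sum once its q-series is
    normalised to [divsum]; H(-1) enters through [zeta_limit]. *)
Lemma eisenstein_Mk (R : realType) k (H : Cplx R ->
  Cplx R) (c : Cplx R) (N : int) (E : ps int) :
  (4 <= k)%N -> ~~ odd k -> lip_dup k H -> lip_est k H ->
  (forall q, nm q < 1 -> conv (cps R (power_ps k.-1)) q (c * H q)) -> c != 0 -> N != 0 ->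
  (N%:~R)^-1 = c * H (-1) / (2 * (2 ^+ k - 1)) -> E = 1 + N%:~R * divsum k.-1 -> Mk_int R k E.
Proof.
move=> k4 k2 hd he hT c0 N0 hN EE.
have /choice [l hl] : forall z : Cplx R, exists l, 0 < complex.Im z ->
  conv (cps R (divsum k.-1)) (nome z) l.
  move=> z; have [z0|z0] := boolP (0 < complex.Im z); last by exists 0.
  by have [l hl] := tame_conv (@tame_divsum R k.-1) (nome_lt1 z0); exists l.
have NC : (N%:~R : Cplx R) != 0 by rewrite intr_eq0.
apply: (@Mk_intI _ _ _ (fun z => N%:~R * ((N%:~R)^-1 + l z))); last first.
  apply/has_qexpP => z z0; rewrite EE mulrDr mulfV // cpsD cps1; apply: convD;
    first exact: (conv_psX 0).
  by apply: convZ (hl _ z0) => n; rewrite /cps psMzl intrM intz.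
apply: weakly_modular_ST => // z z0.
  have z1 : 0 < complex.Im (z + 1) by case: (z) z0 => x y /=; rewrite addr0.
  congr (_ * (_ + _)); apply: (conv_unique (hl _ z1)); rewrite nomeD nome1 mulr1; exact: hl.
rewrite mulrCA; congr (_ * _); apply: (eisenstein_S k4 k2 hd he hT c0 z0 hN (hl _ z0)).
exact: hl (Im_invN_gt0 z0).
Qed.

Lemma ps_int_nat n : ((n%:R : int)%:~R : ps int) = n%:R.
Proof. exact: (rmorph_nat intr). Qed.

Lemma Qform_Mk (R : realType) : Mk_int R 4 Qform.
Proof.
have t0 := tpi_neq0 R.
have c0 : 6 / tpi R ^+ 4 != 0 by rewrite mulf_neq0 ?invr_eq0 ?expf_neq0 ?pnatr_eq0.
have N0 : (240 : int) != 0 by rewrite pnatr_eq0.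
have hN : ((240 : int)%:~R : Cplx R)^-1 = 6 / tpi R ^+ 4 * lip4 (-1) / (2 * (2 ^+ 4 - 1)).
  by rewrite (rmorph_nat intr) /lip4 /lip_Y opprK; field; rewrite t0.
have EE : (Qform : ps int) = 1 + (240 : int)%:~R * divsum 3 by rewrite QformE ps_int_nat.
exact: (@eisenstein_Mk _ 4 _ _ _ _ isT isT (@lip4_dup R) (@lip4_est R) (@conv_cubes R) c0 N0
  hN EE).
Qed.

Lemma Rform_Mk (R : realType) : Mk_int R 6 Rform.
Proof.
have t0 := tpi_neq0 R.
have c0 : 120 / tpi R ^+ 6 != 0 by rewrite mulf_neq0 ?invr_eq0 ?expf_neq0 ?pnatr_eq0.
have N0 : - (504 : int) != 0 by rewrite oppr_eq0 pnatr_eq0.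
have hN : ((- (504 : int))%:~R : Cplx R)^-1 = 120 / tpi R ^+ 6 * lip6 (-1) / (2 * (2 ^+ 6 - 1)).
  by rewrite mulrNz (rmorph_nat intr) /lip6 /lip_Y opprK; field; rewrite t0.
have EE : (Rform : ps int) = 1 +
  (- (504 : int))%:~R * divsum 5 by rewrite RformE mulrNz ps_int_nat mulNr.
exact: (@eisenstein_Mk _ 6 _ _ _ _ isT isT (@lip6_dup R) (@lip6_est R) (@conv_fifth_powers R)
  c0 N0 hN EE).
Qed.

Lemma Mk_int_divn (R : realType) k n (a : ps int) : (0 < n)%N -> Mk_int R k (n%:R * a) ->
  Mk_int R k a.
Proof.
move=> n0 /Mk_has_series[F [_ Fm /has_qexpP Fq]].
apply: (@Mk_intI _ _ _ (fun z => n%:R^-1 * F z)).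
  by move=> A B C D h z z0; rewrite (Fm _ _ _ _ h _ z0) mulrCA.
apply/has_qexpP => z z0; apply: convZ (Fq _ z0) => j.
by rewrite /cps psMnl intrM (rmorph_nat intr) mulKf // pnatr_eq0 -lt0n.
Qed.

Lemma Delta_Mk (R : realType) : Mk_int R 12 Delta.
Proof.
apply: (@Mk_int_divn _ _ 1728); first by [].
rewrite DeltaQR; apply: Mk_intD; first exact: (Mk_intX 3 (@Qform_Mk R)).
exact: Mk_intN (Mk_intX 2 (@Rform_Mk R)).
Qed.

(** * Expansions in the basis and the main theorem *)

Lemma Mk_int_vanish (R : realType) k (a : ps int) : Mk_int R k a ->
  (forall n, (12 * n <= k)%N -> a n = 0) -> a = 0.
Proof. exact: vanishing (@Delta_Mk R). Qed.

(** The matrix -1 gives F = -F. *)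
Lemma Mk_int_odd (R : realType) k (a : ps int) : odd k -> Mk_int R k a -> a = 0.
Proof.
move=> k1 /Mk_has_series[F [_ Fm Fq]]; apply: (@cps_eq0 R); apply: qexp_zero Fq _ => z z0.
have := Fm (-1) 0 0 (-1) erefl z z0.
rewrite !mulrNz mul0r addr0 add0r mulN1r invrN invr1 mulrN1 opprK -signr_odd k1 expr1 mulN1r
  => /eqP.
by rewrite -addr_eq0 -mulr2n mulrn_eq0 => /eqP.
Qed.

Lemma ps_expf_eq0 (A : idomainType) (f : ps A) n : f ^+ n = 0 -> f = 0.
Proof.
elim: n => [|n IH]; first by rewrite expr0 => /eqP; rewrite oner_eq0.
by rewrite exprS => /ps_mulf_eq0 [|/IH].
Qed.

Lemma ps_exp0 (A : comNzRingType) (f : ps A) n : (f ^+ n) 0%N = f 0%N ^+ n.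
Proof. by elim: n => // n IH; rewrite !exprS psM_0 IH. Qed.

Lemma eta24_0 : eta24 0%N = 1. Proof. exact: Delta_1. Qed.

Lemma monom_shift eps a c : monom eps a c =
  psX int c * ((Rform : ps int) ^+ eps * (Qform : ps int) ^+ a * eta24 ^+ c).
Proof. by rewrite /monom Delta_eta exprMn psX_exp; ring. Qed.

Lemma monom_lt eps a c n : (n < c)%N -> monom eps a c n = 0.
Proof. by move=> nc; rewrite monom_shift psXM leqNgt nc. Qed.

Lemma monom_eq eps a c : monom eps a c c = 1.
Proof.
have Q0 : Qform 0%N = 1 by []. have R0 : Rform 0%N = 1 by [].
by rewrite monom_shift psXM leqnn subnn psM_0 psM_0 !ps_exp0 eta24_0 Q0 R0 !expr1n !mulr1.
Qed.

Lemma monom_Mk (R : realType) (eps : bool) a c : Mk_int R (6 * eps + 4 * a +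
  12 * c) (monom eps a c).
Proof.
apply: Mk_intM; last exact: Mk_intX (@Delta_Mk R).
by apply: Mk_intM; [exact: Mk_intX (@Rform_Mk R)|exact: Mk_intX (@Qform_Mk R)].
Qed.

(** The difference of the two sides vanishes to order c + 1 > k / 12. *)
Lemma Mk_int_lead (R : realType) k (a : ps int) (eps : bool) al c : Mk_int R k a ->
  (k = 6 * eps + 4 * al + 12 * c)%N -> (k < 12 * c.+1)%N ->
  (forall n, (n < c)%N -> a n = 0) -> a = (a c)%:~R * monom eps al c.
Proof.
move=> ha kE kc a0; apply/eqP; rewrite -subr_eq0; apply/eqP; apply: (@Mk_int_vanish R k).
  apply: Mk_intD => //; apply: Mk_intN; apply: Mk_intZ; rewrite kE; exact: monom_Mk.
move=> n nk; have : (n <= c)%N by lia.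
rewrite psB psMzl leq_eqVlt => /orP[/eqP ->|nc]; first by rewrite monom_eq mulr1 intz subrr.
by rewrite a0 // monom_lt // mulr0 subrr.
Qed.

(* The square and the cube of the form are multiples of Q Delta ^ (2 * n) and of
   R Delta ^ (3 * n), so their common sixth power shows that it vanishes. *)
Lemma Mk_int_2mod12 (R : realType) n (a : ps int) : Mk_int R (12 * n + 2) a ->
  (forall i, (i < n)%N -> a i = 0) -> a = 0.
Proof.
move=> ha a0; have [a' aE] := psX_div a0.
have aX e : a ^+ e = psX int (n * e) * a' ^+ e.
  by rewrite aE exprMn -(psX_exp _ n) -exprM psX_exp.
pose s := a' 0%N.
have lead e : (a ^+ e) (n * e)%N = s ^+ e by rewrite aX psXM leqnn subnn ps_exp0.
have low e i : (i < n * e)%N -> (a ^+ e) i = 0 by move=> h; rewrite aX psXM leqNgt h.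
have h2 : a ^+ 2 = (s ^+ 2)%:~R * monom false 1 (n * 2).
  rewrite -lead; apply: (Mk_int_lead (Mk_intX 2 ha)); [lia|lia|exact: low].
have h3 : a ^+ 3 = (s ^+ 3)%:~R * monom true 0 (n * 3).
  rewrite -lead; apply: (Mk_int_lead (Mk_intX 3 ha)); [lia|lia|exact: low].
have h6 : (s ^+ 6)%:~R * (1728 * (Delta : ps int)) * (Delta : ps int) ^+ (n * 6) = 0.
  have e : (a ^+ 2) ^+ 3 = (a ^+ 3) ^+ 2 by rewrite -!exprM.
  have uv : (Delta : ps int) ^+ (n * 3) ^+ 2 = (Delta : ps int) ^+ (n * 2) ^+ 3.
    by rewrite -!exprM; congr (_ ^+ _); lia.
  have -> : (Delta : ps int) ^+ (n * 6) = (Delta : ps int) ^+ (n * 2) ^+ 3.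
    by rewrite -!exprM; congr (_ ^+ _); lia.
  move: uv e; rewrite h2 h3 /monom DeltaQR !rmorphXn /= !expr0 !expr1 !mulr1 mul1r.
  move: ((Delta : ps int) ^+ (n * 3)) ((Delta : ps int) ^+ (n * 2)) => u v.
  move: (s%:~R : ps int) (Qform : ps int) (Rform : ps int) => t Q Rf uv e.
  have -> : t ^+ 6 * (Q ^+ 3 - Rf ^+ 2) * v ^+ 3 =
    (t ^+ 2 * (Q * v)) ^+ 3 - t ^+ 6 * Rf ^+ 2 * v ^+ 3 by ring.
  by rewrite e -uv; ring.
have D0 : (Delta : ps int) <> 0 by move/(congr1 (fun f => f 1%N)); rewrite ps0 [Delta 1]Delta_1.
case: (ps_mulf_eq0 h6) => [h|/ps_expf_eq0 //].
have := congr1 (fun f => f 1%N) h; rewrite psMzl psMnl ps0 [Delta 1]Delta_1 => /eqP.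
rewrite mulr1 mulf_eq0 pnatr_eq0 orbF intz expf_eq0 /= => /eqP s0.
by apply: (@ps_expf_eq0 _ _ 2); rewrite h2 s0 expr0n /= mul0r.
Qed.

Definition basis_eps (k : nat) : bool := ~~ (4 %| k)%N.
(** The exponents of Delta that occur in weight k are those below this number. For k = 2 modulo 4 it
    is floor((k - 6)/12) + 1, written so as to give 0 for k = 2. *)
Definition basis_size (k : nat) : nat :=
  if odd k then 0%N else if (4 %| k)%N then (k %/ 12).+1 else ((k + 6) %/ 12)%N.
Definition basis_al (k c : nat) : nat := ((k - 6 * basis_eps k - 12 * c) %/ 4)%N.

Lemma basis_weight k c : (c < basis_size k)%N ->
  (6 * basis_eps k + 4 * basis_al k c + 12 * c = k)%N.
Proof.
rewrite /basis_size /basis_al /basis_eps; case: ifP => // k2; case: ifP => k4 h /=; lia.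
Qed.

(** Each monomial starts with q^c with coefficient 1, so the coefficients are eliminated one by one
    over Z. *)
Lemma Mk_int_expansion (R : realType) k (a : ps int) : Mk_int R k a ->
  exists x, a = expansion (basis_eps k) (basis_size k) x (basis_al k).
Proof.
move=> ha; set eps := basis_eps k; set al := basis_al k.
have step j : (j <= basis_size k)%N -> exists x, Mk_int R k (a - expansion eps j x al) /\
    forall n, (n < j)%N -> (a - expansion eps j x al) n = 0.
  elim: j => [|j IH] jN; first by exists (fun=> 0); rewrite /expansion big_geq // subr0.
  have [x [h1 h2]] := IH (ltnW jN); set r := a - _ in h1 h2.
  exists (fun c => if c == j then r j else x c).
  have -> : a - expansion eps j.+1 (fun c => if c == j then r j else x c) al =
      r - (r j)%:~R * monom eps (al j) j.
    rewrite /expansion big_nat_recr //= eqxx opprD addrA; congr (_ - _ - _).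
    by apply: eq_big_nat => c /andP[_ cj]; rewrite (ltn_eqF cj).
  split.
    apply: Mk_intD => //; apply: Mk_intN; apply: Mk_intZ.
    by rewrite -{1}(basis_weight jN); exact: monom_Mk.
  move=> n; rewrite ltnS psB psMzl leq_eqVlt => /orP[/eqP ->|nj].
    by rewrite monom_eq mulr1 intz subrr.
  by rewrite h2 // monom_lt // mulr0 subrr.
have [x [h1 h2]] := step _ (leqnn _); exists x; apply/eqP; rewrite -subr_eq0; apply/eqP.
have [k2|k2] := boolP (odd k); first exact: Mk_int_odd k2 h1.
(* For k = 2 modulo 12 there is one monomial fewer than [Mk_int_vanish] asks for. *)
have [k12|k12] := eqVneq (k %% 12)%N 2.
  have kE : (k = 12 * (k %/ 12) + 2)%N by lia.
  apply: (@Mk_int_2mod12 R (k %/ 12)) => [|i hi]; first by rewrite -kE.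
  apply: h2.
  by rewrite /basis_size (negPf k2); case: ifP => k4; lia.
apply: (Mk_int_vanish h1) => n hn; apply: h2.
by rewrite /basis_size (negPf k2); case: ifP => k4; lia.
Qed.

Lemma basis_formE k a c : basis_form k a c = monom (basis_eps k) a c.
Proof.
rewrite /basis_form /monom /basis_eps; case: ifP => _ /=;
  rewrite !ps_mulE !ps_expE ?expr0 ?mul1r //.
by rewrite expr1 mulrA.
Qed.

Lemma basis_indexE k a c : ~~ odd k ->
  basis_index k a c = (c < basis_size k)%N && (a == basis_al k c).
Proof.
rewrite /basis_index /basis_size /basis_al /basis_eps => k2; rewrite (negPf k2).
by case: ifP => k4 /=; lia.
Qed.

(** * Reduction modulo 2^m *)

Lemma Zp_int_eq0 N (x : int) : (1 < N)%N -> (x%:~R = 0 :> 'Z_N) <-> (N%:Z %| x)%Z.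
Proof.
move=> N1; have key (n : nat) : (n%:R = 0 :> 'Z_N) <-> (N %| n)%N.
  rewrite /dvdn; split => [h|/eqP h]; last by apply: val_inj; rewrite /= val_Zp_nat.
  by rewrite -(val_Zp_nat N1) h.
case: x => n; first exact: key.
rewrite NegzE mulrNz dvdzE abszN; split => [/eqP|h].
  by rewrite oppr_eq0 => /eqP /(key n.+1).
by rewrite (_ : (n.+1%:Z)%:~R = 0) ?oppr0 //; exact: (key n.+1).2 h.
Qed.

Lemma Zp_int_eq N (x y : int) : (1 < N)%N -> (x = y %[mod N%:Z])%Z -> x%:~R = y%:~R :> 'Z_N.
Proof.
move=> N1 /eqP; rewrite eqz_mod_dvd => /(Zp_int_eq0 _ N1) /eqP.
by rewrite rmorphB subr_eq0 => /eqP.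
Qed.

Lemma two_power_gt1 m : (0 < m)%N -> (1 < 2 ^ m)%N.
Proof. by move=> m0; rewrite -{1}(expn0 2) ltn_exp2l. Qed.

Lemma z2_redE m (x : Z2) (y : int) : (0 < m)%N -> (z2_res x m = y %[mod 2 ^+ m])%Z ->
  z2_red m x = y%:~R.
Proof.
move=> m0 h; apply: Zp_int_eq; first exact: two_power_gt1.
by rewrite PoszM || (have -> : (2 ^ m)%N%:Z = 2 ^+ m by rewrite -natz natrX natz).
Qed.

Lemma z2_redD m (x y : Z2) : (0 < m)%N -> z2_red m (x + y) = z2_red m x + z2_red m y.
Proof. by move=> m0; rewrite (z2_redE m0 (z2_ofE _ _)) intrD. Qed.

Lemma z2_redM m (x y : Z2) : (0 < m)%N -> z2_red m (x * y) = z2_red m x * z2_red m y.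
Proof. by move=> m0; rewrite (z2_redE m0 (z2_ofE _ _)) intrM. Qed.

Lemma z2_redN m (x : Z2) : (0 < m)%N -> z2_red m (- x) = - z2_red m x.
Proof. by move=> m0; rewrite (z2_redE m0 (z2_ofE _ _)) mulrNz. Qed.

Lemma z2_red1 m : (0 < m)%N -> z2_red m 1 = 1.
Proof. by move=> m0; rewrite (z2_redE m0 (z2_ofE _ _)). Qed.

Lemma z2_red0 m : (0 < m)%N -> z2_red m 0 = 0.
Proof. by move=> m0; rewrite (z2_redE m0 (z2_ofE _ _)). Qed.

Lemma z2_red_nat m (n : nat) : (0 < m)%N -> z2_red m n%:R = n%:R.
Proof.
move=> m0; elim: n => [|n IH]; first exact: z2_red0.
by rewrite -!natr1 z2_redD // IH z2_red1.
Qed.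

Lemma z2_red_int m (x : int) : (0 < m)%N -> z2_red m x%:~R = x%:~R.
Proof.
move=> m0; case: x => n; first exact: z2_red_nat.
by rewrite NegzE !mulrNz z2_redN // (z2_red_nat n.+1).
Qed.

Lemma z2_red_sum m (I : Type) (r : seq I) (F : I -> Z2) : (0 < m)%N ->
  z2_red m (\sum_(i <- r) F i) = \sum_(i <- r) z2_red m (F i).
Proof.
move=> m0; elim: r => [|i r IH]; first by rewrite !big_nil z2_red0.
by rewrite !big_cons z2_redD // IH.
Qed.

Lemma int_lift m (X : 'Z_(2 ^ m)) : exists y : int, y%:~R = X.
Proof. by exists (val X)%:Z; exact: natr_Zp. Qed.

Lemma pscong_coef m (f g : ps int) : (0 < m)%N ->
  pscong (2 ^ m) f g <-> forall n, (f n)%:~R = (g n)%:~R :> 'Z_(2 ^ m).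
Proof.
move=> m0; have N1 := two_power_gt1 m0; split.
  move=> [h ->] n; rewrite psD psMnl intrD intrM (rmorph_nat intr) pchar_Zp // mul0r addr0 //.
move=> fg; exists (fun n => ((f n - g n) %/ (2 ^ m)%N)%Z); apply: funext => n.
have dv : ((2 ^ m)%N%:Z %| f n - g n)%Z.
  by apply/(Zp_int_eq0 _ N1); rewrite rmorphB /= fg subrr.
rewrite psD psMnl; move: dv; move: (2 ^ m)%N (f n) (g n) => M x y dv.
by rewrite natz mulrC divzK // addrC subrK.
Qed.

Lemma expansion_coef (A : comNzRingType) eps N x al n :
  (expansion eps N x al n)%:~R = \sum_(c < N) (x c)%:~R * (monom eps (al c) c n)%:~R :> A.
Proof.
rewrite /expansion big_mkord ps_sum rmorph_sum /=; apply: eq_bigr => c _.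
by rewrite psMzl intz intrM.
Qed.

(** The coefficients in Z/2^m are lifted to integers, so that congruences between integral series
    become available. *)
Lemma Sk_expansion (R : realType) m k (f : nat -> 'Z_(2 ^ m)) : Sk R k f -> exists y : nat ->
  int,
  forall n, f n = (expansion (basis_eps k) (basis_size k) y (basis_al k) n)%:~R.
Proof.
move=> [r [c [g [gS fE]]]].
have /choice [x xP] i : exists x, g i = expansion (basis_eps k) (basis_size k) x (basis_al k).
  by case: (gS i) => /Mk_int_expansion.
have /choice [y yP] j := int_lift (\sum_(i < r) c i * (x i j)%:~R).
exists y => n; rewrite fE expansion_coef.
under eq_bigr => i _ do rewrite xP expansion_coef mulr_sumr.
rewrite exchange_big /=; apply: eq_bigr => j _; rewrite yP mulr_suml.
by apply: eq_bigr => i _; rewrite mulrA.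
Qed.

(** There is no nonzero cusp form of weight 0 or 1; this makes 2^(k-1) even, as [hecke_zero]
    requires. *)
Lemma eigenform_weight (R : realType) k (g : nat -> Z2) : Sk R k g -> g 1%N = 1 -> (2 <= k)%N.
Proof.
move=> [r [c [h [hS gE]]]] g1; rewrite leqNgt; apply/negP => k1.
have h0 i : h i = (0 : ps int).
  have [hM h0] := hS i; case: k k1 hM {hS} => [|[|//]] _ hM; last exact: Mk_int_odd hM.
  by apply: (Mk_int_vanish hM) => n; rewrite leqn0 muln_eq0 /= => /eqP ->.
move: g1; rewrite gE big1 => [/eqP|i _]; first by rewrite eq_sym oner_eq0.
by rewrite h0 mulr0.
Qed.

Lemma hecke_prime (A : comNzRingType) k p (f : nat -> A) j : prime p ->
  hecke k p f j = f (p * j)%N + (if (p %| j)%N then (p ^ k.-1)%N%:R * f (j %/ p)%N else 0).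
Proof.
move=> pp; have p0 := prime_gt0 pp; rewrite /hecke.
have -> : \sum_(d <- divisors p | (d %| j)%N) (d ^ k.-1)%N%:R * f ((p * j) %/ d ^ 2)%N =
    \sum_(d <- [:: 1; p]%N | (d %| j)%N) (d ^ k.-1)%N%:R * f ((p * j) %/ d ^ 2)%N.
  apply: perm_big; apply: uniq_perm; first exact: divisors_uniq.
    by rewrite /= inE andbT neq_ltn prime_gt1.
  move=> d; rewrite -dvdn_divisors // !inE; apply/idP/idP => [/(primeP pp).2|].
    by [].
  by case/orP => /eqP ->; rewrite ?dvd1n ?dvdnn.
rewrite !big_cons big_nil dvd1n exp1n mul1r exp1n divn1 !addr0; congr (_ + _).
case: ifP => // pj; congr (_ * f _).
by rewrite expnS expn1 divnMl.
Qed.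

(** The weight k2 of the eigenform may differ from the one in which f is expanded; only the series F
    enters. *)
Lemma eigenform_hecke_zero (R : realType) m k2 p (f : nat -> 'Z_(2 ^ m)) (g : nat ->
  Z2) (F : ps int) :
  (0 < m)%N -> prime p -> eigenform R k2 g -> (forall n, f n = z2_red m (g n)) ->
  (forall n, f n = (F n)%:~R) -> hecke_zero m p F.
Proof.
move=> m0 pp [gS g1 gH] fg fF; have k2_2 := eigenform_weight gS g1.
have [lam hlam] := gH p (prime_gt0 pp); have [l hl] := int_lift (z2_red m lam).
exists (p ^ k2.-1)%N%:Z, l; split.
  rewrite dvdzE /= Euclid_dvdX //; have -> : (0 < k2.-1)%N by lia.
  by rewrite andbT dvdn_prime2 // eq_sym.
apply/(pscong_coef _ _ m0) => j; rewrite ps0 /heckeop psB psD !psMzl !intz.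
have := congr1 (z2_red m) (hlam j);
  rewrite hecke_prime // z2_redD // z2_redM // -!fg -hl !fF => e.
rewrite rmorphB rmorphD /= !intrM -e /psU /psV.
case: ifP => pj; last by rewrite z2_red0 // mulr0 addr0 subrr.
by rewrite z2_redM // z2_red_nat // -fg fF -pmulrn subrr.
Qed.

Lemma basis_size_le k : (basis_size k <= k.+1)%N.
Proof. by rewrite /basis_size; do 2! [case: ifP => // _]; lia. Qed.

(** [f 1 != 0] ensures that some coefficient is nonzero, so that a largest exponent exists. *)
Lemma expansion_has_degree m k (f : nat -> 'Z_(2 ^ m)) (y : nat -> int) D : f 1%N != 0 ->
  (forall n, f n = (expansion (basis_eps k) (basis_size k) y (basis_al k) n)%:~R) ->
  (forall c, (D <= c < basis_size k)%N -> (y c)%:~R = 0 :> 'Z_(2 ^ m)) ->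
  exists d, has_degree k f d /\ (d <= D)%N.
Proof.
move=> f1 fE yD; set N := basis_size k in fE yD *.
pose P c := (c < N)%N && ((y c)%:~R != 0 :> 'Z_(2 ^ m)).
have exP : exists c, P c.
  apply: contrapT => h; move/eqP: f1; apply; rewrite fE expansion_coef big1 // => c _.
  have [->|yc] := eqVneq ((y c)%:~R : 'Z_(2 ^ m)) 0; first by rewrite mul0r.
  by case: h; exists c; rewrite /P ltn_ord.
have ubP c : P c -> (c <= N)%N by case/andP => /ltnW.
case: (ex_maxnP exP ubP) => d /andP[dN yd] dmax; exists d; split; last first.
  by rewrite leqNgt; apply/negP => Dd; move/eqP: yd; apply; apply: yD; rewrite ltnW.
have k2 : ~~ odd k by apply/negP => k1; move: dN; rewrite /N /basis_size k1.
exists (fun _ c => (y c)%:~R); split; last 2 first.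
- by exists (basis_al k d); rewrite basis_indexE // dN eqxx.
- by move=> a c; rewrite basis_indexE // => /andP[cN _] yc; apply: dmax; rewrite /P cN.
move=> n; rewrite fE expansion_coef (exchange_big_dep xpredT) //=.
rewrite (big_ord_widen k.+1 (fun c =>
  (y c)%:~R * (monom (basis_eps k) (basis_al k c) c n)%:~R)).
  rewrite big_mkcond; apply: eq_bigr => c _; have [cN|cN] := boolP (c < N)%N; last first.
    by rewrite big_pred0 // => a; rewrite basis_indexE // (negPf cN).
  have ak : (basis_al k c < k.+1)%N by have := basis_weight cN; lia.
  rewrite (big_pred1 (Ordinal ak)) ?basis_formE // => a.
  by rewrite basis_indexE // cN.
exact: basis_size_le.
Qed.

Lemma monom_cong m (eps eps' : bool) a a' c : ((m <= 3)%N || (eps == eps')) ->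
  (a = a' %[mod 2 ^ (m - 4)])%N -> pscong (2 ^ m) (monom eps a c) (monom eps' a' c).
Proof.
move=> me aa; apply: pscongM; last exact: pscong_refl.
apply: pscongM; last exact: Qform_period.
case/orP: me => [m3|/eqP ->]; last exact: pscong_refl.
have R1 (b : bool) : pscong (2 ^ m) ((Rform : ps int) ^+ b) 1.
  rewrite -(expr1n _ b); apply: pscongX; apply: (@pscong_dvd _ 8); last exact: Rform_cong.
  by rewrite (dvdn_exp2l 2 (m := m) (n := 3)).
by apply: pscong_trans (R1 eps) _; apply: pscong_sym; exact: R1.
Qed.

(** Exponents of Q count only modulo P = 2^(m-4), and 4 e < 4 P = 2^(m-2) gives the bound on the
    weight for m >= 4. *)
Lemma low_weight_lift (R : realType) m k (f : nat -> 'Z_(2 ^ m)) (y : nat ->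
  int) D : (0 < m)%N ->
  (forall n, f n = (expansion (basis_eps k) (basis_size k) y (basis_al k) n)%:~R) ->
  (forall c, (D <= c < basis_size k)%N -> (y c)%:~R = 0 :> 'Z_(2 ^ m)) ->
  exists (k' : nat) (g : nat -> Z2),
    (k' <= if (m <= 3)%N then 12 * D else 6 + 2 ^ (m - 2) + 12 * D)%N /\
    Mk R k' g /\ forall n, f n = z2_red m (g n).
Proof.
move=> m0 fE yD; set N := basis_size k in fE yD *.
pose P := (2 ^ (m - 4))%N; have P0 : (0 < P)%N by rewrite expn_gt0.
pose eps := basis_eps k && (3 < m)%N.
(* The term 3 D (P - 1) stands for -3D modulo P. *)
pose e := if (m <= 3)%N then 0%N else ((basis_al k 0 + 3 * D * P.-1) %% P)%N.
(* As 12 = 3 * 4, three powers of Q make up for each missing Delta: all terms get the weight 6 eps +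
   12 D + 4 e. *)
pose al c := (3 * (D - c) + e)%N.
have alE c : (c < N)%N -> (c < D)%N -> (basis_al k c = al c %[mod P])%N.
  move=> cN cD; rewrite /al /e /P; case: (leqP m 3) => m3.
    have -> : (m - 4 = 0)%N by lia.
    by rewrite expn0 !modn1.
  rewrite -/P modnDmr.
  have a0 : (basis_al k 0 = basis_al k c + 3 * c)%N.
    have N0 : (0 < N)%N by apply: leq_ltn_trans cN.
    by have := basis_weight cN; have := basis_weight N0; lia.
  have -> : (3 * (D - c) + (basis_al k 0 + 3 * D * P.-1) = 3 * D * P + basis_al k c)%N.
    rewrite a0 -{2}(prednK P0) mulnS; lia.
  by rewrite modnMDl.
exists (6 * eps + 12 * D + 4 * e)%N.
exists (fun n => \sum_(c < minn N D) (y c)%:~R * (monom eps (al c) c n)%:~R); split; [|split].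
- rewrite /eps /e; case: (leqP m 3) => m3; first by rewrite andbF muln0 !addn0 add0n.
  have -> : (2 ^ (m - 2) = 4 * P)%N.
    by rewrite /P (_ : 4 = 2 ^ 2)%N // -expnD; congr (2 ^ _)%N; lia.
  have : ((basis_al k 0 + 3 * D * P.-1) %% P < P)%N by rewrite ltn_mod.
  by case: (basis_eps k) => /=; lia.
- exists (minn N D), (fun c : 'I_(minn N D) => (y c)%:~R), (fun c : 'I_(minn N D) =>
  monom eps (al c) c).
  split => // c; have cD : (c < D)%N by apply: leq_trans (ltn_ord c) (geq_minr _ _).
  have -> : (6 * eps + 12 * D + 4 * e = 6 * eps + 4 * al c + 12 * c)%N by rewrite /al; lia.
  exact: monom_Mk.
move=> n; rewrite fE expansion_coef z2_red_sum //.
rewrite (big_ord_widen N (fun c =>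
  z2_red m ((y c)%:~R * (monom eps (al c) c n)%:~R))) ?geq_minl //.
rewrite [RHS]big_mkcond; apply: eq_bigr => c _; rewrite leq_min ltn_ord /=.
have [cD|Dc] := ltnP c D; last by rewrite yD ?mul0r // Dc ltn_ord.
rewrite z2_redM // !z2_red_int //; congr (_ * _).
have cong : pscong (2 ^ m) (monom (basis_eps k) (basis_al k c) c) (monom eps (al c) c).
  apply: monom_cong; last exact: alE.
  by rewrite /eps; case: leqP => //=; rewrite andbT.
exact: (pscong_coef _ _ m0).1 cong n.
Qed.

Theorem theorem13 (R : realType) (m : nat) (hm : (0 < m)%N) :
  exists C kappa : nat,
    ((m <= 3)%N -> kappa = (12 * C)%N) /\
    ((4 <= m)%N -> kappa = (6 + 2 ^ (m - 2) + 12 * C)%N) /\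
    (forall (k : nat) (f : nat -> 'Z_(2 ^ m)),
      Sk R k f -> strong_eigenform_Z2 R f ->
      (exists d : nat, has_degree k f d /\ (d <= C)%N) /\
      (exists (k' : nat) (g : nat -> Z2),
        (k' <= kappa)%N /\ Mk R k' g /\ (forall n : nat, f n = z2_red m (g n)))).
Proof.
have [D hD] := uniform_divisibility hm (leqnn m).
exists D, (if (m <= 3)%N then 12 * D else 6 + 2 ^ (m - 2) + 12 * D)%N.
split; [by move=> -> | split; [by rewrite ltnNge => /negPf -> |]].
move=> k f fS [k2 [g [gE fg]]]; have [y fy] := Sk_expansion fS.
have hz p : prime p -> hecke_zero m p (expansion (basis_eps k) (basis_size k) y (basis_al k)).
  by move=> pp; apply: eigenform_hecke_zero hm pp gE fg fy.
have yD c : (D <= c < basis_size k)%N -> (y c)%:~R = 0 :> 'Z_(2 ^ m).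
  move=> hc; apply/(Zp_int_eq0 _ (two_power_gt1 hm)).
  by have := hD _ _ _ _ (hz 2%N isT) (hz 3%N isT) (hz 5%N isT) _ hc; rewrite natz.
split; last exact: low_weight_lift hm fy yD.
apply: expansion_has_degree fy yD.
by case: gE => _ g1 _; rewrite fg g1 z2_red1 // oner_eq0.
Qed.
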